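(* Let $d=1$ and let $W:\mathbb{R}\times\mathbb{T}^1\to\mathbb{R}$ be $$W(x,y)=\mathbf{1}_{[-1/2,1/2]}(x)\left(\mathbf{1}_{[0,\pi]}(y)-\mathbf{1}_{[-\pi,0]}(y)\right),$$ whose zeroth Fourier coefficient in $y$ vanishes, and which satisfies $\sum_{k\ne0}|k|^{-s}|W_k|_{H^s}<\infty$ for every $s\in(0,1/2)$. For $\varepsilon>0$ let $V_\varepsilon(x)=W(x,x/\varepsilon)$. Then, with $\varepsilon_n=1/(2\pi n)$ (so that $V_{\varepsilon_n}$ takes alternately the values $\pm1$ on $2n$ consecutive intervals of length $1/(2n)$ partitioning $[-1/2,1/2]$, and is $0$ outside), for all $n$ large enough the potential $V_{\varepsilon_n}$ has a resonance $\lambda_n$ such that $\lambda_n\sim-i\ln(n)$ as $n\to+\infty$.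
   Context: $\mathbb{T}^1=\mathbb{R}/2\pi\mathbb{Z}$, with $y$ represented in $[-\pi,\pi]$; $W_k(x)=(2\pi)^{-1}\int_{-\pi}^{\pi}W(x,y)e^{-iky}dy$; $|\cdot|_{H^s}$ is the norm of $H^s(\mathbb{R})$. For a bounded compactly supported $\mathcal V:\mathbb{R}\to\mathbb{C}$, $R_{\mathcal V}(\lambda)=(-\partial_x^2+\mathcal V-\lambda^2)^{-1}:L^2\to H^2$, well defined for $\operatorname{Im}\lambda\gg1$, extends to a meromorphic family of operators $L^2_{\mathrm{comp}}(\mathbb{R})\to H^2_{\mathrm{loc}}(\mathbb{R})$, $\lambda\in\mathbb{C}$; its poles are the resonances of $\mathcal V$. The notation $\lambda_n\sim-i\ln(n)$ means $\lambda_n/(-i\ln n)\to1$. *)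

(* Defs.v *)
From mathcomp Require Export all_boot all_order all_algebra.
From mathcomp Require Export all_classical all_reals all_analysis.
From mathcomp Require Export complex.
Export Order.TTheory GRing.Theory Num.Theory.
Export numFieldNormedType.Exports.

Set Implicit Arguments.
Unset Strict Implicit.
Unset Printing Implicit Defensive.

Local Open Scope classical_set_scope.
Local Open Scope ring_scope.
Local Open Scope complex_scope.

Section Functions.
Variable R : realType.
Local Notation C := R[i].
Local Notation mu := (@lebesgue_measure R).
Implicit Types (f g u : R -> C) (A : set R).

Definition Cintegral A f : C :=
  (\int[mu]_(x in A) complex.Re (f x)) +i* (\int[mu]_(x in A) complex.Im (f x)).

Definition Cmeasurable f : Prop :=
  measurable_fun setT (fun x => complex.Re (f x)) /\
  measurable_fun setT (fun x => complex.Im (f x)).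

(* Lebesgue classes are handled through representatives. *)
Definition aeq f g : Prop := {ae mu, forall x, f x = g x}.

(* Squared norm of L^2(A). *)
Definition L2norm2 A f : \bar R :=
  (\int[mu]_(x in A) (Normc.normc (f x) ^+ 2)%:E)%E.

Definition L2 f : Prop := Cmeasurable f /\ (L2norm2 setT f < +oo)%E.

(* Elements of L^2 supported in [-r, r]; L^2_comp is the union over r. *)
Definition L2supp (r : R) f : Prop :=
  L2 f /\ {ae mu, forall x, r < `|x| -> f x = 0}.

Definition L2comp f : Prop := exists r, L2supp r f.

Definition C1c (phi : R -> R) : Prop :=
  [/\ forall x, derivable phi x 1,
      continuous (derive1 phi)
    & exists r : R, forall x, r < `|x| -> phi x = 0].

Definition Cloc_integrable f : Prop :=
  locally_integrable setT (fun x => complex.Re (f x)) /\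
  locally_integrable setT (fun x => complex.Im (f x)).

(* g is the weak derivative of u on the line. Real test functions suffice for
   complex-valued u, by linearity. *)
Definition weak_derivative u g : Prop :=
  [/\ Cloc_integrable u, Cloc_integrable g
    & forall phi, C1c phi ->
      Cintegral setT (fun x => u x * (derive1 phi x)%:C) =
      - Cintegral setT (fun x => g x * (phi x)%:C)].

(* Squared norm of H^2(A). The weak derivatives are unique up to null sets, so
   the infimum is over a single value; it is +oo if u is not twice weakly
   differentiable. *)
Definition H2norm2 A u : \bar R :=
  ereal_inf [set m | exists u1 u2,
    [/\ weak_derivative u u1, weak_derivative u1 u2
      & m = (L2norm2 A u + L2norm2 A u1 + L2norm2 A u2)%E]].

Definition H2loc_norm2 (rho : R) u : \bar R := H2norm2 `]- rho, rho[ u.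

Definition H2 u : Prop := (H2norm2 setT u < +oo)%E.

End Functions.

Section Operators.
Variable R : realType.
Local Notation C := R[i].

Definition operator := (R -> C) -> (R -> C).

(* Continuous linear operators from L^2_comp to H^2_loc: for all r and rho,
   bounded from L^2([-r, r]) to H^2((-rho, rho)). *)
Definition comp_loc_operator (T : operator) : Prop :=
  (forall (a : C) f g, L2comp f -> L2comp g ->
     aeq (T (fun x => a * f x + g x)) (fun x => a * T f x + T g x)) /\
  (forall r rho : R, exists M : R, forall f, L2supp r f ->
     (H2loc_norm2 rho (T f) <= M%:E * L2norm2 setT f)%E).

(* Complex differentiability at l, with respect to the operator norms from
   L^2([-r, r]) to H^2((-rho, rho)). *)
Definition op_differentiable (B : C -> operator) (l : C) : Prop :=
  comp_loc_operator (B l) /\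
  exists D : operator, comp_loc_operator D /\
    forall r rho e : R, 0 < e ->
      \forall m \near (l : C^o)^', forall f, L2supp r f ->
        (H2loc_norm2 rho
           (fun x => (m - l)^-1 * (B m f x - B l f x) - D f x)%R
         <= e%:E * L2norm2 setT f)%E.

Definition op_holomorphic_near (B : C -> operator) (l0 : C) : Prop :=
  \forall l \near (l0 : C^o), op_differentiable B l.

(* Near l0, (l - l0)^N F(l) extends to a holomorphic family. *)
Definition pole_order_le (F : C -> operator) (l0 : C) (N : nat) : Prop :=
  exists2 B : C -> operator, op_holomorphic_near B l0 &
    \forall l \near (l0 : C^o)^', forall f, L2comp f ->
      aeq (F l f) (fun x => (l - l0) ^- N * B l f x).

(* The values of the family at the points of a discrete set are irrelevant. *)
Definition op_meromorphic (F : C -> operator) : Prop :=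
  forall l0, exists N, pole_order_le F l0 N.

Definition is_pole (F : C -> operator) (l0 : C) : Prop :=
  ~ pole_order_le F l0 0.

(* u in H^2 and - u'' + V u - l^2 u = f. *)
Definition helmholtz (V : R -> C) (l : C) (u f : R -> C) : Prop :=
  H2 u /\ exists u1 u2, [/\ weak_derivative u u1, weak_derivative u1 u2
    & aeq (fun x => - u2 x + V x * u x - l ^+ 2 * u x) f].

(* T is the inverse of -d^2/dx^2 + V - l^2 : H^2 -> L^2. *)
Definition is_resolvent (V : R -> C) (l : C) (T : operator) : Prop :=
  forall f, L2 f ->
    helmholtz V l (T f) f /\ forall u, helmholtz V l u f -> aeq u (T f).

Definition resolvent_continuation (V : R -> C) (F : C -> operator) : Prop :=
  op_meromorphic F /\
  exists c : R, forall l : C, c < complex.Im l ->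
    exists2 T, is_resolvent V l T & forall f, L2comp f -> aeq (F l f) (T f).

(* The continuation is unique away from a discrete set, by the identity
   theorem. *)
Definition resonance (V : R -> C) (l : C) : Prop :=
  exists2 F, resolvent_continuation V F & is_pole F l.

End Operators.

Section Fourier.
Variable R : realType.
Local Notation C := R[i].
Local Notation mu := (@lebesgue_measure R).

Definition cis (t : R) : C := cos t +i* sin t.

(* W_k(x), for W(x, y) 2pi-periodic in y. *)
Definition fourier_coef (W : R -> R -> R) (k : int) (x : R) : C :=
  ((2 * pi)^-1)%:C *
  Cintegral `[- pi, pi] (fun y => (W x y)%:C * cis (- (k%:~R * y))).

(* For integrable f. *)
Definition fourier (f : R -> C) (xi : R) : C :=
  Cintegral setT (fun x => f x * cis (- (xi * x))).

(* Norm of H^s(R), normalized so that s = 0 gives the L^2 norm. *)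
Definition Hnorm (s : R) (f : R -> C) : \bar R :=
  (((2 * pi)^-1%:E * \int[mu]_xi
     ((1 + xi ^+ 2) `^ s * Normc.normc (fourier f xi) ^+ 2)%:E) `^ (2^-1))%E.

End Fourier.

Section Potential.
Variable R : realType.

(* Preimage in R of the image of A in R / 2pi Z. *)
Definition periodized (A : set R) : set R :=
  [set y | exists m : int, A (y + 2 * pi * m%:~R)].

(* Functions on the circle are 2pi-periodic functions on R. The two arcs share
   the endpoints 0 and pi, where W(x, .) vanishes. *)
Definition W (x y : R) : R :=
  \1_(`[- 2^-1, 2^-1] : set R) x *
  (\1_(periodized `[0, pi]) y - \1_(periodized `[- pi, 0]) y).

Definition Vosc (eps x : R) : R := W x (x / eps).

Definition eps_ (n : nat) : R := (2 * pi * n%:R)^-1.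

End Potential.

(* Main.v *)
(* The resolvent of a step potential has a Green kernel built from the solutions [psiM] and
   [psiP] of [- u'' + V u = l ^ 2 u] that are multiples of [exp (- i l x)] on the left and of
   [exp (i l x)] on the right of the support. Both are entire in [l], so that dividing by their
   Wronskian [Om] gives the meromorphic continuation. [Om] has no zero for [Im l > 1], by the
   monotonicity of a flux, and a zero of [Om] is a pole, as the action on a truncated
   exponential shows.

   For the oscillating potential put [k = i l] and [h = 1 / 2n]. Two consecutive steps have a
   transfer matrix with eigenvalues [m] and [1 / m], where [m] is close to [exp (2 k h)], and one
   finds [Om ~ 2 k exp (- k) (1 + exp (2 k) / (64 n ^ 2 k ^ 2))] as long as [k] is of size [ln n].
   For [k = k0 + z] with [k0 = ln (8 n) + ln (ln (8 n)) + i pi / 2] the last factor is close to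
   [1 - exp (2 z)]. Hence [|Om|] is smaller at [k0] than on the boundary of a small square around
   it, and by the minimum modulus principle [Om] vanishes inside.

   The Fourier coefficient [W_k] is a multiple [O(1 / |k|)] of the indicator of an interval, which
   belongs to [H^s] for [s < 1 / 2]. *)

Require Import Defs.
From mathcomp Require Import all_boot all_order all_algebra.
From mathcomp Require Import all_classical all_reals all_analysis.
From mathcomp Require Import complex measurable_realfun.
From mathcomp Require Import ring lra.

Local Open Scope classical_set_scope.
Local Open Scope ring_scope.
Local Open Scope complex_scope.

Set Implicit Arguments.
Unset Strict Implicit.
Unset Printing Implicit Defensive.

(** The exponential factor vanishes when [exp k = 8 i n k] up to sign, that is
    [k = ln (8 n) + ln k + i pi / 2], and one iteration from [ln (8 n)] gives [k0]. Its coefficient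
    is that of a double reflection: the oscillations average out inside the layer, and each end
    reflects with an amplitude of size [h / (4 k) = 1 / (8 n k)], so [exp (2 k)] has to reach the
    size of [n ^ 2 k ^ 2]. The obstacle is precision. With [P] the normalized value after two steps,
    [Om] combines [m ^ n] and [m ^ (- n)] with coefficients [P - 1 / m] and [m - P]. The former is
    of order [h ^ 3 / k], while [m] is only known up to [k ^ 3 h ^ 3]; it is therefore derived from
    an exact formula for the product [(m - P) (P - 1 / m)], of order [h ^ 4]. The power [m ^ n]
    requires [n |k h| ^ 3] to be small, which holds for [k] of logarithmic size. Entire functions
    are limits of polynomials for weighted coefficient norms. These norms are compatible with
    products, translations and division by powers of [l - l0], which yields both the expansions of
    the kernels and the factorization at a zero. *)

Local Notation nc := Normc.normc.

(* [lra] is slow on large contexts, much more than on the same facts as premises of the goal,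
   and on atoms that are moduli of large complex expressions, which it compares up to
   conversion. *)
Ltac rlra :=
  repeat match goal with H : ?P |- _ =>
    lazymatch type of P with Prop => idtac | _ => fail end;
    lazymatch P with
    | context [Normc.normc _] => clear H
    | is_true (@Order.le _ _ _ _) => revert H
    | is_true (@Order.lt _ _ _ _) => revert H
    | is_true (andb _ _) => revert H
    | _ => clear H
    end
  end; lra.

(** * Modulus and limits of complex numbers *)

Section ComplexModulus.
Variable R : realType.
Local Notation C := R[i].
Implicit Types (z w : C).

Lemma ReD z w : complex.Re (z + w) = complex.Re z + complex.Re w.
Proof. by case: z; case: w. Qed.
Lemma ImD z w : complex.Im (z + w) = complex.Im z + complex.Im w.
Proof. by case: z; case: w. Qed.
Lemma ReN z : complex.Re (- z) = - complex.Re z.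
Proof. by case: z. Qed.
Lemma ImN z : complex.Im (- z) = - complex.Im z.
Proof. by case: z. Qed.
Lemma ReB z w : complex.Re (z - w) = complex.Re z - complex.Re w.
Proof. by rewrite ReD ReN. Qed.
Lemma ImB z w : complex.Im (z - w) = complex.Im z - complex.Im w.
Proof. by rewrite ImD ImN. Qed.
Lemma ReM z w : complex.Re (z * w) =
  complex.Re z * complex.Re w - complex.Im z * complex.Im w.
Proof. by case: z; case: w. Qed.
Lemma ImM z w : complex.Im (z * w) =
  complex.Re z * complex.Im w + complex.Im z * complex.Re w.
Proof. by case: z; case: w. Qed.
Lemma ReZ (a : R) z : complex.Re (a%:C * z) = a * complex.Re z.
Proof. by rewrite ReM /= mul0r subr0. Qed.
Lemma ImZ (a : R) z : complex.Im (a%:C * z) = a * complex.Im z.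
Proof. by rewrite ImM /= mul0r addr0. Qed.

Definition ReImE := (ReD, ImD, ReN, ImN, ReM, ImM).

Lemma complexP z w : complex.Re z = complex.Re w -> complex.Im z = complex.Im w ->
  z = w.
Proof. by case: z w => a b [c d] /= -> ->. Qed.

Lemma nc_norm z : `|z| = (nc z)%:C.
Proof. by rewrite normc_def; case: z. Qed.

Lemma ncE z : nc z = Num.sqrt (complex.Re z ^+ 2 + complex.Im z ^+ 2).
Proof. by case: z. Qed.

Lemma nc_sqr z : nc z ^+ 2 = complex.Re z ^+ 2 + complex.Im z ^+ 2.
Proof. by rewrite ncE sqr_sqrtr// addr_ge0// sqr_ge0. Qed.

Lemma nc_ge0 z : 0 <= nc z.
Proof. by rewrite ncE sqrtr_ge0. Qed.

Lemma ncD z w : nc (z + w) <= nc z + nc w.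
Proof. exact: le_normcD. Qed.
Lemma ncN z : nc (- z) = nc z.
Proof. exact: normcN. Qed.
Lemma ncB z w : nc (z - w) <= nc z + nc w.
Proof. by rewrite -(ncN w) ncD. Qed.
Lemma ncBC z w : nc (z - w) = nc (w - z).
Proof. by rewrite -ncN opprB. Qed.
Lemma ncM z w : nc (z * w) = nc z * nc w.
Proof. exact: Normc.normcM. Qed.
Lemma ncV z : nc z^-1 = (nc z)^-1.
Proof. exact: Normc.normcV. Qed.
Lemma nc0 : nc (0 : C) = 0.
Proof. exact: Normc.normc0. Qed.
Lemma nc1 : nc (1 : C) = 1.
Proof. exact: Normc.normc1. Qed.
Lemma ncX z n : nc (z ^+ n) = nc z ^+ n.
Proof. by elim: n => [|n IH]; rewrite ?expr0 ?nc1// !exprS ncM IH. Qed.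
Lemma nc_eq0 z : (nc z == 0) = (z == 0).
Proof.
apply/eqP/eqP => [/Normc.eq0_normc//|->]; exact: nc0.
Qed.
Lemma nc_gt0 z : (0 < nc z) = (z != 0).
Proof. by rewrite lt_def nc_ge0 andbT nc_eq0. Qed.
Lemma nc_real (a : R) : nc a%:C = `|a|.
Proof. by rewrite ncE /= expr0n/= addr0 sqrtr_sqr. Qed.
Lemma nc_nat n : nc (n%:R : C) = n%:R.
Proof.
have -> : (n%:R : C) = (n%:R)%:C by rewrite rmorph_nat.
by rewrite nc_real ger0_norm.
Qed.
Lemma nc_i : nc ('i%C : C) = 1.
Proof. by rewrite ncE /= expr0n /= add0r expr1n sqrtr1. Qed.
Lemma nc_Re z : `|complex.Re z| <= nc z.
Proof. by rewrite ncE -sqrtr_sqr ler_wsqrtr// lerDl sqr_ge0. Qed.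
Lemma nc_Im z : `|complex.Im z| <= nc z.
Proof. by rewrite ncE -sqrtr_sqr ler_wsqrtr// lerDr sqr_ge0. Qed.
Lemma nc_ReIm z : nc z <= `|complex.Re z| + `|complex.Im z|.
Proof.
case: z => a b; have -> : a +i* b = a%:C + 'i%C * b%:C :> C.
  by apply: complexP; rewrite !ReImE /=; ring.
rewrite (le_trans (ncD _ _))// ncM nc_i mul1r !nc_real !ReImE /=.
by rewrite !(mul0r, mul1r, subr0, addr0, add0r).
Qed.
Lemma nc_sum (I : Type) (r : seq I) (P : pred I) (F : I -> C) :
  nc (\sum_(i <- r | P i) F i) <= \sum_(i <- r | P i) nc (F i).
Proof.
elim/big_ind2 : _ => //; first by rewrite nc0.
by move=> x x' y y' h1 h2; apply: (le_trans (ncD _ _)); exact: lerD.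
Qed.
Lemma ncB_ge z w : nc z - nc w <= nc (z - w).
Proof. by rewrite lerBlDr -{1}(subrK w z) ncD. Qed.
Lemma ncD_ge z w : nc z - nc w <= nc (z + w).
Proof. by rewrite -{2}(opprK w) -(ncN w) ncB_ge. Qed.
Lemma nc_conj z : nc (conjc z) = nc z.
Proof. by rewrite !ncE; case: z => a b /=; rewrite sqrrN. Qed.
Lemma sqri : ('i%C : C) * 'i%C = -1.
Proof. by rewrite -expr2 sqr_i. Qed.

Lemma ler_eps (a b : R) : (forall e, 0 < e -> a <= b + e) -> a <= b.
Proof.
move=> h; rewrite leNgt; apply/negP => ba.
have := h ((a - b) / 2); rewrite divr_gt0 ?subr_gt0// => /(_ isT).
by move=> h'; lra.
Qed.

Lemma ler_half2 (a b e : R) : a <= e / 2 -> b <= e / 2 -> a + b <= e.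
Proof. by move=> h1 h2; lra. Qed.

Lemma nc_eps z : (forall e, 0 < e -> nc z <= e) -> z = 0.
Proof.
move=> h; apply/eqP; rewrite -nc_eq0 eq_le nc_ge0 andbT.
by apply: ler_eps => e /h; rewrite add0r.
Qed.

(** Neighbourhoods in [R[i]] have a radius in [R[i]]; positivity for its order forces the imaginary
    part of the radius to vanish, so real radii suffice. *)
Lemma near_ncP (l : C) (P : C -> Prop) :
  (\forall m \near (l : C^o), P m) <->
  exists2 d : R, 0 < d & forall m, nc (m - l) < d -> P m.
Proof.
split.
  move/nbhs_normP => [e /= e0 h].
  have er : e = (complex.Re e)%:C.
    by case: e e0 {h} => a b; rewrite ltcE /= => /andP[/eqP-> _].
  exists (complex.Re e); first by move: e0; rewrite ltcE => /andP[_].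
  by move=> m hm; apply: h; rewrite /= er -normrN opprB nc_norm ltcR.
move=> [d d0 h]; apply/nbhs_normP; exists d%:C; first by rewrite /= ltcR.
by move=> m /=; rewrite -normrN opprB nc_norm ltcR => /h.
Qed.

Lemma dnear_ncP (l : C) (P : C -> Prop) :
  (\forall m \near (l : C^o)^', P m) <->
  exists2 d : R, 0 < d & forall m, m != l -> nc (m - l) < d -> P m.
Proof.
rewrite near_withinE.
split.
  by move/near_ncP => [d d0 h]; exists d => // m ml /h; exact.
by move=> [d d0 h]; apply/near_ncP; exists d => // m /h hm /hm.
Qed.

(** Convergence with real errors, because the norm of [R[i]] takes its values in [R[i]]. *)
Definition ccvg (u : nat -> C) (l : C) :=
  forall e : R, 0 < e -> exists n0, forall n, (n0 <= n)%N -> nc (u n - l) <= e.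

Lemma ccvg_cst l : ccvg (fun=> l) l.
Proof. by move=> e e0; exists 0%N => n _; rewrite subrr nc0 ltW. Qed.

Lemma ccvg_unique u l l' : ccvg u l -> ccvg u l' -> l = l'.
Proof.
move=> h h'; apply/eqP; rewrite -subr_eq0; apply/eqP/nc_eps => e e0.
have e2 : 0 < e / 2 by rewrite divr_gt0.
have [n1 h1] := h _ e2; have [n2 h2] := h' _ e2.
have {}h1 := h1 _ (leq_maxl n1 n2); have {}h2 := h2 _ (leq_maxr n1 n2).
rewrite -(subrKA (u (maxn n1 n2))) (le_trans (ncD _ _))//.
by rewrite ler_half2// ncBC.
Qed.

Lemma ccvgD u v l k : ccvg u l -> ccvg v k -> ccvg (fun n => u n + v n) (l + k).
Proof.
move=> h h' e e0; have e2 : 0 < e / 2 by rewrite divr_gt0.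
have [n1 h1] := h _ e2; have [n2 h2] := h' _ e2.
exists (maxn n1 n2) => n; rewrite geq_max => /andP[/h1 {}h1 /h2 {}h2].
have -> : u n + v n - (l + k) = (u n - l) + (v n - k) by ring.
by rewrite (le_trans (ncD _ _))// ler_half2.
Qed.

Lemma ccvg_bounded u l : ccvg u l -> exists n0, forall n, (n0 <= n)%N -> nc (u n) <= nc l + 1.
Proof.
move=> /(_ 1 ltr01) [n0 h]; exists n0 => n /h hn.
by rewrite -(subrK l (u n)) (le_trans (ncD _ _))// addrC lerD.
Qed.

Lemma ccvgM u v l k : ccvg u l -> ccvg v k -> ccvg (fun n => u n * v n) (l * k).
Proof.
move=> h h' e e0.
have [n0 h0] := ccvg_bounded h.
have A0 : 0 < nc l + 1 by rewrite ltr_wpDl ?nc_ge0.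
have B0 : 0 < nc k + 1 by rewrite ltr_wpDl ?nc_ge0.
have [n1 h1] : exists n0, forall n, (n0 <= n)%N -> nc (u n - l) <= e / 2 / (nc k + 1).
  by apply: h; rewrite !divr_gt0.
have [n2 h2] : exists n0, forall n, (n0 <= n)%N -> nc (v n - k) <= e / 2 / (nc l + 1).
  by apply: h'; rewrite !divr_gt0.
exists (maxn n0 (maxn n1 n2)) => n; rewrite !geq_max => /and3P[/h0 {}h0 /h1 {}h1 /h2 {}h2].
have -> : u n * v n - l * k = u n * (v n - k) + (u n - l) * k by ring.
rewrite (le_trans (ncD _ _))// !ncM ler_half2//.
  rewrite (le_trans (ler_pM (nc_ge0 _) (nc_ge0 _) h0 h2))//.
  by rewrite mulrCA divff ?mulr1// gt_eqF.
have hk : nc k <= nc k + 1 by rewrite lerDl.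
rewrite (le_trans (ler_pM (nc_ge0 _) (nc_ge0 _) h1 hk))//.
by rewrite divfK// gt_eqF.
Qed.

Lemma ccvgN u l : ccvg u l -> ccvg (fun n => - u n) (- l).
Proof.
by move=> h e /h [n0 hn]; exists n0 => n /hn; rewrite -opprD ncN.
Qed.

Lemma ccvg_cauchy (u : nat -> C) :
  (forall e : R, 0 < e -> exists n0, forall n m, (n0 <= n)%N -> (n0 <= m)%N ->
     nc (u n - u m) <= e) ->
  exists l, ccvg u l.
Proof.
move=> h.
have aux (P : C -> R) : (forall z w, P (z - w) = P z - P w) ->
    (forall z, `|P z| <= nc z) ->
    exists l, forall e : R, 0 < e -> exists n0, forall n, (n0 <= n)%N -> `|P (u n) - l| <= e.
  move=> PB Pn.
  have : cvgn (P \o u).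
    apply/cauchy_cvgP/cauchy_exP => e e0.
    have [n0 hn] := h (e / 2) (divr_gt0 e0 (ltr0n _ 2)).
    exists (P (u n0)); exists n0 => // n /= n0n.
    rewrite /ball /= -PB (le_lt_trans (Pn _))// (le_lt_trans (hn _ _ _ _))//.
    by rewrite ltr_pdivrMr// mulr_natr mulr2n ltrDl.
  move=> /cvgrPdist_le cv; exists (limn (P \o u)) => e /cv [n0 _ hn].
  by exists n0 => n /hn; rewrite distrC.
have [a ha] := aux _ (@ReB) nc_Re.
have [b hb] := aux _ (@ImB) nc_Im.
exists (a +i* b) => e e0; have e2 : 0 < e / 2 by rewrite divr_gt0.
have [n1 h1] := ha _ e2; have [n2 h2] := hb _ e2.
exists (maxn n1 n2) => n; rewrite geq_max => /andP[/h1 {}h1 /h2 {}h2].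
by rewrite (le_trans (nc_ReIm _))// ReB ImB /= ler_half2.
Qed.

End ComplexModulus.

(** * Derivatives along the real line and the complex exponential *)

Section ComplexExponential.
Variable R : realType.
Local Notation C := R[i].
Implicit Types (z w : C) (f g u v : R -> R).

Definition rder u v := forall t : R, is_derive t 1 u (v t).

Lemma rder_eq u u1 v1 : rder u u1 -> u1 =1 v1 -> rder u v1.
Proof. by move=> h e t; rewrite -e. Qed.

Lemma rder_cst (c : R) : rder (fun=> c) (fun=> 0).
Proof. by move=> t; exact: is_derive_cst. Qed.

Lemma rder_id : rder (fun t => t) (fun=> 1).
Proof. by move=> t; exact: is_derive_id. Qed.

Lemma rderD u u1 v v1 : rder u u1 -> rder v v1 ->
  rder (fun t => u t + v t) (fun t => u1 t + v1 t).
Proof. by move=> h h' t; exact: (is_deriveD (h t) (h' t)). Qed.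

Lemma rderN u u1 : rder u u1 -> rder (fun t => - u t) (fun t => - u1 t).
Proof. by move=> h t; exact: (is_deriveN (h t)). Qed.

Lemma rderB u u1 v v1 : rder u u1 -> rder v v1 ->
  rder (fun t => u t - v t) (fun t => u1 t - v1 t).
Proof. by move=> h h' t; exact: (is_deriveB (h t) (h' t)). Qed.

Lemma rderM u u1 v v1 : rder u u1 -> rder v v1 ->
  rder (fun t => u t * v t) (fun t => u1 t * v t + u t * v1 t).
Proof.
move=> h h' t; apply: is_derive_eq; first exact: (is_deriveM (h t) (h' t)).
by rewrite /GRing.scale /=; ring.
Qed.

Lemma rderZ (c : R) u u1 : rder u u1 -> rder (fun t => c * u t) (fun t => c * u1 t).
Proof. by move=> h t; exact: (is_deriveZ c (h t)). Qed.

Lemma rder_comp u u1 v v1 : rder u u1 -> rder v v1 ->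
  rder (fun t => u (v t)) (fun t => u1 (v t) * v1 t).
Proof. by move=> h h' t; exact: (is_derive1_comp (h _) (h' t)). Qed.

Lemma rderX n u u1 : rder u u1 -> rder (fun t => u t ^+ n) (fun t => n%:R * u t ^+ n.-1 * u1 t).
Proof.
move=> h; elim: n => [|n IH].
  under eq_fun do rewrite expr0.
  by apply: (rder_eq (rder_cst 1)) => t; rewrite !mul0r.
under eq_fun do rewrite exprS.
apply: (rder_eq (rderM h IH)) => t /=.
case: n {IH} => [|n] /=; first by rewrite !expr0; ring.
by rewrite (exprS _ n) [in RHS](@natrD _ 1 n.+1); ring.
Qed.

Lemma rder_continuous u u1 : rder u u1 -> continuous u.
Proof.
move=> h t; apply: differentiable_continuous; apply/derivable1_diffP.
exact: (@ex_derive _ _ _ _ _ _ _ (h t)).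
Qed.

Lemma rder_mono u u1 a b : rder u u1 -> (forall t, a <= t <= b -> 0 <= u1 t) ->
  a <= b -> u a <= u b.
Proof.
move=> h h1 ab.
have [c ci e] := @MVT_segment R u u1 a b ab (fun x _ => h x)
  (@continuous_subspaceT _ _ _ _ (rder_continuous h)).
by rewrite -subr_ge0 e mulr_ge0 ?subr_ge0// h1.
Qed.

Definition cder (u v : R -> C) :=
  rder (fun t => complex.Re (u t)) (fun t => complex.Re (v t)) /\
  rder (fun t => complex.Im (u t)) (fun t => complex.Im (v t)).

Lemma cder_eq (u u1 v1 : R -> C) : cder u u1 -> u1 =1 v1 -> cder u v1.
Proof.
by move=> [h h'] e; split; [apply: (rder_eq h)|apply: (rder_eq h')] => t; rewrite e.
Qed.

Lemma cder_cst (c : C) : cder (fun=> c) (fun=> 0).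
Proof. by split=> /=; exact: rder_cst. Qed.

Lemma cder_id : cder (fun t => t%:C) (fun=> 1).
Proof. by split=> /=; [exact: rder_id|exact: rder_cst]. Qed.

Lemma cderD (u u1 v v1 : R -> C) : cder u u1 -> cder v v1 ->
  cder (fun t => u t + v t) (fun t => u1 t + v1 t).
Proof.
move=> [a b] [c d]; split.
  have := rderD a c; under [X in rder X]eq_fun do rewrite -ReD.
  by move/rder_eq; apply => t; rewrite ReD.
have := rderD b d; under [X in rder X]eq_fun do rewrite -ImD.
by move/rder_eq; apply => t; rewrite ImD.
Qed.

Lemma cderM (u u1 v v1 : R -> C) : cder u u1 -> cder v v1 ->
  cder (fun t => u t * v t) (fun t => u1 t * v t + u t * v1 t).
Proof.
move=> [a b] [c d]; split.
  have := rderB (rderM a c) (rderM b d); under [X in rder X]eq_fun do rewrite -ReM.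
  by move/rder_eq; apply => t; rewrite ReD !ReM; ring.
have := rderD (rderM a d) (rderM b c); under [X in rder X]eq_fun do rewrite -ImM.
by move/rder_eq; apply => t; rewrite ImD !ImM; ring.
Qed.

Lemma cderZ (c : C) (u u1 : R -> C) : cder u u1 ->
  cder (fun t => c * u t) (fun t => c * u1 t).
Proof.
move=> h; apply: (cder_eq (cderM (cder_cst c) h)) => t.
by rewrite mul0r add0r.
Qed.

Lemma cderN (u u1 : R -> C) : cder u u1 -> cder (fun t => - u t) (fun t => - u1 t).
Proof.
move=> /(cderZ (-1)) h; have -> : (fun t => - u t) = (fun t => -1 * u t).
  by apply/funext => t; rewrite mulN1r.
by apply: (cder_eq h) => t; rewrite mulN1r.
Qed.

Lemma cderX n (u u1 : R -> C) : cder u u1 ->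
  cder (fun t => u t ^+ n) (fun t => n%:R * u t ^+ n.-1 * u1 t).
Proof.
move=> h; elim: n => [|n IH].
  under eq_fun do rewrite expr0.
  by apply: (cder_eq (cder_cst 1)) => t; rewrite !mul0r.
under eq_fun do rewrite exprS.
apply: (cder_eq (cderM h IH)) => t /=.
case: n {IH} => [|n] /=; first by rewrite !expr0; ring.
by rewrite (exprS _ n) [in RHS](@natrD _ 1 n.+1); ring.
Qed.

Lemma cder_sum (I : Type) (r : seq I) (F G : I -> R -> C) :
  (forall i, cder (F i) (G i)) ->
  cder (fun t => \sum_(i <- r) F i t) (fun t => \sum_(i <- r) G i t).
Proof.
move=> h; elim: r => [|i r IH].
  under eq_fun do rewrite big_nil.
  by apply: (cder_eq (cder_cst 0)) => t; rewrite big_nil.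
under eq_fun do rewrite big_cons.
by apply: (cder_eq (cderD (h i) IH)) => t; rewrite big_cons.
Qed.

Lemma cder_shift (a : R) (u u1 : R -> C) : cder u u1 ->
  cder (fun t => u (t - a)) (fun t => u1 (t - a)).
Proof.
have hs : rder (fun t => t - a) (fun=> 1).
  by apply: (rder_eq (rderB rder_id (rder_cst a))) => t; rewrite subr0.
move=> [h h']; split.
  by apply: (rder_eq (rder_comp h hs)) => t; rewrite mulr1.
by apply: (rder_eq (rder_comp h' hs)) => t; rewrite mulr1.
Qed.

Definition cexp z : C := (expR (complex.Re z))%:C * cis (complex.Im z).

Lemma cexp0 : cexp 0 = 1.
Proof. by rewrite /cexp /cis /= expR0 cos0 sin0 mul1r. Qed.

Lemma cisD (a b : R) : cis (a + b) = cis a * cis b.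
Proof. by apply: complexP; rewrite ?ReM ?ImM /= ?cosD ?sinD; ring. Qed.

Lemma nc_cis (a : R) : nc (cis a) = 1.
Proof. by rewrite ncE /= cos2Dsin2 sqrtr1. Qed.

Lemma cexpD z w : cexp (z + w) = cexp z * cexp w.
Proof. by rewrite /cexp ReD ImD expRD cisD rmorphM /=; ring. Qed.

Lemma nc_cexp z : nc (cexp z) = expR (complex.Re z).
Proof. by rewrite ncM nc_cis mulr1 nc_real ger0_norm// expR_ge0. Qed.

Lemma cexp_neq0 z : cexp z != 0.
Proof. by rewrite -nc_gt0 nc_cexp expR_gt0. Qed.

Lemma cexpN z : cexp (- z) = (cexp z)^-1.
Proof.
by apply: (mulfI (cexp_neq0 z)); rewrite -cexpD subrr cexp0 divff// cexp_neq0.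
Qed.

Lemma cexpX z n : cexp (n%:R * z) = cexp z ^+ n.
Proof.
elim: n => [|n IH]; first by rewrite mul0r cexp0 expr0.
by rewrite -natr1 mulrDl mul1r cexpD IH exprSr.
Qed.

Lemma cder_cexp z : cder (fun t => cexp (z * t%:C)) (fun t => z * cexp (z * t%:C)).
Proof.
have e1 t : complex.Re (z * t%:C) = complex.Re z * t.
  by rewrite ReM /= mulr0 subr0.
have e2 t : complex.Im (z * t%:C) = complex.Im z * t.
  by rewrite ImM /= mulr0 add0r.
have hl c : rder (fun t => c * t) (fun=> c).
  by apply: (rder_eq (rderZ c rder_id)) => t; rewrite mulr1.
have hE := rder_comp (@is_derive_expR R) (hl (complex.Re z)).
have hC := rder_comp (@is_derive_cos R) (hl (complex.Im z)).
have hS := rder_comp (@is_derive_sin R) (hl (complex.Im z)).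
split.
  have -> : (fun t => complex.Re (cexp (z * t%:C))) =
      (fun t => expR (complex.Re z * t) * cos (complex.Im z * t)).
    by apply/funext => t; rewrite /cexp ReZ e1 e2.
  apply: (rder_eq (rderM hE hC)) => t.
  by rewrite ReM /cexp ReZ ImZ e1 e2 /=; ring.
have -> : (fun t => complex.Im (cexp (z * t%:C))) =
    (fun t => expR (complex.Re z * t) * sin (complex.Im z * t)).
  by apply/funext => t; rewrite /cexp ImZ e1 e2.
apply: (rder_eq (rderM hE hS)) => t.
by rewrite ImM /cexp ReZ ImZ e1 e2 /=; ring.
Qed.

(** After a rotation by the phase [c], the number [c * u t] equals [nc (u t)], and the real function
    [psi - Re (c * u)] has a nonnegative derivative on [[0, t]]. *)
Lemma cmvt (u u1 : R -> C) psi psi1 t : cder u u1 -> rder psi psi1 ->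
  0 <= t -> u 0 = 0 -> psi 0 = 0 -> (forall s, 0 <= s <= t -> nc (u1 s) <= psi1 s) ->
  nc (u t) <= psi t.
Proof.
move=> hu hp t0 u0 p0 h.
have [->|ut] := eqVneq (u t) 0.
  rewrite nc0 -p0; apply: (rder_mono hp) => // s /h; exact/le_trans/nc_ge0.
set c := conjc (u t) / (nc (u t))%:C.
have n0 : nc (u t) != 0 by rewrite nc_eq0.
have nC : nc c = 1.
  by rewrite ncM nc_conj ncV nc_real ger0_norm ?nc_ge0// divff.
have cu : complex.Re (c * u t) = nc (u t).
  have -> : c * u t = (nc (u t))%:C.
    rewrite /c mulrAC; apply: (canLR (mulfK _)).
      by apply/eqP => /complexI/eqP; apply/negP.
    rewrite -rmorphM/= -expr2 nc_sqr.
    by case: (u t) => a b; apply: complexP; rewrite ?ReM ?ImM /=; ring.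
  by [].
have [hre _] := cderZ c hu.
have := rder_mono (rderB hp hre) _ t0.
rewrite u0 mulr0 p0 /= subrr cu subr_ge0; apply => s /h hs.
rewrite subr_ge0 (le_trans _ hs)// (le_trans (ler_norm _))//.
by rewrite (le_trans (nc_Re _))// ncM nC mul1r.
Qed.

Definition cexp_sum n z : C := \sum_(k < n) z ^+ k / (k`!)%:R.

(** Along the ray through [z], the derivative of the remainder of order [n + 1] is [z] times the
    remainder of order [n], so [cmvt] integrates the bound. The power [t ^ n] in the auxiliary claim
    makes the induction close. *)
Lemma cexp_taylor n z :
  nc (cexp z - cexp_sum n z) <= nc z ^+ n / (n`!)%:R * expR (nc z).
Proof.
suff h t : 0 <= t <= 1 -> nc (cexp (z * t%:C) - cexp_sum n (z * t%:C)) <=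
     (nc z ^+ n / (n`!)%:R * expR (nc z)) * t ^+ n.
  by have := h 1; rewrite ler01 lexx mulr1 expr1n mulr1; exact.
elim: n t => [|n IH] t /andP[t0 t1].
  rewrite /cexp_sum big_ord0 subr0 nc_cexp !expr0 fact0 invr1 !mul1r mulr1.
  rewrite ler_expR ReM /= mulr0 subr0 (le_trans (ler_norm _))// normrM.
  by rewrite (le_trans _ (nc_Re z))// ler_piMr ?normr_ge0// ger0_norm.
have hsum : cder (fun t => cexp_sum n.+1 (z * t%:C)) (fun t => z * cexp_sum n (z * t%:C)).
  rewrite /cexp_sum.
  under eq_fun do rewrite big_ord_recl expr0 fact0 invr1 mulr1.
  have hz : cder (fun t => z * t%:C) (fun=> z).
    by apply: (cder_eq (cderZ z cder_id)) => s; rewrite mulr1.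
  have hk (k : 'I_n) : cder (fun t => (z * t%:C) ^+ lift ord0 k / ((lift ord0 k)`!)%:R)
      (fun t => z * ((z * t%:C) ^+ k / (k`!)%:R)).
    under eq_fun do rewrite mulrC.
    apply: (cder_eq (cderZ _ (cderX _ hz))) => s; rewrite lift0 /= factS natrM.
    have f0 : (k`!)%:R != 0 :> C by rewrite pnatr_eq0 -lt0n fact_gt0.
    have k0 : (k.+1)%:R != 0 :> C by rewrite pnatr_eq0.
    move: f0 k0; move: (k`!%:R : C) (k.+1%:R : C) => F K f0 k0.
    by field; rewrite f0 k0.
  have := cderD (cder_cst 1) (cder_sum (index_enum 'I_n) hk).
  by move/cder_eq; apply => s; rewrite add0r mulr_sumr.
have hd := cderD (cder_cexp z) (cderN hsum).
have hp : rder (fun t => (nc z ^+ n.+1 / (n.+1)`!%:R * expR (nc z)) * t ^+ n.+1)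
   (fun t => nc z * ((nc z ^+ n / n`!%:R * expR (nc z)) * t ^+ n)).
  apply: (rder_eq (rderZ _ (rderX _ rder_id))) => s; rewrite /= mulr1 factS natrM.
  have f0 : (n`!)%:R != 0 :> R by rewrite pnatr_eq0 -lt0n fact_gt0.
  have k0 : (n.+1)%:R != 0 :> R by rewrite pnatr_eq0.
  rewrite exprS; move: f0 k0; move: (n`!%:R : R) (n.+1%:R : R) => F K f0 k0.
  by field; rewrite f0 k0.
apply: (cmvt hd hp t0).
- rewrite mulr0 cexp0 /cexp_sum big_ord_recl expr0 fact0 invr1 mulr1 big1 ?addr0 ?subrr// => i _.
  by rewrite lift0 exprS !mul0r.
- by rewrite expr0n mulr0.
- move=> s /andP[s0 st]; rewrite -mulrBr ncM ler_wpM2l ?nc_ge0// IH//.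
  by rewrite s0 (le_trans st).
Qed.

End ComplexExponential.

(** * Entire fundamental solutions of u'' = z u *)

Section HyperbolicFunctions.
Variable R : realType.
Local Notation C := R[i].
Implicit Types (z w a : C).

(* [coshs z t = cosh (sqrt z t)] and [sinhs z t = sinh (sqrt z t) / sqrt z], the
   fundamental solutions of [u'' = z u]; both are entire in [z]. *)
Definition coshs z (t : R) : C :=
  (cexp (sqrtc z * t%:C) + cexp (- (sqrtc z * t%:C))) / 2.
Definition sinhs z (t : R) : C :=
  if z == 0 then t%:C
  else (cexp (sqrtc z * t%:C) - cexp (- (sqrtc z * t%:C))) / (2 * sqrtc z).

Lemma two_neq0 : (2 : C) != 0.
Proof. by rewrite pnatr_eq0. Qed.
Hint Resolve two_neq0 : core.

(** The formula is even in the square root, so any root [a] of [z] may replace [sqrtc z]; the choice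
    of branch is thereby invisible. *)
Lemma coshsE a z t : a ^+ 2 = z ->
  coshs z t = (cexp (a * t%:C) + cexp (- (a * t%:C))) / 2.
Proof.
move=> az; have /eqP := sqr_sqrtc z; rewrite -{2}az eqf_sqr => /orP[] /eqP e.
  by rewrite /coshs e.
by rewrite /coshs e mulNr opprK [in RHS]addrC.
Qed.

Lemma sinhsE a z t : a ^+ 2 = z -> a != 0 ->
  sinhs z t = (cexp (a * t%:C) - cexp (- (a * t%:C))) / (2 * a).
Proof.
move=> az a0; have z0 : z == 0 = false by rewrite -az sqrf_eq0 (negbTE a0).
rewrite /sinhs z0.
have /eqP := sqr_sqrtc z; rewrite -{2}az eqf_sqr => /orP[] /eqP e; rewrite e//.
by rewrite mulNr opprK mulrN invrN mulrN -mulNr opprB.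
Qed.

Lemma sqrtc_neq0 z : z != 0 -> sqrtc z != 0.
Proof. by rewrite sqrtc_eq0. Qed.

Lemma sinhs_mul a z t : a ^+ 2 = z -> a * sinhs z t = (cexp (a * t%:C) - cexp (- (a * t%:C))) / 2.
Proof.
move=> az; have [a0|a0] := eqVneq a 0; first by rewrite a0 !mul0r oppr0 subrr mul0r.
by rewrite (sinhsE t az a0); field; rewrite a0.
Qed.

Lemma cexp_csD a z t : a ^+ 2 = z -> cexp (a * t%:C) = coshs z t + a * sinhs z t.
Proof. by move=> az; rewrite (sinhs_mul t az) (coshsE t az); field. Qed.

Lemma cexp_csB a z t : a ^+ 2 = z -> cexp (- (a * t%:C)) = coshs z t - a * sinhs z t.
Proof. by move=> az; rewrite (sinhs_mul t az) (coshsE t az); field. Qed.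

Lemma coshs_det z t : coshs z t ^+ 2 - z * sinhs z t ^+ 2 = 1.
Proof.
have e := sqr_sqrtc z; rewrite -{2}e.
rewrite (_ : _ - _ = (coshs z t + sqrtc z * sinhs z t) * (coshs z t - sqrtc z * sinhs z t)); last by ring.
by rewrite -cexp_csD// -cexp_csB// -cexpD subrr cexp0.
Qed.

Lemma coshs0 z : coshs z 0 = 1.
Proof. by rewrite /coshs mulr0 oppr0 cexp0 -[1 + 1]/2 divff. Qed.

Lemma sinhs0 z : sinhs z 0 = 0.
Proof. by rewrite /sinhs mulr0 oppr0 cexp0 subrr mul0r; case: ifP. Qed.

Lemma cder_coshs z : cder (coshs z) (fun t => z * sinhs z t).
Proof.
have e := sqr_sqrtc z.
have h : cder (coshs z) (fun t => 2^-1 * (sqrtc z * cexp (sqrtc z * t%:C) + - sqrtc z * cexp (- sqrtc z * t%:C))).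
  rewrite /coshs; under eq_fun do rewrite mulrC -[- (sqrtc z * _)]mulNr.
  by apply: cderZ; apply: cderD; exact: cder_cexp.
apply: (cder_eq h) => t.
have -> : z * sinhs z t = sqrtc z * ((cexp (sqrtc z * t%:C) - cexp (- (sqrtc z * t%:C))) / 2).
  by rewrite -(sinhs_mul t e) mulrA -expr2 e.
by rewrite !mulNr; ring.
Qed.

Lemma cder_sinhs z : cder (sinhs z) (coshs z).
Proof.
have [z0|z0] := eqVneq z 0.
  rewrite z0 /sinhs eqxx; apply: (cder_eq (@cder_id R)) => t.
  by rewrite /coshs sqrtc0 !mul0r oppr0 cexp0 -[1 + 1]/2 divff.
have e := sqr_sqrtc z; have a0 := sqrtc_neq0 z0.
have h : cder (sinhs z) (fun t => (2 * sqrtc z)^-1 * (sqrtc z * cexp (sqrtc z * t%:C) + - (- sqrtc z * cexp (- sqrtc z * t%:C)))).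
  rewrite /sinhs (negbTE z0); under eq_fun do rewrite mulrC -[- (sqrtc z * _)]mulNr.
  apply: cderZ; apply: cderD; first exact: cder_cexp.
  by apply: cderN; exact: cder_cexp.
apply: (cder_eq h) => t; rewrite (coshsE t e) mulNr opprK -mulrDr mulrA mulNr.
by field; rewrite a0.
Qed.

Lemma expr_even_opp (w : C) n : (- w) ^+ (2 * n) = w ^+ (2 * n).
Proof. by rewrite !exprM sqrrN. Qed.

(** The odd terms of the exponential sums at [a t] and [- a t] cancel. *)
Lemma coshs_sumE n a t : \sum_(k < n) (a ^+ 2) ^+ k * t%:C ^+ (2 * k) / ((2 * k)`!)%:R =
  (cexp_sum (2 * n) (a * t%:C) + cexp_sum (2 * n) (- (a * t%:C))) / 2.
Proof.
elim: n => [|n IH]; first by rewrite muln0 /cexp_sum !big_ord0 addr0 mul0r.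
rewrite big_ord_recr /= IH mulnS add2n /cexp_sum !big_ord_recr /=.
rewrite !(exprS _ (2 * n)) !expr_even_opp -exprM exprMn.
have f0 : (((2 * n)`!)%:R : C) != 0 by rewrite pnatr_eq0 -lt0n fact_gt0.
have f1 : (((2 * n).+1`!)%:R : C) != 0 by rewrite pnatr_eq0 -lt0n fact_gt0.
move: f0 f1; move: (((2 * n)`!)%:R : C) (((2 * n).+1`!)%:R : C) => F G f0 f1.
by field; rewrite f0 f1.
Qed.

Lemma sinhs_sumE n a t : a * \sum_(k < n) (a ^+ 2) ^+ k * t%:C ^+ (2 * k).+1 / ((2 * k).+1`!)%:R =
  (cexp_sum (2 * n).+1 (a * t%:C) - cexp_sum (2 * n).+1 (- (a * t%:C))) / 2.
Proof.
elim: n => [|n IH].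
  by rewrite muln0 /cexp_sum !big_ord0 !big_ord_recr !big_ord0 /= !expr0 subrr mul0r mulr0.
rewrite big_ord_recr /= mulrDr IH mulnS add2n /cexp_sum !(big_ord_recr (2 * n).+2) !(big_ord_recr (2 * n).+1) /=.
rewrite !(exprS (- _)) !expr_even_opp -exprM.
have f0 : (((2 * n).+1`!)%:R : C) != 0 by rewrite pnatr_eq0 -lt0n fact_gt0.
have f1 : (((2 * n).+2`!)%:R : C) != 0 by rewrite pnatr_eq0 -lt0n fact_gt0.
have -> : a * (a ^+ (2 * n) * t%:C ^+ (2 * n).+1 / ((2 * n).+1)`!%:R) = (a * t%:C) ^+ (2 * n).+1 / ((2 * n).+1)`!%:R.
  by rewrite exprMn (exprS a) !mulrA.
rewrite !(exprS (a * _)).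
move: f0 f1; move: (((2 * n).+1`!)%:R : C) (((2 * n).+2`!)%:R : C) => F G f0 f1.
by field; rewrite f0 f1.
Qed.

Lemma coshs_taylor n a z t : a ^+ 2 = z ->
  nc (coshs z t - \sum_(k < n) z ^+ k * t%:C ^+ (2 * k) / ((2 * k)`!)%:R) <=
  (nc a * `|t|) ^+ (2 * n) / ((2 * n)`!)%:R * expR (nc a * `|t|).
Proof.
move=> az; rewrite -[in X in X <= _]az coshs_sumE (coshsE t (erefl (a ^+ 2))).
have h := cexp_taylor (2 * n) (a * t%:C); have h' := cexp_taylor (2 * n) (- (a * t%:C)).
rewrite ncN in h'; rewrite ncM nc_real in h h'.
set A := cexp _ in h *; set B := cexp _ in h' *; set A' := cexp_sum _ _ in h *; set B' := cexp_sum _ _ in h' *.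
have -> : (A + B) / 2 - (A' + B') / 2 = ((A - A') + (B - B')) / 2 by ring.
rewrite ncM ncV nc_nat ler_pdivrMr// (le_trans (ncD _ _))//.
by rewrite mulr_natr mulr2n lerD.
Qed.

Lemma sinhs_taylor n a z t : a ^+ 2 = z ->
  nc (sinhs z t - \sum_(k < n) z ^+ k * t%:C ^+ (2 * k).+1 / ((2 * k).+1`!)%:R) <=
  nc a ^+ (2 * n) * `|t| ^+ (2 * n).+1 / ((2 * n).+1`!)%:R * expR (nc a * `|t|).
Proof.
move=> az; have [a0|a0] := eqVneq a 0.
  rewrite -az a0 expr2 mul0r /sinhs eqxx nc0 mul0r expR0 mulr1.
  case: n => [|n]; last first.
    rewrite big_ord_recl big1 => [|k _]; last by rewrite lift0 exprS !mul0r.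
    by rewrite (_ : nat_of_ord ord0 = 0%N)// muln0 expr0 mul1r expr1 (_ : 1`! = 1%N)// divr1 addr0 subrr nc0 mulnS add2n !exprS !mul0r.
  by rewrite big_ord0 subr0 muln0 expr0 mul1r expr1 (_ : 1`! = 1%N)// divr1 nc_real.
have p : 0 < nc a by rewrite nc_gt0.
rewrite -(ler_pM2l p) -ncM mulrBr (sinhs_mul t az) -[in X in X <= _]az sinhs_sumE.
have h := cexp_taylor (2 * n).+1 (a * t%:C); have h' := cexp_taylor (2 * n).+1 (- (a * t%:C)).
rewrite ncN in h'; rewrite ncM nc_real in h h'.
set A := cexp _ in h *; set B := cexp _ in h' *; set A' := cexp_sum _ _ in h *; set B' := cexp_sum _ _ in h' *.
have -> : (A - B) / 2 - (A' - B') / 2 = ((A - A') - (B - B')) / 2 by ring.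
rewrite ncM ncV nc_nat ler_pdivrMr// (le_trans (ncB _ _))//.
rewrite mulr_natr mulr2n !mulrA -exprS -exprMn; exact: lerD.
Qed.

End HyperbolicFunctions.

(** * Measurability of complex functions *)

Section ComplexMeasurable.
Context d (T : measurableType d) (R : realType).
Local Notation C := R[i].
Implicit Types (f g : T -> C).

(** [Cmeasurable] over an arbitrary measurable space, because kernels live on [R * R]. *)
Definition cmeas f := measurable_fun setT (fun x => complex.Re (f x)) /\
  measurable_fun setT (fun x => complex.Im (f x)).

Lemma cmeas_cst (c : C) : cmeas (fun=> c).
Proof. by split; exact: measurable_cst. Qed.

Lemma cmeasD f g : cmeas f -> cmeas g -> cmeas (fun x => f x + g x).
Proof.
move=> [a b] [c e]; split.
  by under eq_fun do rewrite ReD; exact: measurable_funD.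
by under eq_fun do rewrite ImD; exact: measurable_funD.
Qed.

Lemma cmeasM f g : cmeas f -> cmeas g -> cmeas (fun x => f x * g x).
Proof.
move=> [a b] [c e]; split.
  by under eq_fun do rewrite ReM; apply: measurable_funB; exact: measurable_funM.
by under eq_fun do rewrite ImM; apply: measurable_funD; exact: measurable_funM.
Qed.

Lemma cmeasZ (c : C) f : cmeas f -> cmeas (fun x => c * f x).
Proof. by apply: cmeasM; exact: cmeas_cst. Qed.

Lemma cmeasN f : cmeas f -> cmeas (fun x => - f x).
Proof.
by move=> /(cmeasZ (-1)); under eq_fun do rewrite mulN1r.
Qed.

Lemma cmeasB f g : cmeas f -> cmeas g -> cmeas (fun x => f x - g x).
Proof. by move=> h /cmeasN; exact: cmeasD. Qed.

Lemma cmeas_real (f : T -> R) : measurable_fun setT f -> cmeas (fun x => (f x)%:C).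
Proof. by move=> h; split=> //=; exact: measurable_cst. Qed.

Lemma cmeas_if (b : T -> bool) f g : measurable_fun setT b -> cmeas f -> cmeas g ->
  cmeas (fun x => if b x then f x else g x).
Proof.
move=> mb [h1 h2] [h3 h4]; split.
  have -> : (fun x => complex.Re (if b x then f x else g x)) =
     (fun x => if b x then complex.Re (f x) else complex.Re (g x)).
    by apply/funext => x; case: ifP.
  exact: measurable_fun_ifT.
have -> : (fun x => complex.Im (if b x then f x else g x)) =
   (fun x => if b x then complex.Im (f x) else complex.Im (g x)).
  by apply/funext => x; case: ifP.
exact: measurable_fun_ifT.
Qed.

Lemma measurable_nc f : cmeas f -> measurable_fun setT (fun x => nc (f x)).
Proof.
move=> [h1 h2]; under eq_fun do rewrite ncE.
apply: measurableT_comp; first by apply: continuous_measurable_fun; exact: sqrt_continuous.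
by apply: measurable_funD; apply: measurable_funX.
Qed.

Lemma cmeas_lim (u : nat -> T -> C) f : (forall n, cmeas (u n)) ->
  (forall x, ccvg (u ^~ x) (f x)) -> cmeas f.
Proof.
move=> mu cv; split.
  apply: (@measurable_fun_cvg _ _ _ setT (fun n x => complex.Re (u n x))) => //.
    by move=> n; have [] := mu n.
  move=> x _; apply/cvgrPdist_le => e e0.
  have [n0 h] := cv x e e0; exists n0 => // n /= /h; apply: le_trans.
  by rewrite distrC -ReB nc_Re.
apply: (@measurable_fun_cvg _ _ _ setT (fun n x => complex.Im (u n x))) => //.
  by move=> n; have [] := mu n.
move=> x _; apply/cvgrPdist_le => e e0.
have [n0 h] := cv x e e0; exists n0 => // n /= /h; apply: le_trans.
by rewrite distrC -ImB nc_Im.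
Qed.

End ComplexMeasurable.

Lemma cmeas_comp d1 d2 (T1 : measurableType d1) (T2 : measurableType d2) (R : realType)
  (f : T2 -> R[i]) (g : T1 -> T2) : cmeas f -> measurable_fun setT g ->
  cmeas (fun x => f (g x)).
Proof.
move=> [h1 h2] mg; split.
  exact: (measurableT_comp h1 mg).
exact: (measurableT_comp h2 mg).
Qed.

(** * Integrals of complex functions *)

Section ComplexIntegral.
Variable R : realType.
Local Notation C := R[i].
Local Notation mu := (@lebesgue_measure R).
Implicit Types (f g : R -> C) (A : set R).

Lemma ae_imp (P Q : R -> Prop) : {ae mu, forall x, P x} ->
  (forall x, P x -> Q x) -> {ae mu, forall x, Q x}.
Proof. by move=> h pq; apply: negligibleS h => x /= nq p; apply: nq; exact: pq. Qed.

Lemma ae_and (P Q : R -> Prop) : {ae mu, forall x, P x} -> {ae mu, forall x, Q x} ->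
  {ae mu, forall x, P x /\ Q x}.
Proof.
move=> h h'; have := negligibleU h h'; apply: negligibleS => x /= nq.
by apply: contrapT => /not_orP[/contrapT p /contrapT q]; apply: nq.
Qed.

Lemma conjMnc (z : C) : conjc z * z = (nc z ^+ 2)%:C.
Proof.
by rewrite nc_sqr; case: z => a b; apply: complexP; rewrite ?ReM ?ImM /=; ring.
Qed.

Definition rint A (f : R -> R) := mu.-integrable A (fun x => (f x)%:E).

Lemma rint_eq A (f g : R -> R) : measurable A -> (forall x, A x -> f x = g x) ->
  rint A f -> rint A g.
Proof.
move=> mA h; apply: eq_integrable => // x; rewrite inE => Ax /=; by rewrite h.
Qed.

Lemma rintD A (f g : R -> R) : measurable A -> rint A f -> rint A g ->
  rint A (fun x => f x + g x).
Proof. by move=> mA a b; exact: (@integrableD _ _ R mu A mA _ _ a b). Qed.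

Lemma rintB A (f g : R -> R) : measurable A -> rint A f -> rint A g ->
  rint A (fun x => f x - g x).
Proof. by move=> mA a b; exact: (@integrableB _ _ R mu A mA _ _ a b). Qed.

Lemma rintZ A (c : R) (f : R -> R) : measurable A -> rint A f ->
  rint A (fun x => c * f x).
Proof. by move=> mA a; exact: (@integrableZl _ _ R mu A mA c _ a). Qed.

Lemma rint_norm A (f : R -> R) : rint A f -> rint A (fun x => `|f x|).
Proof. by move=> a; exact: (@integrable_abse _ _ R mu A _ a). Qed.

Lemma rintS (A B : set R) (f : R -> R) : measurable A -> measurable B -> B `<=` A ->
  rint A f -> rint B f.
Proof. by move=> mA mB BA a; exact: (@integrableS _ _ R mu A B _ mA mB BA a). Qed.

Definition Cint A f := mu.-integrable A (fun x => (complex.Re (f x))%:E) /\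
  mu.-integrable A (fun x => (complex.Im (f x))%:E).

Lemma integrable_le (A : set R) (f : R -> R) (G : R -> R) : measurable A ->
  measurable_fun setT f ->
  mu.-integrable A (fun x => (G x)%:E) -> (forall x, A x -> `|f x| <= G x) ->
  mu.-integrable A (fun x => (f x)%:E).
Proof.
move=> mA mf iG h; apply: le_integrable iG => //.
  by apply/measurable_EFinP; exact: measurable_funTS.
move=> x Ax /=; rewrite lee_fin (le_trans (h x Ax))//; exact: ler_norm.
Qed.

Lemma Cint_le A f (G : R -> R) : measurable A -> cmeas f ->
  mu.-integrable A (fun x => (G x)%:E) -> (forall x, A x -> nc (f x) <= G x) ->
  Cint A f.
Proof.
move=> mA [m1 m2] iG h; split; apply: (integrable_le mA _ iG) => // x /h; apply: le_trans.
  exact: nc_Re.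
exact: nc_Im.
Qed.

Lemma Cint_nc A f : measurable A -> cmeas f -> Cint A f ->
  rint A (fun x => nc (f x)).
Proof.
move=> mA mf [i1 i2]; have i3 := rintD mA (rint_norm i1) (rint_norm i2).
apply: (integrable_le mA _ i3); first exact: measurable_nc.
by move=> x _; rewrite ger0_norm ?nc_ge0// nc_ReIm.
Qed.

Lemma CintD A f g : measurable A -> Cint A f -> Cint A g -> Cint A (fun x => f x + g x).
Proof.
move=> mA [a b] [c d]; split.
  by apply: (rint_eq mA _ (rintD mA a c)) => x _; rewrite ReD.
by apply: (rint_eq mA _ (rintD mA b d)) => x _; rewrite ImD.
Qed.

Lemma CintZ A (c : C) f : measurable A -> Cint A f -> Cint A (fun x => c * f x).
Proof.
move=> mA [a b]; split.
  by apply: (rint_eq mA _ (rintB mA (rintZ (complex.Re c) mA a) (rintZ (complex.Im c) mA b)))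
    => x _; rewrite ReM.
by apply: (rint_eq mA _ (rintD mA (rintZ (complex.Re c) mA b) (rintZ (complex.Im c) mA a)))
  => x _; rewrite ImM.
Qed.

Lemma CintN A f : measurable A -> Cint A f -> Cint A (fun x => - f x).
Proof. by move=> mA /(CintZ (-1) mA); under eq_fun do rewrite mulN1r. Qed.

Lemma CintegralD A f g : measurable A -> Cint A f -> Cint A g ->
  Cintegral A (fun x => f x + g x) = Cintegral A f + Cintegral A g.
Proof.
move=> mA [a b] [c d]; rewrite /Cintegral.
under eq_Rintegral do rewrite ReD.
under [X in _ +i* X]eq_Rintegral do rewrite ImD.
by rewrite !RintegralD.
Qed.

Lemma CintegralZ A (c : C) f : measurable A -> Cint A f ->
  Cintegral A (fun x => c * f x) = c * Cintegral A f.
Proof.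
move=> mA [a b]; rewrite /Cintegral.
under eq_Rintegral do rewrite ReM.
under [X in _ +i* X]eq_Rintegral do rewrite ImM.
rewrite RintegralB ?RintegralD//; try exact: rintZ.
by rewrite !RintegralZl//; apply: complexP; rewrite ?ReM ?ImM.
Qed.

Lemma CintegralN A f : measurable A -> Cint A f ->
  Cintegral A (fun x => - f x) = - Cintegral A f.
Proof.
move=> mA /(CintegralZ (-1) mA) h; rewrite -mulN1r -h.
by congr Cintegral; apply/funext => x; rewrite mulN1r.
Qed.

Lemma CintegralB A f g : measurable A -> Cint A f -> Cint A g ->
  Cintegral A (fun x => f x - g x) = Cintegral A f - Cintegral A g.
Proof. by move=> mA iF iG; rewrite CintegralD// ?CintegralN//; exact: CintN. Qed.

Lemma eq_Cintegral A f g : (forall x, A x -> f x = g x) -> Cintegral A f = Cintegral A g.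
Proof.
by move=> h; rewrite /Cintegral; congr (_ +i* _); apply: eq_Rintegral => x;
  rewrite inE => /h ->.
Qed.

Lemma Cintegral0 A : Cintegral A (fun=> 0 : C) = 0.
Proof.
rewrite /Cintegral /=; have -> : \int[mu]_(x in A) (0 : R) = 0.
  by rewrite /Rintegral integral0.
by [].
Qed.

(** The phase [c] turns the integral into its modulus, which is then the integral of [Re (c * f)], a
    function below [nc f]. *)
Lemma nc_Cintegral_le A f (G : R -> R) : measurable A -> Cint A f ->
  mu.-integrable A (fun x => (G x)%:E) ->
  (forall x, A x -> nc (f x) <= G x) -> nc (Cintegral A f) <= \int[mu]_(x in A) G x.
Proof.
move=> mA iF iG h; set I := Cintegral A f.
have [I0|I0] := eqVneq I 0.
  rewrite I0 nc0; apply: Rintegral_ge0 => x /h; apply: le_trans; exact: nc_ge0.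
have n0 : nc I != 0 by rewrite nc_eq0.
set c := conjc I / (nc I)%:C.
have nC : nc c = 1.
  by rewrite ncM nc_conj ncV nc_real ger0_norm ?nc_ge0// divff.
have -> : nc I = complex.Re (c * I).
  have -> : c * I = (nc I)%:C.
    rewrite /c mulrAC; apply: (canLR (mulfK _)).
      by apply/eqP => /complexI/eqP; apply/negP.
    by rewrite conjMnc -rmorphM.
  by [].
rewrite /I -CintegralZ//= le_Rintegral//; first by have [] := CintZ c mA iF.
move=> x /h hx; rewrite (le_trans (ler_norm _))// (le_trans (nc_Re _))//.
by rewrite ncM nC mul1r.
Qed.

Lemma Cintegral_mkcond A f : measurable A ->
  Cintegral A f = Cintegral setT (fun x => if x \in A then f x else 0).
Proof.
move=> mA; rewrite /Cintegral Rintegral_mkcond [X in _ +i* X]Rintegral_mkcond.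
by congr (_ +i* _); apply: eq_Rintegral => x _; rewrite patchE; case: ifP.
Qed.

Lemma Cint_mkcond A f : measurable A -> Cint A f <->
  Cint setT (fun x => if x \in A then f x else 0).
Proof.
have aux (g : R -> R) : measurable A -> (mu.-integrable A (fun x => (g x)%:E) <->
    mu.-integrable setT (fun x => (if x \in A then g x else 0)%:E)).
  move=> mA; apply: (iff_trans (@integrable_mkcond _ _ R mu A (fun x => (g x)%:E) mA)).
  have -> // : ((fun x => (g x)%:E) \_ A) = (fun x => (if x \in A then g x else 0)%:E).
  by apply/funext => x; rewrite patchE; case: ifP.
move=> mA; split=> -[i1 i2]; split.
- apply: (rint_eq measurableT _ ((aux _ mA).1 i1)) => x _; by case: ifP.
- apply: (rint_eq measurableT _ ((aux _ mA).1 i2)) => x _; by case: ifP.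
- apply/(aux _ mA); apply: (rint_eq measurableT _ i1) => x _; by case: ifP.
- apply/(aux _ mA); apply: (rint_eq measurableT _ i2) => x _; by case: ifP.
Qed.

Lemma aeq_Cintegral A f g : measurable A -> cmeas f -> cmeas g -> aeq f g ->
  Cintegral A f = Cintegral A g.
Proof.
move=> mA [m1 m2] [m3 m4] e; rewrite /Cintegral /Rintegral.
have aux (h k : R -> R) : measurable_fun setT h -> measurable_fun setT k ->
   {ae mu, forall x, h x = k x} ->
   (\int[mu]_(x in A) (h x)%:E = \int[mu]_(x in A) (k x)%:E)%E.
  move=> mh mk hk; apply: ae_eq_integral => //.
  - by apply/measurable_EFinP; exact: measurable_funTS.
  - by apply/measurable_EFinP; exact: measurable_funTS.
  by apply: (ae_imp hk) => x ->.
congr (fine _ +i* fine _).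
  by apply: aux => //; apply: (ae_imp e) => x ->.
by apply: aux => //; apply: (ae_imp e) => x ->.
Qed.

End ComplexIntegral.

(** * Fubini's theorem for dominated functions, and primitives *)

Section RealFubini.
Variable R : realType.
Local Notation mu := (@lebesgue_measure R).
Implicit Types (f g u v : R -> R).

Lemma rint_fine A f : measurable A -> rint A f ->
  (\int[mu]_(x in A) (f x)%:E)%E = (\int[mu]_(x in A) f x)%:E.
Proof. by move=> mA h; rewrite /Rintegral fineK//; exact: integrable_fin_num. Qed.

Lemma rint_mul_setT f (c : R) : rint setT f -> (\int[mu]_x (f x * c)%:E)%E = ((\int[mu]_x f x) * c)%:E.
Proof.
move=> h; rewrite rint_fine//; last first.
  by apply: (rint_eq measurableT _ (rintZ c measurableT h)) => x _; rewrite mulrC.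
by rewrite RintegralZr.
Qed.

Lemma meas_sec1 (H : R -> R -> R) x : measurable_fun setT (fun p : R * R => H p.1 p.2) ->
  measurable_fun setT (H x).
Proof. by move=> h; exact: (measurableT_comp h (pair1_measurable x)). Qed.

Lemma meas_sec2 (H : R -> R -> R) y : measurable_fun setT (fun p : R * R => H p.1 p.2) ->
  measurable_fun setT (H ^~ y).
Proof. by move=> h; exact: (measurableT_comp h (pair2_measurable y)). Qed.

(** The product bound gives integrability on the plane by iterated integration of
    [|F x| * |G y|]. *)
Lemma rFubini_int (H : R -> R -> R) (F G : R -> R) :
  measurable_fun setT (fun p : R * R => H p.1 p.2) ->
  rint setT F -> rint setT G -> (forall x y, `|H x y| <= F x * G y) ->
  rint setT (fun x => \int[mu]_y H x y) /\
  (mu \x mu)%E.-integrable setT (fun p : R * R => (H p.1 p.2)%:E).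
Proof.
move=> mH iF iG hH.
have iF' := rint_norm iF; have iG' := rint_norm iG.
have hH' x y : `|H x y| <= `|F x| * `|G y|.
  by rewrite (le_trans (hH x y))// -normrM ler_norm.
have i1 x : rint setT (H x).
  apply: (integrable_le measurableT (meas_sec1 x mH) (rintZ `|F x| measurableT iG')) => y _.
  exact: hH'.
have mHE : measurable_fun setT (fun p : R * R => (H p.1 p.2)%:E).
  by apply/measurable_EFinP.
have iH : (mu \x mu)%E.-integrable setT (fun p : R * R => (H p.1 p.2)%:E).
  apply/(integrable12ltyP mu mu) => //.
  apply: (@le_lt_trans _ _ (\int[mu]_x (`|F x| * \int[mu]_y `|G y|)%:E)%E).
    apply: ge0_le_integral => //.
    - by move=> x _; apply: integral_ge0 => y _.
    - have := @measurable_fun_fubini_tonelli_F _ _ _ _ _ mu (fun p : R * R => `|(H p.1 p.2)%:E|%E).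
      apply => //; exact: measurableT_comp.
    - apply/measurable_EFinP; apply: measurable_funM => //.
      by apply/measurable_EFinP; exact: measurable_int iF'.
    move=> x _ /=.
    rewrite -[X in (_ <= X)%E](_ : (\int[mu]_y (`|F x| * `|G y|)%:E = _)%E); last first.
      rewrite (rint_fine measurableT (rintZ `|F x| measurableT iG')).
      by rewrite RintegralZl.
    apply: ge0_le_integral => //.
    - by have := measurable_int _ (rint_norm (i1 x)).
    - by have := measurable_int _ (rintZ `|F x| measurableT iG').
    - by move=> y _ /=; rewrite lee_fin.
  by rewrite rint_mul_setT// ltry.
have e1 x : (\int[mu]_y (H x y)%:E)%E = (\int[mu]_y H x y)%:E by rewrite rint_fine.
split=> //; have := integrable_fubini_F iH; rewrite /fubini_F /=.
by under eq_fun do rewrite e1.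
Qed.

Lemma rFubini (H : R -> R -> R) (F G : R -> R) :
  measurable_fun setT (fun p : R * R => H p.1 p.2) ->
  rint setT F -> rint setT G -> (forall x y, `|H x y| <= F x * G y) ->
  [/\ rint setT (fun x => \int[mu]_y H x y),
      rint setT (fun y => \int[mu]_x H x y) &
      \int[mu]_x \int[mu]_y H x y = \int[mu]_y \int[mu]_x H x y].
Proof.
move=> mH iF iG hH.
have [h1 iH] := rFubini_int mH iF iG hH.
have mH' : measurable_fun setT (fun p : R * R => H p.2 p.1).
  exact: (measurableT_comp mH (measurable_fun_pair measurable_snd measurable_fst)).
have hH' y x : `|H x y| <= G y * F x by rewrite mulrC.
have [h2 _] := rFubini_int mH' iG iF hH'.
have i1 x : rint setT (H x).
  by apply: (integrable_le measurableT (meas_sec1 x mH) (rintZ (F x) measurableT iG)).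
have i2 y : rint setT (H ^~ y).
  by apply: (integrable_le measurableT (meas_sec2 y mH) (rintZ (G y) measurableT iF)).
have e1 x : (\int[mu]_y (H x y)%:E)%E = (\int[mu]_y H x y)%:E by rewrite rint_fine.
have e2 y : (\int[mu]_x (H x y)%:E)%E = (\int[mu]_x H x y)%:E by rewrite rint_fine.
split; [exact: h1|exact: h2|].
have f1 : (\int[mu]_x \int[mu]_y (H x y)%:E = \int[mu]_y \int[mu]_x (H x y)%:E)%E := Fubini iH.
have f2 : (\int[mu]_x \int[mu]_y (H x y)%:E = (\int[mu]_x \int[mu]_y H x y)%:E)%E.
  by rewrite -(rint_fine measurableT h1); apply: eq_integral => x _; exact: e1.
have f3 : (\int[mu]_y \int[mu]_x (H x y)%:E = (\int[mu]_y \int[mu]_x H x y)%:E)%E.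
  by rewrite -(rint_fine measurableT h2); apply: eq_integral => y _; exact: e2.
by rewrite f2 f3 in f1; case: f1.
Qed.

(** [u] is locally absolutely continuous with density [g], in integrated form so that [g] may
    jump. *)
Definition rprim u g := [/\ measurable_fun setT g, forall a b, a <= b -> rint `[a, b] g &
  forall a b, a <= b -> u b - u a = \int[mu]_(x in `[a, b]) g x].

Lemma rprim_continuous u g : rprim u g -> continuous u.
Proof.
move=> [mg ig h] x.
have xx : x - 1 < x + 1 by rewrite ltrBlDr -addrA ltrDl.
have c := parameterized_integral_continuous (ltW xx) (ig _ _ (ltW xx)).
have {}c : {for x, continuous (fun y => \int[mu]_(t in `[x - 1, y]) g t)}.
  apply: (within_continuous_continuous xx c).
  by rewrite in_itv /= ltrBlDr !ltrDl ltr01.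
have {}c : {for x, continuous (fun y => u (x - 1) + \int[mu]_(t in `[x - 1, y]) g t)}.
  by apply: cvgD => //; exact: cvg_cst.
have e : \forall y \near x, u (x - 1) + \int[mu]_(t in `[x - 1, y]) g t = u y.
  have : \forall y \near x, x - 1 < y.
    by apply: lt_nbhsr; rewrite ltrBlDr ltrDl.
  by apply: filterS => y hy; rewrite -h ?ltW// addrC subrK.
have := cvg_trans (near_eq_cvg e) c.
have -> : u (x - 1) + \int[mu]_(t in `[x - 1, x]) g t = u x.
  by rewrite -h ?lerBlDr ?lerDl// addrC subrK.
by apply.
Qed.

Lemma continuous_rint u : continuous u -> forall a b, rint `[a, b] u.
Proof.
move=> cu a b; apply: continuous_compact_integrable; first exact: segment_compact.
exact: continuous_subspaceT.
Qed.

Lemma rint_locally u : measurable_fun setT u -> (forall a b, a <= b -> rint `[a, b] u) ->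
  locally_integrable setT u.
Proof.
move=> mu' h; split => //; first exact: openT.
move=> K _ cK; have [M [Mr /(_ (`|M| + 1))]] := compact_bounded cK.
rewrite (le_lt_trans (ler_norm M)) ?ltrDl// => /(_ isT) hM.
set N := `|M| + 1 in hM.
have N0 : - N <= N by rewrite -subr_ge0 opprK addr_ge0// addr_ge0.
have mK := compact_measurable cK.
have KN : K `<=` `[- N, N] by move=> x /hM /=; rewrite in_itv /= ler_norml.
have := @rintS _ `[- N, N] K _ _ mK KN (h _ _ N0).
by move=> /(_ (measurable_itv _)) /integrableP[_].
Qed.

Lemma locally_rint u : locally_integrable setT u -> forall a b, rint `[a, b] u.
Proof.
move=> [m _ h] a b; apply/integrableP; split.
  by apply/measurable_EFinP; exact: measurable_funTS.
by have := h `[a, b]%classic (@subsetT _ _) (@segment_compact _ a b).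
Qed.

End RealFubini.

(** * Absolutely continuous functions have weak derivatives *)

Section WeakDerivatives.
Variable R : realType.
Local Notation C := R[i].
Local Notation mu := (@lebesgue_measure R).
Implicit Types (f g u v phi : R -> R).

Lemma Rint_congr (A : set R) f g : f =1 g ->
  \int[mu]_(x in A) f x = \int[mu]_(x in A) g x.
Proof. by move=> /funext ->. Qed.

Lemma Rint_eq0 (A : set R) f : f =1 (fun=> 0) -> \int[mu]_(x in A) f x = 0.
Proof. by move=> /funext ->; rewrite /Rintegral integral0. Qed.

Lemma RintZl (A : set R) (c : R) f : measurable A -> rint A f ->
  \int[mu]_(x in A) (c * f x) = c * \int[mu]_(x in A) f x.
Proof. by move=> mA h; rewrite RintegralZl. Qed.

Lemma RintZr (A : set R) (c : R) f : measurable A -> rint A f ->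
  \int[mu]_(x in A) (f x * c) = (\int[mu]_(x in A) f x) * c.
Proof. by move=> mA h; rewrite RintegralZr. Qed.

Lemma RintB (A : set R) f g : measurable A -> rint A f -> rint A g ->
  \int[mu]_(x in A) (f x - g x) = \int[mu]_(x in A) f x - \int[mu]_(x in A) g x.
Proof. by move=> mA h h'; rewrite RintegralB. Qed.

Lemma RintD (A : set R) f g : measurable A -> rint A f -> rint A g ->
  \int[mu]_(x in A) (f x + g x) = \int[mu]_(x in A) f x + \int[mu]_(x in A) g x.
Proof. by move=> mA h h'; rewrite RintegralD. Qed.

Lemma RintN (A : set R) f : measurable A -> rint A f ->
  \int[mu]_(x in A) (- f x) = - \int[mu]_(x in A) f x.
Proof.
move=> mA h; rewrite -mulN1r -(RintZl _ mA h).
by apply: Rint_congr => x; rewrite mulN1r.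
Qed.

Lemma Rintegral_if (a b : R) f :
  \int[mu]_x (if a <= x <= b then f x else 0) = \int[mu]_(x in `[a, b]) f x.
Proof.
rewrite [RHS]Rintegral_mkcond; apply: eq_Rintegral => x _; rewrite patchE.
by rewrite mem_setE in_itv /=.
Qed.

Lemma rint_if (a b : R) f : rint `[a, b] f ->
  rint setT (fun x => if a <= x <= b then f x else 0).
Proof.
move=> h; have := (@integrable_mkcond _ _ R mu `[a, b]%classic (fun x => (f x)%:E) (measurable_itv _)).1 h.
apply: eq_integrable => // x _; rewrite patchE mem_setE in_itv /=.
by case: ifP.
Qed.

Lemma measurable_itv_bool d (T : measurableType d) (f g h : T -> R) :
  measurable_fun setT f -> measurable_fun setT g -> measurable_fun setT h ->
  measurable_fun setT (fun x => f x <= g x <= h x).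
Proof.
by move=> mf mg mh; apply: measurable_and; exact: measurable_fun_ler.
Qed.

Lemma continuous_bounded_itv f (a b : R) : continuous f -> exists M : R, forall x, a <= x <= b -> `|f x| <= M.
Proof.
move=> cf; have [ab|ba] := lerP a b; last first.
  by exists 0 => x /andP[ax xb]; have := lt_le_trans ba (le_trans ax xb); rewrite ltxx.
have cn : {within `[a, b], continuous (fun x => `|f x|)}.
  apply: continuous_subspaceT => x; apply: cvg_norm; exact: cf.
have [c _ h] := EVT_max ab cn.
by exists `|f c| => x hx; apply: h; rewrite in_itv.
Qed.

Lemma rder_rprim u v : rder u v -> continuous v -> rprim u v.
Proof.
move=> h cv; split; first exact: continuous_measurable_fun.
  by move=> a b _; exact: continuous_rint.
move=> a b; rewrite le_eqVlt => /orP[/eqP->|ab].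
  by rewrite subrr set_itv1 Rintegral_set1.
have cu := rder_continuous h.
have := @continuous_FTC2 R v u a b ab (continuous_subspaceT cv).
rewrite /Rintegral => -> //.
  split; first by move=> x _; exact: (@ex_derive _ _ _ _ _ _ _ (h x)).
    exact/cvg_at_right_filter/cu.
  exact/cvg_at_left_filter/cu.
by move=> x _; rewrite derive1E; apply: derive_val; exact: h.
Qed.

Lemma C1c_rder phi : C1c phi -> rder phi (derive1 phi).
Proof.
move=> [h _ _] x; have := derivableP (h x); by rewrite derive1E.
Qed.

(** On the open set where [r < |x|] the function is locally zero, hence its derivative vanishes
    there too. *)
Lemma C1c_supp phi : C1c phi -> exists2 b : R, 0 < b &
  forall x, b <= `|x| -> phi x = 0 /\ derive1 phi x = 0.
Proof.
move=> [_ _ [r h]]; exists (`|r| + 1); first by rewrite ltr_wpDl.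
move=> x hx; have rx : r < `|x|.
  by rewrite (lt_le_trans _ hx)// (le_lt_trans (ler_norm r))// ltrDl.
split; first exact: h.
have near0 : \forall y \near x, phi y = (fun=> 0) y.
  have : \forall y \near x, r < `|y|.
    by have /(_ x) := @norm_continuous _ R; move/(_ _ (lt_nbhsr rx)).
  by apply: filterS => y /h.
by rewrite derive1E (near_eq_derive _ near0) derive_cst.
Qed.

(** Integration by parts as Fubini for [g s * phi' x] on the triangle [a <= s <= x <= b]:
    integration in [x] gives [- g s * phi s], integration in [s] gives [(u x - u a) * phi' x], and
    the constant [u a] contributes nothing because [phi a = phi b = 0]. *)
Lemma rprim_weak u g phi : rprim u g -> C1c phi ->
  \int[mu]_x (u x * derive1 phi x) = - \int[mu]_x (g x * phi x).
Proof.
move=> pu hphi; have [mg ig hg] := pu; have cu := rprim_continuous pu.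
have dphi := C1c_rder hphi; have [_ cphi' _] := hphi.
have cphi := rder_continuous dphi.
have [b b0 h0] := C1c_supp hphi; pose a := - b.
have ab : a <= b by rewrite /a -subr_ge0 opprK addr_ge0// ltW.
have out x : ~~ (a <= x <= b) -> phi x = 0 /\ derive1 phi x = 0.
  by move=> hx; apply: h0; rewrite leNgt ltr_norml -/a; apply: contra hx => /andP[/ltW-> /ltW->].
have [phia _] : phi a = 0 /\ derive1 phi a = 0 by apply: h0; rewrite normrN ger0_norm// ltW.
have [phib _] : phi b = 0 /\ derive1 phi b = 0 by apply: h0; rewrite ger0_norm// ltW.
have [_ iphi hphi'] := rder_rprim dphi cphi'.
have [M hM] := continuous_bounded_itv a b cphi'.
pose H (s x : R) := if (a <= s <= x) && (x <= b) then g s * derive1 phi x else 0.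
have mH : measurable_fun setT (fun p : R * R => H p.1 p.2).
  apply: measurable_fun_ifT.
  - apply: measurable_and; last by apply: measurable_fun_ler; [exact: measurable_snd|exact: measurable_cst].
    by apply: measurable_itv_bool; [exact: measurable_cst|exact: measurable_fst|exact: measurable_snd].
  - apply: measurable_funM; first exact: (measurableT_comp mg measurable_fst).
    exact: (measurableT_comp (continuous_measurable_fun cphi') measurable_snd).
  - exact: measurable_cst.
have iF := rint_if (rint_norm (ig _ _ ab)).
have iG : rint setT (fun x => if a <= x <= b then M else 0).
  by apply: (@rint_if a b (fun=> M)); apply: continuous_rint => x; exact: cvg_cst.
have HFG s x : `|H s x| <= (if a <= s <= b then `|g s| else 0) * (if a <= x <= b then M else 0).
  rewrite /H; case: ifPn => [/andP[/andP[as_ sx] xb]|_].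
    rewrite as_ xb (le_trans sx xb) (le_trans as_ sx) /= normrM ler_wpM2l ?normr_ge0//.
    by apply: hM; rewrite xb (le_trans as_ sx).
  rewrite normr0; case: ifP => _; last by rewrite mul0r.
  case: ifP => hx; last by rewrite mulr0.
  by rewrite mulr_ge0 ?normr_ge0// (le_trans _ (hM _ hx))// normr_ge0.
have [_ _ e] := rFubini mH iF iG HFG.
have e1 s : \int[mu]_x H s x = - (g s * phi s).
  have [hs|hs] := boolP (a <= s <= b); last first.
    rewrite (out _ hs).1 mulr0 oppr0; apply: Rint_eq0 => x.
    rewrite /H; case: ifPn => [/andP[/andP[h1 h2] h3]|_]; last by [].
    by move: hs; rewrite h1 (le_trans h2 h3).
  move: hs => /andP[as_ sb].
  rewrite (@Rint_congr _ _ (fun x => if s <= x <= b then g s * derive1 phi x else 0)); last first.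
    by move=> x; rewrite /H as_.
  rewrite Rintegral_if (RintZl _ (measurable_itv _) (iphi _ _ sb)) -(hphi' _ _ sb).
  by rewrite phib sub0r mulrN.
have e2 x : \int[mu]_s H s x = u x * derive1 phi x - u a * derive1 phi x.
  have [hx|hx] := boolP (a <= x <= b); last first.
    rewrite (out _ hx).2 !mulr0 subr0; apply: Rint_eq0 => s.
    rewrite /H; case: ifPn => [/andP[/andP[h1 h2] h3]|_]; last by [].
    by move: hx; rewrite h3 (le_trans h1 h2).
  move: hx => /andP[ax xb].
  rewrite (@Rint_congr _ _ (fun s => if a <= s <= x then g s * derive1 phi x else 0)); last first.
    by move=> s; rewrite /H xb andbT.
  by rewrite Rintegral_if (RintZr _ (measurable_itv _) (ig _ _ ax)) -(hg _ _ ax) mulrBl.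
clearbody H.
have iuphi (w : R -> R) : continuous w -> rint setT (fun x => w x * derive1 phi x).
  move=> cw; have iw : rint `[a, b] (fun x => w x * derive1 phi x).
    by apply: continuous_rint => x; apply: cvgM; [exact: cw|exact: cphi'].
  apply: (rint_eq measurableT _ (rint_if iw)) => x _; case: ifPn => [_|/out[_ ->]]; first by [].
  by rewrite mulr0.
have i1 : rint setT (derive1 phi).
  apply: (rint_eq measurableT _ (iuphi (fun=> 1) (fun x => cvg_cst _))).
  by move=> x _; rewrite mul1r.
have e3 : \int[mu]_x (u a * derive1 phi x) = 0.
  rewrite (RintZl _ measurableT i1).
  rewrite (@Rint_congr _ _ (fun x => if a <= x <= b then derive1 phi x else 0)).
    by rewrite Rintegral_if -(hphi' _ _ ab) phia phib subrr mulr0.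
  by move=> x; case: ifPn => [_|/out[_ ->]].
have i2 : rint setT (fun x => u a * derive1 phi x) by exact: rintZ.
have e4 : \int[mu]_x - (g x * phi x) = \int[mu]_x (u x * derive1 phi x - u a * derive1 phi x).
  by rewrite -(Rint_congr _ e1) e (Rint_congr _ e2).
rewrite (RintB measurableT (iuphi _ cu) i2) e3 subr0 in e4.
rewrite -e4 (RintN measurableT); first by [].
have [N hN] := continuous_bounded_itv a b cphi.
have i3 := rintZ N measurableT iF.
apply: (integrable_le measurableT _ i3).
  by apply: measurable_funM; [exact: mg|exact: continuous_measurable_fun].
move=> x _; case: ifPn => [hx|/out[-> _]]; last by rewrite mulr0 normr0 mulr0.
by rewrite normrM mulrC ler_wpM2r ?normr_ge0// hN.
Qed.

End WeakDerivatives.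

(** * The lemma of du Bois-Reymond *)

Section DuBoisReymond.
Variable R : realType.
Local Notation C := R[i].
Local Notation mu := (@lebesgue_measure R).
Implicit Types (f g u v phi : R -> R).

(** The positive part of [w = 1 - |x - a| / d], written [(w + |w|) / 2]. *)
Definition tent (a d x : R) : R := ((1 - `|x - a| / d) + `|1 - `|x - a| / d|) / 2.

Lemma tent_continuous a d : continuous (tent a d).
Proof.
have h : continuous (fun x : R => 1 - `|x - a| / d).
  move=> x; apply: cvgB; first exact: cvg_cst.
  apply: cvgM; last exact: cvg_cst.
  apply: cvg_norm; apply: cvgB; [exact: cvg_id|exact: cvg_cst].
move=> x; apply: cvgM; last exact: cvg_cst.
by apply: cvgD; [exact: h|apply: cvg_norm; exact: h].
Qed.

Lemma tent_ge0 a d x : 0 <= tent a d x.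
Proof.
rewrite /tent divr_ge0// -lerBlDl sub0r; set w := 1 - _.
by rewrite -normrN ler_norm.
Qed.

Lemma tent_le1 a d x : 0 < d -> tent a d x <= 1.
Proof.
move=> d0; rewrite /tent ler_pdivrMr// mul1r; set w := 1 - _.
have w1 : w <= 1 by rewrite /w lerBlDr lerDl divr_ge0// ltW.
by case: (ger0P w) => w0; lra.
Qed.

Lemma tent_out a d x : 0 < d -> ~~ (a - d <= x <= a + d) -> tent a d x = 0.
Proof.
move=> d0; rewrite -ler_distl -ltNge => h; rewrite /tent.
have : 1 - `|x - a| / d < 0 by rewrite subr_lt0 ltr_pdivlMr// mul1r.
by move=> w; rewrite (ltr0_norm w) subrr mul0r.
Qed.

Lemma tent_ge a d x : 0 < d -> a - d / 2 <= x <= a + d / 2 -> 2^-1 <= tent a d x.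
Proof.
move=> d0; rewrite -ler_distl => h; rewrite /tent.
have : `|x - a| / d <= 2^-1 by rewrite ler_pdivrMr// mulrC.
set w := `|x - a| / d => hw; have w1 : 0 <= 1 - w by lra.
by rewrite ger0_norm//; lra.
Qed.

Lemma rint_tentM a d f : 0 < d -> measurable_fun setT f -> (forall a b, rint `[a, b] f) ->
  rint setT (fun x => f x * tent a d x).
Proof.
move=> d0 mf h; have ad : a - d <= a + d by rewrite lerD2l -subr_ge0 opprK addr_ge0// ltW.
apply: (integrable_le measurableT _ (rint_if (rint_norm (h (a - d) (a + d))))).
  by apply: measurable_funM => //; apply: continuous_measurable_fun; exact: tent_continuous.
move=> x _; case: ifPn => hx; last by rewrite tent_out// mulr0 normr0.
by rewrite normrM ler_piMr ?normr_ge0// ger0_norm ?tent_ge0// tent_le1.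
Qed.

Lemma rint_cst a b (c : R) : rint `[a, b] (fun=> c).
Proof. by apply: continuous_rint => x; exact: cvg_cst. Qed.

Lemma rint_tent a d : 0 < d -> rint setT (tent a d).
Proof.
move=> d0; have := @rint_tentM a d (fun=> 1) d0 (measurable_cst _) (fun _ _ => rint_cst _ _ _).
by move=> h; apply: (rint_eq measurableT _ h) => x _; rewrite mul1r.
Qed.

Lemma lebesgue_measure_itv_le (a b : R) : a <= b -> lebesgue_measure (`[a, b]%classic : set R) = (b - a)%:E.
Proof.
move=> ab; rewrite lebesgue_measure_itv /= lte_fin; case: ltrP => h //=.
by have -> : b = a; [apply/eqP; rewrite eq_le ab h|rewrite subrr].
Qed.

Lemma Rint_cst a b (c : R) : a <= b -> \int[mu]_(x in `[a, b]) c = c * (b - a).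
Proof.
move=> ab; rewrite Rintegral_cst; last exact: measurable_itv.
congr (_ * _); rewrite -[RHS]/(fine (b - a)%:E); congr fine.
exact: lebesgue_measure_itv_le.
Qed.

Lemma tent_mass a d : 0 < d -> d / 2 <= \int[mu]_x tent a d x.
Proof.
move=> d0; have ad : a - d / 2 <= a + d / 2 by lra.
have e : \int[mu]_x (if a - d / 2 <= x <= a + d / 2 then 2^-1 else 0) = d / 2.
  by rewrite Rintegral_if Rint_cst//; field.
rewrite -e; apply: le_Rintegral; [exact: measurableT| |exact: rint_tent|].
  exact: (@rint_if _ _ _ (fun=> 2^-1) (rint_cst _ _ _)).
by move=> x _; case: ifPn => [/(tent_ge d0)|_]; [|exact: tent_ge0].
Qed.

(** The tent of half-width [d / 2] is supported in [ball a d], of length [2 d], and has mass at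
    least [d / 4]; its mean of [|v - v a|] is therefore at most 8 times the mean over the ball. *)
Lemma lebesgue_pt_tent v a : locally_integrable setT v -> lebesgue_pt v a ->
  forall e : R, 0 < e -> \forall d \near 0^'+,
  `|(\int[mu]_x (v x * tent a (d / 2) x)) / (\int[mu]_x tent a (d / 2) x) - v a| <= 8 * e.
Proof.
move=> lv la e e0; have iv := locally_rint lv; have [mv _ _] := lv.
have n0 : nbhs (0%:E : \bar R) [set x | (x < e%:E)%E].
  by apply: open_nbhs_nbhs; split; [exact: open_ereal_lt_ereal|rewrite /= lte_fin].
have {}la := la _ n0.
near=> d.
have d0 : 0 < d by near: d; exact: nbhs_right_gt.
have h : (davg v a d < e%:E)%E by near: d; exact: la.
pose w x := `|v x - v a|.
have d2 : 0 < d / 2 by rewrite divr_gt0.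
have ad : a - d / 2 <= a + d / 2 by lra.
have iw : rint `[a - d / 2, a + d / 2] w.
  by apply: rint_norm; apply: rintB; [exact: measurable_itv|exact: iv|exact: rint_cst].
have hE : \int[mu]_(x in `[a - d / 2, a + d / 2]) w x <= 2 * d * e.
  rewrite -lee_fin -(rint_fine (measurable_itv _) iw).
  move: h; rewrite /davg /iavg lebesgue_measure_ball; last exact: ltW.
  rewrite inver mulrn_eq0 /= (gt_eqF d0) => h.
  have dd : 0 < d *+ 2 by rewrite pmulrn_lgt0.
  have {}h : (\int[mu]_(y in ball a d) `|((center (v a) \o v) y)%:E| < (2 * d * e)%:E)%E.
    by move: h; rewrite lte_pdivrMl// -EFinM mulr_natl.
  apply: le_trans (ltW h).
  apply: (@ge0_subset_integral _ _ R mu _ _ (measurable_itv _) (measurable_ball _ _)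
    (fun y => `|((center (v a) \o v) y)%:E|%E)).
  - apply: measurableT_comp => //; apply/measurable_EFinP; apply: measurable_funTS.
    by apply: measurable_funB; [exact: mv|exact: measurable_cst].
  - by move=> x _; exact: abse_ge0.
  - move=> x /=; rewrite in_itv /= -ler_distl -ball_normE /= /ball_ /= distrC => hx.
    by rewrite (le_lt_trans hx)// ltr_pdivrMr// mulr_natr mulr2n ltrDl.
set m := \int[mu]_x tent a (d / 2) x.
have m4 : d / 4 <= m by have := tent_mass a d2; rewrite -/m; lra.
have m0 : 0 < m by lra.
have iva : rint setT (fun x => v a * tent a (d / 2) x) by apply: rintZ => //; exact: rint_tent.
have ivt := rint_tentM a d2 mv (fun a b => iv a b).
have -> : (\int[mu]_x (v x * tent a (d / 2) x)) / m - v a =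
    (\int[mu]_x (v x * tent a (d / 2) x - v a * tent a (d / 2) x)) / m.
  rewrite (RintB measurableT ivt iva) (RintZl _ measurableT (rint_tent a d2)) -/m.
  by field; rewrite gt_eqF.
rewrite normrM normfV (gtr0_norm m0) ler_pdivrMr//.
have iD := rintB measurableT ivt iva.
rewrite (le_trans (le_normr_Rintegral measurableT iD))//.
apply: (@le_trans _ _ (\int[mu]_(x in `[a - d / 2, a + d / 2]) w x)).
  rewrite -Rintegral_if; apply: le_Rintegral; [exact: measurableT|exact: rint_norm|exact: rint_if|].
  move=> x _; case: ifPn => hx; last by rewrite tent_out// !mulr0 subrr normr0.
  by rewrite -mulrBl normrM ler_piMr ?normr_ge0// ger0_norm ?tent_ge0// tent_le1.
by rewrite (le_trans hE)//; nra.
Unshelve. all: by end_near.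
Qed.

(** The difference of two tents of mass one at [a] and [b] has integral zero, so its primitive is an
    admissible test function. Hence [v] has equal tent means at [a] and [b] for every width, and the
    widths shrink to zero. *)
Lemma weak_zero_lebesgue_pt v a b : locally_integrable setT v ->
  (forall phi, C1c phi -> \int[mu]_x (v x * derive1 phi x) = 0) ->
  lebesgue_pt v a -> lebesgue_pt v b -> v a = v b.
Proof.
move=> lv hv la lb; have iv := locally_rint lv; have [mv _ _] := lv.
have key d : 0 < d ->
    (\int[mu]_x (v x * tent a d x)) / (\int[mu]_x tent a d x) =
    (\int[mu]_x (v x * tent b d x)) / (\int[mu]_x tent b d x).
  move=> d0.
  have ma := tent_mass a d0; have mb := tent_mass b d0.
  set Ma := \int[mu]_x tent a d x in ma *; set Mb := \int[mu]_x tent b d x in mb *.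
  have Ma0 : Ma != 0 by rewrite gt_eqF// (lt_le_trans _ ma)// divr_gt0.
  have Mb0 : Mb != 0 by rewrite gt_eqF// (lt_le_trans _ mb)// divr_gt0.
  pose h x := Ma^-1 * tent a d x - Mb^-1 * tent b d x.
  have ita := rint_tent a d0; have itb := rint_tent b d0.
  have ih : rint setT h by apply: rintB; [exact: measurableT|exact: rintZ|exact: rintZ].
  have ch : continuous h.
    move=> x; apply: cvgB; apply: cvgM; try exact: cvg_cst; exact: tent_continuous.
  have h0 : \int[mu]_x h x = 0.
    rewrite /h (RintB measurableT (rintZ _ measurableT ita) (rintZ _ measurableT itb)).
    by rewrite (RintZl _ measurableT ita) (RintZl _ measurableT itb) !mulVf// subrr.
  pose N := `|a| + `|b| + d.
  have hout x : N < `|x| -> h x = 0.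
    rewrite /N => hx; have na := ler_norm a; have nb := ler_norm b.
    have na' := ler_norm (- a); have nb' := ler_norm (- b); rewrite !normrN in na' nb'.
    rewrite /h !tent_out// ?mulr0 ?subrr//.
      by apply/negP => /andP[h1 h2]; move: hx; case: (ger0P x) => x0; rlra.
    by apply/negP => /andP[h1 h2]; move: hx; case: (ger0P x) => x0; rlra.
  pose phi x := \int[mu]_(t in `]-oo, x]) h t.
  have der x : derivable phi x 1 /\ derive1 phi x = h x.
    apply: (@continuous_FTC1 R h -oo%O x (x + 1)).
    - by rewrite ltrDl.
    - by apply: (rintS _ _ _ ih) => //; exact: measurable_itv.
    - exact: ltNyr.
    - exact: ch.
  have hphi : C1c phi.
    split; first by move=> x; have [] := der x.
      by move=> x; rewrite (_ : derive1 phi = h) //; apply/funext => y; have [] := der y.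
    exists N => x hx; have [x0|x0] := lerP 0 x.
      rewrite /phi Rintegral_mkcond -[RHS]h0; apply: Rint_congr => t.
      rewrite patchE mem_setE in_itv /=; case: ifPn => // ; rewrite -ltNge => xt.
      rewrite hout// (lt_trans hx)// ger0_norm// (lt_le_trans xt)// ler_norm//.
    rewrite /phi (@eq_Rintegral _ _ _ _ _ (fun=> 0)) ?Rint_eq0// => t.
    rewrite inE /= in_itv /= => tx; apply: hout; rewrite (lt_le_trans hx)//.
    by rewrite (ltr0_norm x0) (ltr0_norm (le_lt_trans tx x0)) lerN2.
  have := hv _ hphi.
  rewrite (_ : (fun x => v x * derive1 phi x) = (fun x => Ma^-1 * (v x * tent a d x) - Mb^-1 * (v x * tent b d x))); last first.
    by apply/funext => x; rewrite (der x).2 /h; ring.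
  have iva := rint_tentM a d0 mv iv; have ivb := rint_tentM b d0 mv iv.
  rewrite (RintB measurableT (rintZ _ measurableT iva) (rintZ _ measurableT ivb)).
  rewrite (RintZl _ measurableT iva) (RintZl _ measurableT ivb) => /eqP.
  by rewrite subr_eq0 => /eqP; rewrite mulrC => ->; rewrite mulrC.
apply/eqP; rewrite -subr_eq0 -normr_eq0 eq_le normr_ge0 andbT; apply: ler_eps => e e0.
have e16 : 0 < e / 16 by rewrite divr_gt0.
have : \forall d \near (0:R)^'+, `|v a - v b| <= 0 + e.
  near=> d.
  have d0 : 0 < d by near: d; exact: nbhs_right_gt.
  have h1 : `|(\int[mu]_x (v x * tent a (d / 2) x)) / (\int[mu]_x tent a (d / 2) x) - v a| <= 8 * (e / 16).
    by near: d; exact: lebesgue_pt_tent.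
  have h2 : `|(\int[mu]_x (v x * tent b (d / 2) x)) / (\int[mu]_x tent b (d / 2) x) - v b| <= 8 * (e / 16).
    by near: d; exact: lebesgue_pt_tent.
  rewrite (key _ (divr_gt0 d0 (ltr0n _ 2))) in h1.
  rewrite add0r; move: h1 h2; set A := _ / _ => h1 h2.
  have -> : v a - v b = (A - v b) - (A - v a) by ring.
  by rewrite (le_trans (ler_normB _ _))//; rlra.
by move=> /filter_ex[].
Unshelve. all: by end_near.
Qed.

Lemma weak_zero v : locally_integrable setT v ->
  (forall phi, C1c phi -> \int[mu]_x (v x * derive1 phi x) = 0) ->
  exists c : R, {ae mu, forall x, v x = c}.
Proof.
move=> lv hv; have h := lebesgue_differentiation lv.
(* Otherwise [[0, 1]] would be negligible. *)
have [a la] : exists a, lebesgue_pt v a.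
  apply: contrapT => /forallNP hn.
  have h01 : mu.-negligible (`[0, 1]%classic : set R).
    by apply: negligibleS h => x _ /=; exact: hn.
  have := @measure_negligible _ _ R mu _ (measurable_itv _) h01.
  have := lebesgue_measure_itv_le (@ler01 R).
  by rewrite /= => -> /eqP; rewrite subr0 onee_eq0.
by exists (v a); apply: (ae_imp h) => x lx; exact: weak_zero_lebesgue_pt.
Qed.

End DuBoisReymond.

(** * Primitives of locally integrable functions *)

Section RealPrimitives.
Variable R : realType.
Local Notation mu := (@lebesgue_measure R).
Implicit Types (f g u v phi : R -> R).

Lemma Rint_split g a b c : a <= b -> b <= c -> rint `[a, c] g ->
  \int[mu]_(x in `[a, c]) g x = \int[mu]_(x in `[a, b]) g x + \int[mu]_(x in `[b, c]) g x.
Proof.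
move=> ab bc i; rewrite -[X in _ + X]Rintegral_itv_obnd_cbnd.
  have := @Rintegral_itvB _ g (BLeft a) (BRight c) b i.
  rewrite !bnd_simp => /(_ ab bc) <-; by rewrite addrC subrK.
apply: (rintS _ _ _ i); [exact: measurable_itv|exact: measurable_itv|].
by apply: subset_itvr; rewrite bnd_simp.
Qed.

Lemma rprimD u g v k : rprim u g -> rprim v k -> rprim (fun x => u x + v x) (fun x => g x + k x).
Proof.
move=> [m1 i1 h1] [m2 i2 h2]; split.
- exact: measurable_funD.
- by move=> a b ab; apply: rintD; [exact: measurable_itv|exact: i1|exact: i2].
move=> a b ab; rewrite (RintD (measurable_itv _) (i1 _ _ ab) (i2 _ _ ab)).
by rewrite -(h1 _ _ ab) -(h2 _ _ ab); ring.
Qed.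

Lemma rprimZ c u g : rprim u g -> rprim (fun x => c * u x) (fun x => c * g x).
Proof.
move=> [m1 i1 h1]; split.
- by apply: measurable_funM => //; exact: measurable_cst.
- by move=> a b ab; apply: rintZ; [exact: measurable_itv|exact: i1].
by move=> a b ab; rewrite (RintZl _ (measurable_itv _) (i1 _ _ ab)) -(h1 _ _ ab) mulrBr.
Qed.

Lemma rprimB u g v k : rprim u g -> rprim v k -> rprim (fun x => u x - v x) (fun x => g x - k x).
Proof.
move=> h /(rprimZ (-1)) h'; have := rprimD h h'.
by congr rprim; apply/funext => x; rewrite mulN1r.
Qed.

Lemma rprim_addc c u g : rprim u g -> rprim (fun x => u x + c) g.
Proof.
move=> [m1 i1 h1]; split => // a b ab; rewrite -h1//; ring.
Qed.

(** Solutions are assembled piece by piece with this: the values agree at [p], while the densities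
    may jump there. *)
Lemma rprim_glue u g v k (p : R) : rprim u g -> rprim v k -> u p = v p ->
  rprim (fun x => if x <= p then u x else v x) (fun x => if x <= p then g x else k x).
Proof.
move=> [m1 i1 h1] [m2 i2 h2] e.
set F := (fun x => if x <= p then g x else k x).
have mF : measurable_fun setT F.
  by apply: measurable_fun_ifT; [apply: measurable_fun_ler => //; exact: measurable_cst|exact: m1|exact: m2].
have iF a b : a <= b -> rint `[a, b] F.
  move=> ab; have i3 := rintD (measurable_itv _) (rint_norm (i1 _ _ ab)) (rint_norm (i2 _ _ ab)).
  apply: (integrable_le (measurable_itv _) mF i3) => x _; rewrite /F.
  by case: ifP => _; [rewrite lerDl normr_ge0|rewrite lerDr normr_ge0].
have hl a b : a <= b -> b <= p -> u b - u a = \int[mu]_(x in `[a, b]) F x.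
  move=> ab bp; rewrite (h1 _ _ ab); apply: eq_Rintegral => x; rewrite inE /= in_itv /= => /andP[_ xb].
  by rewrite /F (le_trans xb bp).
have hr a b : a <= b -> p <= a -> v b - v a = \int[mu]_(x in `[a, b]) F x.
  move=> ab pa; rewrite (h2 _ _ ab).
  have sub : `]a, b]%classic `<=` `[a, b]%classic by apply: subset_itvr; rewrite bnd_simp.
  have j1 := rintS (measurable_itv _) (measurable_itv _) sub (i2 _ _ ab).
  have j2 := rintS (measurable_itv _) (measurable_itv _) sub (iF _ _ ab).
  rewrite -(Rintegral_itv_obnd_cbnd j1) -(Rintegral_itv_obnd_cbnd j2).
  apply: eq_Rintegral => x; rewrite inE /= in_itv /= => /andP[ax _].
  by rewrite /F leNgt (le_lt_trans pa ax).
split=> // a b ab; have [bp|pb] := lerP b p.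
  by rewrite (le_trans ab bp) (hl _ _ ab bp).
have [ap|pa] := lerP a p; last by rewrite (hr _ _ ab (ltW pa)).
rewrite (Rint_split ap (ltW pb) (iF _ _ ab)) -(hl _ _ ap (lexx _)) -(hr _ _ (ltW pb) (lexx _)) e.
ring.
Qed.

Lemma rprim_ae u g g' : rprim u g -> measurable_fun setT g' ->
  {ae mu, forall x, g x = g' x} -> rprim u g'.
Proof.
move=> [m1 i1 h1] m' e.
have aux A : measurable A -> (\int[mu]_(x in A) (g x)%:E = \int[mu]_(x in A) (g' x)%:E)%E /\
   (\int[mu]_(x in A) `|(g x)%:E| = \int[mu]_(x in A) `|(g' x)%:E|)%E.
  move=> mA.
  have mg : measurable_fun A (fun x => (g x)%:E) by apply/measurable_EFinP; exact: measurable_funTS.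
  have mg' : measurable_fun A (fun x => (g' x)%:E) by apply/measurable_EFinP; exact: measurable_funTS.
  split; apply: ae_eq_integral => //.
  - by apply: (ae_imp e) => x ->.
  - by apply: measurableT_comp.
  - by apply: measurableT_comp.
  - by apply: (ae_imp e) => x ->.
split=> // a b ab.
  have /integrableP[_ h] := i1 _ _ ab; apply/integrableP; split.
    by apply/measurable_EFinP; exact: measurable_funTS.
  by rewrite -(aux _ (measurable_itv _)).2.
by rewrite (h1 _ _ ab) /Rintegral (aux _ (measurable_itv _)).1.
Qed.

Lemma rprim_exists g : measurable_fun setT g -> (forall a b, rint `[a, b] g) ->
  exists u, rprim u g.
Proof.
move=> mg ig.
pose u x := if 0 <= x then \int[mu]_(t in `[0, x]) g t else - \int[mu]_(t in `[x, 0]) g t.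
exists u; split => // a b ab; rewrite /u.
have [b0|b0] := lerP 0 b; have [a0|a0] := lerP 0 a.
- by rewrite (Rint_split a0 ab (ig _ _)); ring.
- by rewrite (Rint_split (ltW a0) b0 (ig _ _)); ring.
- by have := le_lt_trans (le_trans a0 ab) b0; rewrite ltxx.
- by rewrite (Rint_split ab (ltW b0) (ig _ _)); ring.
Qed.

Lemma rint_C1c f phi : measurable_fun setT f -> (forall a b, rint `[a, b] f) -> C1c phi ->
  rint setT (fun x => f x * phi x) /\ rint setT (fun x => f x * derive1 phi x).
Proof.
move=> mf jf hphi; have dphi := C1c_rder hphi; have [_ cphi' _] := hphi.
have cphi := rder_continuous dphi.
have [b b0 h0] := C1c_supp hphi.
have aux (w : R -> R) : continuous w -> (forall x, b <= `|x| -> w x = 0) ->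
    rint setT (fun x => f x * w x).
  move=> cw hw; have [M hM] := continuous_bounded_itv (- b) b cw.
  apply: (integrable_le measurableT _ (rintZ M measurableT (rint_if (rint_norm (jf (- b) b))))).
    by apply: measurable_funM; [exact: mf|exact: continuous_measurable_fun].
  move=> x _; case: ifPn => hx; first by rewrite normrM mulrC ler_wpM2r ?normr_ge0// hM.
  by rewrite -ler_norml -ltNge in hx; rewrite hw ?mulr0 ?normr0// ltW.
by split; apply: aux => // x /h0[].
Qed.

(** A primitive [w] of [g] has the weak derivative [g] by [rprim_weak], so [u - w] has weak
    derivative zero and is constant almost everywhere. *)
Lemma weak_rprim u g : locally_integrable setT u -> locally_integrable setT g ->
  (forall phi, C1c phi -> \int[mu]_x (u x * derive1 phi x) = - \int[mu]_x (g x * phi x)) ->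
  exists2 w, rprim w g & {ae mu, forall x, u x = w x}.
Proof.
move=> lu lg h; have [mg _ _] := lg; have [mu' _ _] := lu.
have [w hw] := rprim_exists mg (locally_rint lg).
have cw := rprim_continuous hw.
have [c hc] : exists c : R, {ae mu, forall x, u x - w x = c}.
  apply: weak_zero.
    apply: rint_locally.
      by apply: measurable_funB; [exact: mu'|exact: continuous_measurable_fun].
    move=> a b _; apply: rintB; [exact: measurable_itv|exact: locally_rint|exact: continuous_rint].
  move=> phi hphi.
  have i1 := (rint_C1c mu' (locally_rint lu) hphi).2.
  have i2 := (rint_C1c (continuous_measurable_fun cw) (continuous_rint cw) hphi).2.
  rewrite (@Rint_congr _ _ _ (fun x => u x * derive1 phi x - w x * derive1 phi x)); last first.
    by move=> x; rewrite mulrBl.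
  by rewrite (RintB measurableT i1 i2) (h _ hphi) (rprim_weak hw hphi) subrr.
exists (fun x => w x + c); first exact: rprim_addc.
by apply: (ae_imp hc) => x <-; rewrite addrC subrK.
Qed.

End RealPrimitives.

(** * Complex primitives and weak derivatives *)

Section ComplexPrimitives.
Variable R : realType.
Local Notation C := R[i].
Local Notation mu := (@lebesgue_measure R).
Implicit Types (u v g k : R -> C).

Definition cprim u g :=
  rprim (fun x => complex.Re (u x)) (fun x => complex.Re (g x)) /\
  rprim (fun x => complex.Im (u x)) (fun x => complex.Im (g x)).

Lemma cder_cprim u g g' : cder u g -> cder g g' -> cprim u g.
Proof.
by move=> [h1 h2] [h3 h4]; split; apply: rder_rprim => //; [exact: (rder_continuous h3)|exact: (rder_continuous h4)].
Qed.

Lemma cprim_cmeas u g : cprim u g -> cmeas u.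
Proof.
move=> [h1 h2]; split; apply: continuous_measurable_fun; [exact: (rprim_continuous h1)|exact: (rprim_continuous h2)].
Qed.

Lemma cprim_cmeas1 u g : cprim u g -> cmeas g.
Proof. by move=> [[m1 _ _] [m2 _ _]]; split. Qed.

Lemma cprimE u g a b : cprim u g -> a <= b -> u b - u a = Cintegral `[a, b] g.
Proof.
move=> [[_ _ h1] [_ _ h2]] ab; apply: complexP; first by rewrite ReB (h1 _ _ ab).
by rewrite ImB (h2 _ _ ab).
Qed.

Lemma cprim_Cint u g a b : cprim u g -> a <= b -> Cint `[a, b] g.
Proof. by move=> [[_ h1 _] [_ h2 _]] ab; split; [exact: h1|exact: h2]. Qed.

Lemma cprimP u g : cmeas g -> (forall a b, a <= b -> Cint `[a, b] g) ->
  (forall a b, a <= b -> u b - u a = Cintegral `[a, b] g) -> cprim u g.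
Proof.
move=> [m1 m2] i h; split; split => //.
- by move=> a b /i[].
- by move=> a b /h /(f_equal (@complex.Re R)); rewrite ReB.
- by move=> a b /i[].
- by move=> a b /h /(f_equal (@complex.Im R)); rewrite ImB.
Qed.

Lemma cprimD u g v k : cprim u g -> cprim v k -> cprim (fun x => u x + v x) (fun x => g x + k x).
Proof.
move=> [a b] [c d]; split.
  have := rprimD a c; congr rprim; apply/funext => x; by rewrite ReD.
have := rprimD b d; congr rprim; apply/funext => x; by rewrite ImD.
Qed.

Lemma cprimZ (c : C) u g : cprim u g -> cprim (fun x => c * u x) (fun x => c * g x).
Proof.
move=> [a b]; split.
  have := rprimB (rprimZ (complex.Re c) a) (rprimZ (complex.Im c) b).
  by congr rprim; apply/funext => x; rewrite ReM.
have := rprimD (rprimZ (complex.Re c) b) (rprimZ (complex.Im c) a).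
by congr rprim; apply/funext => x; rewrite ImM.
Qed.

Lemma cprim_glue u g v k (p : R) : cprim u g -> cprim v k -> u p = v p ->
  cprim (fun x => if x <= p then u x else v x) (fun x => if x <= p then g x else k x).
Proof.
move=> [a b] [c d] e; split.
  have := rprim_glue a c (f_equal (@complex.Re R) e).
  by congr rprim; apply/funext => x; case: ifP.
have := rprim_glue b d (f_equal (@complex.Im R) e).
by congr rprim; apply/funext => x; case: ifP.
Qed.

Lemma cprim_ae u g g' : cprim u g -> cmeas g' -> aeq g g' -> cprim u g'.
Proof.
move=> [a b] [m1 m2] e; split.
  by apply: (rprim_ae a m1); apply: (ae_imp e) => x ->.
by apply: (rprim_ae b m2); apply: (ae_imp e) => x ->.
Qed.

Lemma rprim_locally (u g : R -> R) : rprim u g -> locally_integrable setT u /\ locally_integrable setT g.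
Proof.
move=> h; have c := rprim_continuous h; have [m i _] := h; split.
  apply: rint_locally; first exact: continuous_measurable_fun.
  by move=> a b _; exact: continuous_rint.
exact: rint_locally.
Qed.

Lemma cprim_weak u g : cprim u g -> weak_derivative u g.
Proof.
move=> [a b]; have [l1 l2] := rprim_locally a; have [l3 l4] := rprim_locally b.
split; [by split|by split|] => phi hphi.
apply: complexP.
  rewrite ReN /= .
  rewrite (@Rint_congr _ _ _ (fun x => complex.Re (u x) * derive1 phi x)); last first.
    by move=> x; rewrite ReM /= mulr0 subr0.
  rewrite (rprim_weak a hphi); congr (- _); apply: Rint_congr => x.
  by rewrite ReM /= mulr0 subr0.
rewrite ImN /= .
rewrite (@Rint_congr _ _ _ (fun x => complex.Im (u x) * derive1 phi x)); last first.
  by move=> x; rewrite ImM /= mulr0 add0r.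
rewrite (rprim_weak b hphi); congr (- _); apply: Rint_congr => x.
by rewrite ImM /= mulr0 add0r.
Qed.

Lemma weak_cprim u g : weak_derivative u g -> exists2 w, cprim w g & aeq u w.
Proof.
move=> [[l1 l2] [l3 l4] h].
have [w1 h1 e1] : exists2 w, rprim w (fun x => complex.Re (g x)) & {ae mu, forall x, complex.Re (u x) = w x}.
  apply: weak_rprim => // phi /h /(f_equal (@complex.Re R)); rewrite ReN /= => e.
  rewrite (@Rint_congr _ _ _ (fun x => complex.Re (u x * (derive1 phi x)%:C))); last first.
    by move=> x; rewrite ReM /= mulr0 subr0.
  rewrite e; congr (- _); apply: Rint_congr => x.
  by rewrite ReM /= mulr0 subr0.
have [w2 h2 e2] : exists2 w, rprim w (fun x => complex.Im (g x)) & {ae mu, forall x, complex.Im (u x) = w x}.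
  apply: weak_rprim => // phi /h /(f_equal (@complex.Im R)); rewrite ImN /= => e.
  rewrite (@Rint_congr _ _ _ (fun x => complex.Im (u x * (derive1 phi x)%:C))); last first.
    by move=> x; rewrite ImM /= mulr0 add0r.
  rewrite e; congr (- _); apply: Rint_congr => x.
  by rewrite ImM /= mulr0 add0r.
exists (fun x => w1 x +i* w2 x) => //.
by apply: (ae_imp (ae_and e1 e2)) => x [a b]; exact: complexP.
Qed.

End ComplexPrimitives.

(** * Integral operators with a kernel that is singular on the diagonal *)

Section Kernels.
Variable R : realType.
Local Notation C := R[i].
Local Notation mu := (@lebesgue_measure R).
Implicit Types (f g u v : R -> C) (K H : R -> R -> C).

Definition cmeas2 H := cmeas (fun p : R * R => H p.1 p.2).

Lemma cmeas2_1 H x : cmeas2 H -> cmeas (H x).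
Proof. by move=> h; exact: (cmeas_comp h (pair1_measurable x)). Qed.

Lemma cmeas2_2 H y : cmeas2 H -> cmeas (H ^~ y).
Proof. by move=> h; exact: (cmeas_comp h (pair2_measurable y)). Qed.

Lemma cFubini H (F G : R -> R) : cmeas2 H -> rint setT F -> rint setT G ->
  (forall x y, nc (H x y) <= F x * G y) ->
  [/\ Cint setT (fun x => Cintegral setT (H x)),
      forall x, Cint setT (H x), forall y, Cint setT (H ^~ y) &
      Cintegral setT (fun x => Cintegral setT (H x)) =
      Cintegral setT (fun y => Cintegral setT (H ^~ y))].
Proof.
move=> mH iF iG h; have [m1 m2] := mH.
have h1 x y : `|complex.Re (H x y)| <= F x * G y by rewrite (le_trans (nc_Re _)).
have h2 x y : `|complex.Im (H x y)| <= F x * G y by rewrite (le_trans (nc_Im _)).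
have [i1 _ e1] := @rFubini R (fun x y => complex.Re (H x y)) _ _ m1 iF iG h1.
have [j1 _ e2] := @rFubini R (fun x y => complex.Im (H x y)) _ _ m2 iF iG h2.
split.
- by split.
- move=> x; apply: (Cint_le measurableT _ (rintZ (F x) measurableT iG)); first exact: cmeas2_1.
  by move=> y _.
- move=> y; apply: (Cint_le measurableT _ (rintZ (G y) measurableT iF)); first exact: cmeas2_2.
  by move=> x _; rewrite mulrC.
by apply: complexP; [exact: e1|exact: e2].
Qed.

(* [K1] is the derivative of [K] in the first variable, and [K2] that of [K1] off the
   diagonal, where [K1] jumps by [c]. *)
Record goodK K K1 K2 (c : C) : Prop := GoodK {
  gk_m : [/\ cmeas2 K, cmeas2 K1 & cmeas2 K2];
  gk_b : forall r : R, exists M : R, forall x y, `|x| <= r -> `|y| <= r ->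
    [/\ nc (K x y) <= M, nc (K1 x y) <= M & nc (K2 x y) <= M];
  gk_d : forall y a b, a <= b -> K b y - K a y = Cintegral `[a, b] (K1 ^~ y);
  gk_d1 : forall y a b, a <= b ->
    K1 b y - K1 a y = Cintegral `[a, b] (K2 ^~ y) + c * ((y < b)%R%:R - (y < a)%R%:R)
}.

Definition Op K f (x : R) : C := Cintegral setT (fun y => K x y * f y).

(** Domination of the integrand of [Op K f], locally uniform in [x]. It covers truncated [f] as well
    as [f] in [L^2] against an exponentially decaying kernel. *)
Definition dom K f := forall r : R, exists2 G : R -> R, rint setT G &
  forall x y, `|x| <= r -> nc (K x y * f y) <= G y.

Lemma goodK_Cint K K1 K2 c y a b : goodK K K1 K2 c ->
  Cint `[a, b] (K1 ^~ y) /\ Cint `[a, b] (K2 ^~ y).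
Proof.
move=> [[m0 m1 m2] hb _ _].
have [M hM] := hb (`|a| + `|b| + `|y|).
have hx x : a <= x <= b -> `|x| <= `|a| + `|b| + `|y|.
  move=> /andP[ax xb]; have := normr_ge0 y.
  have h1 := ler_norm b; have h2 := ler_norm (- a); rewrite normrN in h2.
  have h3 := normr_ge0 a; have h4 := normr_ge0 b.
  by case: (ger0P x) => x0; rlra.
have hy : `|y| <= `|a| + `|b| + `|y| by rewrite lerDr addr_ge0.
split; apply: (Cint_le (measurable_itv _) _ (rint_cst a b M)).
- exact: cmeas2_2.
- by move=> x; rewrite /= in_itv /= => /hx /hM /(_ hy)[].
- exact: cmeas2_2.
- by move=> x; rewrite /= in_itv /= => /hx /hM /(_ hy)[].
Qed.

Lemma dom_Cint K f x : cmeas2 K -> cmeas f -> dom K f -> Cint setT (fun y => K x y * f y).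
Proof.
move=> mK mf /(_ `|x|)[G iG h]; apply: (Cint_le measurableT _ iG).
  by apply: cmeasM => //; exact: cmeas2_1.
by move=> y _; exact: h.
Qed.

Lemma Op_fubini K f a b : cmeas2 K -> cmeas f -> dom K f -> a <= b ->
  Cint `[a, b] (Op K f) /\ Cintegral `[a, b] (Op K f) =
   Cintegral setT (fun y => Cintegral `[a, b] (fun s => K s y * f y)).
Proof.
move=> mK mf hd ab.
have [G iG hG] := hd (`|a| + `|b|).
have hx x : a <= x <= b -> `|x| <= `|a| + `|b|.
  move=> /andP[ax xb].
  have h1 := ler_norm b; have h2 := ler_norm (- a); rewrite normrN in h2.
  have h3 := normr_ge0 a; have h4 := normr_ge0 b.
  by case: (ger0P x) => x0; rlra.
pose H s y := if a <= s <= b then K s y * f y else 0.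
have mH : cmeas2 H.
  apply: cmeas_if.
  - by apply: measurable_itv_bool; [exact: measurable_cst|exact: measurable_fst|exact: measurable_cst].
  - by apply: cmeasM; [exact: mK|exact: (cmeas_comp mf measurable_snd)].
  - exact: cmeas_cst.
have iF : rint setT (fun s => if a <= s <= b then 1 else 0).
  exact: (@rint_if _ _ _ (fun=> 1) (rint_cst _ _ _)).
have hH x y : nc (H x y) <= (if a <= x <= b then 1 else 0) * G y.
  rewrite /H; case: ifPn => [/hx hxx|_]; last by rewrite nc0 mul0r.
  by rewrite mul1r hG.
have [i1 i2 i3 e] := cFubini mH iF iG hH.
have mE : (fun s => if s \in `[a, b]%classic then Op K f s else 0) =
   (fun s => Cintegral setT (H s)).
  apply/funext => s; rewrite mem_setE /= /H in_itv /= /Op.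
  by case: ifP => _; [|rewrite Cintegral0].
split.
  by apply/(Cint_mkcond _ (measurable_itv _)); rewrite mE.
rewrite (Cintegral_mkcond _ (measurable_itv _)) mE e.
apply: eq_Cintegral => y _; rewrite (Cintegral_mkcond _ (measurable_itv _)).
apply: eq_Cintegral => s _; rewrite mem_setE in_itv /= /H.
by case: ifP.
Qed.

(** Measurability is a by-product of Fubini: on each [[- n, n]] the function [Op K f] is integrable,
    hence measurable, and it is the limit of these restrictions. *)
Lemma Op_cmeas K f : cmeas2 K -> cmeas f -> dom K f -> cmeas (Op K f).
Proof.
move=> mK mf hd.
apply: (@cmeas_lim _ _ _ (fun n x => if x \in (`[- n%:R, n%:R]%classic : set R) then Op K f x else 0)).
  move=> n; have n0 : - n%:R <= n%:R :> R by rewrite -subr_ge0 opprK addr_ge0.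
  have [i _] := Op_fubini mK mf hd n0.
  have [i1 i2] := (Cint_mkcond (Op K f) (measurable_itv _)).1 i.
  split; apply/measurable_EFinP; [exact: measurable_int i1|exact: measurable_int i2].
move=> x e e0; exists (Num.truncn `|x|).+1 => n hn.
have hx : `|x| <= n%:R.
  by apply: ltW; apply: (lt_le_trans (truncnS_gt _)); rewrite ler_nat.
by rewrite mem_setE in_itv /= -ler_norml hx subrr nc0 ltW.
Qed.

Lemma aeq_singleton (f g : R -> C) (p : R) : (forall x, x != p -> f x = g x) -> aeq f g.
Proof.
move=> h; rewrite /aeq; apply: (@negligibleS _ _ _ mu [set p]).
  move=> x /= /(contra_not (@h x)) /negP; rewrite negbK => /eqP ->//.
exists [set p]; split => //; exact: lebesgue_measure_set1.
Qed.

(** Differentiation under the integral sign in integrated form: [gk_d] and [gk_d1] are multiplied by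
    [f y], integrated in [y], and the integrals are exchanged. The jump of [K1] becomes [c] times
    the integral of [f] over [[a, b]]. *)
Lemma Op_cprim K K1 K2 c f : goodK K K1 K2 c -> cmeas f -> (forall a b, Cint `[a, b] f) ->
  dom K f -> dom K1 f -> dom K2 f ->
  cprim (Op K f) (Op K1 f) /\ cprim (Op K1 f) (fun x => Op K2 f x + c * f x).
Proof.
move=> gk mf jf d0 d1 d2; have [[m0 m1 m2] _ h1 h2] := gk.
split; apply: cprimP.
- exact: Op_cmeas.
- by move=> a b ab; have [] := Op_fubini m1 mf d1 ab.
- move=> a b ab; have [_ ->] := Op_fubini m1 mf d1 ab.
  rewrite /Op -(CintegralB measurableT (dom_Cint b m0 mf d0) (dom_Cint a m0 mf d0)).
  apply: eq_Cintegral => y _; rewrite -mulrBl (h1 _ _ _ ab) mulrC.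
  rewrite -(CintegralZ _ (measurable_itv _) (goodK_Cint y a b gk).1).
  by apply: eq_Cintegral => s _; rewrite mulrC.
- by apply: cmeasD; [exact: Op_cmeas|exact: cmeasZ].
- move=> a b ab; apply: CintD; [exact: measurable_itv| |exact: CintZ].
  by have [] := Op_fubini m2 mf d2 ab.
move=> a b ab; have [i2 e2] := Op_fubini m2 mf d2 ab.
rewrite (CintegralD (measurable_itv _) i2 (CintZ c (measurable_itv _) (jf a b))) e2.
rewrite (CintegralZ c (measurable_itv _) (jf a b)).
(* The bracket is the indicator of [a <= y < b]; it differs from that of [[a, b]] only at [b]. *)
pose J y : C := ((y < b)%R%:R - (y < a)%R%:R) * f y.
have mJ : cmeas J.
  rewrite (_ : J = (fun y => if a <= y then (if y < b then f y else 0) else 0)); last first.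
    apply/funext => y; rewrite /J; case: (ltrP y a) => ya.
      by rewrite (lt_le_trans ya ab) subrr mul0r.
    by case: ifP => _; rewrite subr0 ?mul1r ?mul0r.
  apply: cmeas_if; [by apply: measurable_fun_ler => //; exact: measurable_cst| |exact: cmeas_cst].
  apply: cmeas_if; [by apply: measurable_fun_ltr => //; exact: measurable_cst|exact: mf|exact: cmeas_cst].
have eJ : aeq J (fun y => if y \in (`[a, b]%classic : set R) then f y else 0).
  apply: (@aeq_singleton _ _ b) => y yb; rewrite /J mem_setE in_itv /=.
  case: (ltrP y a) => ya; first by rewrite (lt_le_trans ya ab) subrr mul0r.
  by rewrite le_eqVlt (negbTE yb) /= subr0; case: ifP; rewrite ?mul1r ?mul0r.
have iJ' := (Cint_mkcond f (measurable_itv _)).1 (jf a b).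
have mJ' : cmeas (fun y => if y \in (`[a, b]%classic : set R) then f y else 0).
  have [k1 k2] := iJ'.
  split; apply/measurable_EFinP; [exact: measurable_int k1|exact: measurable_int k2].
have iJ : Cint setT J.
  have i3 := Cint_nc measurableT mJ' iJ'.
  apply: (Cint_le measurableT mJ i3) => y _.
  have [yab|yab] := boolP ((a <= y) && (y < b)).
    have /andP[ya yb] := yab; rewrite mem_setE in_itv /= ya (ltW yb) /=.
    by rewrite /J yb ltNge ya /= subr0 mul1r.
  have -> : J y = 0.
    rewrite /J; case: (ltrP y a) yab => ya /= yb.
      by rewrite (lt_le_trans ya ab) subrr mul0r.
    by rewrite (negbTE yb) subrr mul0r.
  by rewrite nc0; exact: nc_ge0.
rewrite (Cintegral_mkcond f (measurable_itv _)) -(aeq_Cintegral measurableT mJ mJ' eJ).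
rewrite -(CintegralZ c measurableT iJ).
have eI y : Cintegral `[a, b] (fun s => K2 s y * f y) = (K1 b y * f y - K1 a y * f y) - c * J y.
  have -> : Cintegral `[a, b] (fun s => K2 s y * f y) = f y * Cintegral `[a, b] (K2 ^~ y).
    rewrite -(CintegralZ _ (measurable_itv _) (goodK_Cint y a b gk).2).
    by apply: eq_Cintegral => s _; rewrite mulrC.
  have := h2 y a b ab; set I := Cintegral _ _ => h.
  have -> : I = K1 b y - K1 a y - c * ((y < b)%R%:R - (y < a)%R%:R) by rewrite h addrK.
  by rewrite /J; ring.
have ib := dom_Cint b m1 mf d1; have ia := dom_Cint a m1 mf d1.
rewrite (@eq_Cintegral _ _ (fun y => Cintegral _ _) _ (fun y _ => eI y)).
rewrite (CintegralB measurableT _ (CintZ c measurableT iJ)); last first.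
  exact: (CintD measurableT ib (CintN measurableT ia)).
by rewrite (CintegralB measurableT ib ia) subrK.
Qed.

End Kernels.

(** * Square-integrable functions and local bounds in H^2 *)

Section SquareIntegrable.
Variable R : realType.
Local Notation C := R[i].
Local Notation mu := (@lebesgue_measure R).
Implicit Types (f g u v : R -> C) (K H : R -> R -> C).

Definition N2 f : R := \int[mu]_x (nc (f x) ^+ 2).

Lemma N2_ge0 f : 0 <= N2 f.
Proof. by apply: Rintegral_ge0 => x _; exact: sqr_ge0. Qed.

Lemma L2_rint f : L2 f -> rint setT (fun x => nc (f x) ^+ 2).
Proof.
move=> [mf h]; apply/integrableP; split.
  by apply/measurable_EFinP; apply: measurable_funX; exact: measurable_nc.
apply: le_lt_trans h; rewrite le_eqVlt; apply/orP; left; apply/eqP.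
by apply: eq_integral => x _; rewrite /= ger0_norm// sqr_ge0.
Qed.

Lemma L2norm2E f : L2 f -> L2norm2 setT f = (N2 f)%:E.
Proof. by move=> h; rewrite /L2norm2 (rint_fine measurableT (L2_rint h)). Qed.

Lemma rint_L2 f : cmeas f -> rint setT (fun x => nc (f x) ^+ 2) -> L2 f.
Proof.
move=> mf /integrableP[_ h]; split=> //; apply: le_lt_trans h.
rewrite le_eqVlt; apply/orP; left; apply/eqP.
by apply: eq_integral => x _; rewrite /= ger0_norm// sqr_ge0.
Qed.

Lemma L2_Cint f a b : L2 f -> Cint `[a, b] f.
Proof.
move=> h; have [mf _] := h.
have i := rintS measurableT (measurable_itv `[a, b]) (@subsetT _ _) (L2_rint h).
apply: (Cint_le (measurable_itv _) mf (rintD (measurable_itv _) (rint_cst a b 1) i)).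
move=> x _; have := nc_ge0 (f x); set t := nc _ => t0.
have := sqr_ge0 (t - 1); rewrite sqrrB1 => h1; have := sqr_ge0 t; lra.
Qed.

(** Integrate [k * (al * g - A) ^ 2 >= 0], with [A] the integral of [k * g]. A bound [al > 0] in
    place of the mass of [k] covers a vanishing mass. *)
Lemma cauchy_schwarz (k g : R -> R) (al : R) : rint setT k -> rint setT (fun x => k x * g x) ->
  rint setT (fun x => k x * g x ^+ 2) -> (forall x, 0 <= k x) ->
  \int[mu]_x k x <= al -> 0 < al ->
  (\int[mu]_x (k x * g x)) ^+ 2 <= al * \int[mu]_x (k x * g x ^+ 2).
Proof.
move=> i0 i1 i2 k0 hal al0.
set A := \int[mu]_x (k x * g x); set B := \int[mu]_x (k x * g x ^+ 2).
have j1 := rintZ (al ^+ 2) measurableT i2.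
have j2 := rintZ (2 * al * A) measurableT i1.
have j3 := rintZ (A ^+ 2) measurableT i0.
have h : 0 <= \int[mu]_x (al ^+ 2 * (k x * g x ^+ 2) - 2 * al * A * (k x * g x) + A ^+ 2 * k x).
  apply: Rintegral_ge0 => x _.
  have -> : al ^+ 2 * (k x * g x ^+ 2) - 2 * al * A * (k x * g x) + A ^+ 2 * k x =
    k x * (al * g x - A) ^+ 2 by ring.
  by rewrite mulr_ge0// sqr_ge0.
rewrite (RintD measurableT (rintB measurableT j1 j2) j3) (RintB measurableT j1 j2) in h.
rewrite (RintZl _ measurableT i2) (RintZl _ measurableT i1) (RintZl _ measurableT i0) in h.
rewrite -/A -/B in h.
have h2 : A ^+ 2 * \int[mu]_x k x <= A ^+ 2 * al by rewrite ler_wpM2l// sqr_ge0.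
rewrite -(ler_pM2l al0).
have e1 : 2 * al * A * A = 2 * (al * A ^+ 2) by ring.
have e2 : A ^+ 2 * al = al * A ^+ 2 by ring.
have e3 : al ^+ 2 * B = al * (al * B) by ring.
rewrite e1 e3 in h; rewrite e2 in h2.
by move: h h2; set X := al * (al * B); set Y := al * A ^+ 2; set Z := A ^+ 2 * _; lra.
Qed.

(** A representative of an element of [L2supp r] that vanishes at every point outside [[- r, r]]. *)
Definition trunc (r : R) f (x : R) : C := if `|x| <= r then f x else 0.

Lemma trunc_cmeas r f : cmeas f -> cmeas (trunc r f).
Proof.
move=> mf; apply: cmeas_if; [|exact: mf|exact: cmeas_cst].
by apply: measurable_fun_ler; [exact: normr_measurable|exact: measurable_cst].
Qed.

Lemma trunc_aeq r f : L2supp r f -> aeq f (trunc r f).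
Proof.
move=> [_ h]; apply: (ae_imp h) => x hx; rewrite /trunc.
by case: lerP => // /hx.
Qed.

Lemma L2supp_rint r f : L2supp r f -> rint setT (fun x => nc (trunc r f x)).
Proof.
move=> h; have [hf _] := h; have [mf _] := hf.
have i := rint_if (Cint_nc (measurable_itv _) mf (L2_Cint (- r) r hf)).
apply: (rint_eq measurableT _ i) => x _; rewrite /trunc ler_norml.
by case: ifP => //; rewrite nc0.
Qed.

Lemma Op_trunc K r f : cmeas2 K -> L2supp r f -> Op K f = Op K (trunc r f).
Proof.
move=> mK h; have [[mf _] _] := h; apply/funext => x; rewrite /Op.
apply: aeq_Cintegral => //.
- by apply: cmeasM => //; exact: cmeas2_1.
- by apply: cmeasM; [exact: cmeas2_1|exact: trunc_cmeas].
by apply: (ae_imp (trunc_aeq h)) => y <-.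
Qed.

Lemma dom_trunc K r f : (forall p, exists M : R, forall x y, `|x| <= p -> `|y| <= p -> nc (K x y) <= M) ->
  L2supp r f -> dom K (trunc r f).
Proof.
move=> hb h p; have [M hM] := hb (`|p| + `|r|).
exists (fun y => `|M| * nc (trunc r f y)); first by apply: rintZ => //; exact: L2supp_rint.
move=> x y hx; rewrite ncM; have := nc_ge0 (trunc r f y).
rewrite /trunc; case: ifP => hy t0; last by rewrite nc0 !mulr0.
rewrite ler_wpM2r// (le_trans _ (ler_norm M))// hM//.
  by rewrite (le_trans hx)// (le_trans (ler_norm p))// lerDl.
by rewrite (le_trans hy)// (le_trans (ler_norm r))// lerDr.
Qed.

(** Cauchy-Schwarz on [[- r, r]], whose length [2 r] is enlarged to [2 r + 1] to be positive. *)
Lemma Op_bound K r f (M x : R) : cmeas2 K -> L2supp r f -> 0 <= r -> 0 <= M ->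
  (forall y, `|y| <= r -> nc (K x y) <= M) ->
  nc (Op K f x) ^+ 2 <= (2 * r + 1) * M ^+ 2 * N2 f.
Proof.
move=> mK h r0 M0 hM; rewrite (Op_trunc mK h).
have [hf _] := h; have [mf _] := hf.
have mt := trunc_cmeas r mf.
have i1 := L2supp_rint h.
have hK y : nc (K x y * trunc r f y) <= M * nc (trunc r f y).
  rewrite ncM /trunc; case: ifP => [/hM h1|_]; last by rewrite nc0 !mulr0.
  by rewrite ler_wpM2r// nc_ge0.
have mKt : cmeas (fun y => K x y * trunc r f y) by apply: cmeasM => //; exact: cmeas2_1.
have iK : Cint setT (fun y => K x y * trunc r f y).
  by apply: (Cint_le measurableT mKt (rintZ M measurableT i1)) => y _.
have h1 : nc (Op K (trunc r f) x) <= M * \int[mu]_y nc (trunc r f y).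
  rewrite -(RintZl _ measurableT i1).
  by apply: (nc_Cintegral_le measurableT iK (rintZ M measurableT i1)) => y _.
pose k (y : R) : R := if - r <= y <= r then 1 else 0.
have ik : rint setT k by exact: (@rint_if _ _ _ (fun=> 1) (rint_cst _ _ _)).
have ek y : nc (trunc r f y) = k y * nc (f y).
  by rewrite /trunc /k ler_norml; case: ifP; rewrite ?mul1r ?mul0r ?nc0.
have j1 : rint setT (fun y => k y * nc (f y)).
  by apply: (rint_eq measurableT _ i1) => y _; rewrite ek.
have k1 y : 0 <= k y <= 1 by rewrite /k; case: ifP => _; rewrite ler01 lexx.
have j2 : rint setT (fun y => k y * nc (f y) ^+ 2).
  apply: (integrable_le measurableT _ (L2_rint hf)).
    apply: measurable_funM; last by apply: measurable_funX; exact: measurable_nc.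
    by apply/measurable_EFinP; exact: measurable_int ik.
  move=> y _; have /andP[a b] := k1 y.
  by rewrite ger0_norm; [rewrite ler_piMl// sqr_ge0|rewrite mulr_ge0// sqr_ge0].
have hk : \int[mu]_y k y <= 2 * r + 1.
  rewrite /k Rintegral_if Rint_cst; last by rewrite -subr_ge0 opprK addr_ge0.
  by lra.
have r1 : 0 < 2 * r + 1 by lra.
have cs := cauchy_schwarz ik j1 j2 (fun y => (andP (k1 y)).1) hk r1.
have hN : \int[mu]_y (k y * nc (f y) ^+ 2) <= N2 f.
  apply: le_Rintegral => //; first exact: L2_rint.
  by move=> y _; have /andP[a b] := k1 y; rewrite ler_piMl// sqr_ge0.
rewrite (Rint_congr _ ek) in h1.
have h2 : nc (Op K (trunc r f) x) ^+ 2 <= (M * \int[mu]_y (k y * nc (f y))) ^+ 2.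
  by rewrite lerXn2r// ?nnegrE ?nc_ge0// (le_trans (nc_ge0 _) h1).
apply: (le_trans h2); rewrite exprMn.
have -> : (2 * r + 1) * M ^+ 2 * N2 f = M ^+ 2 * ((2 * r + 1) * N2 f) by ring.
rewrite ler_wpM2l ?sqr_ge0// (le_trans cs)// ler_wpM2l//; exact: ltW.
Qed.

Lemma L2norm2_itv_le (p b : R) (h : R -> R) u : cmeas u -> 0 <= b ->
  (forall x, 0 <= h x) -> rint setT h ->
  (forall x, `|x| <= `|p| -> nc (u x) ^+ 2 <= b + h x) ->
  (L2norm2 [set` `](- p)%R, p[%R] u <= (2 * `|p| * b + \int[mu]_x h x)%:E)%E.
Proof.
move=> mu' b0 h0 ih hu.
have mU : measurable_fun setT (fun x => (nc (u x) ^+ 2)%:E).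
  by apply/measurable_EFinP; apply: measurable_funX; exact: measurable_nc.
have pp : - `|p| <= `|p| by rewrite -subr_ge0 opprK addr_ge0.
have ihp := rintS measurableT (measurable_itv `[- `|p|, `|p|]) (@subsetT _ _) ih.
have ibh := rintD (measurable_itv _) (rint_cst (- `|p|) `|p| b) ihp.
pose B : set R := [set` `[- `|p|, `|p|]].
apply: (@le_trans _ _ (\int[mu]_(x in B) (nc (u x) ^+ 2)%:E)%E).
  apply: (@ge0_subset_integral _ _ R mu _ _ (measurable_itv _) (measurable_itv _)
    (fun x => (nc (u x) ^+ 2)%:E)).
  - exact: measurable_funTS.
  - by move=> x _; rewrite lee_fin sqr_ge0.
  - move=> x /=; rewrite !in_itv /= => /andP[h1 h2].
    have h3 := ler_norm p; have h4 := h3.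
    by apply/andP; split; rlra.
apply: (@le_trans _ _ (\int[mu]_(x in B) (b + h x)%:E)%E).
  apply: ge0_le_integral => //.
  - exact: measurable_itv.
  - by move=> x _; rewrite lee_fin sqr_ge0.
  - exact: measurable_funTS.
  - exact: measurable_int ibh.
  - by move=> x; rewrite /B /= in_itv /= -ler_norml lee_fin => /hu.
rewrite (rint_fine (measurable_itv _) ibh) lee_fin.
rewrite (RintD (measurable_itv _) (rint_cst _ _ _) ihp) Rint_cst// lerD//; first by lra.
rewrite -Rintegral_if; apply: le_Rintegral => //; first exact: rint_if.
by move=> x _; case: ifP.
Qed.

Lemma H2norm2_le A u u1 u2 : weak_derivative u u1 -> weak_derivative u1 u2 ->
  (H2norm2 A u <= L2norm2 A u + L2norm2 A u1 + L2norm2 A u2)%E.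
Proof. by move=> h1 h2; apply: ereal_inf_lbound; exists u1, u2. Qed.

Lemma nc_add_sqr (z w : C) : nc (z + w) ^+ 2 <= 2 * nc z ^+ 2 + 2 * nc w ^+ 2.
Proof.
have h := ncD z w; have := nc_ge0 z; have := nc_ge0 w; have h0 := nc_ge0 (z + w).
move: h h0; set a := nc (z + w); set b := nc z; set c := nc w => h h0 c0 b0.
have : a ^+ 2 <= (b + c) ^+ 2 by rewrite lerXn2r// nnegrE addr_ge0.
have := sqr_ge0 (b - c); rewrite sqrrB sqrrD => h1 h2; lra.
Qed.

(** With [X = (2 r + 1) M ^ 2 N2 f], the squared norms of [u] and [u'] are at most [2 |p| X] each,
    and that of [u''] is at most [4 |p| X + 2 M ^ 2 N2 f]. *)
Definition loc_const (p r : R) : R := 8 * `|p| * (2 * r + 1) + 2.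

Lemma goodK_sol K K1 K2 c r f : goodK K K1 K2 c -> L2supp r f ->
  let t := trunc r f in
  [/\ cprim (Op K f) (Op K1 f), cprim (Op K1 f) (fun x => Op K2 f x + c * t x) &
    cmeas (Op K2 f)].
Proof.
move=> gk h /=; have [[m0 m1 m2] hb _ _] := gk; have [hf _] := h; have [mf _] := hf.
have mt := trunc_cmeas r mf.
have it a b : Cint `[a, b] (trunc r f).
  apply: (Cint_le (measurable_itv _) mt (Cint_nc (measurable_itv _) mf (L2_Cint a b hf))) => x _.
  by rewrite /trunc; case: ifP; rewrite ?nc0// nc_ge0.
have d0 : dom K (trunc r f).
  by apply: dom_trunc h => p; have [M hM] := hb p; exists M => x y hx hy; have [] := hM x y hx hy.
have d1 : dom K1 (trunc r f).
  by apply: dom_trunc h => p; have [M hM] := hb p; exists M => x y hx hy; have [] := hM x y hx hy.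
have d2 : dom K2 (trunc r f).
  by apply: dom_trunc h => p; have [M hM] := hb p; exists M => x y hx hy; have [] := hM x y hx hy.
have [h1 h2] := Op_cprim gk mt it d0 d1 d2.
by rewrite (Op_trunc m0 h) (Op_trunc m1 h) (Op_trunc m2 h); split => //; exact: Op_cmeas.
Qed.

Lemma H2loc_Op K K1 K2 c r f (p M : R) : goodK K K1 K2 c -> L2supp r f -> 0 <= r -> 0 <= M ->
  (forall x y, `|x| <= `|p| -> `|y| <= r ->
    [/\ nc (K x y) <= M, nc (K1 x y) <= M & nc (K2 x y) <= M]) -> nc c <= M ->
  (H2loc_norm2 p (Op K f) <= (loc_const p r * M ^+ 2)%:E * L2norm2 setT f)%E.
Proof.
move=> gk h r0 M0 hM hc; have [[m0 m1 m2] _ _ _] := gk; have [hf _] := h; have [mf _] := hf.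
have mt := trunc_cmeas r mf.
have [p0 p1 mO2] := goodK_sol gk h.
have iN := L2_rint hf.
set X := (2 * r + 1) * M ^+ 2 * N2 f.
have X0 : 0 <= X.
  by rewrite /X !mulr_ge0// ?sqr_ge0 ?N2_ge0// addr_ge0// mulr_ge0.
have b0 x : `|x| <= `|p| -> nc (Op K f x) ^+ 2 <= X + (fun=> 0) x.
  by move=> hx; rewrite addr0; apply: Op_bound => // y hy; have [] := hM x y hx hy.
have b1 x : `|x| <= `|p| -> nc (Op K1 f x) ^+ 2 <= X + (fun=> 0) x.
  by move=> hx; rewrite addr0; apply: Op_bound => // y hy; have [] := hM x y hx hy.
have b2 x : `|x| <= `|p| -> nc (Op K2 f x + c * trunc r f x) ^+ 2 <= 2 * X + 2 * M ^+ 2 * nc (f x) ^+ 2.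
  move=> hx; apply: (le_trans (nc_add_sqr _ _)).
  have h1 : nc (Op K2 f x) ^+ 2 <= X by apply: Op_bound => // y hy; have [] := hM x y hx hy.
  have h2 : nc (c * trunc r f x) ^+ 2 <= M ^+ 2 * nc (f x) ^+ 2.
    rewrite ncM exprMn ler_pM ?sqr_ge0// lerXn2r ?nnegrE ?nc_ge0//.
    by rewrite /trunc; case: ifP; rewrite ?nc0 ?nc_ge0.
  by move: h1 h2; set a := nc _ ^+ 2; set b := nc (_ * _) ^+ 2; rewrite -mulrA; set d := M ^+ 2 * _; rlra.
have z0 : rint setT (fun=> 0 : R).
  by have := rintZ 0 measurableT iN; apply: rint_eq => // x _; rewrite mul0r.
have e0 := L2norm2_itv_le (cprim_cmeas p0) X0 (fun=> lexx _) z0 b0.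
have e1 := L2norm2_itv_le (cprim_cmeas p1) X0 (fun=> lexx _) z0 b1.
have X20 : 0 <= 2 * X by rewrite mulr_ge0.
have h0 x : 0 <= 2 * M ^+ 2 * nc (f x) ^+ 2 by rewrite mulr_ge0 ?sqr_ge0// mulr_ge0 ?sqr_ge0.
have e2 := L2norm2_itv_le (cprim_cmeas1 p1) X20 h0 (rintZ _ measurableT iN) b2.
apply: (le_trans (H2norm2_le _ (cprim_weak p0) (cprim_weak p1))).
apply: (le_trans (leeD (leeD e0 e1) e2)).
rewrite (L2norm2E hf) -!EFinD -EFinM lee_fin (RintZl _ measurableT iN) -/(N2 f).
rewrite (Rint_eq0 _ (fun=> erefl)) /loc_const /X.
by rewrite le_eqVlt; apply/orP; left; apply/eqP; ring.
Qed.

End SquareIntegrable.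

(** * Holomorphic families of kernels and of operators *)

Section KernelFamilies.
Variable R : realType.
Local Notation C := R[i].
Local Notation mu := (@lebesgue_measure R).
Implicit Types (f g u v : R -> C) (K L H : R -> R -> C).

Lemma rint_ae A (f g : R -> R) : measurable A -> measurable_fun setT g -> rint A f ->
  {ae mu, forall x, f x = g x} -> rint A g.
Proof.
move=> mA mg h e; have /integrableP[mf hf] := h; apply/integrableP; split.
  by apply/measurable_EFinP; exact: measurable_funTS.
rewrite (_ : (\int[mu]_(x in A) `|(g x)%:E|)%E = (\int[mu]_(x in A) `|(f x)%:E|)%E)//.
apply: ae_eq_integral => //.
- by apply: measurableT_comp => //; apply/measurable_EFinP; exact: measurable_funTS.
- by apply: measurableT_comp.
- by apply: (ae_imp e) => x ->.
Qed.

Lemma Cint_ae A f g : measurable A -> cmeas g -> Cint A f -> aeq f g -> Cint A g.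
Proof.
move=> mA [m1 m2] [i1 i2] e; split.
  by apply: (rint_ae mA m1 i1); apply: (ae_imp e) => x ->.
by apply: (rint_ae mA m2 i2); apply: (ae_imp e) => x ->.
Qed.

Definition locb K := forall p : R, exists M : R, forall x y, `|x| <= p -> `|y| <= p -> nc (K x y) <= M.

Lemma goodK_locb K K1 K2 c : goodK K K1 K2 c -> [/\ locb K, locb K1 & locb K2].
Proof.
move=> [_ hb _ _]; split=> p; have [M hM] := hb p; exists M => x y hx hy;
  by have [] := hM x y hx hy.
Qed.

Lemma L2supp_mono r r' f : r <= r' -> L2supp r f -> L2supp r' f.
Proof.
by move=> rr [h e]; split=> //; apply: (ae_imp e) => x hx rx; apply: hx; exact: le_lt_trans rx.
Qed.

Lemma aeq_sym f g : aeq f g -> aeq g f.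
Proof. by move=> h; apply: (ae_imp h) => x ->. Qed.

Lemma L2supp_Cint K r f x : cmeas2 K -> locb K -> L2supp r f -> Cint setT (fun y => K x y * f y).
Proof.
move=> mK hb h; have [[mf _] _] := h.
apply: (Cint_ae measurableT _ (dom_Cint x mK (trunc_cmeas r mf) (dom_trunc hb h))).
  by apply: cmeasM => //; exact: cmeas2_1.
by apply: (ae_imp (trunc_aeq h)) => y ->.
Qed.

Lemma Op_lin_f K (a : C) r f g x : cmeas2 K -> locb K -> L2supp r f -> L2supp r g ->
  Op K (fun y => a * f y + g y) x = a * Op K f x + Op K g x.
Proof.
move=> mK hb hf hg.
have i1 := L2supp_Cint x mK hb hf; have i2 := L2supp_Cint x mK hb hg.
rewrite /Op -(CintegralZ a measurableT i1) -(CintegralD measurableT (CintZ a measurableT i1) i2).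
by apply: eq_Cintegral => y _; ring.
Qed.

Lemma Op_lin_K K L (a b : C) r f x : cmeas2 K -> cmeas2 L -> locb K -> locb L -> L2supp r f ->
  Op (fun x y => a * K x y + b * L x y) f x = a * Op K f x + b * Op L f x.
Proof.
move=> mK mL hK hL hf.
have i1 := L2supp_Cint x mK hK hf; have i2 := L2supp_Cint x mL hL hf.
rewrite /Op -(CintegralZ a measurableT i1) -(CintegralZ b measurableT i2).
rewrite -(CintegralD measurableT (CintZ a measurableT i1) (CintZ b measurableT i2)).
by apply: eq_Cintegral => y _; ring.
Qed.

Lemma cmeas2_lin K L (a b : C) : cmeas2 K -> cmeas2 L -> cmeas2 (fun x y => a * K x y + b * L x y).
Proof. by move=> h h'; apply: cmeasD; exact: cmeasZ. Qed.

Lemma goodK_lin K K1 K2 c L L1 L2' d (a b : C) : goodK K K1 K2 c -> goodK L L1 L2' d ->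
  goodK (fun x y => a * K x y + b * L x y) (fun x y => a * K1 x y + b * L1 x y)
        (fun x y => a * K2 x y + b * L2' x y) (a * c + b * d).
Proof.
move=> gK gL; have [[m0 m1 m2] hb h1 h2] := gK; have [[n0 n1 n2] hb' h1' h2'] := gL.
split.
- by split; exact: cmeas2_lin.
- move=> p; have [M hM] := hb p; have [N hN] := hb' p.
  exists (nc a * M + nc b * N) => x y hx hy.
  have [a0 a1 a2] := hM x y hx hy; have [b0 b1 b2] := hN x y hx hy.
  have na := nc_ge0 a; have nb := nc_ge0 b.
  by split; rewrite (le_trans (ncD _ _))// !ncM lerD// ler_wpM2l.
- move=> y s t st.
  have [i1 _] := goodK_Cint y s t gK; have [j1 _] := goodK_Cint y s t gL.
  rewrite (CintegralD (measurable_itv _) (CintZ a (measurable_itv _) i1) (CintZ b (measurable_itv _) j1)).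
  rewrite (CintegralZ a (measurable_itv _) i1) (CintegralZ b (measurable_itv _) j1).
  by rewrite -(h1 _ _ _ st) -(h1' _ _ _ st); ring.
move=> y s t st.
have [_ i1] := goodK_Cint y s t gK; have [_ j1] := goodK_Cint y s t gL.
rewrite (CintegralD (measurable_itv _) (CintZ a (measurable_itv _) i1) (CintZ b (measurable_itv _) j1)).
rewrite (CintegralZ a (measurable_itv _) i1) (CintegralZ b (measurable_itv _) j1).
have e1 := h2 y s t st; have e2 := h2' y s t st.
rewrite (_ : a * K1 t y + b * L1 t y - (a * K1 s y + b * L1 s y) =
  a * (K1 t y - K1 s y) + b * (L1 t y - L1 s y)); last by ring.
by rewrite e1 e2; ring.
Qed.

Lemma goodK_comp_loc K K1 K2 c : goodK K K1 K2 c -> comp_loc_operator (Op K).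
Proof.
move=> gK; have [[m0 m1 m2] hb _ _] := gK; have [l0 _ _] := goodK_locb gK.
split.
  move=> a f g [r hf] [s hg]; apply: aeW => x /=.
  by apply: (Op_lin_f _ _ m0 l0 (L2supp_mono (r' := Num.max r s) _ hf) (L2supp_mono _ hg));
    rewrite le_max lexx ?orbT.
move=> r p.
have [M hM] := hb (`|r| + `|p|).
set N := `|M| + nc c.
have N0 : 0 <= N by apply: addr_ge0; [|exact: nc_ge0].
exists (loc_const p `|r| * N ^+ 2) => f hf.
have hf' := L2supp_mono (ler_norm r) hf.
apply: (H2loc_Op gK hf' (normr_ge0 r) N0) => [x y hx hy|]; last by rewrite lerDr.
have hx' : `|x| <= `|r| + `|p| by rewrite (le_trans hx)// lerDr.
have hy' : `|y| <= `|r| + `|p| by rewrite (le_trans hy)// lerDl.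
have [a1 a2 a3] := hM x y hx' hy'.
have MN : M <= N by rewrite (le_trans (ler_norm M))// lerDl nc_ge0.
by split; apply: le_trans MN.
Qed.

(** Differentiability at [l] with derivative [D], in the form of a quadratic remainder uniform for
    bounded [x] and [y]. *)
Definition holK (F : C -> R -> R -> C) (l : C) (D : R -> R -> C) := forall p : R,
  exists M d : R, 0 < d /\ forall m x y, nc (m - l) < d -> `|x| <= p -> `|y| <= p ->
    nc (F m x y - F l x y - (m - l) * D x y) <= M * nc (m - l) ^+ 2.

Definition hol (F : C -> C) (l D : C) :=
  exists M d : R, 0 < d /\ forall m, nc (m - l) < d ->
    nc (F m - F l - (m - l) * D) <= M * nc (m - l) ^+ 2.

(** Division by [k] leaves [nc X <= M * k]. This turns an identity that holds for difference
    quotients up to [O (k)] into an exact one for the derivative. *)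
Lemma nc_linear_zero (X : C) (M d : R) : 0 < d ->
  (forall k : R, 0 < k -> k < d -> k * nc X <= M * k ^+ 2) -> X = 0.
Proof.
move=> d0 h; apply: nc_eps => e e0.
pose k := Num.min (d / 2) (e / (`|M| + 1)).
have M0 : 0 < `|M| + 1 by rewrite ltr_wpDl.
have k0 : 0 < k by rewrite /k lt_min !divr_gt0.
have kd : k < d by rewrite /k gt_min ltr_pdivrMr// ltr_pMr// ltr1n.
have ke : k <= e / (`|M| + 1) by rewrite /k ge_min lexx orbT.
have := h k k0 kd; rewrite expr2 mulrCA ler_pM2l// => h1.
have h2 : M * k <= (`|M| + 1) * k by rewrite ler_wpM2r ?(ltW k0)// (le_trans (ler_norm M))// lerDl.
apply: (le_trans h1); apply: (le_trans h2).
by rewrite mulrC -ler_pdivlMr.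
Qed.

(** [D] is the pointwise limit of the difference quotients with real steps [k n], all smaller than
    [d]. *)
Lemma holK_cmeas F l D (d : R) : 0 < d -> (forall m, nc (m - l) < d -> cmeas2 (F m)) ->
  holK F l D -> cmeas2 D.
Proof.
move=> d0 hm hF.
pose n0 := (Num.truncn d^-1).+1.
pose k n : R := ((n + n0)%:R)^-1.
have n0d : d^-1 < n0%:R by exact: truncnS_gt.
have k0 n : 0 < k n by rewrite invr_gt0 ltr0n addn_gt0 orbT.
have kd n : k n < d.
  rewrite -[d]invrK ltf_pV2 ?posrE ?invr_gt0 ?ltr0n ?addn_gt0 ?orbT//.
  by rewrite (lt_le_trans n0d)// ler_nat leq_addl.
apply: (@cmeas_lim _ _ _ (fun n (p : R * R) => (k n)%:C^-1 * (F (l + (k n)%:C) p.1 p.2 - F l p.1 p.2))).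
  move=> n; apply: cmeasZ; apply: cmeasB; apply: hm.
    by rewrite addrAC subrr add0r nc_real gtr0_norm.
  by rewrite subrr nc0.
move=> [x y] e e0 /=.
have [M [d' [d'0 hM]]] := hF (`|x| + `|y|).
have hx : `|x| <= `|x| + `|y| by rewrite lerDl.
have hy : `|y| <= `|x| + `|y| by rewrite lerDr.
have [N hN] : exists N : nat, (d'^-1 < N%:R) /\ (`|M| / e < N%:R).
  exists (Num.truncn d'^-1 + Num.truncn (`|M| / e)).+1; split.
    by rewrite (lt_le_trans (truncnS_gt _))// ler_nat ltnS leq_addr.
  by rewrite (lt_le_trans (truncnS_gt _))// ler_nat ltnS leq_addl.
exists N => n Nn.
have kn : k n < d'.
  rewrite -[d']invrK ltf_pV2 ?posrE ?invr_gt0 ?ltr0n ?addn_gt0 ?orbT//.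
  by rewrite (lt_le_trans hN.1)// ler_nat (leq_trans Nn)// leq_addr.
have ekl : nc (l + (k n)%:C - l) = k n by rewrite addrAC subrr add0r nc_real gtr0_norm.
have := hM (l + (k n)%:C) x y; rewrite ekl => /(_ kn hx hy).
rewrite [l + _ - l]addrAC subrr add0r => h.
have kC : (k n)%:C != 0 :> C by rewrite -nc_gt0 nc_real gtr0_norm.
have -> : (k n)%:C^-1 * (F (l + (k n)%:C) x y - F l x y) - D x y =
  (k n)%:C^-1 * (F (l + (k n)%:C) x y - F l x y - (k n)%:C * D x y).
  by rewrite [RHS]mulrBr mulKf.
rewrite ncM ncV nc_real gtr0_norm// mulrC ler_pdivrMr//.
apply: (le_trans h); rewrite expr2 mulrA ler_wpM2r ?(ltW (k0 n))//.
apply: (@le_trans _ _ (`|M| * k n)); first by rewrite ler_wpM2r ?(ltW (k0 n))// ler_norm.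
rewrite /k ler_pdivrMr ?ltr0n ?addn_gt0 ?orbT// mulrC -ler_pdivrMr//.
by rewrite (le_trans (ltW hN.2))// ler_nat (leq_trans Nn)// leq_addr.
Qed.

(** One difference quotient, with a fixed step [k], already bounds [D]. *)
Lemma holK_locb F l D (d : R) : 0 < d -> (forall m, nc (m - l) < d -> locb (F m)) ->
  holK F l D -> locb D.
Proof.
move=> d0 hm hF p; have [M [d' [d'0 hM]]] := hF p.
pose k := Num.min d d' / 2.
have dd : 0 < Num.min d d' by rewrite lt_min d0.
have k0 : 0 < k by rewrite divr_gt0.
have kdd : k < Num.min d d' by rewrite ltr_pdivrMr// ltr_pMr// ltr1n.
have kd : k < d by rewrite (lt_le_trans kdd)// ge_min lexx.
have kd' : k < d' by rewrite (lt_le_trans kdd)// ge_min lexx orbT.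
have ekl : nc (l + k%:C - l) = k by rewrite addrAC subrr add0r nc_real gtr0_norm.
have [A hA] := hm (l + k%:C) ltac:(by rewrite ekl) p.
have [B hB] := hm l ltac:(by rewrite subrr nc0) p.
exists ((A + B + M * k ^+ 2) / k) => x y hx hy.
have := hM (l + k%:C) x y; rewrite ekl => /(_ kd' hx hy).
rewrite [l + _ - l]addrAC subrr add0r => h.
rewrite ler_pdivlMr// mulrC -{1}(gtr0_norm k0) -nc_real -ncM.
have -> : k%:C * D x y = F (l + k%:C) x y - F l x y - (F (l + k%:C) x y - F l x y - k%:C * D x y).
  by rewrite subKr.
rewrite (le_trans (ncB _ _))// lerD// (le_trans (ncB _ _))// lerD//; [exact: hA|exact: hB].
Qed.

(** The relations in [goodK] are linear, so they hold for difference quotients; the quadratic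
    remainders and [nc_linear_zero] transfer them to the derivatives. *)
Lemma goodK_hol (Kf K1f K2f : C -> R -> R -> C) (cf : C -> C) (D D1 D2 : R -> R -> C) (dc l : C) (d : R) :
  0 < d -> (forall m, nc (m - l) < d -> goodK (Kf m) (K1f m) (K2f m) (cf m)) ->
  holK Kf l D -> holK K1f l D1 -> holK K2f l D2 -> hol cf l dc -> goodK D D1 D2 dc.
Proof.
move=> d0 gk h0 h1 h2 hc.
have m0 : cmeas2 D by apply: (holK_cmeas d0 _ h0) => m /gk[[]].
have m1 : cmeas2 D1 by apply: (holK_cmeas d0 _ h1) => m /gk[[]].
have m2 : cmeas2 D2 by apply: (holK_cmeas d0 _ h2) => m /gk[[]].
have l0 : locb D by apply: (holK_locb d0 _ h0) => m /gk/goodK_locb[].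
have l1 : locb D1 by apply: (holK_locb d0 _ h1) => m /gk/goodK_locb[].
have l2 : locb D2 by apply: (holK_locb d0 _ h2) => m /gk/goodK_locb[].
have iD (L : R -> R -> C) y a b : cmeas2 L -> locb L -> Cint `[a, b] (L ^~ y).
  move=> mL hL; have [M hM] := hL (`|a| + `|b| + `|y|).
  apply: (Cint_le (measurable_itv _) (cmeas2_2 y mL) (rint_cst a b M)) => x.
  rewrite /= in_itv /= => /andP[ax xb]; apply: hM; last by rewrite lerDr addr_ge0.
  have := normr_ge0 y.
  have g1 := ler_norm b; have g2 := ler_norm (- a); rewrite normrN in g2.
  have g3 := normr_ge0 a; have g4 := normr_ge0 b.
  by case: (ger0P x) => x0; rlra.
have glm : goodK (Kf l) (K1f l) (K2f l) (cf l) by apply: gk; rewrite subrr nc0.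
split=> //.
- move=> p; have [A hA] := l0 p; have [B hB] := l1 p; have [E hE] := l2 p.
  exists (`|A| + `|B| + `|E|) => x y hx hy.
  have a1 := ler_norm A; have a2 := ler_norm B; have a3 := ler_norm E.
  have b1 := normr_ge0 A; have b2 := normr_ge0 B; have b3 := normr_ge0 E.
  have := hA x y hx hy; have := hB x y hx hy; have := hE x y hx hy.
  by split; lra.
- move=> y a b ab; apply/eqP; rewrite -subr_eq0; apply/eqP.
  pose p := `|a| + `|b| + `|y|.
  have py : `|y| <= p by rewrite lerDr addr_ge0.
  have px x : a <= x <= b -> `|x| <= p.
    move=> /andP[ax xb]; rewrite /p; have := normr_ge0 y.
    have g1 := ler_norm b; have g2 := ler_norm (- a); rewrite normrN in g2.
    have g3 := normr_ge0 a; have g4 := normr_ge0 b.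
    by case: (ger0P x) => x0; rlra.
  have [M0 [d1 [d10 hM0]]] := h0 p; have [M1 [d2 [d20 hM1]]] := h1 p.
  apply: (@nc_linear_zero _ (M0 + M0 + M1 * (b - a)) (Num.min d (Num.min d1 d2))).
    by rewrite !lt_min d0 d10.
  move=> k k0; rewrite !lt_min => /and3P[kd kd1 kd2].
  have ekl : nc (l + k%:C - l) = k by rewrite addrAC subrr add0r nc_real gtr0_norm.
  have ekC : l + k%:C - l = k%:C by rewrite addrAC subrr add0r.
  have gm : goodK (Kf (l + k%:C)) (K1f (l + k%:C)) (K2f (l + k%:C)) (cf (l + k%:C)).
    by apply: gk; rewrite ekl.
  have r0 x : a <= x <= b -> nc (Kf (l + k%:C) x y - Kf l x y - k%:C * D x y) <= M0 * k ^+ 2.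
    by move=> /px hx; have := hM0 (l + k%:C) x y; rewrite ekl ekC => /(_ kd1 hx py).
  have r1 x : a <= x <= b -> nc (K1f (l + k%:C) x y - K1f l x y - k%:C * D1 x y) <= M1 * k ^+ 2.
    by move=> /px hx; have := hM1 (l + k%:C) x y; rewrite ekl ekC => /(_ kd2 hx py).
  have [i1 _] := goodK_Cint y a b gm; have [j1 _] := goodK_Cint y a b glm.
  have k1 := iD D1 y a b m1 l1.
  have ii := CintN (measurable_itv `[a, b]) j1.
  have ij := CintD (measurable_itv `[a, b]) i1 ii.
  have ik := CintN (measurable_itv `[a, b]) (CintZ k%:C (measurable_itv _) k1).
  have il := CintD (measurable_itv `[a, b]) ij ik.
  have e3 : k%:C * (D b y - D a y - Cintegral `[a, b] (D1^~ y)) =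
    - (Kf (l + k%:C) b y - Kf l b y - k%:C * D b y) + (Kf (l + k%:C) a y - Kf l a y - k%:C * D a y)
    + Cintegral `[a, b] (fun x => K1f (l + k%:C) x y - K1f l x y - k%:C * D1 x y).
    rewrite (CintegralD (measurable_itv _) ij ik) (CintegralD (measurable_itv _) i1 ii).
    rewrite (CintegralN (measurable_itv _) j1) (CintegralN (measurable_itv _) (CintZ k%:C (measurable_itv _) k1)).
    rewrite (CintegralZ _ (measurable_itv _) k1).
    have [_ _ g1 _] := gm; have [_ _ g2 _] := glm.
    by rewrite -(g1 _ _ _ ab) -(g2 _ _ _ ab); ring.
  rewrite -{1}(gtr0_norm k0) -nc_real -ncM e3 (le_trans (ncD _ _))// mulrDl lerD//.
    rewrite (le_trans (ncD _ _))// ncN mulrDl lerD// r0// ?lexx ?ab//.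
  apply: (@le_trans _ _ (\int[mu]_(x in `[a, b]) (M1 * k ^+ 2))).
    apply: (nc_Cintegral_le (measurable_itv _) il (rint_cst _ _ _)) => x.
    by rewrite /= in_itv /=; exact: r1.
  by rewrite Rint_cst// le_eqVlt; apply/orP; left; apply/eqP; ring.
move=> y a b ab; apply/eqP; rewrite -subr_eq0; apply/eqP.
pose p := `|a| + `|b| + `|y|.
have py : `|y| <= p by rewrite lerDr addr_ge0.
have px x : a <= x <= b -> `|x| <= p.
  move=> /andP[ax xb]; rewrite /p; have := normr_ge0 y.
  have g1 := ler_norm b; have g2 := ler_norm (- a); rewrite normrN in g2.
  have g3 := normr_ge0 a; have g4 := normr_ge0 b.
  by case: (ger0P x) => x0; rlra.
have [M0 [d1 [d10 hM0]]] := h1 p; have [M1 [d2 [d20 hM1]]] := h2 p.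
have [M2 [d3 [d30 hM2]]] := hc.
set J : C := (y < b)%R%:R - (y < a)%R%:R.
have nJ : nc J <= 1.
  rewrite /J; case: (ltrP y a) => ya; first by rewrite (lt_le_trans ya ab) subrr nc0.
  by case: (ltrP y b) => yb; rewrite subr0 ?nc1 ?nc0.
apply: (@nc_linear_zero _ (M0 + M0 + M1 * (b - a) + M2) (Num.min d (Num.min d1 (Num.min d2 d3)))).
  by rewrite !lt_min d0 d10 d20.
move=> k k0; rewrite !lt_min => /and4P[kd kd1 kd2 kd3].
have ekl : nc (l + k%:C - l) = k by rewrite addrAC subrr add0r nc_real gtr0_norm.
have ekC : l + k%:C - l = k%:C by rewrite addrAC subrr add0r.
have gm : goodK (Kf (l + k%:C)) (K1f (l + k%:C)) (K2f (l + k%:C)) (cf (l + k%:C)).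
  by apply: gk; rewrite ekl.
have r0 x : a <= x <= b -> nc (K1f (l + k%:C) x y - K1f l x y - k%:C * D1 x y) <= M0 * k ^+ 2.
  by move=> /px hx; have := hM0 (l + k%:C) x y; rewrite ekl ekC => /(_ kd1 hx py).
have r1 x : a <= x <= b -> nc (K2f (l + k%:C) x y - K2f l x y - k%:C * D2 x y) <= M1 * k ^+ 2.
  by move=> /px hx; have := hM1 (l + k%:C) x y; rewrite ekl ekC => /(_ kd2 hx py).
have r2 : nc (cf (l + k%:C) - cf l - k%:C * dc) <= M2 * k ^+ 2.
  by have := hM2 (l + k%:C); rewrite ekl ekC => /(_ kd3).
have [_ i1] := goodK_Cint y a b gm; have [_ j1] := goodK_Cint y a b glm.
have k1 := iD D2 y a b m2 l2.
have ii := CintN (measurable_itv `[a, b]) j1.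
have ij := CintD (measurable_itv `[a, b]) i1 ii.
have ik := CintN (measurable_itv `[a, b]) (CintZ k%:C (measurable_itv _) k1).
have il := CintD (measurable_itv `[a, b]) ij ik.
have e3 : k%:C * (D1 b y - D1 a y - (Cintegral `[a, b] (D2^~ y) + dc * J)) =
  - (K1f (l + k%:C) b y - K1f l b y - k%:C * D1 b y) + (K1f (l + k%:C) a y - K1f l a y - k%:C * D1 a y)
  + Cintegral `[a, b] (fun x => K2f (l + k%:C) x y - K2f l x y - k%:C * D2 x y)
  + (cf (l + k%:C) - cf l - k%:C * dc) * J.
  rewrite (CintegralD (measurable_itv _) ij ik) (CintegralD (measurable_itv _) i1 ii).
  rewrite (CintegralN (measurable_itv _) j1) (CintegralN (measurable_itv _) (CintZ k%:C (measurable_itv _) k1)).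
  rewrite (CintegralZ _ (measurable_itv _) k1).
  have [_ _ _ g1] := gm; have [_ _ _ g2] := glm.
  have q1 := g1 y a b ab; have q2 := g2 y a b ab; rewrite -/J in q1 q2.
  set I1 := Cintegral _ _ in q1 *; set I2 := Cintegral _ _ in q2 *; set I3 := Cintegral _ _.
  have -> : I1 = K1f (l + k%:C) b y - K1f (l + k%:C) a y - cf (l + k%:C) * J by rewrite q1 addrK.
  have -> : I2 = K1f l b y - K1f l a y - cf l * J by rewrite q2 addrK.
  by ring.
rewrite -{1}(gtr0_norm k0) -nc_real -ncM e3 (le_trans (ncD _ _))// [leRHS]mulrDl lerD//.
  rewrite (le_trans (ncD _ _))// [leRHS]mulrDl lerD//.
    rewrite (le_trans (ncD _ _))// ncN [leRHS]mulrDl lerD// r0// ?lexx ?ab//.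
  apply: (@le_trans _ _ (\int[mu]_(x in `[a, b]) (M1 * k ^+ 2))).
    apply: (nc_Cintegral_le (measurable_itv _) il (rint_cst _ _ _)) => x.
    by rewrite /= in_itv /=; exact: r1.
  by rewrite Rint_cst// le_eqVlt; apply/orP; left; apply/eqP; ring.
by rewrite ncM (le_trans _ r2)// ler_piMr// nc_ge0.
Qed.

(** The difference quotient minus [D] is again a good kernel, whose entries and jump are at most
    [M * nc (m - l)], and [H2loc_Op] applies to it. *)
Lemma Op_differentiable (Kf K1f K2f : C -> R -> R -> C) (cf : C -> C) (D D1 D2 : R -> R -> C) (dc l : C) (d : R) :
  0 < d -> (forall m, nc (m - l) < d -> goodK (Kf m) (K1f m) (K2f m) (cf m)) ->
  holK Kf l D -> holK K1f l D1 -> holK K2f l D2 -> hol cf l dc ->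
  op_differentiable (fun m => Op (Kf m)) l.
Proof.
move=> d0 gk h0 h1 h2 hc.
have gD := goodK_hol d0 gk h0 h1 h2 hc.
have gl : goodK (Kf l) (K1f l) (K2f l) (cf l) by apply: gk; rewrite subrr nc0.
split; first exact: (goodK_comp_loc gl).
exists (Op D); split; first exact: (goodK_comp_loc gD).
move=> r p e e0; apply/dnear_ncP.
pose q := `|r| + `|p|.
have [M0 [d1 [d10 hM0]]] := h0 q; have [M1 [d2 [d20 hM1]]] := h1 q.
have [M2 [d3 [d30 hM2]]] := h2 q; have [M3 [d4 [d40 hM3]]] := hc.
pose M := `|M0| + `|M1| + `|M2| + `|M3|.
have M00 : 0 <= M by rewrite !addr_ge0.
have L0 : 0 <= loc_const p `|r|.
  by rewrite /loc_const addr_ge0// !mulr_ge0// addr_ge0// mulr_ge0.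
pose B := loc_const p `|r| * M ^+ 2 + 1.
have B0 : 0 < B by rewrite ltr_wpDl// mulr_ge0// sqr_ge0.
(* The entry [1] gives [t ^ 2 <= t] for [t = nc (m - l)], and [e / B] then keeps the bound [B * t]
   below [e]. *)
pose d' := Num.min d (Num.min d1 (Num.min d2 (Num.min d3 (Num.min d4 (Num.min 1 (e / B)))))).
exists d'; first by rewrite /d' !lt_min d0 d10 d20 d30 d40 ltr01 divr_gt0.
move=> m ml; rewrite /d' !lt_min => /andP[md /andP[md1 /andP[md2 /andP[md3 /andP[md4 /andP[m1 me]]]]]] f hf.
have gm := gk m md.
have gQ := goodK_lin (m - l)^-1 (- (m - l)^-1) gm gl.
have g := goodK_lin 1 (-1) gQ gD.
have hf' := L2supp_mono (ler_norm r) hf.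
have [[n0 _ _] _ _ _] := gm; have [[n1 _ _] _ _ _] := gl; have [[n2 _ _] _ _ _] := gD.
have [b0 _ _] := goodK_locb gm; have [b1 _ _] := goodK_locb gl; have [b2 _ _] := goodK_locb gD.
have [[n3 _ _] _ _ _] := gQ; have [b3 _ _] := goodK_locb gQ.
set t := nc (m - l) in m1 me *.
have t0 : 0 < t by rewrite nc_gt0 subr_eq0.
have mlC : m - l != 0 by rewrite subr_eq0.
have eK (F : C) (G E : C) (N : R) : nc (F - G - (m - l) * E) <= N * t ^+ 2 -> N <= M ->
   nc (1 * ((m - l)^-1 * F + - (m - l)^-1 * G) + -1 * E) <= M * t.
  move=> h hN; have -> : 1 * ((m - l)^-1 * F + - (m - l)^-1 * G) + -1 * E = (m - l)^-1 * (F - G - (m - l) * E).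
    by field.
  rewrite ncM ncV -/t mulrC ler_pdivrMr// -mulrA -expr2 (le_trans h)//.
  by rewrite ler_wpM2r// sqr_ge0.
have lM0 : M0 <= M by rewrite (le_trans (ler_norm _))// /M -!addrA lerDl !addr_ge0.
have lM1 : M1 <= M.
  by rewrite (le_trans (ler_norm _))// /M [`|M0| + _]addrC -!addrA lerDl !addr_ge0.
have lM2 : M2 <= M.
  by rewrite (le_trans (ler_norm _))// /M [_ + `|M2|]addrC -!addrA lerDl !addr_ge0.
have lM3 : M3 <= M by rewrite (le_trans (ler_norm _))// /M lerDr !addr_ge0.
have -> : (fun x => (m - l)^-1 * (Op (Kf m) f x - Op (Kf l) f x) - Op D f x) =
  Op (fun x y => 1 * ((m - l)^-1 * Kf m x y + - (m - l)^-1 * Kf l x y) + -1 * D x y) f.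
  apply/funext => x.
  rewrite (Op_lin_K 1 (-1) x n3 n2 b3 b2 hf) (Op_lin_K (m - l)^-1 (- (m - l)^-1) x n0 n1 b0 b1 hf).
  by ring.
apply: (@le_trans _ _ ((loc_const p `|r| * (M * t) ^+ 2)%:E * L2norm2 setT f)%E).
  apply: (H2loc_Op g hf' (normr_ge0 r)).
  - by rewrite mulr_ge0// ltW.
  - move=> x y hx hy.
    have xq : `|x| <= q by rewrite (le_trans hx)// lerDr.
    have yq : `|y| <= q by rewrite (le_trans hy)// lerDl.
    split.
    + by apply: (eK _ _ _ M0) => //; exact: hM0.
    + by apply: (eK _ _ _ M1) => //; exact: hM1.
    + by apply: (eK _ _ _ M2) => //; exact: hM2.
  - by apply: (eK _ _ _ M3) => //; exact: hM3.
have [hL2 _] := hf.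
rewrite (L2norm2E hL2) -!EFinM lee_fin ler_wpM2r ?N2_ge0// exprMn mulrA.
apply: (@le_trans _ _ (B * t)); last by rewrite mulrC -ler_pdivlMr// ltW.
rewrite expr2 mulrA ler_wpM2r ?(ltW t0)//.
apply: (@le_trans _ _ (loc_const p `|r| * M ^+ 2)); last by rewrite /B lerDl.
by rewrite ler_piMr ?(ltW m1)// mulr_ge0// sqr_ge0.
Qed.

End KernelFamilies.

(** * A submultiplicative norm on polynomials *)

Section PolynomialNorm.
Variable R : realType.
Local Notation C := R[i].
Implicit Types (p q : {poly C}) (r : R).

(** The majorant norm at radius [r]. It controls coefficients and values on the disc, and it is
    stable under the operations performed on entire functions: products, translations, removal of
    low-order terms. *)
Definition pnorm r p : R := \sum_(j < size p) nc p`_j * r ^+ j.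

Lemma pnormE r p n : (size p <= n)%N -> pnorm r p = \sum_(j < n) nc p`_j * r ^+ j.
Proof.
move=> pn; rewrite /pnorm (big_ord_widen n (fun j => nc p`_j * r ^+ j) pn).
rewrite [RHS](bigID (fun j : 'I_n => (j < size p)%N)) /= [X in _ = _ + X]big1 ?addr0// => j.
by rewrite -leqNgt => h; rewrite nth_default// nc0 mul0r.
Qed.

Lemma pnorm_ge0 r p : 0 <= r -> 0 <= pnorm r p.
Proof. by move=> r0; apply: sumr_ge0 => j _; rewrite mulr_ge0 ?nc_ge0// exprn_ge0. Qed.

Lemma pnorm0 r : pnorm r 0 = 0.
Proof. by rewrite /pnorm size_poly0 big_ord0. Qed.

Lemma pnormD r p q : 0 <= r -> pnorm r (p + q) <= pnorm r p + pnorm r q.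
Proof.
move=> r0; pose n := maxn (size p) (size q).
rewrite (@pnormE r (p + q) n) ?size_polyD// (@pnormE r p n) ?leq_maxl// (@pnormE r q n) ?leq_maxr//.
rewrite -big_split /=; apply: ler_sum => j _.
by rewrite coefD -mulrDl ler_wpM2r ?exprn_ge0// ncD.
Qed.

Lemma pnormN r p : pnorm r (- p) = pnorm r p.
Proof. by rewrite /pnorm size_polyN; apply: eq_bigr => j _; rewrite coefN ncN. Qed.

Lemma pnorm_sum r (I : Type) (s : seq I) (P : pred I) (F : I -> {poly C}) : 0 <= r ->
  pnorm r (\sum_(i <- s | P i) F i) <= \sum_(i <- s | P i) pnorm r (F i).
Proof.
move=> r0; elim/big_ind2 : _ => //; first by rewrite pnorm0.
by move=> x x' y y' h1 h2; apply: (le_trans (pnormD _ _ r0)); exact: lerD.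
Qed.

Lemma pnormC r (c : C) : pnorm r c%:P = nc c.
Proof. by rewrite (@pnormE _ _ 1) ?size_polyC_leq1// big_ord1 coefC eqxx expr0 mulr1. Qed.

Lemma pnormMX r p : pnorm r (p * 'X) = r * pnorm r p.
Proof.
rewrite (@pnormE _ _ (size p).+1); last first.
  by have [->|p0] := eqVneq p 0; rewrite ?mul0r ?size_poly0// size_mulX.
rewrite big_ord_recl coefMX eqxx nc0 mul0r add0r /pnorm mulr_sumr.
by apply: eq_bigr => j _; rewrite coefMX lift0 /= exprS; ring.
Qed.

Lemma pnormX r : pnorm r 'X = r.
Proof. by rewrite -['X]mul1r pnormMX -polyC1 pnormC nc1 mulr1. Qed.

Lemma pnormZ r (c : C) p : 0 <= r -> pnorm r (c *: p) = nc c * pnorm r p.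
Proof.
move=> r0; rewrite (@pnormE _ _ (size p)) ?size_scale_leq// /pnorm mulr_sumr.
by apply: eq_bigr => j _; rewrite coefZ ncM mulrA.
Qed.

Lemma pnormM r p q : 0 <= r -> pnorm r (p * q) <= pnorm r p * pnorm r q.
Proof.
move=> r0; elim/poly_ind: p => [|p c IH]; first by rewrite mul0r pnorm0 mul0r.
have e : pnorm r (p * 'X + c%:P) = r * pnorm r p + nc c.
  rewrite (@pnormE _ _ (size p).+1); last first.
    by rewrite (leq_trans (size_polyD _ _))// geq_max (leq_trans (size_polyMleq _ _)) ?size_polyX ?addn2//=
      (leq_trans (size_polyC_leq1 _)).
  rewrite big_ord_recl coefD coefMX coefC /= add0r expr0 mulr1 addrC /pnorm mulr_sumr; congr (_ + _).
  by apply: eq_bigr => j _; rewrite coefD coefMX coefC /bump leq0n add1n /= addr0 exprS; ring.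
rewrite e mulrDl -mulrA (mulrC 'X) mulrA mul_polyC (le_trans (pnormD _ _ r0))//.
rewrite mulrDl pnormMX pnormZ// lerD// -mulrA ler_wpM2l//.
Qed.

Lemma pnormX_le r p n : 0 <= r -> pnorm r (p ^+ n) <= pnorm r p ^+ n.
Proof.
move=> r0; elim: n => [|n IH]; first by rewrite !expr0 -polyC1 pnormC nc1.
by rewrite !exprS (le_trans (pnormM _ _ r0))// ler_wpM2l// pnorm_ge0.
Qed.

Lemma pnorm_mono r r' p : 0 <= r -> r <= r' -> pnorm r p <= pnorm r' p.
Proof.
move=> r0 rr; apply: ler_sum => j _; rewrite ler_wpM2l ?nc_ge0// lerXn2r// nnegrE//.
exact: le_trans rr.
Qed.

Lemma pnorm_coef r p j : 0 <= r -> nc p`_j * r ^+ j <= pnorm r p.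
Proof.
move=> r0; have [jp|pj] := ltnP j (size p); last first.
  by rewrite nth_default// nc0 mul0r pnorm_ge0.
rewrite /pnorm (bigD1 (Ordinal jp)) //= lerDl sumr_ge0// => i _.
by rewrite mulr_ge0 ?nc_ge0// exprn_ge0.
Qed.

Lemma pnorm_horner r p z : nc z <= r -> nc p.[z] <= pnorm r p.
Proof.
move=> zr; rewrite horner_coef (le_trans (nc_sum _ _ _))//; apply: ler_sum => j _.
rewrite ncM ncX ler_wpM2l ?nc_ge0// lerXn2r// nnegrE ?nc_ge0//.
exact: (le_trans (nc_ge0 z) zr).
Qed.

(** The norm of [('X + c) ^ j] is at most [(r + nc c) ^ j]. *)
Lemma pnorm_shift r p c : 0 <= r -> pnorm r (p \Po ('X + c%:P)) <= pnorm (r + nc c) p.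
Proof.
move=> r0; rewrite comp_polyE (le_trans (pnorm_sum _ _ _ r0))//; apply: ler_sum => j _.
rewrite pnormZ// ler_wpM2l ?nc_ge0// (le_trans (pnormX_le _ _ r0))//.
rewrite lerXn2r// ?nnegrE ?pnorm_ge0 ?addr_ge0 ?nc_ge0//.
by rewrite (le_trans (pnormD _ _ r0))// pnormX pnormC.
Qed.

(** Each remaining coefficient moves to a lower exponent, which decreases the power of [r] for
    [1 <= r]. *)
Lemma pnorm_drop r p n : 1 <= r -> pnorm r (drop_poly n p) <= pnorm r p.
Proof.
move=> r1; have r0 : 0 <= r by apply: le_trans r1.
rewrite (@pnormE r p (n + size p)) ?leq_addl// big_split_ord /=.
rewrite (@pnormE r _ (size p)) ?size_drop_poly ?leq_subr//.
rewrite -[leLHS]add0r lerD//; first by apply: sumr_ge0 => j _; rewrite mulr_ge0 ?nc_ge0// exprn_ge0.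
apply: ler_sum => j _; rewrite coef_drop_poly addnC ler_wpM2l ?nc_ge0//.
by rewrite ler_weXn2l// leq_addl.
Qed.

Lemma horner_take_drop n p z : p.[z] = (take_poly n p).[z] + z ^+ n * (drop_poly n p).[z].
Proof. by rewrite -{1}(poly_take_drop n p) !hornerE mulrC. Qed.

End PolynomialNorm.

(** * Entire functions as limits of polynomials *)

Section EntireFamilies.
Variable R : realType.
Local Notation C := R[i].
Implicit Types (f g : R -> C -> C) (p q : nat -> R -> {poly C}).

Definition approx p f := [/\ forall r : R, 0 <= r ->
    exists M : R, forall n x, `|x| <= r -> pnorm r (p n x) <= M,
   forall r e : R, 0 <= r -> 0 < e -> exists n0 : nat, forall n m x, (n0 <= n)%N -> (n0 <= m)%N ->
      `|x| <= r -> pnorm r (p n x - p m x) <= e &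
   forall x z, ccvg (fun n => (p n x).[z]) (f x z)].

(* Families [f x] of entire functions, uniform for bounded [x]: limits of polynomials
   in the norms [sum |p_j| r^j], for all [r]. *)
Definition entfam f := exists p, approx p f.

Lemma entfam_poly (P : {poly C}) : entfam (fun _ z => P.[z]).
Proof.
exists (fun _ _ => P); split=> [r r0|r e r0 e0|x z]; last exact: ccvg_cst.
  by exists (pnorm r P).
by exists 0%N => n m x _ _ _; rewrite subrr pnorm0 ltW.
Qed.

Lemma entfam_eq f g : (forall x z, f x z = g x z) -> entfam f -> entfam g.
Proof. by move=> h; have -> : g = f by apply/funext => x; apply/funext => z; rewrite h. Qed.

Lemma entfam_cst (c : C) : entfam (fun _ _ => c).
Proof. by apply: entfam_eq (entfam_poly c%:P) => x z; rewrite hornerC. Qed.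

Lemma entfam_id : entfam (fun _ z => z).
Proof. by apply: entfam_eq (entfam_poly 'X) => x z; rewrite hornerX. Qed.

Lemma entfamD f g : entfam f -> entfam g -> entfam (fun x z => f x z + g x z).
Proof.
move=> [p [b1 c1 l1]] [q [b2 c2 l2]]; exists (fun n x => p n x + q n x); split.
- move=> r r0; have [M hM] := b1 r r0; have [N hN] := b2 r r0.
  by exists (M + N) => n x hx; rewrite (le_trans (pnormD _ _ r0))// lerD ?hM ?hN.
- move=> r e r0 e0; have e2 : 0 < e / 2 by rewrite divr_gt0.
  have [n1 h1] := c1 r _ r0 e2; have [n2 h2] := c2 r _ r0 e2.
  exists (maxn n1 n2) => n m x; rewrite !geq_max => /andP[a1 a2] /andP[a3 a4] hx.
  rewrite (_ : _ - _ = (p n x - p m x) + (q n x - q m x)); last by ring.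
  by rewrite (le_trans (pnormD _ _ r0))// ler_half2 ?h1 ?h2.
by move=> x z; have := ccvgD (l1 x z) (l2 x z); under eq_fun do rewrite -hornerD.
Qed.

Lemma entfamM f g : entfam f -> entfam g -> entfam (fun x z => f x z * g x z).
Proof.
move=> [p [b1 c1 l1]] [q [b2 c2 l2]]; exists (fun n x => p n x * q n x); split.
- move=> r r0; have [M hM] := b1 r r0; have [N hN] := b2 r r0.
  exists (M * N) => n x hx; rewrite (le_trans (pnormM _ _ r0))//.
  by rewrite ler_pM ?pnorm_ge0// ?hM ?hN.
- move=> r e r0 e0; have [M hM] := b1 r r0; have [N hN] := b2 r r0.
  have M0 : 0 < `|M| + 1 by rewrite ltr_wpDl.
  have N0 : 0 < `|N| + 1 by rewrite ltr_wpDl.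
  have [n1 h1] := c1 r (e / 2 / (`|N| + 1)) r0 (divr_gt0 (divr_gt0 e0 (ltr0n _ 2)) N0).
  have [n2 h2] := c2 r (e / 2 / (`|M| + 1)) r0 (divr_gt0 (divr_gt0 e0 (ltr0n _ 2)) M0).
  exists (maxn n1 n2) => n m x; rewrite !geq_max => /andP[a1 a2] /andP[a3 a4] hx.
  rewrite (_ : _ - _ = p n x * (q n x - q m x) + (p n x - p m x) * q m x); last by ring.
  rewrite (le_trans (pnormD _ _ r0))// ler_half2//.
    rewrite (le_trans (pnormM _ _ r0))// (@le_trans _ _ ((`|M| + 1) * (e / 2 / (`|M| + 1))))//.
      rewrite ler_pM ?pnorm_ge0// ?h2//.
      by rewrite (le_trans (hM _ _ hx))// (le_trans (ler_norm _))// lerDl.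
    by rewrite mulrCA divff ?mulr1// gt_eqF.
  rewrite (le_trans (pnormM _ _ r0))// (@le_trans _ _ ((e / 2 / (`|N| + 1)) * (`|N| + 1)))//.
    rewrite ler_pM ?pnorm_ge0// ?h1//.
    by rewrite (le_trans (hN _ _ hx))// (le_trans (ler_norm _))// lerDl.
  by rewrite divfK// gt_eqF.
by move=> x z; have := ccvgM (l1 x z) (l2 x z); under eq_fun do rewrite -hornerM.
Qed.

Lemma entfamZ (c : C) f : entfam f -> entfam (fun x z => c * f x z).
Proof. by move=> h; apply: entfamM (entfam_cst c) h. Qed.

Lemma entfamN f : entfam f -> entfam (fun x z => - f x z).
Proof. by move=> /(entfamZ (-1)); apply: entfam_eq => x z; rewrite mulN1r. Qed.

Lemma entfamB f g : entfam f -> entfam g -> entfam (fun x z => f x z - g x z).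
Proof. by move=> h /entfamN; exact: entfamD. Qed.

Lemma entfam_if (b : R -> bool) f g : entfam f -> entfam g ->
  entfam (fun x z => if b x then f x z else g x z).
Proof.
move=> [p [b1 c1 l1]] [q [b2 c2 l2]]; exists (fun n x => if b x then p n x else q n x); split.
- move=> r r0; have [M hM] := b1 r r0; have [N hN] := b2 r r0.
  exists (`|M| + `|N|) => n x hx; case: (b x).
    by rewrite (le_trans (hM _ _ hx))// (le_trans (ler_norm _))// lerDl.
  by rewrite (le_trans (hN _ _ hx))// (le_trans (ler_norm _))// lerDr.
- move=> r e r0 e0; have [n1 h1] := c1 r _ r0 e0; have [n2 h2] := c2 r _ r0 e0.
  exists (maxn n1 n2) => n m x; rewrite !geq_max => /andP[a1 a2] /andP[a3 a4] hx.
  by case: (b x); [exact: h1|exact: h2].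
by move=> x z; case: (b x); [exact: l1|exact: l2].
Qed.

Lemma entfam_at (a : R) f : entfam f -> entfam (fun _ z => f a z).
Proof.
move=> [p [b1 c1 l1]]; exists (fun n _ => p n a); split.
- move=> r r0; have ra : 0 <= Num.max r `|a| by rewrite le_max r0.
  have [M hM] := b1 _ ra; exists M => n x _; rewrite (le_trans _ (hM n a _))//.
    by rewrite pnorm_mono// le_max lexx.
  by rewrite le_max lexx orbT.
- move=> r e r0 e0; have ra : 0 <= Num.max r `|a| by rewrite le_max r0.
  have [n1 h1] := c1 _ e ra e0; exists n1 => n m x hn hm _.
  rewrite (le_trans _ (h1 n m a hn hm _))//; last by rewrite le_max lexx orbT.
  by rewrite pnorm_mono// le_max lexx.
by move=> x z; exact: l1.
Qed.

Lemma entfam_shift (c : C) f : entfam f -> entfam (fun x z => f x (z + c)).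
Proof.
move=> [p [b1 c1 l1]]; exists (fun n x => p n x \Po ('X + c%:P)); split.
- move=> r r0; have ra : 0 <= r + nc c by rewrite addr_ge0// nc_ge0.
  have [M hM] := b1 _ ra; exists M => n x hx; rewrite (le_trans (pnorm_shift _ _ r0))// hM//.
  by rewrite (le_trans hx)// lerDl nc_ge0.
- move=> r e r0 e0; have ra : 0 <= r + nc c by rewrite addr_ge0// nc_ge0.
  have [n1 h1] := c1 _ e ra e0; exists n1 => n m x hn hm hx.
  rewrite -comp_polyB (le_trans (pnorm_shift _ _ r0))// h1//.
  by rewrite (le_trans hx)// lerDl nc_ge0.
move=> x z; have -> : (fun n => (p n x \Po ('X + c%:P)).[z]) = (fun n => (p n x).[z + c]).
  by apply/funext => n; rewrite horner_comp !hornerE.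
exact: l1.
Qed.

Lemma entfam_bounded f : entfam f -> forall r : R, exists M : R, forall x z, `|x| <= r -> nc z <= r ->
  nc (f x z) <= M.
Proof.
move=> [p [b1 c1 l1]] r; have [r0|r0] := lerP 0 r; last first.
  by exists 0 => x z hx; have := le_lt_trans hx r0; rewrite normr_lt0.
have [M hM] := b1 r r0; exists (M + 1) => x z hx hz.
have [n0 h] := l1 x z 1 ltr01; have {}h := h n0 (leqnn _).
rewrite -(subrK (p n0 x).[z] (f x z)) (le_trans (ncD _ _))// addrC lerD//; last by rewrite ncBC.
by rewrite (le_trans (pnorm_horner _ hz))// hM.
Qed.

Lemma ccvg_le (u : nat -> C) l (M : R) : ccvg u l -> (forall n, nc (u n) <= M) -> nc l <= M.
Proof.
move=> h hu; apply: ler_eps => e e0; have [n0 hn] := h e e0; have {}hn := hn n0 (leqnn _).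
by rewrite -(subrK (u n0) l) (le_trans (ncD _ _))// addrC lerD// ncBC.
Qed.

Lemma approx_coef p f x j : approx p f -> exists a, ccvg (fun n => (p n x)`_j) a.
Proof.
move=> [_ c1 _]; apply: ccvg_cauchy => e e0.
have r1 : 0 <= `|x| + 1 by rewrite addr_ge0.
have [n0 h] := c1 _ e r1 e0; exists n0 => n m hn hm.
have := h n m x hn hm; rewrite lerDl ler01 => /(_ isT); apply: le_trans.
rewrite -coefB (le_trans _ (pnorm_coef _ j r1))// ler_peMr ?nc_ge0//.
by rewrite exprn_ege1// lerDr.
Qed.

(** After translation to [l], the remainder of a polynomial is [(m - l) ^ 2] times the polynomial
    without its two lowest terms, which [pnorm_drop] bounds. The limit inherits the bound, and [D x]
    is the limit of the coefficients of degree one. *)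
Lemma entfam_hol f (l : C) : entfam f -> exists D : R -> C, forall r : R, exists M : R,
  forall x m, `|x| <= r -> nc (m - l) <= 1 ->
    nc (f x m - f x l - (m - l) * D x) <= M * nc (m - l) ^+ 2.
Proof.
move=> /(entfam_shift l) [p ap].
have [D hD] := choice (fun x => approx_coef x 1 ap).
have [b1 c1 l1] := ap.
(* One radius serves both variables, [|x| <= r] and [nc (m - l) <= 1]. *)
exists D => r; have r1 : 0 <= `|r| + 1 by rewrite addr_ge0.
have [M hM] := b1 _ r1; exists M => x m hx hm.
have xr : `|x| <= `|r| + 1 by rewrite (le_trans hx)// (le_trans (ler_norm r))// lerDl.
have e n : (p n x).[m - l] - (p n x).[0] - (m - l) * (p n x)`_1 = (m - l) ^+ 2 * (drop_poly 2 (p n x)).[m - l].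
  rewrite (horner_take_drop 2 (p n x) (m - l)) horner_coef0.
  have -> : (take_poly 2 (p n x)).[m - l] = (p n x)`_0 + (m - l) * (p n x)`_1.
    rewrite (@horner_coef_wide _ 2) ?size_take_poly// !big_ord_recr big_ord0 /= !coef_take_poly /=.
    by rewrite expr0 expr1; ring.
  by ring.
have cv := ccvgD (ccvgD (l1 x (m - l)) (ccvgN (l1 x 0))) (ccvgN (ccvgM (ccvg_cst (m - l)) (hD x))).
rewrite subrK add0r in cv.
apply: (ccvg_le cv) => n; rewrite e ncM ncX mulrC ler_wpM2r ?exprn_ge0 ?nc_ge0//.
have m1 : nc (m - l) <= `|r| + 1 by rewrite (le_trans hm)// lerDr.
rewrite (le_trans (pnorm_horner _ m1))// (le_trans (pnorm_drop _ _ _))// ?lerDr//.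
exact: hM.
Qed.

Lemma ccvg0_sum (n : nat) (u : nat -> nat -> C) (r : R) : (forall j, (j < n)%N -> ccvg (u j) 0) -> 0 <= r ->
  forall e : R, 0 < e -> exists n0, forall k, (n0 <= k)%N -> \sum_(j < n) nc (u j k) * r ^+ j <= e.
Proof.
elim: n => [|n IH] h r0 e e0; first by exists 0%N => k _; rewrite big_ord0 ltW.
have e2 : 0 < e / 2 by rewrite divr_gt0.
have [n1 h1] := IH (fun j jn => h j (ltnW jn)) r0 _ e2.
have rn : 0 < r ^+ n + 1 by rewrite ltr_wpDl// exprn_ge0.
have [n2 h2] := h n (ltnSn n) (e / 2 / (r ^+ n + 1)) (divr_gt0 e2 rn).
exists (maxn n1 n2) => k; rewrite geq_max => /andP[/h1 a1 /h2 a2].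
rewrite big_ord_recr /= ler_half2//; rewrite subr0 in a2.
apply: (@le_trans _ _ (e / 2 / (r ^+ n + 1) * (r ^+ n + 1))); last by rewrite divfK// gt_eqF.
by rewrite ler_pM ?nc_ge0 ?exprn_ge0// lerDl.
Qed.

(** The coefficients at [l] of the approximants converge to some [a j], not all zero because
    [W z1 != 0]. [N] is the first index with [a N != 0], and [g] is the limit of the approximants
    without their first [N] terms, so that [g l = a N]. *)
Lemma entire_zero_factor (W : C -> C) (l z1 : C) : entfam (fun _ => W) -> W z1 != 0 ->
  exists (N : nat) (g : C -> C), [/\ entfam (fun _ => g), g l != 0 & forall z, W z = (z - l) ^+ N * g z].
Proof.
move=> /(entfam_shift l) [p ap] W1.
have [a ha] := choice (fun j => approx_coef 0 j ap).
have [b1 c1 l1] := ap.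
pose P n := p n 0.
have [j0 hj0] : exists j, a j != 0.
  (* If every limit vanishes, cut [P n] at the size of a fixed [P n1]: the low part tends to zero
     coefficient by coefficient, and the high part is that of [P n - P n1], small by the Cauchy
     property. *)
  apply: contrapT => /forallNP h0.
  have {}h0 j : a j = 0 by apply/eqP; apply: contrapT => /negP; exact: h0.
  move: W1; apply/negP; rewrite negbK; apply/eqP/nc_eps => e e0.
  have e3 : 0 < e / 2 / 2 by rewrite !divr_gt0.
  pose z := z1 - l; pose r := nc z + 1.
  have r1 : 1 <= r by rewrite /r lerDr nc_ge0.
  have r0 : 0 <= r by apply: le_trans r1.
  have [n1 h1] := c1 r _ r0 e3.
  have [n2 h2] := @ccvg0_sum (size (P n1)) (fun j n => (P n)`_j) r
     (fun j _ => ltac:(by have := ha j; rewrite h0)) r0 _ e3.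
  have e2 : 0 < e / 2 by rewrite divr_gt0.
  have [n3 h3] := l1 0 z _ e2; rewrite /z subrK -/z in h3.
  pose n := maxn n1 (maxn n2 n3).
  have hn1 : (n1 <= n)%N by rewrite leq_maxl.
  have hn2 : (n2 <= n)%N by rewrite (leq_trans (leq_maxl n2 n3))// leq_maxr.
  have hn3 : (n3 <= n)%N by rewrite (leq_trans (leq_maxr n2 n3))// leq_maxr.
  rewrite -(subrK (P n).[z] (W z1)) (le_trans (ncD _ _))// ler_half2//.
    by rewrite ncBC h3.
  rewrite (horner_take_drop (size (P n1))) (le_trans (ncD _ _))// ler_half2//.
    apply: (le_trans _ (h2 _ hn2)).
    rewrite (@horner_coef_wide _ (size (P n1))) ?size_take_poly//.
    rewrite (le_trans (nc_sum _ _ _))//; apply: ler_sum => j _.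
    rewrite coef_take_poly ltn_ord ncM ncX ler_wpM2l ?nc_ge0//.
    by rewrite lerXn2r ?nnegrE ?nc_ge0// /r lerDl.
  have := h1 n n1 0 hn1 (leqnn _); rewrite normr0 r0 => /(_ isT); apply: le_trans.
  set Q := p n 0 - p n1 0.
  have dQ : drop_poly (size (P n1)) (P n) = drop_poly (size (P n1)) Q.
    by rewrite /Q raddfB /= [X in _ - X]drop_poly_eq0 ?subr0.
  rewrite dQ.
  have hz : nc z <= r by rewrite /r lerDl.
  have -> : z ^+ size (P n1) * (drop_poly (size (P n1)) Q).[z] = (drop_poly (size (P n1)) Q * 'X^(size (P n1))).[z].
    by rewrite !hornerE mulrC.
  apply: (le_trans (pnorm_horner _ hz)).
  rewrite (@pnormE _ _ _ (size (P n1) + size Q)); last first.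
    have [->|d0] := eqVneq (drop_poly (size (P n1)) Q) 0; first by rewrite mul0r size_poly0.
    by rewrite size_mulXn// leq_add2l size_drop_poly leq_subr.
  rewrite (@pnormE _ _ Q (size (P n1) + size Q)) ?leq_addl//.
  apply: ler_sum => j _; rewrite ler_wpM2r ?exprn_ge0// coefMXn; case: ltnP => hj.
    by rewrite nc0 nc_ge0.
  by rewrite coef_drop_poly subnK.
have exj : exists j, a j != 0 by exists j0.
pose N := ex_minn exj.
have [aN minN] : a N != 0 /\ forall j, (j < N)%N -> a j = 0.
  rewrite /N; case: ex_minnP => j hj hm; split=> // k kj; apply/eqP; apply: contraTT kj => hk.
  by rewrite -leqNgt hm.
pose q n := drop_poly N (P n).
have exg h : exists g1 : C, ccvg (fun n => (q n).[h]) g1.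
  apply: ccvg_cauchy => e e0.
  have r1 : 1 <= nc h + 1 by rewrite lerDr nc_ge0.
  have r0 : 0 <= nc h + 1 by apply: le_trans r1.
  have [n0 hn0] := c1 _ e r0 e0; exists n0 => n m hn hm.
  have hh : nc h <= nc h + 1 by rewrite lerDl.
  rewrite -hornerN -hornerD /q -raddfB /= (le_trans (pnorm_horner _ hh))//.
  by rewrite (le_trans (pnorm_drop _ _ r1))// hn0// normr0.
have [g0 hg0] := choice exg.
have ent0 : entfam (fun _ => g0).
  exists (fun n _ => q n); split => //.
  - move=> r r0; have r1 : 0 <= Num.max r 1 by rewrite le_max r0.
    have [M hM] := b1 _ r1; exists M => n x _.
    have rm : r <= Num.max r 1 by rewrite le_max lexx.
    rewrite (le_trans (pnorm_mono _ r0 rm))// (le_trans (pnorm_drop _ _ _))//.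
      by rewrite le_max lexx orbT.
    by apply: hM; rewrite normr0.
  - move=> r e r0 e0; have r1 : 0 <= Num.max r 1 by rewrite le_max r0.
    have [n0 hn0] := c1 _ e r1 e0; exists n0 => n m x hn hm _.
    have rm : r <= Num.max r 1 by rewrite le_max lexx.
    rewrite /q -raddfB /= (le_trans (pnorm_mono _ r0 rm))// (le_trans (pnorm_drop _ _ _))//.
      by rewrite le_max lexx orbT.
    by apply: hn0 => //; rewrite normr0.
have W0 h : W (h + l) = h ^+ N * g0 h.
  apply: (ccvg_unique (l1 0 h)).
  have -> : (fun n => (p n 0).[h]) = (fun n => (take_poly N (P n)).[h] + h ^+ N * (q n).[h]).
    by apply/funext => n; rewrite (horner_take_drop N).
  rewrite -[h ^+ N * g0 h]add0r; apply: ccvgD; last by apply: ccvgM => //; exact: ccvg_cst.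
  move=> e e0.
  have [n0 hn] := @ccvg0_sum N (fun j n => (P n)`_j) (nc h)
     (fun j jN => ltac:(by have := ha j; rewrite (minN _ jN))) (nc_ge0 h) _ e0.
  exists n0 => n /hn; apply: le_trans.
  rewrite subr0 (@horner_coef_wide _ N) ?size_take_poly// (le_trans (nc_sum _ _ _))//.
  by apply: ler_sum => j _; rewrite coef_take_poly ltn_ord ncM ncX.
exists N, (fun z => g0 (z - l)); split.
- by apply: entfam_eq (entfam_shift (- l) ent0).
- rewrite subrr (_ : g0 0 = a N)//.
  apply: (ccvg_unique (hg0 0)).
  have -> : (fun n => (q n).[0]) = (fun n => (p n 0)`_N).
    by apply/funext => n; rewrite horner_coef0 coef_drop_poly.
  exact: ha.
- by move=> z; rewrite -W0 subrK.
Qed.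

End EntireFamilies.

(** * The hyperbolic solutions are entire in the spectral parameter *)

Section EntireHyperbolic.
Variable R : realType.
Local Notation C := R[i].

Lemma exp_tail_small (y e : R) : 0 < e -> exists n0, forall n m, (n0 <= n)%N -> (n <= m)%N ->
  \sum_(n <= k < m) y ^+ k / (k`!)%:R <= e.
Proof.
move=> e0; have /cauchy_cvgP/cauchy_seriesP h := is_cvg_series_exp_coeff y.
have [[A B] /= [[n1 _ h1] [n2 _ h2]] hAB] := h e e0.
exists (maxn n1 n2) => n m; rewrite geq_max => /andP[a1 a2] nm.
have := hAB (n, m); rewrite /= => /(_ (conj (h1 n a1) (h2 m (leq_trans a2 nm)))) hh.
rewrite (le_trans (ler_norm _))//.
by apply: ltW; move: hh; rewrite (eq_bigr (fun k => y ^+ k / (k`!)%:R)).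
Qed.

Lemma exp_partial_le (y : R) : 0 <= y -> exists2 B : R, 0 <= B &
  forall n, \sum_(k < n) y ^+ k / (k`!)%:R <= B.
Proof.
move=> y0; have [n0 h] := exp_tail_small y ltr01.
pose S n := \sum_(0 <= k < n) y ^+ k / (k`!)%:R.
have t0 k : 0 <= y ^+ k / (k`!)%:R by rewrite divr_ge0// exprn_ge0.
exists (S n0 + 1); first by rewrite addr_ge0// sumr_ge0.
move=> n; rewrite -(big_mkord xpredT (fun k => y ^+ k / (k`!)%:R)).
have [n0n|nn0] := leqP n0 n.
  by rewrite (big_cat_nat (leq0n n0) n0n)//= lerD2l h.
rewrite (@le_trans _ _ (S n0))// ?lerDl//.
by rewrite /S (big_cat_nat (leq0n n) (ltnW nn0))//= lerDl sumr_ge0.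
Qed.

(** A Weierstrass test with the exponential series as majorant. *)
Lemma entfam_series (q : nat -> R -> {poly C}) (f : R -> C -> C) :
  (forall r, 0 <= r -> exists A y : R, [/\ 0 <= A, 0 <= y & forall k x, `|x| <= r ->
     pnorm r (q k x) <= A * (y ^+ k / (k`!)%:R)]) ->
  (forall x z, ccvg (fun n => \sum_(k < n) (q k x).[z]) (f x z)) -> entfam f.
Proof.
move=> h hf; exists (fun n x => \sum_(k < n) q k x); split.
- move=> r r0; have [A [y [A0 y0 hA]]] := h r r0.
  have [B B0 hB] := exp_partial_le y0; exists (A * B) => n x hx.
  rewrite (le_trans (pnorm_sum _ _ _ r0))// (@le_trans _ _ (\sum_(k < n) A * (y ^+ k / (k`!)%:R)))//.
    by apply: ler_sum => k _; exact: hA.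
  by rewrite -mulr_sumr ler_wpM2l.
- move=> r e r0 e0; have [A [y [A0 y0 hA]]] := h r r0.
  have A1 : 0 < A + 1 by rewrite ltr_wpDl.
  have [n0 hn0] := exp_tail_small y (divr_gt0 e0 A1).
  have aux n m x : (n0 <= n)%N -> (n <= m)%N -> `|x| <= r ->
      pnorm r (\sum_(k < m) q k x - \sum_(k < n) q k x) <= e.
    move=> hn nm hx.
    rewrite -!(big_mkord xpredT (fun k => q k x)) (big_cat_nat (leq0n n) nm)//= addrAC subrr add0r.
    rewrite (le_trans (pnorm_sum _ _ _ r0))// (@le_trans _ _ (\sum_(n <= k < m) A * (y ^+ k / (k`!)%:R)))//.
      by apply: ler_sum => k _; exact: hA.
    rewrite -mulr_sumr (@le_trans _ _ ((A + 1) * (e / (A + 1))))//; last first.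
      by rewrite mulrCA divff ?mulr1// gt_eqF.
    apply: ler_pM => //; first by apply: sumr_ge0 => k _; rewrite divr_ge0// exprn_ge0.
      by rewrite lerDl.
    exact: hn0.
  exists n0 => n m x hn hm hx; have [nm|mn] := leqP n m; last exact: aux (ltnW mn) hx.
  by rewrite -pnormN opprB; exact: aux.
move=> x z; have := hf x z; congr ccvg; apply/funext => n.
by rewrite horner_sum.
Qed.

Lemma pow_fact_cvg0 (y e : R) : 0 <= y -> 0 < e -> exists n0, forall n, (n0 <= n)%N -> y ^+ n / (n`!)%:R <= e.
Proof.
move=> y0 e0; have [n0 h] := exp_tail_small y e0; exists n0 => n hn.
by have := h n n.+1 hn (leqnSn n); rewrite big_nat1.
Qed.

Lemma leq_fact m n : (m <= n)%N -> (m`! <= n`!)%N.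
Proof.
move=> /subnK <-; elim: (n - m)%N => // k IH.
by rewrite addSn factS (leq_trans IH)// leq_pmull.
Qed.

Lemma fact_le_double k : (k`! <= (2 * k)`!)%N.
Proof. by rewrite leq_fact// mul2n -addnn leq_addr. Qed.

Lemma pow_fact_le (y : R) k m : 0 <= y -> (k`! <= m`!)%N -> y / (m`!)%:R <= y / (k`!)%:R.
Proof.
move=> y0 h; rewrite ler_wpM2l// lef_pV2 ?posrE ?ltr0n ?fact_gt0//.
by rewrite ler_nat.
Qed.

(** The Taylor series contains only whole powers of [s = v - z ^ 2], hence its terms are polynomials
    in [z]; [k! <= (2 k)!] reduces it to the exponential majorant. *)
Lemma entfam_coshs (v a : R) : entfam (fun x z => coshs (v%:C - z ^+ 2) (x - a)).
Proof.
pose P : {poly C} := (v%:C)%:P - 'X ^+ 2.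
pose q k x := P ^+ k * (((x - a)%:C ^+ (2 * k)) / ((2 * k)`!)%:R)%:P.
apply: (@entfam_series q).
  move=> r r0; exists 1, (pnorm r P * (r + `|a|) ^+ 2); split=> //.
    by rewrite mulr_ge0 ?pnorm_ge0// sqr_ge0.
  move=> k x hx; rewrite mul1r /q (le_trans (pnormM _ _ r0))// pnormC.
  rewrite exprMn -mulrA ler_pM ?pnorm_ge0 ?nc_ge0 ?pnormX_le//.
  rewrite ncM ncV nc_nat ncX nc_real -exprM.
  apply: (@le_trans _ _ ((r + `|a|) ^+ (2 * k) / ((2 * k)`!)%:R)).
    rewrite ler_wpM2r ?invr_ge0// lerXn2r ?nnegrE ?addr_ge0//.
    by rewrite (le_trans (ler_normB _ _))// lerD.
  by apply: pow_fact_le; [rewrite exprn_ge0// addr_ge0|exact: fact_le_double].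
move=> x z e e0; set s := v%:C - z ^+ 2; set t := x - a.
have sq := sqr_sqrtc s; set b := sqrtc s in sq *; set y := nc b * `|t|.
have y0 : 0 <= y by rewrite mulr_ge0 ?nc_ge0.
have [n0 h] := pow_fact_cvg0 y0 (divr_gt0 e0 (expR_gt0 y)).
exists n0 => n hn; rewrite ncBC.
have -> : \sum_(k < n) (q k x).[z] = \sum_(k < n) s ^+ k * t%:C ^+ (2 * k) / ((2 * k)`!)%:R.
  by apply: eq_bigr => k _; rewrite /q /P hornerM hornerC horner_exp hornerD hornerN horner_exp hornerX hornerC mulrA.
apply: (le_trans (coshs_taylor n t sq)); rewrite -/y -ler_pdivlMr ?expR_gt0//.
by apply: h; rewrite (leq_trans hn)// mul2n -addnn leq_addr.
Qed.

Lemma entfam_sinhs (v a : R) : entfam (fun x z => sinhs (v%:C - z ^+ 2) (x - a)).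
Proof.
pose P : {poly C} := (v%:C)%:P - 'X ^+ 2.
pose q k x := P ^+ k * (((x - a)%:C ^+ (2 * k).+1) / ((2 * k).+1`!)%:R)%:P.
apply: (@entfam_series q).
  move=> r r0; exists (r + `|a|), (pnorm r P * (r + `|a|) ^+ 2); split=> //.
  - by rewrite addr_ge0.
  - by rewrite mulr_ge0 ?pnorm_ge0// sqr_ge0.
  move=> k x hx; rewrite /q (le_trans (pnormM _ _ r0))// pnormC.
  rewrite exprMn -mulrA mulrCA ler_pM ?pnorm_ge0 ?nc_ge0 ?pnormX_le//.
  rewrite ncM ncV nc_nat ncX nc_real -exprM mulrA -exprS.
  apply: (@le_trans _ _ ((r + `|a|) ^+ (2 * k).+1 / ((2 * k).+1`!)%:R)).
    rewrite ler_wpM2r ?invr_ge0// lerXn2r ?nnegrE ?addr_ge0//.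
    by rewrite (le_trans (ler_normB _ _))// lerD.
  apply: pow_fact_le; first by rewrite exprn_ge0// addr_ge0.
  by rewrite (leq_trans (fact_le_double k))// leq_fact.
move=> x z e e0; set s := v%:C - z ^+ 2; set t := x - a.
have sq := sqr_sqrtc s; set b := sqrtc s in sq *; set y := nc b * `|t|.
have y0 : 0 <= y by rewrite mulr_ge0 ?nc_ge0.
have t1 : 0 < `|t| + 1 by rewrite ltr_wpDl.
have [n0 h] := pow_fact_cvg0 y0 (divr_gt0 (divr_gt0 e0 (expR_gt0 y)) t1).
exists n0 => n hn; rewrite ncBC.
have -> : \sum_(k < n) (q k x).[z] = \sum_(k < n) s ^+ k * t%:C ^+ (2 * k).+1 / ((2 * k).+1`!)%:R.
  by apply: eq_bigr => k _; rewrite /q /P hornerM hornerC horner_exp hornerD hornerN horner_exp hornerX hornerC mulrA.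
apply: (le_trans (sinhs_taylor n t sq)); rewrite -/y -ler_pdivlMr ?expR_gt0//.
have -> : nc b ^+ (2 * n) * `|t| ^+ (2 * n).+1 / ((2 * n).+1`!)%:R = `|t| * (y ^+ (2 * n) / ((2 * n).+1`!)%:R).
  by rewrite /y exprMn exprS; ring.
apply: (@le_trans _ _ ((`|t| + 1) * (e / expR y / (`|t| + 1)))); last first.
  by rewrite mulrCA divff ?mulr1// gt_eqF.
apply: ler_pM => //.
- by rewrite divr_ge0// exprn_ge0.
- by rewrite lerDl.
apply: (le_trans (pow_fact_le _ (leq_fact (leqnSn (2 * n))))); first by rewrite exprn_ge0.
by apply: h; rewrite (leq_trans hn)// mul2n -addnn leq_addr.
Qed.

End EntireHyperbolic.

(** * Step potentials and their solutions *)

Section StepPotentials.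
Variable R : realType.
Local Notation C := R[i].
Implicit Types (Y : C * C) (z l : C) (s : seq (R * R)).

(** The flow of [u'' = z u] over a length [t], acting on the data [(u, u')]. *)
Definition estep z (t : R) Y : C * C :=
  (coshs z t * Y.1 + sinhs z t * Y.2, z * sinhs z t * Y.1 + coshs z t * Y.2).

Lemma estep0 z Y : estep z 0 Y = Y.
Proof.
by case: Y => u w; rewrite /estep coshs0 sinhs0 /= !(mulr0, mul0r, mul1r, addr0, add0r).
Qed.

Lemma estep_lin z t (a b : C) Y Z :
  estep z t (a * Y.1 + b * Z.1, a * Y.2 + b * Z.2) =
  (a * (estep z t Y).1 + b * (estep z t Z).1, a * (estep z t Y).2 + b * (estep z t Z).2).
Proof. by congr pair; rewrite /=; ring. Qed.

Definition wron Y Z : C := Y.1 * Z.2 - Y.2 * Z.1.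

Lemma estep_wron z t Y Z : wron (estep z t Y) (estep z t Z) = wron Y Z.
Proof.
rewrite /wron /= -[RHS]mul1r -(coshs_det z t); ring.
Qed.

Lemma cder_estep z Y : cder (fun t => (estep z t Y).1) (fun t => (estep z t Y).2) /\
  cder (fun t => (estep z t Y).2) (fun t => z * (estep z t Y).1).
Proof.
have hc := cder_coshs z; have hs := cder_sinhs z; split.
  have := cderD (cderM hc (cder_cst Y.1)) (cderM hs (cder_cst Y.2)).
  by move/cder_eq; apply => t /=; ring.
have := cderD (cderM (cderZ z hs) (cder_cst Y.1)) (cderM hc (cder_cst Y.2)).
by move/cder_eq; apply => t /=; ring.
Qed.

Lemma cprim_estep z Y (a : R) : cprim (fun x => (estep z (x - a) Y).1) (fun x => (estep z (x - a) Y).2) /\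
  cprim (fun x => (estep z (x - a) Y).2) (fun x => z * (estep z (x - a) Y).1).
Proof.
have [h1 h2] := cder_estep z Y.
have g1 := cder_shift a h1; have g2 := cder_shift a h2.
by split; [exact: (cder_cprim g1 g2)|exact: (cder_cprim g2 (cderZ z g1))].
Qed.

(** The breakpoint itself belongs to the left piece, as in [steppot]. *)
Definition step_ext l (av : R * R) (Y : R -> C * C) (x : R) : C * C :=
  if x <= av.1 then Y x else estep ((av.2)%:C - l ^+ 2) (x - av.1) (Y av.1).

(* The solution of [- u'' + V u = l ^ 2 u], as a pair [(u, u')], with data [Y] at [a0],
   for [V] the step potential with values [av.2] to the right of the breakpoints [av.1]. *)
Definition stepsol l (a0 : R) Y s : R -> C * C :=
  foldl (fun F av => step_ext l av F) (fun x => estep (0%:C - l ^+ 2) (x - a0) Y) s.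

Definition steppot s : R -> R :=
  foldl (fun (V : R -> R) av => fun x => if x <= av.1 then V x else av.2) (fun=> 0) s.

Lemma stepsol_rcons l a0 Y s av : stepsol l a0 Y (rcons s av) = step_ext l av (stepsol l a0 Y s).
Proof. by rewrite /stepsol foldl_rcons. Qed.

Lemma steppot_rcons s av : steppot (rcons s av) = fun x => if x <= av.1 then steppot s x else av.2.
Proof. by rewrite /steppot foldl_rcons. Qed.

Lemma measurable_steppot s : measurable_fun setT (steppot s).
Proof.
elim/last_ind: s => [|s av IH]; first exact: measurable_cst.
rewrite steppot_rcons; apply: measurable_fun_ifT; [|exact: IH|exact: measurable_cst].
by apply: measurable_fun_ler => //; exact: measurable_cst.
Qed.

Lemma steppot_bounded s (B : R) : 0 <= B -> (forall av, av \in s -> `|av.2| <= B) ->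
  forall x, `|steppot s x| <= B.
Proof.
move=> B0; elim/last_ind: s => [|s av IH] h x; first by rewrite normr0.
rewrite steppot_rcons; case: ifP => _; last by apply: h; rewrite mem_rcons inE eqxx.
by apply: IH => a ha; apply: h; rewrite mem_rcons inE ha orbT.
Qed.

Definition odesol (V : R -> R) l (Y : R -> C * C) :=
  cprim (fun x => (Y x).1) (fun x => (Y x).2) /\
  cprim (fun x => (Y x).2) (fun x => ((V x)%:C - l ^+ 2) * (Y x).1).

Lemma stepsol_ode l a0 Y s : odesol (steppot s) l (stepsol l a0 Y s).
Proof.
elim/last_ind: s => [|s [a v] [h1 h2]].
  by have [g1 g2] := cprim_estep (0%:C - l ^+ 2) Y a0; split.
rewrite stepsol_rcons steppot_rcons.
set F := stepsol l a0 Y s in h1 h2 *.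
have [g1 g2] := cprim_estep (v%:C - l ^+ 2) (F a) a.
have e1 : (F a).1 = (estep (v%:C - l ^+ 2) (a - a) (F a)).1 by rewrite subrr estep0.
have e2 : (F a).2 = (estep (v%:C - l ^+ 2) (a - a) (F a)).2 by rewrite subrr estep0.
split.
  have := cprim_glue h1 g1 e1; by congr cprim; apply/funext => x; rewrite /step_ext /=; case: ifP.
have := cprim_glue h2 g2 e2; by congr cprim; apply/funext => x; rewrite /step_ext /=; case: ifP.
Qed.

Lemma stepsol_lin l a0 s (a b : C) Y Z x :
  stepsol l a0 (a * Y.1 + b * Z.1, a * Y.2 + b * Z.2) s x =
  (a * (stepsol l a0 Y s x).1 + b * (stepsol l a0 Z s x).1,
   a * (stepsol l a0 Y s x).2 + b * (stepsol l a0 Z s x).2).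
Proof.
elim/last_ind: s x => [|s [p v] IH] x; first exact: estep_lin.
by rewrite !stepsol_rcons /step_ext /=; case: ifP => _ //; rewrite IH estep_lin.
Qed.

Lemma stepsol_wron l a0 s Y Z x : wron (stepsol l a0 Y s x) (stepsol l a0 Z s x) = wron Y Z.
Proof.
elim/last_ind: s x => [|s [p v] IH] x; first exact: estep_wron.
by rewrite !stepsol_rcons /step_ext /=; case: ifP => _; rewrite ?estep_wron IH.
Qed.

Lemma stepsol_left l a0 s Y x : x <= a0 -> (forall av, av \in s -> a0 <= av.1) ->
  stepsol l a0 Y s x = estep (0%:C - l ^+ 2) (x - a0) Y.
Proof.
move=> xa; elim/last_ind: s => [//|s [p v] IH] h.
rewrite stepsol_rcons /step_ext /= ifT; last first.
  by rewrite (le_trans xa)//; apply: (h (p, v)); rewrite mem_rcons inE eqxx.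
by apply: IH => av hav; apply: h; rewrite mem_rcons inE hav orbT.
Qed.

Lemma stepsol_right l a0 s Y (p v x : R) : p <= x ->
  stepsol l a0 Y (rcons s (p, v)) x = estep (v%:C - l ^+ 2) (x - p) (stepsol l a0 Y s p).
Proof.
rewrite stepsol_rcons /step_ext /=; rewrite le_eqVlt => /orP[/eqP <-|px].
  by rewrite lexx subrr estep0.
by rewrite leNgt px.
Qed.

(** At each breakpoint the solution is frozen at [p], by [entfam_at], and combined with the entire
    functions [coshs] and [sinhs]. *)
Lemma entfam_stepsol a0 s (y1 y2 : C -> C) : entfam (fun (_ : R) => y1) -> entfam (fun (_ : R) => y2) ->
  entfam (fun x l => (stepsol l a0 (y1 l, y2 l) s x).1) /\
  entfam (fun x l => (stepsol l a0 (y1 l, y2 l) s x).2).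
Proof.
move=> e1 e2.
have aux (v a : R) (f1 f2 : R -> C -> C) : entfam f1 -> entfam f2 ->
   entfam (fun x l => (estep (v%:C - l ^+ 2) (x - a) (f1 x l, f2 x l)).1) /\
   entfam (fun x l => (estep (v%:C - l ^+ 2) (x - a) (f1 x l, f2 x l)).2).
  move=> h1 h2; have hc := entfam_coshs v a; have hs := entfam_sinhs v a.
  have hz : entfam (fun (_ : R) l => v%:C - l ^+ 2).
    by apply: (entfam_eq _ (entfam_poly ((v%:C)%:P - 'X ^+ 2))) => x z; rewrite !hornerE.
  split; first by apply: entfamD; exact: entfamM.
  by apply: entfamD; apply: entfamM => //; exact: entfamM.
elim/last_ind: s => [|s [p v] [h1 h2]]; first exact: aux.
have [g1 g2] := aux v p _ _ (entfam_at p h1) (entfam_at p h2).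
split.
  have := entfam_if (fun x => x <= p) h1 g1; apply: entfam_eq => x l.
  by rewrite stepsol_rcons /step_ext /=; case: ifP.
have := entfam_if (fun x => x <= p) h2 g2; apply: entfam_eq => x l.
by rewrite stepsol_rcons /step_ext /=; case: ifP.
Qed.

Lemma Re_conj (w : C) : complex.Re (conjc w) = complex.Re w. Proof. by case: w. Qed.

Lemma Im_conj (w : C) : complex.Im (conjc w) = - complex.Im w. Proof. by case: w. Qed.

(** [om] is a phase left free: its choice depends on the sign of [Re l]. *)
Definition flux (om : C) Y : R := complex.Re (om * (Y.2 * conjc Y.1)).

(* [(w conj u)' = z |u|^2 + |w|^2] along [u' = w], [w' = z u]. *)
Lemma flux_estep (om z : C) (t : R) Y : 0 <= t -> 0 <= complex.Re om -> 0 <= complex.Re (om * z) ->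
  flux om Y <= flux om (estep z t Y).
Proof.
move=> t0 o1 o2; have [h1 h2] := cder_estep z Y.
have hconj : cder (fun t => conjc (estep z t Y).1) (fun t => conjc (estep z t Y).2).
  case: h1 => a b; split.
    have -> : (fun t => complex.Re (conjc (estep z t Y).1)) = (fun t => complex.Re (estep z t Y).1).
      by apply/funext => x; rewrite Re_conj.
    by apply: (rder_eq a) => x; rewrite Re_conj.
  have -> : (fun t => complex.Im (conjc (estep z t Y).1)) = (fun t => - complex.Im (estep z t Y).1).
    by apply/funext => x; rewrite Im_conj.
  by apply: (rder_eq (rderN b)) => x; rewrite Im_conj.
have [hq _] := cderZ om (cderM h2 hconj).
have := rder_mono hq _ t0; rewrite !estep0; apply => x _.
set U := (estep z x Y).1; set W := (estep z x Y).2.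
have -> : om * (z * U * conjc U + W * conjc W) = om * z * (conjc U * U) + om * (conjc W * W) by ring.
by rewrite !conjMnc ReD ![_ * (_)%:C]mulrC !ReZ addr_ge0// mulr_ge0// sqr_ge0.
Qed.

Lemma flux_stepsol (om l : C) a0 s Y x : 0 <= complex.Re om ->
  path (fun a b => a <= b) a0 [seq av.1 | av <- s] ->
  (forall v, v = 0 \/ v \in [seq av.2 | av <- s] -> 0 <= complex.Re (om * (v%:C - l ^+ 2))) ->
  last a0 [seq av.1 | av <- s] <= x -> flux om Y <= flux om (stepsol l a0 Y s x).
Proof.
move=> o1; elim/last_ind: s x => [|s [p v] IH] x /=.
  by move=> _ h ax; apply: flux_estep; rewrite ?subr_ge0//; apply: h; left.
rewrite !map_rcons last_rcons rcons_path /= => /andP[h1 h2] h px.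
rewrite (stepsol_right _ _ _ _ v px).
have hv w : w = 0 \/ w \in [seq av.2 | av <- s] -> 0 <= complex.Re (om * (w%:C - l ^+ 2)).
  by case=> [->|hw]; apply: h; [left|right; rewrite mem_rcons inE hw orbT].
apply: (le_trans (IH p h1 hv h2)); apply: flux_estep => //; first by rewrite subr_ge0.
by apply: h; right; rewrite mem_rcons inE eqxx.
Qed.

End StepPotentials.

(** * Calculus of holomorphic kernels *)

Section HolomorphicKernels.
Variable R : realType.
Local Notation C := R[i].
Implicit Types (F G : C -> R -> R -> C) (l : C) (D E : R -> R -> C).

(** The local bounds accompany the expansion because the product rule uses them. *)
Definition holb F l D := [/\ holK F l D, locb (F l) & locb D].

Lemma locbM D E : locb D -> locb E -> locb (fun x y => D x y * E x y).
Proof.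
move=> hD hE p; have [M hM] := hD p; have [N hN] := hE p; exists (M * N) => x y hx hy.
by rewrite ncM ler_pM ?nc_ge0 ?hM ?hN.
Qed.

Lemma locbD D E : locb D -> locb E -> locb (fun x y => D x y + E x y).
Proof.
move=> hD hE p; have [M hM] := hD p; have [N hN] := hE p; exists (M + N) => x y hx hy.
by rewrite (le_trans (ncD _ _))// lerD ?hM ?hN.
Qed.

(** The remainder of the product is [h ^ 2 f1 g1 + (f + h f1) rg + rf (g + h g1 + rg)], and
    [nc h <= 1] absorbs the higher powers of [h]. *)
Lemma hol_mul_bound (h f f1 rf g g1 rg : C) (A B M N : R) : nc h <= 1 ->
  nc f <= A -> nc f1 <= A -> nc g <= B -> nc g1 <= B -> 0 <= M -> 0 <= N ->
  nc rf <= M * nc h ^+ 2 -> nc rg <= N * nc h ^+ 2 ->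
  nc ((f + h * f1 + rf) * (g + h * g1 + rg) - f * g - h * (f1 * g + f * g1)) <=
  (A * B + 2 * A * N + M * (2 * B + N)) * nc h ^+ 2.
Proof.
move=> h1 hf hf1 hg hg1 M0 N0 hr hs.
have -> : (f + h * f1 + rf) * (g + h * g1 + rg) - f * g - h * (f1 * g + f * g1) =
  h ^+ 2 * (f1 * g1) + (f + h * f1) * rg + rf * (g + h * g1 + rg) by ring.
have h0 := nc_ge0 h; have q0 : 0 <= nc h ^+ 2 by rewrite exprn_ge0.
have q1 : nc h ^+ 2 <= 1 by rewrite exprn_ile1.
have A0 : 0 <= A by exact: le_trans (nc_ge0 _) hf.
have B0 : 0 <= B by exact: le_trans (nc_ge0 _) hg.
have e1 : nc (f + h * f1) <= 2 * A.
  rewrite (le_trans (ncD _ _))// ncM.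
  have : nc h * nc f1 <= 1 * A by apply: ler_pM; rewrite ?nc_ge0.
  by lra.
have e2 : nc (g + h * g1 + rg) <= 2 * B + N.
  rewrite (le_trans (ncD _ _))// lerD//; last first.
    by rewrite (le_trans hs)// ler_piMr.
  rewrite (le_trans (ncD _ _))// ncM.
  have : nc h * nc g1 <= 1 * B by apply: ler_pM; rewrite ?nc_ge0.
  by lra.
rewrite (le_trans (ncD _ _))// (le_trans (lerD (ncD _ _) (lexx _)))// !ncM.
have k1 : nc h * nc h * (nc f1 * nc g1) <= nc h ^+ 2 * (A * B).
  rewrite -expr2; by apply: ler_wpM2l => //; apply: ler_pM; rewrite ?nc_ge0.
have k2 : nc (f + h * f1) * nc rg <= 2 * A * (N * nc h ^+ 2) by apply: ler_pM; rewrite ?nc_ge0.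
have k3 : nc rf * nc (g + h * g1 + rg) <= M * nc h ^+ 2 * (2 * B + N) by apply: ler_pM; rewrite ?nc_ge0.
by move: k1 k2 k3; rlra.
Qed.

Lemma holbM F G l D E : holb F l D -> holb G l E ->
  holb (fun m x y => F m x y * G m x y) l (fun x y => D x y * G l x y + F l x y * E x y).
Proof.
move=> [hF bF bD] [hG bG bE]; split; [|exact: locbM|by apply: locbD; apply: locbM].
move=> p; have [M [d [d0 hM]]] := hF p; have [N [d' [d'0 hN]]] := hG p.
have [A1 hA1] := bF p; have [A2 hA2] := bD p; have [B1 hB1] := bG p; have [B2 hB2] := bE p.
pose A := Num.max A1 A2; pose B := Num.max B1 B2.
pose M' := Num.max M 0; pose N' := Num.max N 0.
exists (A * B + 2 * A * N' + M' * (2 * B + N')), (Num.min 1 (Num.min d d')); split.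
  by rewrite !lt_min ltr01 d0.
move=> m x y; rewrite !lt_min => /andP[k1 /andP[k2 k3]] hx hy.
set h := m - l in k1 k2 k3 *.
have q0 : 0 <= nc h ^+ 2 by rewrite exprn_ge0// nc_ge0.
have e1 : nc (F m x y - F l x y - h * D x y) <= M' * nc h ^+ 2.
  by rewrite (le_trans (hM m x y k2 hx hy))// ler_wpM2r// le_max lexx.
have e2 : nc (G m x y - G l x y - h * E x y) <= N' * nc h ^+ 2.
  by rewrite (le_trans (hN m x y k3 hx hy))// ler_wpM2r// le_max lexx.
have := @hol_mul_bound h (F l x y) (D x y) _ (G l x y) (E x y) _ A B M' N' (ltW k1) _ _ _ _ _ _ e1 e2.
have -> : F l x y + h * D x y + (F m x y - F l x y - h * D x y) = F m x y by ring.
have -> : G l x y + h * E x y + (G m x y - G l x y - h * E x y) = G m x y by ring.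
by apply; rewrite /A /B /M' /N' le_max ?hA1 ?hA2 ?hB1 ?hB2 ?lexx ?orbT.
Qed.

Lemma holb_if (b : R -> R -> bool) F G l D E : holb F l D -> holb G l E ->
  holb (fun m x y => if b x y then F m x y else G m x y) l (fun x y => if b x y then D x y else E x y).
Proof.
move=> [hF bF bD] [hG bG bE].
have bif (D1 E1 : R -> R -> C) : locb D1 -> locb E1 -> locb (fun x y => if b x y then D1 x y else E1 x y).
  move=> h1 h2 p; have [M hM] := h1 p; have [N hN] := h2 p; exists (Num.max M N) => x y hx hy.
  by case: (b x y); rewrite le_max ?hM ?hN ?orbT.
split; [|exact: bif|exact: bif].
move=> p; have [M [d [d0 hM]]] := hF p; have [N [d' [d'0 hN]]] := hG p.
exists (Num.max M N), (Num.min d d'); split; first by rewrite lt_min d0.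
move=> m x y; rewrite lt_min => /andP[k2 k3] hx hy.
have q0 : 0 <= nc (m - l) ^+ 2 by rewrite exprn_ge0// nc_ge0.
case: (b x y).
  by rewrite (le_trans (hM m x y k2 hx hy))// ler_wpM2r// le_max lexx.
by rewrite (le_trans (hN m x y k3 hx hy))// ler_wpM2r// le_max lexx orbT.
Qed.

Lemma holb_hol (a : C -> C) l da : hol a l da -> holb (fun m _ _ => a m) l (fun _ _ => da).
Proof.
move=> [M [d [d0 h]]]; split=> [p|p|p].
- by exists M, d; split=> // m x y hm _ _; exact: h.
- by exists (nc (a l)).
- by exists (nc da).
Qed.

Lemma entfam_holb (f : R -> C -> C) l : entfam f -> exists2 D : R -> C,
  holb (fun m x _ => f x m) l (fun x _ => D x) & holb (fun m _ y => f y m) l (fun _ y => D y).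
Proof.
move=> ef; have [D hD] := entfam_hol l ef.
have lb m : locb (fun x _ => f x m).
  move=> p; have [M hM] := entfam_bounded ef (`|p| + nc m); exists M => x y hx _; apply: hM.
    by rewrite (le_trans hx)// (le_trans (ler_norm _))// lerDl nc_ge0.
  by rewrite lerDr.
have hK : holK (fun m x _ => f x m) l (fun x _ => D x).
  move=> p; have [M hM] := hD p; exists M, 1; split=> // m x y hm hx _; exact: hM (ltW hm).
have lD : locb (fun x (_ : R) => D x) by exact: (holK_locb ltr01 _ hK).
exists D; split=> //.
- by move=> p; have [M [d [d0 h]]] := hK p; exists M, d; split=> // m x y hm hx hy; exact: (h m y x).
- by move=> p; have [M h] := lb l p; exists M => x y hx hy; exact: (h y x).
by move=> p; have [M h] := lD p; exists M => x y hx hy; exact: (h y x).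
Qed.

Lemma entfam_hol0 (a : C -> C) l : entfam (fun _ : R => a) -> exists da, hol a l da.
Proof.
move=> ea; have [D hD] := entfam_hol l ea; have [M hM] := hD 0.
by exists (D 0), M, 1; split=> // m hm; apply: (hM 0); rewrite ?normr0// ltW.
Qed.

Lemma hol_lip (a : C -> C) l da : hol a l da -> exists M d : R, [/\ 0 < d, 0 <= M &
  forall m, nc (m - l) < d -> nc (a m - a l) <= M * nc (m - l)].
Proof.
move=> [M [d [d0 h]]]; exists (nc da + `|M|), (Num.min 1 d); split.
- by rewrite lt_min ltr01.
- by rewrite addr_ge0// nc_ge0.
move=> m; rewrite lt_min => /andP[h1 /h]; set k := nc (m - l) in h1 * => h2.
have k0 : 0 <= k by exact: nc_ge0.
have -> : a m - a l = (m - l) * da + (a m - a l - (m - l) * da) by ring.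
rewrite (le_trans (ncD _ _))// ncM -/k [X in _ <= X]mulrDl (mulrC (nc da)) lerD2l (le_trans h2)//.
rewrite expr2 mulrA ler_wpM2r// (le_trans (ler_norm _))// normrM (ger0_norm k0).
by rewrite ler_piMr// ltW.
Qed.

Lemma hol_neq0 (a : C -> C) l da : hol a l da -> a l != 0 ->
  exists2 d : R, 0 < d & forall m, nc (m - l) < d -> nc (a l) / 2 <= nc (a m).
Proof.
move=> ha al; have [M [d [d0 M0 h]]] := hol_lip ha.
have a0 : 0 < nc (a l) by rewrite nc_gt0.
have M1 : 0 < M + 1 by rewrite ltr_wpDl.
exists (Num.min d (nc (a l) / 2 / (M + 1))); first by rewrite lt_min d0 !divr_gt0.
move=> m; rewrite lt_min => /andP[/h h1]; rewrite ltr_pdivlMr// => h2.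
have := ncB_ge (a l) (a m); rewrite (ncBC (a l)).
have := nc_ge0 (m - l); nra.
Qed.

Lemma holV (a : C -> C) l da : hol a l da -> a l != 0 ->
  exists db, hol (fun m => (a m)^-1) l db.
Proof.
move=> ha al; have [d1 d10 h1] := hol_neq0 ha al; have [M [d [d0 h]]] := ha.
have a0 : 0 < nc (a l) by rewrite nc_gt0.
exists (- (da / a l ^+ 2)).
(* [K * nc t ^ 2] bounds the numerator of the remainder; the factor 2 comes from
   [nc (a m) >= nc (a l) / 2] in the denominator. *)
set K := nc (a l) * `|M| + nc da ^+ 2 + nc da * `|M|.
exists (2 * K / nc (a l) ^+ 3), (Num.min 1 (Num.min d d1)); split.
  by rewrite !lt_min ltr01 d0.
move=> m; rewrite !lt_min => /andP[k1 /andP[/h k2 /h1 k3]].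
set t := m - l in k1 k2 *; set r := a m - a l - t * da in k2.
have t0 := nc_ge0 t.
have am : a m != 0 by rewrite -nc_gt0; lra.
have -> : (a m)^-1 - (a l)^-1 - t * - (da / a l ^+ 2) =
   (- (a l) * r + t ^+ 2 * da ^+ 2 + t * da * r) / (a m * a l ^+ 2).
  have -> : r = a m - a l - t * da by [].
  by move: (a m) (a l) am al => u v u0 v0; field; rewrite ?u0 ?v0.
rewrite ncM ncV ncM ncX ler_pdivrMr ?mulr_gt0 ?exprn_gt0 ?nc_gt0//.
have hr : nc r <= `|M| * nc t ^+ 2.
  by rewrite (le_trans k2)// ler_wpM2r ?exprn_ge0// ler_norm.
have hN : nc (- a l * r + t ^+ 2 * da ^+ 2 + t * da * r) <= K * nc t ^+ 2.
  rewrite (le_trans (ncD _ _))// (le_trans (lerD (ncD _ _) (lexx _)))// !ncM ncN.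
  have r0 := nc_ge0 r; have e1 : nc (a l) * nc r <= nc (a l) * (`|M| * nc t ^+ 2) by rewrite ler_wpM2l// nc_ge0.
  have e2 : nc t * nc da * nc r <= 1 * nc da * (`|M| * nc t ^+ 2).
    by apply: ler_pM => //; rewrite ?mulr_ge0 ?nc_ge0// ler_wpM2r ?nc_ge0// ltW.
  by move: e1 e2; rewrite /K; rlra.
apply: (le_trans hN).
have -> : 2 * K / nc (a l) ^+ 3 * nc t ^+ 2 * (nc (a m) * nc (a l) ^+ 2) =
  K * nc t ^+ 2 * (2 * nc (a m) / nc (a l)).
  by move: (nc (a l)) a0 => v v0; field; rewrite gt_eqF.
rewrite ler_peMr// ?mulr_ge0 ?exprn_ge0//.
  by rewrite /K !addr_ge0 ?mulr_ge0 ?nc_ge0 ?sqr_ge0.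
by rewrite ler_pdivlMr// mul1r; lra.
Qed.

End HolomorphicKernels.

(** * Green kernels and their meromorphic continuation *)

Section GreenKernel.
Variable R : realType.
Local Notation C := R[i].
Implicit Types (V : R -> R) (f g : R -> C -> C) (W : C -> C) (l : C).

(* [f] and [g] are two families of solutions of [- u'' + V u = l ^ 2 u], with derivatives
   [f1] and [g1] and Wronskian [W]. *)
Record green V f (f1 : R -> C -> C) g (g1 : R -> C -> C) W : Prop := Green {
  gr_m : measurable_fun setT V;
  gr_b : forall x, `|V x| <= 1;
  gr_f : entfam f; gr_f1 : entfam f1; gr_g : entfam g; gr_g1 : entfam g1;
  gr_of : forall l, odesol V l (fun x => (f x l, f1 x l));
  gr_og : forall l, odesol V l (fun x => (g x l, g1 x l));
  gr_W : forall l x, W l = f x l * g1 x l - f1 x l * g x l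
}.

(** The Green kernel before division by the Wronskian, hence entire in [l]. *)
Definition gker f g l (x y : R) : C := if (y < x)%R then g x l * f y l else f x l * g y l.

Lemma green_entfam V f f1 g g1 W : green V f f1 g g1 W -> entfam (fun _ : R => W).
Proof.
move=> G; apply: (entfam_eq _ (entfamB (entfamM (entfam_at 0 (gr_f G)) (entfam_at 0 (gr_g1 G)))
  (entfamM (entfam_at 0 (gr_f1 G)) (entfam_at 0 (gr_g G))))) => x z.
by rewrite (gr_W G z 0).
Qed.

Lemma cprim_cst (c : C) : cprim (fun _ : R => c) (fun=> 0).
Proof. exact: (cder_cprim (cder_cst c) (cder_cst 0)). Qed.

Definition gker2 V f g l (x y : R) : C := ((V x)%:C - l ^+ 2) * gker f g l x y.

(** Across the diagonal the first derivative jumps by [g1 * f - f1 * g], which is the Wronskian. *)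
Lemma goodK_green V f f1 g g1 W l : green V f f1 g g1 W ->
  goodK (gker f g l) (fun x y => if (y < x)%R then g1 x l * f y l else f1 x l * g y l)
        (gker2 V f g l) (W l).
Proof.
move=> G; have [of1 of2] := gr_of G l; have [og1 og2] := gr_og G l.
rewrite /= in of1 of2 og1 og2.
have mb : measurable_fun setT (fun p : R * R => (p.2 < p.1)%R).
  by apply: measurable_fun_ltr; [exact: measurable_snd|exact: measurable_fst].
have m1 (u : R -> C) : cmeas u -> cmeas (fun p : R * R => u p.1).
  by move=> mu; apply: (cmeas_comp mu); exact: measurable_fst.
have m2 (u : R -> C) : cmeas u -> cmeas (fun p : R * R => u p.2).
  by move=> mu; apply: (cmeas_comp mu); exact: measurable_snd.
have mf := cprim_cmeas of1; have mf1 := cprim_cmeas of2.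
have mg := cprim_cmeas og1; have mg1 := cprim_cmeas og2.
have mN : cmeas2 (gker f g l).
  exact: (cmeas_if mb (cmeasM (m1 _ mg) (m2 _ mf)) (cmeasM (m1 _ mf) (m2 _ mg))).
have mV : cmeas (fun x => (V x)%:C - l ^+ 2).
  by apply: cmeasB; [apply: cmeas_real; exact: gr_m G|exact: cmeas_cst].
split.
- split=> //.
    exact: (cmeas_if mb (cmeasM (m1 _ mg1) (m2 _ mf)) (cmeasM (m1 _ mf1) (m2 _ mg))).
  exact: (cmeasM (m1 _ mV) mN).
- move=> r; pose q := `|r| + nc l.
  have lq : nc l <= q by rewrite lerDr.
  have xq x : `|x| <= r -> `|x| <= q.
    by move=> hx; rewrite (le_trans hx)// (le_trans (ler_norm _))// lerDl nc_ge0.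
  have [A hA] := entfam_bounded (gr_f G) q; have [B hB] := entfam_bounded (gr_f1 G) q.
  have [A' hA'] := entfam_bounded (gr_g G) q; have [B' hB'] := entfam_bounded (gr_g1 G) q.
  pose M := `|A| + `|B| + `|A'| + `|B'|.
  have Mf x : `|x| <= r -> nc (f x l) <= M.
    move=> /xq hx; rewrite (le_trans (hA _ _ hx lq))// (le_trans (ler_norm _))// /M -!addrA lerDl.
    by rewrite !addr_ge0.
  have Mf1 x : `|x| <= r -> nc (f1 x l) <= M.
    move=> /xq hx; rewrite (le_trans (hB _ _ hx lq))// (le_trans (ler_norm _))// /M -!addrA addrCA lerDl.
    by rewrite !addr_ge0.
  have Mg x : `|x| <= r -> nc (g x l) <= M.
    move=> /xq hx; rewrite (le_trans (hA' _ _ hx lq))// (le_trans (ler_norm _))// /M addrAC lerDr.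
    by rewrite !addr_ge0.
  have Mg1 x : `|x| <= r -> nc (g1 x l) <= M.
    move=> /xq hx; rewrite (le_trans (hB' _ _ hx lq))// (le_trans (ler_norm _))// /M lerDr.
    by rewrite !addr_ge0.
  have M0 : 0 <= M by rewrite /M !addr_ge0.
  have l1 : 1 <= 1 + nc l ^+ 2 by rewrite lerDl sqr_ge0.
  have MM : M * M <= (1 + nc l ^+ 2) * (M * M) by rewrite ler_peMl// mulr_ge0.
  have hN x y : `|x| <= r -> `|y| <= r -> nc (gker f g l x y) <= M * M.
    by move=> hx hy; rewrite /gker; case: ifP => _; rewrite ncM ler_pM ?nc_ge0 ?Mf ?Mg.
  exists ((1 + nc l ^+ 2) * (M * M)) => x y hx hy; split.
  + by apply: le_trans MM; exact: hN.
  + apply: le_trans MM; case: ifP => _; rewrite ncM ler_pM ?nc_ge0 ?Mf ?Mg ?Mf1 ?Mg1//.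
  rewrite /gker2 ncM ler_pM ?nc_ge0 ?hN//.
  by rewrite (le_trans (ncB _ _))// nc_real ncX lerD2r; exact: gr_b G _.
- move=> y a b ab.
  have h := cprim_glue (cprimZ (g y l) of1) (cprimZ (f y l) og1) (mulrC (g y l) (f y l)).
  have := cprimE h ab.
  have e x : gker f g l x y = if x <= y then g y l * f x l else f y l * g x l.
    by rewrite /gker ltNge; case: (x <= y); rewrite /= mulrC.
  rewrite -!e => ->; apply: eq_Cintegral => x _.
  by rewrite ltNge; case: (x <= y); rewrite /= mulrC.
move=> y a b ab.
have h1 := cprimZ (g y l) of2.
(* Subtraction of the constant [W l] closes the jump, so that the two pieces can be glued. *)
have h2 := cprimD (cprimZ (f y l) og2) (cprim_cst (- W l)).
have e0 : g y l * f1 y l = f y l * g1 y l - W l by rewrite (gr_W G l y); ring.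
have := cprimE (cprim_glue h1 h2 e0) ab.
set I1 := Cintegral _ _; set I2 := Cintegral _ _.
have -> : I1 = I2.
  apply: eq_Cintegral => x _; rewrite /gker2 /gker ltNge.
  by case: (x <= y) => /=; ring.
move=> <-; rewrite !ltNge; case: (a <= y); case: (b <= y) => /=; ring.
Qed.

Lemma goodK_scale (K K1 K2 : R -> R -> C) c (a : C) : goodK K K1 K2 c ->
  goodK (fun x y => a * K x y) (fun x y => a * K1 x y) (fun x y => a * K2 x y) (a * c).
Proof.
move=> gK; have := goodK_lin a 0 gK gK.
by congr goodK; rewrite ?mul0r ?addr0//; apply/funext => x; apply/funext => y; rewrite mul0r addr0.
Qed.

(** The denominator [q] is independent of [W], so as to apply to the cofactor of [W] at one of its
    zeros. *)
Lemma green_holK V f f1 g g1 W l (q : C -> C) : green V f f1 g g1 W ->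
  entfam (fun _ : R => q) -> q l != 0 ->
  exists D D1 D2 dc,
  [/\ holK (fun m x y => - (q m)^-1 * gker f g m x y) l D,
      holK (fun m x y => - (q m)^-1 * (if (y < x)%R then g1 x m * f y m else f1 x m * g y m)) l D1,
      holK (fun m x y => - (q m)^-1 * gker2 V f g m x y) l D2 &
      hol (fun m => - (q m)^-1 * W m) l dc].
Proof.
move=> G eq ql; have [dq hq] := entfam_hol0 l eq; have [di [Mi [ri [ri0 hi]]]] := holV hq ql.
have hin : hol (fun m => - (q m)^-1) l (- di).
  exists Mi, ri; split=> // m hm; rewrite -ncN; apply: le_trans (hi m hm).
  by rewrite le_eqVlt; apply/orP; left; apply/eqP; congr nc; ring.
have bi := holb_hol hin.
have [Df hf hf'] := entfam_holb l (gr_f G); have [Df1 hf1 _] := entfam_holb l (gr_f1 G).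
have [Dg hg hg'] := entfam_holb l (gr_g G); have [Dg1 hg1 _] := entfam_holb l (gr_g1 G).
have [dW hW] := entfam_hol0 l (green_entfam G).
have bN := holb_if (fun x y => (y < x)%R) (holbM hg hf') (holbM hf hg').
have bN1 := holb_if (fun x y => (y < x)%R) (holbM hg1 hf') (holbM hf1 hg').
have bV : holb (fun m x (_ : R) => (V x)%:C - m ^+ 2) l (fun _ _ => - (2 * l)).
  split=> p.
  - exists 1, 1; split=> // m x y _ _ _; rewrite mul1r -ncX.
    by rewrite le_eqVlt; apply/orP; left; apply/eqP; rewrite -ncN; congr nc; ring.
  - exists (1 + nc (l ^+ 2)) => x y _ _; rewrite (le_trans (ncB _ _))// nc_real lerD2r; exact: gr_b G _.
  - by exists (nc (- (2 * l))).
have [k1 _ _] := holbM bi bN; have [k2 _ _] := holbM bi bN1.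
have [k3 _ _] := holbM bi (holbM bV bN).
have [k4 _ _] := holbM bi (holb_hol hW).
do 4 eexists; split; [exact: k1|exact: k2|exact: k3|].
have [M [d [d0 h]]] := k4 0; exists M, d; split=> // m hm.
by apply: (h m 0 0 hm); rewrite normr0.
Qed.

(** With this normalization the jump of the derivative is [-1], so [Op_cprim] adds [- f] to the
    second derivative, as [- u'' + V u - l ^ 2 u = f] demands. *)
Definition gres f g W (l : C) : operator R := Op (fun x y => - (W l)^-1 * gker f g l x y).

Lemma green_differentiable V f f1 g g1 W l (q : C -> C) : green V f f1 g g1 W ->
  entfam (fun _ : R => q) -> q l != 0 -> op_differentiable (gres f g q) l.
Proof.
move=> G eq ql; have [D [D1 [D2 [dc [k0 k1 k2 k3]]]]] := green_holK G eq ql.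
apply: (Op_differentiable ltr01 _ k0 k1 k2 k3) => m _.
exact: goodK_scale (goodK_green m G).
Qed.

(** With [W = (l - l0) ^ N * q] and [q l0 != 0], the family with denominator [q] is holomorphic near
    [l0]. *)
Lemma green_pole_order V f f1 g g1 W l0 z1 : green V f f1 g g1 W -> W z1 != 0 ->
  exists N, pole_order_le (gres f g W) l0 N.
Proof.
move=> G W1; have [N [q [eq q0 hW]]] := entire_zero_factor l0 (green_entfam G) W1.
have [dq hq] := entfam_hol0 l0 eq; have [d d0 hd] := hol_neq0 hq q0.
exists N, (gres f g q).
  apply/near_ncP; exists d => // l hl; apply: (green_differentiable G eq).
  by rewrite -nc_gt0; apply: lt_le_trans (hd l hl); rewrite divr_gt0// nc_gt0.
apply/dnear_ncP; exists d => // l ll hl h [r hr]; apply: aeW => x /=.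
have gK := goodK_scale (- (q l)^-1) (goodK_green l G).
have [lb _ _] := goodK_locb gK; have [[m0 _ _] _ _ _] := gK.
have iK := L2supp_Cint x m0 lb hr.
rewrite /gres /Op -(CintegralZ ((l - l0) ^- N) measurableT iK); apply: eq_Cintegral => y _.
by rewrite hW invfM; ring.
Qed.

Lemma green_meromorphic V f f1 g g1 W z1 : green V f f1 g g1 W -> W z1 != 0 ->
  op_meromorphic (gres f g W).
Proof. by move=> G W1 l0; exact: green_pole_order G W1. Qed.

End GreenKernel.

(** * Exponentially decaying kernels on L^2 *)

Section ExponentialKernels.
Variable R : realType.
Local Notation mu := (@lebesgue_measure R).
Local Notation C := R[i].

(** Monotone convergence along [[- n, n]]. *)
Lemma rint_exhaust (g : R -> R) (M : R) : measurable_fun setT g -> (forall x, 0 <= g x) ->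
  (forall a b, a <= b -> rint `[a, b] g) ->
  (forall n : nat, \int[mu]_(x in `[- n%:R, n%:R]) g x <= M) ->
  rint setT g /\ \int[mu]_x g x <= M.
Proof.
move=> mg g0 ig hM.
have mgE : measurable_fun setT (fun x => (g x)%:E) by exact/measurable_EFinP.
have nn (n : nat) : - n%:R <= n%:R :> R by rewrite -subr_ge0 opprK addr_ge0.
have hlim : (\int[mu]_x (g x)%:E <= M%:E)%E.
  rewrite -(bigcup_itvT true false).
  have h : (\int[mu]_(x in [set` `[(- n%:R)%R, n%:R%R]]) (g x)%:E @[n --> \oo] -->
     \int[mu]_(x in \bigcup_n [set` `[(- n%:R)%R, n%:R%R]]) (g x)%:E)%E.
    apply: ge0_nondecreasing_set_cvg_integral.
    - apply/nondecreasing_seqP => n; rewrite subsetEset; apply: subset_itv; rewrite bnd_simp.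
        by rewrite lerN2 ler_nat.
      by rewrite ler_nat.
    - by move=> n; exact: measurable_itv.
    - by move=> n; exact: measurable_funTS.
    - by move=> n x _; rewrite lee_fin.
  rewrite -(cvg_lim _ h)//; apply: lime_le; first exact: cvgP h.
  by apply: nearW => n; rewrite (rint_fine (measurable_itv _) (ig _ _ (nn n))) lee_fin.
have i : rint setT g.
  apply/integrableP; split=> //; apply: le_lt_trans (ltry M); apply: le_trans hlim.
  rewrite le_eqVlt; apply/orP; left; apply/eqP.
  by apply: eq_integral => x _; rewrite /= ger0_norm.
split=> //; rewrite -lee_fin; apply: le_trans hlim.
by rewrite (rint_fine measurableT i).
Qed.

Lemma rder_expR_lin (a b c : R) : rder (fun x => c * expR (a * x + b)) (fun x => c * (a * expR (a * x + b))).
Proof.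
apply: rderZ => x; have h : is_derive x 1 (fun x => a * x + b) a.
  have := rderD (rderZ a (@rder_id R)) (rder_cst b) x.
  by rewrite mulr1 addr0.
have := @is_derive1_comp _ expR (fun x => a * x + b) x (expR (a * x + b)) a (is_derive_expR _) h.
by rewrite [expR _ * a]mulrC.
Qed.

Lemma continuous_expR_lin (a b c : R) : continuous (fun x => c * expR (a * x + b)).
Proof. exact: rder_continuous (rder_expR_lin a b c). Qed.

Definition edec (b x y : R) : R := expR (- (b * `|x - y|)).

Lemma edecC b x y : edec b x y = edec b y x.
Proof. by rewrite /edec distrC. Qed.

Lemma edec_ge0 b x y : 0 <= edec b x y.
Proof. exact: expR_ge0. Qed.

Lemma edec_le1 b x y : 0 < b -> edec b x y <= 1.
Proof. by move=> b0; rewrite /edec -expR0 ler_expR oppr_le0 mulr_ge0// ltW. Qed.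

Lemma measurable_edec b : measurable_fun setT (fun p : R * R => edec b p.1 p.2).
Proof.
apply: measurableT_comp; first exact: measurable_expR.
apply: measurableT_comp => //; apply: measurable_funM; first exact: measurable_cst.
apply: measurableT_comp; first exact: normr_measurable.
by apply: measurable_funB; [exact: measurable_fst|exact: measurable_snd].
Qed.

(** An explicit primitive takes its values between [0] and [2 / b]; the constant [2 / b] on the
    right piece makes the two pieces match at [y]. *)
Lemma rint_edec b y : 0 < b -> rint setT (fun x => edec b x y) /\ \int[mu]_x edec b x y <= 2 / b.
Proof.
move=> b0; have b1 : b != 0 by rewrite gt_eqF.
have bi : 0 < b^-1 by rewrite invr_gt0.
have p1 := rder_rprim (rder_expR_lin b (- (b * y)) b^-1) _.
have {}p1 : rprim (fun x => b^-1 * expR (b * x - b * y)) (fun x => b^-1 * (b * expR (b * x - b * y))).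
  apply: p1; have hc := @continuous_expR_lin b (- (b * y)) 1.
  by rewrite (_ : (fun x => _) = (fun x => 1 * expR (b * x - b * y)))//; apply/funext => x; rewrite mulrA mulVf.
have p2 := rder_rprim (rder_expR_lin (- b) (b * y) (- b^-1)) _.
have {}p2 : rprim (fun x => - b^-1 * expR (- b * x + b * y)) (fun x => - b^-1 * (- b * expR (- b * x + b * y))).
  apply: p2; have hc := @continuous_expR_lin (- b) (b * y) 1.
  by rewrite (_ : (fun x => _) = (fun x => 1 * expR (- b * x + b * y)))//; apply/funext => x; rewrite mulrA mulrNN mulVf.
have e0 : b^-1 * expR (b * y - b * y) = - b^-1 * expR (- b * y + b * y) + 2 / b.
  by rewrite subrr [- b * y]mulNr addNr expR0; lra.
have [mg ig pg] := rprim_glue p1 (rprim_addc (2 / b) p2) e0.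
have e x : edec b x y = if x <= y then b^-1 * (b * expR (b * x - b * y)) else - b^-1 * (- b * expR (- b * x + b * y)).
  rewrite /edec !mulrA mulrNN mulVf// !mul1r; case: lerP => xy; congr expR; ring.
have ef : (fun x => edec b x y) = fun x => if x <= y then b^-1 * (b * expR (b * x - b * y)) else - b^-1 * (- b * expR (- b * x + b * y)).
  by apply/funext => x; exact: e.
apply: rint_exhaust.
- by rewrite ef.
- by move=> x; exact: edec_ge0.
- by rewrite ef.
move=> n; have nn : - n%:R <= n%:R :> R by rewrite -subr_ge0 opprK addr_ge0.
rewrite ef -pg//.
have bd x : 0 <= (if x <= y then b^-1 * expR (b * x - b * y) else - b^-1 * expR (- b * x + b * y) + 2 / b) <= 2 / b.
  case: (lerP x y) => xy.
    have h1 : expR (b * x - b * y) <= 1 by rewrite -expR0 ler_expR subr_le0 ler_wpM2l// ltW.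
    rewrite mulr_ge0 ?expR_ge0//= ?(ltW bi)//.
    have : b^-1 * expR (b * x - b * y) <= b^-1 * 1 by rewrite ler_wpM2l// ltW.
    by move: bi; set q := b^-1; rlra.
  have h1 : expR (- b * x + b * y) <= 1.
    by rewrite -expR0 ler_expR mulNr addrC subr_le0 ler_wpM2l// ltW.
  have h2 := expR_ge0 (- b * x + b * y).
  have : b^-1 * expR (- b * x + b * y) <= b^-1 * 1 by rewrite ler_wpM2l// ltW.
  have : 0 <= b^-1 * expR (- b * x + b * y) by rewrite mulr_ge0// ltW.
  by move: bi; set q := b^-1 => *; apply/andP; split; rlra.
have /andP[_ h1] := bd n%:R; have /andP[h2 _] := bd (- n%:R).
by have := lerB h1 h2; rewrite subr0.
Qed.

Lemma L2_real_Cint (f : R -> C) : L2 f -> rint setT (fun x => nc (f x) ^+ 2) /\ measurable_fun setT (fun x => nc (f x)).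
Proof. by move=> h; split; [exact: L2_rint|exact: (measurable_nc h.1)]. Qed.

(** The triangle inequality moves the centre of the weight from [x] to [0] at the cost of
    [exp (b r)], and [t <= 1 + t ^ 2] expresses the bound with [|f| ^ 2]. *)
Lemma edec_dom K f (A b : R) : 0 <= A -> 0 < b -> cmeas2 K ->
  (forall x y, nc (K x y) <= A * edec b x y) -> L2 f -> dom K f.
Proof.
move=> A0 b0 mK hK hf r; have [i2 mf] := L2_real_Cint hf; have [i1 _] := rint_edec 0 b0.
exists (fun y => A * expR (b * r) * (edec b y 0 + nc (f y) ^+ 2)).
  by apply: (rintZ _ measurableT); exact: (rintD measurableT i1 i2).
move=> x y hx; rewrite ncM.
have f0 := nc_ge0 (f y); have e0 := edec_ge0 b y 0; have e1 := edec_le1 y 0 b0.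
have h1 : edec b x y <= expR (b * r) * edec b y 0.
  rewrite /edec -expRD ler_expR subr0 -subr_ge0.
  have -> : b * r + - (b * `|y|) - - (b * `|x - y|) = b * (r - `|y| + `|x - y|) by ring.
  rewrite mulr_ge0// ?(ltW b0)//; have := ler_normB x (x - y); rewrite opprB addrC subrK; lra.
apply: (@le_trans _ _ (A * (expR (b * r) * edec b y 0) * nc (f y))).
  by rewrite ler_wpM2r// (le_trans (hK x y))// ler_wpM2l.
rewrite -!mulrA ler_wpM2l// ler_wpM2l ?expR_ge0//.
move: e0 e1 f0; set e := edec b y 0; set t := nc (f y) => e0 e1 t0.
have h : t <= 1 + t ^+ 2 by have := sqr_ge0 (t - 1); rewrite sqrrB1; have := sqr_ge0 t; lra.
apply: (@le_trans _ _ (e * (1 + t ^+ 2))); first by rewrite ler_wpM2l.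
by rewrite mulrDr mulr1 lerD2l ler_piMl// sqr_ge0.
Qed.

(** Cauchy-Schwarz with the weight [edec b x], of mass at most [2 / b], followed by Tonelli and the
    same mass bound in the other variable. *)
Lemma schur_test_L2 K f (A b : R) : 0 <= A -> 0 < b -> cmeas2 K ->
  (forall x y, nc (K x y) <= A * edec b x y) -> L2 f -> L2 (Op K f).
Proof.
move=> A0 b0 mK hK hf; have [i2 mf] := L2_real_Cint hf.
have dK := edec_dom A0 b0 mK hK hf; have cf := hf.1.
have me x : measurable_fun setT (edec b x).
  exact: (meas_sec1 x (measurable_edec b)).
have ie x : rint setT (edec b x).
  by have [h _] := rint_edec x b0; apply: (rint_eq measurableT _ h) => y _; rewrite edecC.
have j2 x : rint setT (fun y => edec b x y * nc (f y) ^+ 2).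
  apply: (integrable_le measurableT _ i2).
    by apply: measurable_funM; [exact: me|exact: measurable_funX].
  move=> y _; rewrite ger0_norm; last by rewrite mulr_ge0 ?edec_ge0 ?sqr_ge0.
  by rewrite ler_piMl ?sqr_ge0// edec_le1.
have j1 x : rint setT (fun y => edec b x y * nc (f y)).
  apply: (integrable_le measurableT _ (rintD measurableT (ie x) (j2 x))).
    by apply: measurable_funM; [exact: me|exact: mf].
  move=> y _; rewrite ger0_norm; last by rewrite mulr_ge0 ?edec_ge0 ?nc_ge0.
  rewrite -[X in _ <= X + _]mulr1 -mulrDr ler_wpM2l ?edec_ge0//.
  set t := nc (f y); have := sqr_ge0 (t - 1); rewrite sqrrB1; have := sqr_ge0 t; lra.
split; first exact: Op_cmeas.
have bp x : nc (Op K f x) ^+ 2 <= A ^+ 2 * (2 / b) * \int[mu]_y (edec b x y * nc (f y) ^+ 2).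
  have h1 : nc (Op K f x) <= A * \int[mu]_y (edec b x y * nc (f y)).
    rewrite -(RintZl _ measurableT (j1 x)).
    apply: (nc_Cintegral_le measurableT (dom_Cint x mK cf dK) (rintZ A measurableT (j1 x))) => y _.
    by rewrite ncM mulrA ler_wpM2r// nc_ge0.
  have hk : \int[mu]_y edec b x y <= 2 / b.
    rewrite (Rint_congr setT (fun y => edecC b x y)); exact: (rint_edec x b0).2.
  have b20 : 0 < 2 / b by rewrite divr_gt0.
  have cs := cauchy_schwarz (ie x) (j1 x) (j2 x) (edec_ge0 b x) hk b20.
  apply: (@le_trans _ _ ((A * \int[mu]_y (edec b x y * nc (f y))) ^+ 2)).
    by rewrite lerXn2r// ?nnegrE ?nc_ge0// (le_trans (nc_ge0 _) h1).
  by rewrite exprMn -mulrA ler_wpM2l ?sqr_ge0.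
pose H (p : R * R) := (edec b p.1 p.2 * nc (f p.2) ^+ 2)%:E.
have mH : measurable_fun setT H.
  apply/measurable_EFinP; apply: measurable_funM; first exact: measurable_edec.
  by apply: measurable_funX; apply: (measurableT_comp mf); exact: measurable_snd.
have H0 p : (0 <= H p)%E by rewrite lee_fin mulr_ge0 ?edec_ge0 ?sqr_ge0.
have c0 : 0 <= A ^+ 2 * (2 / b) by rewrite mulr_ge0 ?sqr_ge0 ?divr_ge0 ?ltW.
have mF : measurable_fun setT (fun x => \int[mu]_y H (x, y))%E by exact: measurable_fun_fubini_tonelli_F.
apply: (@le_lt_trans _ _ (\int[mu]_x ((A ^+ 2 * (2 / b))%:E * \int[mu]_y H (x, y)))%E).
  apply: ge0_le_integral; first exact: measurableT.
  - by move=> x _; rewrite lee_fin sqr_ge0.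
  - by apply/measurable_EFinP; apply: measurable_funX; apply: measurable_nc; exact: Op_cmeas.
  - by apply: emeasurable_funM; [exact: measurable_cst|exact: mF].
  - by move=> x _; rewrite /H /= (rint_fine measurableT (j2 x)) -EFinM lee_fin; exact: bp.
have mG : measurable_fun setT (fun y => \int[mu]_x H (x, y))%E by exact: measurable_fun_fubini_tonelli_G.
rewrite ge0_integralZl//; last by move=> x _; exact: integral_ge0.
rewrite lte_mul_pinfty ?lee_fin//.
have ft : (\int[mu]_x \int[mu]_y H (x, y) = \int[mu]_y \int[mu]_x H (x, y))%E by exact: fubini_tonelli.
apply: (@le_lt_trans _ _ (\int[mu]_y \int[mu]_x H (x, y))%E).
  by rewrite le_eqVlt; apply/orP; left; apply/eqP; exact: ft.
apply: (@le_lt_trans _ _ (\int[mu]_y ((2 / b) * nc (f y) ^+ 2)%:E)%E); last first.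
  by rewrite (rint_fine measurableT (rintZ (2 / b) measurableT i2)) ltry.
apply: ge0_le_integral; first exact: measurableT.
- by move=> y _; exact: integral_ge0.
- exact: mG.
- by apply/measurable_EFinP; apply: measurable_funM; [exact: measurable_cst|exact: measurable_funX].
move=> y _; have [k1 k2] := rint_edec y b0.
rewrite /H /= (_ : \int[mu]_x (edec b x y * nc (f y) ^+ 2)%:E = \int[mu]_x (nc (f y) ^+ 2 * edec b x y)%:E)%E; last first.
  by apply: eq_integral => x _; rewrite mulrC.
rewrite (rint_fine measurableT (rintZ _ measurableT k1)) lee_fin (RintZl _ measurableT k1).
by rewrite mulrC; apply: ler_wpM2r; [exact: sqr_ge0|exact: k2].
Qed.

Lemma L2D (f g : R -> C) : L2 f -> L2 g -> L2 (fun x => f x + g x).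
Proof.
move=> hf hg; have m := cmeasD hf.1 hg.1; apply: rint_L2 => //.
have i := rintD measurableT (rintZ 2 measurableT (L2_rint hf)) (rintZ 2 measurableT (L2_rint hg)).
apply: (integrable_le measurableT _ i); first by apply: measurable_funX; exact: measurable_nc.
by move=> x _; rewrite ger0_norm ?sqr_ge0//; exact: nc_add_sqr.
Qed.

Lemma L2Z (c : C) (f : R -> C) : L2 f -> L2 (fun x => c * f x).
Proof.
move=> hf; apply: rint_L2; first exact: cmeasZ hf.1.
apply: (rint_eq measurableT _ (rintZ (nc c ^+ 2) measurableT (L2_rint hf))) => x _.
by rewrite ncM exprMn.
Qed.

Lemma L2_ae (f g : R -> C) : L2 f -> cmeas g -> aeq f g -> L2 g.
Proof.
move=> hf mg e; apply: rint_L2 => //.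
apply: (rint_ae measurableT _ (L2_rint hf)); first by apply: measurable_funX; exact: measurable_nc.
by apply: (ae_imp e) => x ->.
Qed.

Lemma H2norm2_lt (A : set R) u : (H2norm2 A u < +oo)%E ->
  cmeas u /\ (L2norm2 A u < +oo)%E.
Proof.
move=> /ereal_inf_lt [_ [u1 [u2 [[[[a _ _] [b _ _]] _ _] _ ->]]] h]; split=> //.
apply: le_lt_trans h; rewrite -addeA leeDl// adde_ge0// /L2norm2.
all: by apply: integral_ge0 => x _; rewrite lee_fin sqr_ge0.
Qed.

End ExponentialKernels.

(** * The resolvent built from decaying solutions *)

Section Resolvent.
Variable R : realType.
Local Notation mu := (@lebesgue_measure R).
Local Notation C := R[i].
Implicit Types (V : R -> R) (l : C) (Y Z : R -> C * C).

Lemma odesol_lin V l Y Z (a b : C) : odesol V l Y -> odesol V l Z ->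
  odesol V l (fun x => (a * (Y x).1 + b * (Z x).1, a * (Y x).2 + b * (Z x).2)).
Proof.
move=> [h1 h2] [k1 k2]; split; first exact: cprimD (cprimZ a h1) (cprimZ b k1).
have := cprimD (cprimZ a h2) (cprimZ b k2); congr cprim; apply/funext => x /=; ring.
Qed.

Lemma cprim_bounded (u g : R -> C) a b : cprim u g -> exists M : R, forall x, a <= x <= b -> nc (u x) <= M.
Proof.
move=> [h1 h2]; have [M hM] := continuous_bounded_itv a b (rprim_continuous h1).
have [N hN] := continuous_bounded_itv a b (rprim_continuous h2); exists (M + N) => x hx.
by rewrite (le_trans (nc_ReIm _))// lerD ?hM ?hN.
Qed.

Lemma ler_pow_half (t K : R) : (forall n, t <= K / 2 ^+ n) -> t <= 0.
Proof.
move=> h; rewrite leNgt; apply/negP => t0.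
have K0 : 0 <= K by have := h 0%N; rewrite expr0 divr1; lra.
pose n := (Num.truncn (K / t)).+1.
have hn : K / t < n%:R by exact: truncnS_gt.
have h2 : (n%:R : R) <= 2 ^+ n by rewrite -natrX ler_nat ltnW// ltn_expl.
have := h n; rewrite ler_pdivlMr ?exprn_gt0//; apply/negP; rewrite -ltNge.
rewrite ltr_pdivrMr// in hn; apply: (lt_le_trans hn).
by rewrite mulrC ler_wpM2l// ltW.
Qed.

(** Uniqueness for the Cauchy problem. Let [N] bound the coefficients of the system; relative to the
    weight [exp (L (x - a))] with [L = 2 N], each use of the integral equations halves the bound on
    both components. *)
Lemma odesol_zero V l Y a : (forall x, `|V x| <= 1) -> odesol V l Y -> Y a = (0, 0) ->
  forall x, a <= x -> Y x = (0, 0).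
Proof.
move=> V1 [h1 h2] Ya b ab.
have [M1 hM1] := cprim_bounded a b h1; have [M2 hM2] := cprim_bounded a b h2.
pose M := Num.max M1 M2; pose N := 1 + nc l ^+ 2; pose L := 2 * N.
have N1 : 1 <= N by rewrite lerDl sqr_ge0.
have N0 : 0 < N by exact: lt_le_trans N1.
have M0 : 0 <= M.
  rewrite le_max; apply/orP; left; apply: le_trans (nc_ge0 _) (hM1 a _); by rewrite lexx.
have claim n x : a <= x <= b -> nc (Y x).1 <= M / 2 ^+ n * expR (L * x - L * a) /\
    nc (Y x).2 <= M / 2 ^+ n * expR (L * x - L * a).
  elim: n x => [|n IH] x /andP[ax xb].
    have e1 : 1 <= expR (L * x - L * a).
      by rewrite -expR0 ler_expR -mulrBr mulr_ge0 ?subr_ge0// /L mulr_ge0// ltW.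
    rewrite expr0 divr1; split; (apply: (@le_trans _ _ M); last by rewrite ler_peMr).
      by rewrite le_max hM1 ?ax.
    by rewrite le_max hM2 ?ax ?orbT.
  pose c := N * (M / 2 ^+ n).
  have c0 : 0 <= c by rewrite mulr_ge0 ?(ltW N0)// divr_ge0// exprn_ge0.
  have hp := rder_rprim (rder_expR_lin L (- (L * a)) (c / L)) _.
  have {hp} [mg ig pg] : rprim (fun x => c / L * expR (L * x - L * a)) (fun x => c / L * (L * expR (L * x - L * a))).
    apply: hp; have hc := @continuous_expR_lin R L (- (L * a)) (c / L * L).
    by rewrite (_ : (fun x => _) = (fun x => c / L * L * expR (L * x - L * a)))//; apply/funext => y; rewrite mulrA.
  have Lc : c / L * L = c by rewrite divfK// mulf_neq0 ?gt_eqF.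
  have gE y : c / L * (L * expR (L * y - L * a)) = c * expR (L * y - L * a) by rewrite mulrA Lc.
  have hI : \int[mu]_(y in `[a, x]) (c / L * (L * expR (L * y - L * a))) <= M / 2 ^+ n.+1 * expR (L * x - L * a).
    rewrite -pg// subrr expR0 mulr1.
    have -> : M / 2 ^+ n.+1 = c / L.
      have p2 : (2 ^+ n : R) != 0 by rewrite expf_neq0.
      rewrite exprS /c /L; move: (2 ^+ n) p2 (gt_eqF N0) => q q0 N'0; field.
      by rewrite q0 N'0.
    by rewrite gerBl divr_ge0// mulr_ge0// ltW.
  have aux (u g : R -> C) : cprim u g -> u a = 0 ->
     (forall y, a <= y <= b -> nc (g y) <= c * expR (L * y - L * a)) ->
     nc (u x) <= M / 2 ^+ n.+1 * expR (L * x - L * a).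
    move=> hu ua hg; apply: le_trans hI; rewrite -[u x]subr0 -ua (cprimE hu ax).
    apply: (nc_Cintegral_le (measurable_itv _) (cprim_Cint hu ax) (ig _ _ ax)) => y /=.
    by rewrite in_itv /= => /andP[ay yx]; rewrite gE hg// ay (le_trans yx).
  split.
    apply: (aux _ _ h1); first by rewrite Ya.
    move=> y hy; have [_ k] := IH y hy; rewrite (le_trans k)// ler_wpM2r ?expR_ge0//.
    by rewrite /c ler_peMl// divr_ge0// exprn_ge0.
  apply: (aux _ _ h2); first by rewrite Ya.
  move=> y hy; have [k _] := IH y hy; rewrite ncM /c -[N * _ * _]mulrA ler_pM ?nc_ge0//.
  rewrite (le_trans (ncB _ _))// nc_real ncX /N lerD2r//.
have fin (w : C) : (forall n, nc w <= M / 2 ^+ n * expR (L * b - L * a)) -> w = 0.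
  move=> h; apply/eqP; rewrite -nc_eq0 eq_le nc_ge0 andbT.
  by apply: (@ler_pow_half _ (M * expR (L * b - L * a))) => n; rewrite mulrAC.
have bb : a <= b <= b by rewrite ab lexx.
have e1 := fin (Y b).1 (fun n => (claim n b bb).1).
have e2 := fin (Y b).2 (fun n => (claim n b bb).2).
by rewrite (surjective_pairing (Y b)) e1 e2.
Qed.

Lemma stepsol_at l a0 (s : seq (R * R)) (Y : C * C) : (forall av, av \in s -> a0 <= av.1) -> stepsol l a0 Y s a0 = Y.
Proof. by move=> h; rewrite stepsol_left// subrr estep0. Qed.

(** At [a = min x a0] the coefficients of [Y] on two fundamental solutions are Wronskians;
    uniqueness to the right of [a] reaches both [a0], where the coefficients are identified, and
    [x]. *)
Lemma odesol_stepsol l a0 (s : seq (R * R)) Y : (forall av, av \in s -> a0 <= av.1) ->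
  (forall x, `|steppot s x| <= 1) -> odesol (steppot s) l Y ->
  forall x, Y x = stepsol l a0 (Y a0) s x.
Proof.
move=> hs V1 hY x; pose a := Num.min x a0.
pose c := stepsol l a0 (1, 0) s; pose d := stepsol l a0 (0, 1) s.
have w1 : wron (c a) (d a) = 1 by rewrite stepsol_wron /wron /= mulr1 mul0r subr0.
pose al := wron (Y a) (d a); pose be := wron (c a) (Y a).
have hZ := odesol_lin 1 (-1) hY (odesol_lin al be (stepsol_ode l a0 (1, 0) s) (stepsol_ode l a0 (0, 1) s)).
have Z0 y : a <= y -> Y y = (al * (c y).1 + be * (d y).1, al * (c y).2 + be * (d y).2).
  move=> ay; have := odesol_zero V1 hZ _ ay; rewrite -/c -/d /=.
  have -> : (1 * (Y a).1 + -1 * (al * (c a).1 + be * (d a).1), 1 * (Y a).2 + -1 * (al * (c a).2 + be * (d a).2)) = (0, 0).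
    move: w1; rewrite /al /be /wron; case: (Y a) (c a) (d a) => y1 y2 [c1 c2] [d1 d2] /= w1.
    congr pair.
      have -> : 1 * y1 + -1 * ((y1 * d2 - y2 * d1) * c1 + (c1 * y2 - c2 * y1) * d1) = y1 * (1 - (c1 * d2 - c2 * d1)) by ring.
      by rewrite w1 subrr mulr0.
    have -> : 1 * y2 + -1 * ((y1 * d2 - y2 * d1) * c2 + (c1 * y2 - c2 * y1) * d2) = y2 * (1 - (c1 * d2 - c2 * d1)) by ring.
    by rewrite w1 subrr mulr0.
  move=> /(_ erefl) [e1 e2]; rewrite (surjective_pairing (Y y)); congr pair.
    by apply/eqP; rewrite -subr_eq0 -e1; apply/eqP; ring.
  by apply/eqP; rewrite -subr_eq0 -e2; apply/eqP; ring.
have ea := Z0 a0; rewrite /a ge_min lexx orbT in ea; have {}ea := ea isT.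
rewrite /c /d !stepsol_at//= !mulr1 !mulr0 addr0 add0r in ea.
have ex := Z0 x; rewrite {1}/a ge_min lexx in ex; have {}ex := ex isT.
rewrite ex ea /c /d -stepsol_lin /=; congr stepsol; congr pair; ring.
Qed.

(** The squared norm is at least [c ^ 2 * n] for every [n]. *)
Lemma L2_lower (f : R -> C) (c : R) : L2 f -> 0 <= c ->
  (forall n : nat, exists X : R, forall x, X <= x <= X + n%:R -> c <= nc (f x)) -> c = 0.
Proof.
move=> hf c0 h; apply/eqP; rewrite -sqrf_eq0 eq_le sqr_ge0 andbT.
have i2 := L2_rint hf.
have hn (n : nat) : c ^+ 2 * n%:R <= N2 f.
  have [X hX] := h n; have XX : X <= X + n%:R by rewrite lerDl.
  have mI := measurable_itv `[X, X + n%:R].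
  have i3 := rintS measurableT mI (@subsetT _ _) i2.
  have : \int[mu]_(x in `[X, X + n%:R]) c ^+ 2 <= \int[mu]_(x in `[X, X + n%:R]) nc (f x) ^+ 2.
    apply: le_Rintegral; [exact: mI|exact: rint_cst|exact: i3|].
    by move=> x /=; rewrite in_itv /= => /hX hx; rewrite lerXn2r// nnegrE nc_ge0.
  rewrite Rint_cst// addrC addKr => /le_trans; apply.
  rewrite -lee_fin /N2 -(rint_fine mI i3) -(rint_fine measurableT i2).
  apply: ge0_subset_integral => //.
  - apply/measurable_EFinP; apply: measurable_funX; exact: measurable_nc hf.1.
  - by move=> x _; rewrite lee_fin sqr_ge0.
rewrite leNgt; apply/negP => c2.
pose n := (Num.truncn (N2 f / c ^+ 2)).+1.
have : N2 f / c ^+ 2 < n%:R by exact: truncnS_gt.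
by rewrite ltr_pdivrMr// mulrC ltNge hn.
Qed.

(** With [b = - Re A], the modulus is at least [nc q * exp (b t) - nc p] for [t >= 0]; the threshold
    makes [nc q * b * t >= nc p], and [exp (b t) >= 1 + b t]. *)
Lemma expsum_growth (A p q : C) : complex.Re A < 0 -> exists T : R, forall t, T <= t ->
  nc q <= nc (p * cexp (A * t%:C) + q * cexp (- (A * t%:C))).
Proof.
move=> A0; set b := - complex.Re A; have b0 : 0 < b by rewrite oppr_gt0.
have [->|q0] := eqVneq q 0; first by exists 0 => t _; rewrite nc0 nc_ge0.
have qq : 0 < nc q by rewrite nc_gt0.
exists (nc p / nc q / b) => t; rewrite ler_pdivrMr// ler_pdivrMr// => ht.
have t0 : 0 <= t by have := le_trans (nc_ge0 p) ht; rewrite !pmulr_lge0.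
have ReA : complex.Re (A * t%:C) = - (b * t) by rewrite mulrC ReZ /b mulNr opprK mulrC.
rewrite addrC; apply: le_trans (ncD_ge _ _); rewrite (ncM q) (ncM p) !nc_cexp ReN ReA opprK.
have e1 : 1 + b * t <= expR (b * t) by rewrite expR_ge1Dx.
have e2 : expR (- (b * t)) <= 1 by rewrite -expR0 ler_expR oppr_le0 mulr_ge0// ltW.
have k1 : nc q * (1 + b * t) <= nc q * expR (b * t) by rewrite ler_wpM2l// ltW.
have k2 : nc p * expR (- (b * t)) <= nc p * 1 by rewrite ler_wpM2l// nc_ge0.
move: k1 k2 ht; lra.
Qed.

Lemma expsum_L2_right (f : R -> C) (A p q : C) (b0 : R) : complex.Re A < 0 -> L2 f ->
  (forall x, b0 <= x -> f x = p * cexp (A * (x - b0)%:C) + q * cexp (- (A * (x - b0)%:C))) -> q = 0.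
Proof.
move=> A0 hf h; have [T hT] := expsum_growth p q A0.
apply/eqP; rewrite -nc_eq0; apply/eqP; apply: (L2_lower hf (nc_ge0 _)) => n.
exists (Num.max T 0 + b0) => x /andP[hx _].
have m1 : T <= Num.max T 0 by rewrite le_max lexx.
have m2 : 0 <= Num.max T 0 by rewrite le_max lexx orbT.
move: hx m1 m2; set m := Num.max _ _ => hx m1 m2.
rewrite h; last by lra.
by apply: hT; lra.
Qed.

Lemma expsum_L2_left (f : R -> C) (A p q : C) (a0 : R) : complex.Re A < 0 -> L2 f ->
  (forall x, x <= a0 -> f x = p * cexp (A * (x - a0)%:C) + q * cexp (- (A * (x - a0)%:C))) -> p = 0.
Proof.
move=> A0 hf h; have [T hT] := expsum_growth q p A0.
apply/eqP; rewrite -nc_eq0; apply/eqP; apply: (L2_lower hf (nc_ge0 _)) => n.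
exists (a0 - Num.max T 0 - n%:R) => x /andP[_ hx].
have m1 : T <= Num.max T 0 by rewrite le_max lexx.
have m2 : 0 <= Num.max T 0 by rewrite le_max lexx orbT.
move: hx m1 m2; set m := Num.max _ _ => hx m1 m2.
rewrite h; last by lra.
have -> : (x - a0)%:C = - (a0 - x)%:C :> C by rewrite -rmorphN opprB.
by rewrite mulrN opprK addrC; apply: hT; lra.
Qed.

Lemma estep_decomp (A z : C) (t : R) (Y : C * C) : A ^+ 2 = z -> A != 0 ->
  (estep z t Y).1 = (Y.1 + Y.2 / A) / 2 * cexp (A * t%:C) + (Y.1 - Y.2 / A) / 2 * cexp (- (A * t%:C)).
Proof.
move=> h A0; rewrite /estep /= (coshsE t h) (sinhsE t h A0).
have := @two_neq0 R; move: (cexp _) (cexp _) (2 : C) Y.1 Y.2 => E E' w y1 y2 w0; field.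
by rewrite w0 A0.
Qed.

(** Decay of [f] to the left and of [g] to the right bounds the kernels of [u], [u'] and of the
    regular part of [u''] by multiples of [edec b], so Schur's test applies. For uniqueness, weak
    solutions are replaced by primitives, and two of them differ by a square-integrable solution of
    the homogeneous equation. *)
Lemma green_resolvent V f f1 g g1 W l (A b : R) : green V f f1 g g1 W -> W l != 0 -> 0 < b ->
  (forall x, [/\ nc (f x l) <= A * expR (b * x), nc (f1 x l) <= A * expR (b * x),
     nc (g x l) <= A * expR (- (b * x)) & nc (g1 x l) <= A * expR (- (b * x))]) ->
  (forall Y, odesol V l Y -> L2 (fun x => (Y x).1) -> forall x, (Y x).1 = 0) ->
  is_resolvent (fun x => (V x)%:C) l (gres f g W l).
Proof.
move=> G W0 b0 dec uniq.
have A0 : 0 <= A.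
  have [h _ _ _] := dec 0; have := le_trans (nc_ge0 _) h.
  by rewrite mulr0 expR0 mulr1.
pose a := - (W l)^-1; have gK := goodK_scale a (goodK_green l G).
have [[m0 m1 m2] _ _ _] := gK.
have prod (u v : C) x y : (y < x)%R -> nc u <= A * expR (- (b * x)) -> nc v <= A * expR (b * y) ->
    nc (u * v) <= A ^+ 2 * edec b x y.
  move=> xy hu hv; rewrite ncM (le_trans (ler_pM (nc_ge0 _) (nc_ge0 _) hu hv))//.
  rewrite mulrACA -expRD -expr2 ler_wpM2l ?sqr_ge0// /edec ler_expR gtr0_norm ?subr_gt0//; lra.
have prod' (u v : C) x y : x <= y -> nc u <= A * expR (b * x) -> nc v <= A * expR (- (b * y)) ->
    nc (u * v) <= A ^+ 2 * edec b x y.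
  move=> xy hu hv; rewrite ncM (le_trans (ler_pM (nc_ge0 _) (nc_ge0 _) hu hv))//.
  rewrite mulrACA -expRD -expr2 ler_wpM2l ?sqr_ge0// /edec ler_expR ler0_norm ?subr_le0//; lra.
have b1 x y : nc (gker f g l x y) <= A ^+ 2 * edec b x y.
  rewrite /gker; have [h1 h2 h3 h4] := dec x; have [k1 k2 k3 k4] := dec y.
  by case: ltrP => xy; [exact: prod|exact: prod'].
have b2 x y : nc (if (y < x)%R then g1 x l * f y l else f1 x l * g y l) <= A ^+ 2 * edec b x y.
  have [h1 h2 h3 h4] := dec x; have [k1 k2 k3 k4] := dec y.
  by case: ltrP => xy; [exact: prod|exact: prod'].
pose B := nc a * A ^+ 2; pose B' := (1 + nc l ^+ 2) * B.
have B0 : 0 <= B by rewrite mulr_ge0 ?nc_ge0 ?sqr_ge0.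
have B'0 : 0 <= B' by rewrite mulr_ge0// addr_ge0 ?sqr_ge0.
have c1 x y : nc (a * gker f g l x y) <= B * edec b x y.
  by rewrite ncM /B -mulrA ler_wpM2l ?nc_ge0.
have c2 x y : nc (a * (if (y < x)%R then g1 x l * f y l else f1 x l * g y l)) <= B * edec b x y.
  by rewrite ncM /B -mulrA ler_wpM2l ?nc_ge0.
have c3 x y : nc (a * gker2 V f g l x y) <= B' * edec b x y.
  rewrite /gker2 mulrCA ncM /B' -mulrA ler_pM ?nc_ge0 ?c1//.
  by rewrite (le_trans (ncB _ _))// nc_real ncX lerD2r; exact: gr_b G _.
have aW : a * W l = -1 by rewrite /a mulNr mulVf.
move=> h hh; have mh := hh.1.
have d0 := edec_dom B0 b0 m0 c1 hh; have d1 := edec_dom B0 b0 m1 c2 hh.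
have d2 := edec_dom B'0 b0 m2 c3 hh.
have [p1 p2] := Op_cprim gK mh (fun x y => L2_Cint x y hh) d0 d1 d2.
have l0 := schur_test_L2 B0 b0 m0 c1 hh; have l1 := schur_test_L2 B0 b0 m1 c2 hh.
have l2 := schur_test_L2 B'0 b0 m2 c3 hh.
set T := gres f g W l h; have TE : T = Op (fun x y => a * gker f g l x y) h by [].
rewrite -TE in p1 l0.
have e2 x : Op (fun x y => a * gker2 V f g l x y) h x = ((V x)%:C - l ^+ 2) * T x.
  rewrite TE /Op -(CintegralZ _ measurableT (dom_Cint x m0 mh d0)).
  by apply: eq_Cintegral => y _; rewrite /gker2; ring.
have p2' : cprim (Op (fun x y => a * (if (y < x)%R then g1 x l * f y l else f1 x l * g y l)) h)
   (fun x => ((V x)%:C - l ^+ 2) * T x + - h x).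
  by move: p2; congr cprim; apply/funext => x; rewrite e2 aW mulN1r.
have l2' : L2 (fun x => ((V x)%:C - l ^+ 2) * T x + - h x).
  have := L2D l2 (L2Z (-1) hh); congr L2; apply/funext => x; by rewrite e2 mulN1r.
split.
  split.
    apply: (le_lt_trans (H2norm2_le setT (cprim_weak p1) (cprim_weak p2'))).
    by rewrite !L2norm2E// -!EFinD ltry.
  do 2 eexists; split; [exact: cprim_weak p1|exact: cprim_weak p2'|].
  by apply: aeW => x /=; ring.
move=> u [hu [u1 [u2 [w1 w2 eu]]]].
have [w wu uw] := weak_cprim w1; have [w' wu1 uw1] := weak_cprim w2.
have [mu1 hu2] := H2norm2_lt hu.
have Lu : L2 u by [].
have pw := cprim_ae wu (cprim_cmeas wu1) uw1.
have Lw := L2_ae Lu (cprim_cmeas wu) uw.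
have mV : cmeas (fun x => (V x)%:C - l ^+ 2).
  by apply: cmeasB; [apply: cmeas_real; exact: gr_m G|exact: cmeas_cst].
have pw1 : cprim w' (fun x => ((V x)%:C - l ^+ 2) * w x + - h x).
  apply: (cprim_ae wu1).
    by apply: cmeasD; [apply: cmeasM; [exact: mV|exact: cprim_cmeas wu]|exact: cmeasN].
  apply: (ae_imp (ae_and eu uw)) => x [e <-]; rewrite -e; ring.
have oD : odesol V l (fun x => (w x + -1 * T x, w' x + -1 * Op (fun x y => a * (if (y < x)%R then g1 x l * f y l else f1 x l * g y l)) h x)).
  split => /=.
    exact: cprimD pw (cprimZ (-1) p1).
  have := cprimD pw1 (cprimZ (-1) p2'); congr cprim; apply/funext => x; ring.
have D0 := uniq _ oD (L2D Lw (L2Z (-1) l0)).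
apply: (ae_imp uw) => x ->; have /= := D0 x; rewrite mulN1r => /eqP.
by rewrite subr_eq0 => /eqP.
Qed.

End Resolvent.

(** * The resolvent of a step potential *)

Section StepResolvent.
Variable R : realType.
Local Notation C := R[i].
Implicit Types (s : seq (R * R)) (l : C).

Record stepdata (a0 b0 : R) s : Prop := StepData {
  sd_path : path (fun a b => a <= b) a0 [seq av.1 | av <- s];
  sd_last : last a0 [seq av.1 | av <- s] <= b0;
  sd_b : forall av, av \in s -> `|av.2| <= 1
}.

Definition closestep (b0 : R) s := rcons s (b0, 0).

Lemma sd_ge (a0 b0 : R) s : stepdata a0 b0 s -> forall av, av \in s -> a0 <= av.1.
Proof.
move=> [hp _ _] av hav; have tr : transitive (fun a b : R => a <= b) by move=> y x z; exact: le_trans.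
have /allP := order_path_min tr hp; apply; exact: map_f.
Qed.

Lemma sd_ab (a0 b0 : R) s : stepdata a0 b0 s -> a0 <= b0.
Proof.
move=> h; apply: le_trans (sd_last h); have /= := mem_last a0 [seq av.1 | av <- s].
by rewrite inE => /orP[/eqP ->//|/mapP[av hav ->]]; exact: sd_ge h _ hav.
Qed.

Lemma sd_geS (a0 b0 : R) s : stepdata a0 b0 s -> forall av, av \in closestep b0 s -> a0 <= av.1.
Proof.
move=> h av; rewrite mem_rcons inE => /orP[/eqP ->/=|]; [exact: sd_ab h|exact: sd_ge h _].
Qed.

Lemma sd_bS (a0 b0 : R) s : stepdata a0 b0 s -> forall x, `|steppot (closestep b0 s) x| <= 1.
Proof.
move=> h; apply: steppot_bounded => // av; rewrite mem_rcons inE => /orP[/eqP ->/=|]; last exact: sd_b h _.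
by rewrite normr0.
Qed.

Definition psiM (a0 b0 : R) s l : R -> C * C := stepsol l a0 (1, - ('i%C * l)) (closestep b0 s).

(** [al] and [be] are the data at [a0] of the solution with data [(1, i l)] at [b0]: the transfer
    matrix has determinant one, so its inverse is polynomial in its entries. *)
Definition al (a0 b0 : R) s l : C := (stepsol l a0 (0, 1) s b0).2 - 'i%C * l * (stepsol l a0 (0, 1) s b0).1.

Definition be (a0 b0 : R) s l : C := 'i%C * l * (stepsol l a0 (1, 0) s b0).1 - (stepsol l a0 (1, 0) s b0).2.

Definition psiP (a0 b0 : R) s l : R -> C * C := stepsol l a0 (al a0 b0 s l, be a0 b0 s l) (closestep b0 s).

(** The Wronskian of [psiM] and [psiP], evaluated at [a0]. *)
Definition Om (a0 b0 : R) s l : C := be a0 b0 s l + 'i%C * l * al a0 b0 s l.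

Lemma entfam_il : entfam (fun (_ : R) l => 'i%C * l).
Proof. exact: (entfamZ 'i%C (@entfam_id R)). Qed.

Lemma green_step (a0 b0 : R) s : stepdata a0 b0 s -> green (steppot (closestep b0 s))
  (fun x l => (psiM a0 b0 s l x).1) (fun x l => (psiM a0 b0 s l x).2)
  (fun x l => (psiP a0 b0 s l x).1) (fun x l => (psiP a0 b0 s l x).2) (Om a0 b0 s).
Proof.
move=> h.
have e0 := entfam_cst (0 : C); have e1 := entfam_cst (1 : C).
have [c1 c2] := entfam_stepsol a0 s e1 e0; have [d1 d2] := entfam_stepsol a0 s e0 e1.
have ea : entfam (fun _ : R => al a0 b0 s).
  exact: entfamB (entfam_at b0 d2) (entfamM entfam_il (entfam_at b0 d1)).
have eb : entfam (fun _ : R => be a0 b0 s).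
  exact: entfamB (entfamM entfam_il (entfam_at b0 c1)) (entfam_at b0 c2).
have [m1 m2] := entfam_stepsol a0 (closestep b0 s) e1 (entfamN entfam_il).
have [p1 p2] := entfam_stepsol a0 (closestep b0 s) ea eb.
split; [exact: measurable_steppot|exact: sd_bS h|exact: m1|exact: m2|exact: p1|exact: p2| | |].
- by move=> l; exact: stepsol_ode.
- by move=> l; exact: stepsol_ode.
move=> l x; have := stepsol_wron l a0 (closestep b0 s) (1, - ('i%C * l)) (al a0 b0 s l, be a0 b0 s l) x.
by rewrite /wron /psiM /psiP /Om /= => ->; ring.
Qed.

Lemma sqr_il l : ('i%C * l) ^+ 2 = 0%:C - l ^+ 2 :> C.
Proof. by rewrite exprMn expr2 sqri mulN1r sub0r. Qed.

Lemma psiM_left (a0 b0 : R) s l x : stepdata a0 b0 s -> x <= a0 ->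
  psiM a0 b0 s l x = (cexp (- ('i%C * l * (x - a0)%:C)), - ('i%C * l) * cexp (- ('i%C * l * (x - a0)%:C))).
Proof.
move=> h xa; rewrite /psiM stepsol_left//; last exact: sd_geS h.
rewrite (cexp_csB (x - a0) (sqr_il l)) /estep /= -(sqr_il l); congr pair; ring.
Qed.

Lemma closestep_at (a0 b0 : R) s l (Y : C * C) : stepsol l a0 Y (closestep b0 s) b0 = stepsol l a0 Y s b0.
Proof. by rewrite stepsol_right// subrr estep0. Qed.

Lemma psiP_at (a0 b0 : R) s l : stepsol l a0 (al a0 b0 s l, be a0 b0 s l) s b0 = (1, 'i%C * l).
Proof.
have w := stepsol_wron l a0 s (1, 0) (0, 1) b0; rewrite /wron /= mulr1 mul0r subr0 in w.
have e := stepsol_lin l a0 s (al a0 b0 s l) (be a0 b0 s l) (1, 0) (0, 1) b0.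
rewrite /= !mulr1 !mulr0 addr0 add0r in e; rewrite e; move: w.
rewrite /al /be.
case: (stepsol _ _ (1, 0) _ _) (stepsol _ _ (0, 1) _ _) => c c' [d d'] /= w; congr pair.
  by rewrite -w; ring.
by rewrite -[RHS]mulr1 -w; ring.
Qed.

Lemma psiP_right (a0 b0 : R) s l x : b0 <= x ->
  psiP a0 b0 s l x = (cexp ('i%C * l * (x - b0)%:C), 'i%C * l * cexp ('i%C * l * (x - b0)%:C)).
Proof.
move=> bx; rewrite /psiP stepsol_right// psiP_at.
rewrite (cexp_csD (x - b0) (sqr_il l)) /estep /= -(sqr_il l); congr pair; ring.
Qed.

Lemma Re_il l : complex.Re ('i%C * l) = - complex.Im l.
Proof. by rewrite ReM /= mul0r mul1r add0r. Qed.

Lemma Re_ilt l (t : R) : complex.Re ('i%C * l * t%:C) = - (complex.Im l * t).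
Proof. by rewrite mulrC ReZ Re_il mulrN mulrC. Qed.

Lemma estep_bound l (Y : C * C) : 0 < complex.Im l -> exists2 A : R, 0 <= A & forall t,
  nc (estep (0%:C - l ^+ 2) t Y).1 <= A * expR (complex.Im l * `|t|) /\
  nc (estep (0%:C - l ^+ 2) t Y).2 <= A * expR (complex.Im l * `|t|).
Proof.
move=> l0; set b := complex.Im l.
have ln : 'i%C * l != 0 :> C.
  by apply/eqP => /(f_equal (@complex.Re R)); rewrite Re_il /= => /eqP; rewrite oppr_eq0 gt_eqF.
have e1 u : nc (cexp ('i%C * l * u%:C)) <= expR (b * `|u|).
  by rewrite nc_cexp Re_ilt ler_expR -mulrN ler_wpM2l ?(ltW l0)// -normrN ler_norm.
have e2 u : nc (cexp (- ('i%C * l * u%:C))) <= expR (b * `|u|).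
  by rewrite nc_cexp ReN Re_ilt opprK ler_expR ler_wpM2l ?(ltW l0)// ler_norm.
set A := 'i%C * l in ln e1 e2.
have hA := sqr_il l; rewrite -/A in hA.
have comb (p q : C) u : nc (p * cexp (A * u%:C) + q * cexp (- (A * u%:C))) <= (nc p + nc q) * expR (b * `|u|).
  by rewrite (le_trans (ncD _ _))// (ncM p) (ncM q) mulrDl lerD// ler_wpM2l ?nc_ge0.
pose p := (Y.1 + Y.2 / A) / 2; pose q := (Y.1 - Y.2 / A) / 2.
pose p' := (A * Y.1 + Y.2) / 2; pose q' := (Y.2 - A * Y.1) / 2.
exists (nc p + nc q + (nc p' + nc q')); first by rewrite !addr_ge0 ?nc_ge0.
move=> u; have E := expR_ge0 (b * `|u|); split.
  rewrite (estep_decomp u Y hA ln) -/p -/q (le_trans (comb _ _ _))// ler_wpM2r// lerDl.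
  by rewrite addr_ge0 ?nc_ge0.
have -> : (estep (0%:C - l ^+ 2) u Y).2 = p' * cexp (A * u%:C) + q' * cexp (- (A * u%:C)).
  rewrite /estep /= -hA expr2 -(mulrA A) (sinhs_mul u (erefl (A * A))) (coshsE u (erefl (A ^+ 2))) /p' /q'.
  ring.
rewrite (le_trans (comb _ _ _))// ler_wpM2r// lerDr.
by rewrite addr_ge0 ?nc_ge0.
Qed.

Lemma stepsol_bounded (a0 : R) s l (Y : C * C) (r : R) : exists2 M : R, 0 <= M & forall x, `|x| <= r ->
  nc (stepsol l a0 Y s x).1 <= M /\ nc (stepsol l a0 Y s x).2 <= M.
Proof.
have [h1 h2] := entfam_stepsol a0 s (entfam_cst Y.1) (entfam_cst Y.2).
have [A hA] := entfam_bounded h1 (`|r| + nc l); have [B hB] := entfam_bounded h2 (`|r| + nc l).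
exists (`|A| + `|B|); first by rewrite addr_ge0.
have ll : nc l <= `|r| + nc l by rewrite lerDr.
move=> x hx; have hx' : `|x| <= `|r| + nc l.
  by rewrite (le_trans hx)// (le_trans (ler_norm _))// lerDl nc_ge0.
have := hA x l hx' ll; have := hB x l hx' ll; rewrite -surjective_pairing => k1 k2; split.
  by rewrite (le_trans k2)// (le_trans (ler_norm _))// lerDl.
by rewrite (le_trans k1)// (le_trans (ler_norm _))// lerDr.
Qed.

Lemma stepsol_growth_right (a0 b0 : R) s l (Y : C * C) : 0 < complex.Im l ->
  exists2 A : R, 0 <= A & forall x, a0 <= x ->
  nc (stepsol l a0 Y (closestep b0 s) x).1 <= A * expR (complex.Im l * x) /\
  nc (stepsol l a0 Y (closestep b0 s) x).2 <= A * expR (complex.Im l * x).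
Proof.
move=> l0; set b := complex.Im l.
have [M M0 hM] := stepsol_bounded a0 (closestep b0 s) l Y (`|a0| + `|b0|).
have [A A0 hA] := estep_bound (stepsol l a0 Y s b0) l0.
exists (M * expR (- (b * a0)) + A * expR (- (b * b0))).
  by rewrite addr_ge0// mulr_ge0// expR_ge0.
move=> x ax; have [xb|/ltW bx] := lerP x b0.
  have hx : `|x| <= `|a0| + `|b0|.
    rewrite ler_norml; have := ler_norm (- a0); have := ler_norm b0; rewrite normrN.
    have := normr_ge0 a0; have := normr_ge0 b0; lra.
  have e : M <= (M * expR (- (b * a0)) + A * expR (- (b * b0))) * expR (b * x).
    rewrite mulrDl -!mulrA -!expRD -[X in X <= _]addr0 lerD ?mulr_ge0 ?expR_ge0//.
    by rewrite ler_peMr// -expR0 ler_expR addrC -mulrBr mulr_ge0 ?subr_ge0// ltW.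
  by have [k1 k2] := hM x hx; split; [apply: le_trans k1 _|apply: le_trans k2 _].
rewrite stepsol_right//; have [k1 k2] := hA (x - b0).
have e : A * expR (b * `|x - b0|) <= (M * expR (- (b * a0)) + A * expR (- (b * b0))) * expR (b * x).
  rewrite mulrDl -!mulrA -!expRD -[X in X <= _]add0r lerD ?mulr_ge0 ?expR_ge0//.
  by rewrite ger0_norm ?subr_ge0// mulrBr addrC.
by split; [apply: le_trans k1 _|apply: le_trans k2 _].
Qed.

Lemma stepsol_growth_left (a0 b0 : R) s l (Y : C * C) : stepdata a0 b0 s -> 0 < complex.Im l ->
  exists2 A : R, 0 <= A & forall x, x <= b0 ->
  nc (stepsol l a0 Y (closestep b0 s) x).1 <= A * expR (- (complex.Im l * x)) /\
  nc (stepsol l a0 Y (closestep b0 s) x).2 <= A * expR (- (complex.Im l * x)).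
Proof.
move=> sd l0; set b := complex.Im l.
have [M M0 hM] := stepsol_bounded a0 (closestep b0 s) l Y (`|a0| + `|b0|).
have [A A0 hA] := estep_bound Y l0.
exists (M * expR (b * b0) + A * expR (b * a0)).
  by rewrite addr_ge0// mulr_ge0// expR_ge0.
move=> x xb; have [ax|/ltW xa] := lerP a0 x.
  have hx : `|x| <= `|a0| + `|b0|.
    rewrite ler_norml; have := ler_norm (- a0); have := ler_norm b0; rewrite normrN.
    have := normr_ge0 a0; have := normr_ge0 b0; lra.
  have e : M <= (M * expR (b * b0) + A * expR (b * a0)) * expR (- (b * x)).
    rewrite mulrDl -!mulrA -!expRD -[X in X <= _]addr0 lerD ?mulr_ge0 ?expR_ge0//.
    by rewrite ler_peMr// -expR0 ler_expR -mulrBr mulr_ge0 ?subr_ge0// ltW.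
  by have [k1 k2] := hM x hx; split; [apply: le_trans k1 _|apply: le_trans k2 _].
rewrite stepsol_left//; last exact: sd_geS sd.
have [k1 k2] := hA (x - a0).
have e : A * expR (b * `|x - a0|) <= (M * expR (b * b0) + A * expR (b * a0)) * expR (- (b * x)).
  rewrite mulrDl -!mulrA -!expRD -[X in X <= _]add0r lerD ?mulr_ge0 ?expR_ge0//.
  by rewrite ler0_norm ?subr_le0// opprB mulrBr.
by split; [apply: le_trans k1 _|apply: le_trans k2 _].
Qed.

(** On its outer side each solution is an explicit exponential; elsewhere it obeys the growth bound
    of arbitrary solutions. The sum [A + B + c + d] collects the four constants. *)
Lemma psi_decay (a0 b0 : R) s l : stepdata a0 b0 s -> 0 < complex.Im l -> exists A : R, forall x,
  [/\ nc (psiM a0 b0 s l x).1 <= A * expR (complex.Im l * x),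
      nc (psiM a0 b0 s l x).2 <= A * expR (complex.Im l * x),
      nc (psiP a0 b0 s l x).1 <= A * expR (- (complex.Im l * x)) &
      nc (psiP a0 b0 s l x).2 <= A * expR (- (complex.Im l * x))].
Proof.
move=> sd l0; set b := complex.Im l.
have [A A0 hA] := stepsol_growth_right a0 b0 s (1, - ('i%C * l)) l0.
have [B B0 hB] := stepsol_growth_left (al a0 b0 s l, be a0 b0 s l) sd l0.
pose N := 1 + nc l; have N0 : 0 <= N by rewrite addr_ge0// nc_ge0.
have N1 : 1 <= N by rewrite lerDl nc_ge0.
have N2 : nc ('i%C * l) <= N by rewrite ncM nc_i mul1r lerDr.
pose c := N * expR (- (b * a0)); pose d := N * expR (b * b0).
have c0 : 0 <= c by rewrite mulr_ge0// expR_ge0.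
have d0 : 0 <= d by rewrite mulr_ge0// expR_ge0.
exists (A + B + c + d) => x.
have up (k p q r t e : R) : 0 <= p -> 0 <= q -> 0 <= r -> 0 <= e -> k <= t * e -> k <= (t + (p + q + r)) * e.
  by move=> p0 q0 r0 e0 h; apply: le_trans h _; rewrite ler_wpM2r// lerDl !addr_ge0.
have E1 := expR_ge0 (b * x); have E2 := expR_ge0 (- (b * x)).
have upA k : k <= A * expR (b * x) -> k <= (A + B + c + d) * expR (b * x).
  by move=> h; have := up _ _ _ _ _ _ B0 c0 d0 E1 h; rewrite !addrA.
have upc k : k <= c * expR (b * x) -> k <= (A + B + c + d) * expR (b * x).
  by move=> h; have := up _ _ _ _ _ _ A0 B0 d0 E1 h; congr (_ <= _ * _); ring.
have upB k : k <= B * expR (- (b * x)) -> k <= (A + B + c + d) * expR (- (b * x)).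
  by move=> h; have := up _ _ _ _ _ _ A0 c0 d0 E2 h; congr (_ <= _ * _); ring.
have upd k : k <= d * expR (- (b * x)) -> k <= (A + B + c + d) * expR (- (b * x)).
  by move=> h; have := up _ _ _ _ _ _ A0 B0 c0 E2 h; congr (_ <= _ * _); ring.
have [m1 m2] : nc (psiM a0 b0 s l x).1 <= (A + B + c + d) * expR (b * x) /\
    nc (psiM a0 b0 s l x).2 <= (A + B + c + d) * expR (b * x).
  have [ax|/ltW xa] := lerP a0 x.
    by have [k1 k2] := hA x ax; split; exact: upA.
  have e : expR (complex.Re (- ('i%C * l * (x - a0)%:C))) = expR (- (b * a0)) * expR (b * x).
    by rewrite ReN Re_ilt opprK -expRD; congr expR; rewrite /b; ring.
  have [f1 f2] : (psiM a0 b0 s l x).1 = cexp (- ('i%C * l * (x - a0)%:C)) /\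
    (psiM a0 b0 s l x).2 = - ('i%C * l) * cexp (- ('i%C * l * (x - a0)%:C)) by rewrite psiM_left.
  rewrite f1 f2; split; apply: upc.
    by rewrite nc_cexp e /c -mulrA ler_peMl// mulr_ge0// expR_ge0.
  by rewrite (ncM (- _)) ncN nc_cexp e /c -mulrA ler_wpM2r// mulr_ge0// expR_ge0.
have [p1 p2] : nc (psiP a0 b0 s l x).1 <= (A + B + c + d) * expR (- (b * x)) /\
    nc (psiP a0 b0 s l x).2 <= (A + B + c + d) * expR (- (b * x)).
  have [xb|/ltW bx] := lerP x b0.
    by have [k1 k2] := hB x xb; split; exact: upB.
  have e : expR (complex.Re ('i%C * l * (x - b0)%:C)) = expR (b * b0) * expR (- (b * x)).
    by rewrite Re_ilt -expRD; congr expR; rewrite /b; ring.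
  have [f1 f2] : (psiP a0 b0 s l x).1 = cexp ('i%C * l * (x - b0)%:C) /\
    (psiP a0 b0 s l x).2 = 'i%C * l * cexp ('i%C * l * (x - b0)%:C) by rewrite psiP_right.
  rewrite f1 f2; split; apply: upd.
    by rewrite nc_cexp e /d -mulrA ler_peMl// mulr_ge0// expR_ge0.
  by rewrite (ncM (_ * l)) nc_cexp e /d -mulrA ler_wpM2r// mulr_ge0// expR_ge0.
by split.
Qed.

(** Square integrability makes the data at [a0] proportional to [(1, - i l)] and those at [b0]
    proportional to [(1, i l)]. The Wronskian with [psiP] is then zero at [b0], while at [a0] it is
    [Om] times the value of the solution. *)
Lemma step_L2_zero (a0 b0 : R) s l Y : stepdata a0 b0 s -> 0 < complex.Im l -> Om a0 b0 s l != 0 ->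
  odesol (steppot (closestep b0 s)) l Y -> L2 (fun x => (Y x).1) -> forall x, (Y x).1 = 0.
Proof.
move=> sd l0 W0 hY h2.
have eY := odesol_stepsol (sd_geS sd) (sd_bS sd) hY.
have A0 : complex.Re ('i%C * l) < 0 by rewrite Re_il oppr_lt0.
have ln : 'i%C * l != 0 :> C by apply/eqP => h; move: A0; rewrite h ltxx.
have hA := sqr_il l.
set y := Y a0 in eY.
have q1 : (y.1 + y.2 / ('i%C * l)) / 2 = 0.
  apply: (expsum_L2_left (q := (y.1 - y.2 / ('i%C * l)) / 2) (a0 := a0) A0 h2) => x xa.
  by rewrite eY stepsol_left//; [exact: (estep_decomp (x - a0) y hA ln)|exact: sd_geS sd].
pose z := Y b0.
have ez : z = stepsol l a0 y s b0 by rewrite /z eY closestep_at.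
have q2 : (z.1 - z.2 / ('i%C * l)) / 2 = 0.
  apply: (expsum_L2_right (p := (z.1 + z.2 / ('i%C * l)) / 2) (b0 := b0) A0 h2) => x bx.
  by rewrite eY stepsol_right// -ez; exact: (estep_decomp (x - b0) z hA ln).
have {}q1 : y.2 = - ('i%C * l) * y.1.
  move/eqP: q1; rewrite mulf_eq0 invr_eq0 (negPf (@two_neq0 R)) orbF addr_eq0 => /eqP ->.
  by rewrite mulNr mulrN opprK mulrCA divff// mulr1.
have {}q2 : z.2 = 'i%C * l * z.1.
  move/eqP: q2; rewrite mulf_eq0 invr_eq0 (negPf (@two_neq0 R)) orbF subr_eq0 => /eqP ->.
  by rewrite mulrCA divff// mulr1.
have y0 : y.1 = 0.
  have w := stepsol_wron l a0 s y (al a0 b0 s l, be a0 b0 s l) b0.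
  rewrite -ez psiP_at /wron /= q1 q2 mulr1 (mulrC z.1) subrr in w.
  apply/eqP; rewrite -(mulIr_eq0 _ (mulIf W0)); apply/eqP.
  by apply: etrans (esym w); rewrite /Om; ring.
have yy : y = (0, 0) by rewrite (surjective_pairing y) q1 y0 mulr0.
move=> x; rewrite eY yy.
have := stepsol_lin l a0 (closestep b0 s) 0 0 (0, 0) (0, 0) x.
by rewrite /= !mul0r addr0 => ->.
Qed.

Lemma step_resolvent (a0 b0 : R) s l : stepdata a0 b0 s -> 0 < complex.Im l -> Om a0 b0 s l != 0 ->
  is_resolvent (fun x => (steppot (closestep b0 s) x)%:C) l
    (gres (fun x l => (psiM a0 b0 s l x).1) (fun x l => (psiP a0 b0 s l x).1) (Om a0 b0 s) l).
Proof.
move=> sd l0 W0; have [A hA] := psi_decay sd l0.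
exact: (green_resolvent (green_step sd) W0 l0 hA (fun Y => @step_L2_zero _ _ _ _ Y sd l0 W0)).
Qed.

(* If [Om l = 0] then some solution is outgoing on both sides, and the flux through it
   increases from [om * (- i l)] to a positive multiple of [om * (i l)]. *)
Lemma Om_neq0 (a0 b0 : R) s l : stepdata a0 b0 s -> 1 < complex.Im l -> Om a0 b0 s l != 0.
Proof.
move=> sd l1; apply/eqP => W0.
have bal : be a0 b0 s l = - ('i%C * l) * al a0 b0 s l.
  by apply/eqP; rewrite mulNr -addr_eq0; apply/eqP.
have e : (1, 'i%C * l) = (al a0 b0 s l * (psiM a0 b0 s l b0).1, al a0 b0 s l * (psiM a0 b0 s l b0).2) :> C * C.
  rewrite -(psiP_at a0 b0 s l) /psiM closestep_at.
  have := stepsol_lin l a0 s (al a0 b0 s l) 0 (1, - ('i%C * l)) (0, 0) b0.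
  rewrite /= !mul0r !addr0 mulr1 => <-; congr stepsol; congr pair; rewrite bal; ring.
case: e => e1 e2; set P := psiM a0 b0 s l b0 in e1 e2.
have P1 : P.1 != 0 by apply/eqP => h; move/eqP: e1; rewrite h mulr0 oner_eq0.
have P2 : P.2 = 'i%C * l * P.1.
  have a1 : al a0 b0 s l != 0 by apply/eqP => h; move/eqP: e1; rewrite h mul0r oner_eq0.
  by apply: (mulfI a1); rewrite -e2 mulrCA -e1 mulr1.
have fl om : 0 <= complex.Re om -> (forall v : R, `|v| <= 1 -> 0 <= complex.Re (om * (v%:C - l ^+ 2))) ->
    - complex.Re (om * ('i%C * l)) <= nc P.1 ^+ 2 * complex.Re (om * ('i%C * l)).
  move=> o1 o2.
  have := @flux_stepsol R om l a0 (closestep b0 s) (1, - ('i%C * l)) b0 o1 _ _ _.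
  rewrite -/(psiM _ _ _ _ _) -/P /flux /= P2.
  have -> : om * (- ('i%C * l) * conjc 1) = - (om * ('i%C * l)) by rewrite conjc1; ring.
  have -> : om * ('i%C * l * P.1 * conjc P.1) = (conjc P.1 * P.1) * (om * ('i%C * l)) by ring.
  rewrite conjMnc ReZ ReN; apply.
  - by rewrite map_rcons rcons_path (sd_path sd) (sd_last sd).
  - move=> v [->|]; first by apply: o2; rewrite normr0.
    by move=> /mapP[av hav ->]; apply: o2; move: hav; rewrite mem_rcons inE => /orP[/eqP ->/=|/(sd_b sd)//]; rewrite normr0.
  - by rewrite map_rcons last_rcons.
have pos := exprn_gt0 2 (etrans (nc_gt0 P.1) P1); set k := nc P.1 ^+ 2 in pos fl.
have sq : complex.Re (l ^+ 2) = complex.Re l ^+ 2 - complex.Im l ^+ 2 by rewrite expr2 ReM; ring.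
have sqI : complex.Im (l ^+ 2) = 2 * complex.Re l * complex.Im l by rewrite expr2 ImM; ring.
set a := complex.Re l in sq sqI; set b := complex.Im l in l1 sq sqI.
have b0' : 0 < b by exact: lt_trans ltr01 l1.
have i1 : - 'i%C * ('i%C * l) = l :> C by rewrite mulNr mulrA sqri; ring.
have i2 : 'i%C * ('i%C * l) = - l :> C by rewrite mulrA sqri; ring.
(* The phase [om] is [- i], [i] or [1] for [a] negative, positive or zero. Each choice makes
   [Re (om * i l)] negative, against the flux inequality, and [Re (om * (v - l ^ 2))] nonnegative;
   for [a = 0] the latter is [v + b ^ 2] with [v >= -1] and [b > 1]. *)
have [ag|al0|a0'] := ltrgtP a 0.
- have : - complex.Re (- 'i%C * ('i%C * l)) <= k * complex.Re (- 'i%C * ('i%C * l)).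
    apply: fl => [|v _]; first by rewrite /= oppr0.
    rewrite mulNr ReN Re_il opprK ImB sqI /= sub0r; nra.
  rewrite i1 -/a; nra.
- have : - complex.Re ('i%C * ('i%C * l)) <= k * complex.Re ('i%C * ('i%C * l)).
    apply: fl => [|v _]; first by [].
    rewrite Re_il ImB sqI /= sub0r; nra.
  rewrite i2 ReN -/a; nra.
have : - complex.Re (1 * ('i%C * l)) <= k * complex.Re (1 * ('i%C * l)).
  apply: fl => [|v]; first exact: ler01.
  rewrite mul1r ReB sq a0' /= ler_norml => /andP[v1 _]; nra.
rewrite mul1r Re_il -/b; nra.
Qed.

End StepResolvent.

(** * Zeros of the Wronskian are poles *)

Section Poles.
Variable R : realType.
Local Notation mu := (@lebesgue_measure R).
Local Notation C := R[i].
Implicit Types (s : seq (R * R)) (l : C).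

Lemma L2norm2_le_H2norm2 (A : set R) (u : R -> C) : (L2norm2 A u <= H2norm2 A u)%E.
Proof.
apply: le_ereal_inf_tmp => _ [u1 [u2 [_ _ ->]]]; rewrite -addeA leeDl// adde_ge0// /L2norm2.
all: by apply: integral_ge0 => x _; rewrite lee_fin sqr_ge0.
Qed.

Lemma L2norm2_rint (A : set R) (u : R -> C) : measurable A -> cmeas u -> (L2norm2 A u < +oo)%E ->
  rint A (fun x => nc (u x) ^+ 2).
Proof.
move=> mA mu' h; apply/integrableP; split.
  by apply/measurable_EFinP; apply: measurable_funTS; apply: measurable_funX; exact: measurable_nc.
apply: le_lt_trans h; rewrite le_eqVlt; apply/orP; left; apply/eqP.
by apply: eq_integral => x _; rewrite /= ger0_norm// sqr_ge0.
Qed.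

Lemma L2norm2_ae (A : set R) (u v : R -> C) : measurable A -> cmeas u -> cmeas v -> aeq u v ->
  L2norm2 A u = L2norm2 A v.
Proof.
move=> mA mu' mv e; rewrite /L2norm2; apply: ae_eq_integral => //.
- by apply/measurable_EFinP; apply: measurable_funTS; apply: measurable_funX; exact: measurable_nc.
- by apply/measurable_EFinP; apply: measurable_funTS; apply: measurable_funX; exact: measurable_nc.
by apply: (ae_imp e) => x ->.
Qed.

Lemma expR_le_inv (t : R) : 0 <= t -> t < 1 -> expR t <= (1 - t)^-1.
Proof.
move=> t0 t1; rewrite -[t]opprK expRN lef_pV2 ?posrE ?expR_gt0 ?opprK ?subr_gt0//.
exact: expR_ge1Dx.
Qed.

Lemma cexp_sub1 (w : C) : nc w <= 4^-1 -> nc (cexp w - 1) <= 2^-1.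
Proof.
move=> hw; have := cexp_taylor 1 w.
have -> : cexp_sum 1 w = 1 by rewrite /cexp_sum big_ord1 expr0 divr1.
rewrite expr1 divr1 => h.
have w0 := nc_ge0 w.
apply: (le_trans h); have e : expR (nc w) <= 4 / 3.
  by apply: (le_trans (expR_le_inv w0 _)); [lra|rewrite invf_ple ?posrE ?invf_div//; lra].
have : nc w * expR (nc w) <= 4^-1 * (4 / 3) by apply: ler_pM => //; exact: expR_ge0.
lra.
Qed.

(** The integrand stays within [1 / 2] of [1], and so does its integral over an interval of length
    one. *)
Lemma Cintegral_near1 (w : C) (b K : R) : (forall y, 1 <= y <= 2 -> `|y - b| <= K) -> nc w * K <= 4^-1 ->
  2^-1 <= nc (Cintegral `[1, 2] (fun y => cexp (w * (y - b)%:C))).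
Proof.
move=> hK hw; have m12 := measurable_itv `[1 : R, 2].
have c1 := cder_cexp w; have := cder_shift b c1 => c1'.
have c2' := cder_shift b (cderZ w c1).
have cp := cder_cprim c1' c2'.
have mc := cprim_cmeas cp.
have [M hM] := cprim_bounded 1 2 cp.
have ic : Cint `[1, 2] (fun y => cexp (w * (y - b)%:C)).
  by apply: (Cint_le m12 mc (rint_cst 1 2 M)) => y /=; rewrite in_itv /=; exact: hM.
have i1 : Cint `[1, 2] (fun _ => 1 : C) by split; exact: rint_cst.
have e1 : Cintegral `[1, 2] (fun _ : R => 1 : C) = 1.
  by apply: complexP; rewrite /= Rint_cst; lra.
have := ncB_ge (1 : C) (1 - Cintegral `[1, 2] (fun y => cexp (w * (y - b)%:C))).
rewrite opprB addrCA subrr addr0 nc1 => h; apply: le_trans h.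
have hd : nc (1 - Cintegral `[1, 2] (fun y => cexp (w * (y - b)%:C))) <= 2^-1.
  rewrite ncBC -[X in nc (_ - X)]e1 -(CintegralB m12 ic i1).
  have -> : 2^-1 = \int[mu]_(y in `[1, 2]) (2^-1 : R) by rewrite Rint_cst; lra.
  apply: (nc_Cintegral_le m12 (CintD m12 ic (CintN m12 i1)) (rint_cst 1 2 2^-1)) => y /=.
  rewrite in_itv /= => hy; apply: cexp_sub1; rewrite ncM nc_real; apply: le_trans hw.
  by rewrite ler_wpM2l ?nc_ge0 ?hK.
lra.
Qed.

(** The source lies to the right of the potential and is tuned to [psiP] at [l]: against it, [psiP]
    at [m] integrates to nearly [1] for [m] close to [l]. *)
Definition probe (b0 : R) l (y : R) : C := if 1 <= y <= 2 then cexp (- ('i%C * l) * (y - b0)%:C) else 0.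

Lemma L2supp_probe (b0 : R) l : L2supp 2 (probe b0 l).
Proof.
have c1 := cder_cexp (- ('i%C * l)); have c1' := cder_shift b0 c1.
have cp := cder_cprim c1' (cder_shift b0 (cderZ _ c1)).
have [M hM] := cprim_bounded 1 2 cp.
have mf : cmeas (probe b0 l).
  apply: cmeas_if; [|exact: cprim_cmeas cp|exact: cmeas_cst].
  by apply: measurable_itv_bool => //; exact: measurable_cst.
split; last first.
  apply: aeW => y /= hy; rewrite /probe ifF//; apply/negbTE/negP => /andP[y1 y2].
  by move: hy; rewrite ger0_norm; lra.
apply: rint_L2 => //.
have i := rint_if (rint_cst 1 2 (M ^+ 2)).
apply: (integrable_le measurableT _ i); first by apply: measurable_funX; exact: measurable_nc.
move=> y _; rewrite ger0_norm ?sqr_ge0// /probe; case: ifP => hy; last by rewrite nc0 expr0n.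
by rewrite lerXn2r ?nnegrE ?nc_ge0 ?hM//; apply: le_trans (nc_ge0 _) (hM 1 _); lra.
Qed.

Lemma gres_probe (a0 b0 : R) s (l m : C) (x : R) : stepdata a0 b0 s -> -1 <= a0 -> b0 <= 1 -> x <= -1 ->
  gres (fun x l => (psiM a0 b0 s l x).1) (fun x l => (psiP a0 b0 s l x).1) (Om a0 b0 s) m (probe b0 l) x =
  - (Om a0 b0 s m)^-1 * cexp (- ('i%C * m * (x - a0)%:C)) *
    Cintegral `[1, 2] (fun y => cexp ('i%C * (m - l) * (y - b0)%:C)).
Proof.
move=> sd a1 b1 x1; have m12 := measurable_itv `[1 : R, 2].
have c1 := cder_cexp ('i%C * (m - l)); have c1' := cder_shift b0 c1.
have cp := cder_cprim c1' (cder_shift b0 (cderZ _ c1)).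
have [M hM] := cprim_bounded 1 2 cp.
have ic : Cint `[1, 2] (fun y => cexp ('i%C * (m - l) * (y - b0)%:C)).
  by apply: (Cint_le m12 (cprim_cmeas cp) (rint_cst 1 2 M)) => y /=; rewrite in_itv /=; exact: hM.
rewrite -(CintegralZ _ m12 ic) (Cintegral_mkcond _ m12) /gres /Op.
apply: eq_Cintegral => y _; rewrite /probe.
have -> : (y \in `[1, 2]%classic) = (1 <= y <= 2) by apply/idP/idP; rewrite inE /= in_itv.
case: ifP => [/andP[y1 y2]|_]; last by rewrite mulr0.
rewrite /gker ltNge (_ : x <= y) /=; last by lra.
have -> : (psiM a0 b0 s m x).1 = cexp (- ('i%C * m * (x - a0)%:C)) by rewrite psiM_left//; lra.
have -> : (psiP a0 b0 s m y).1 = cexp ('i%C * m * (y - b0)%:C) by rewrite psiP_right//; lra.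
have -> : cexp ('i%C * (m - l) * (y - b0)%:C) = cexp ('i%C * m * (y - b0)%:C) * cexp (- ('i%C * l) * (y - b0)%:C).
  by rewrite -cexpD; congr cexp; ring.
by move: (cexp _) (cexp _) (cexp _) (_^-1) => u v w z; ring.
Qed.

(** If the family were holomorphic at [l0], then [F m f] would stay bounded in [L^2] of []-3, 3[] as
    [m] tends to [l0]; but on [[-2, -1]] its modulus is at least [c0 / nc (Om m)], and
    [Om m = O (m - l0)]. *)
Lemma is_pole_step (a0 b0 : R) s l0 : stepdata a0 b0 s -> -1 <= a0 -> b0 <= 1 -> Om a0 b0 s l0 = 0 ->
  is_pole (gres (fun x l => (psiM a0 b0 s l x).1) (fun x l => (psiP a0 b0 s l x).1) (Om a0 b0 s)) l0.
Proof.
move=> sd a1 b1 W0; have G := green_step sd; set F := gres _ _ _.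
have Wz : Om a0 b0 s (2 * 'i%C) != 0 by apply: Om_neq0 => //; rewrite /=; lra.
move=> [B hol0 /dnear_ncP[d1 d10 hF]].
have /near_ncP[d2 d20 /(_ l0)] := hol0; rewrite subrr nc0 => /(_ d20)[hB [D [hD lim]]].
have hf := L2supp_probe b0 l0; set f := probe b0 l0 in hf.
have fL : L2comp f by exists 2.
have N2f := L2norm2E hf.1.
have /dnear_ncP[d3 d30 hS] := lim 2 3 1 ltr01.
have mA := measurable_itv `](- 3 : R), 3[.
have bnd T : comp_loc_operator T -> cmeas (T f) /\ exists2 q, 0 <= q & (L2norm2 [set` `](- 3)%R, 3%R[] (T f) <= q%:E)%E.
  move=> [_ /(_ 2 3)[M /(_ f hf)]]; rewrite N2f -EFinM => h.
  have [m1 _] := H2norm2_lt (le_lt_trans h (ltry _)); split=> //.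
  exists (Num.max (M * N2 f) 0); first by rewrite le_max lexx orbT.
  apply: (le_trans (L2norm2_le_H2norm2 _ _)); apply: (le_trans h).
  by rewrite lee_fin le_max lexx.
have [mB [q1 q10 hq1]] := bnd _ hB; have [mD [q2 q20 hq2]] := bnd _ hD.
(* A bound for the integral of [3 (|S| ^ 2 + |D f| ^ 2 + |B l0 f| ^ 2)], which dominates
   [|F m f| ^ 2]; here [S] is the error of the difference quotient. *)
pose Q := 3 * (N2 f + q2 + q1).
(* The factorization gives [Om m != 0] for [m] close to but different from [l0]. *)
have [N [g [eg g0 hW]]] := entire_zero_factor l0 (green_entfam G) Wz.
have [dg hg] := entfam_hol0 l0 eg; have [d4 d40 h4] := hol_neq0 hg g0.
have [dW hW1] := entfam_hol0 l0 (green_entfam G); have [M [d5 [d50 M0 h5]]] := hol_lip hW1.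
(* A lower bound for the outgoing exponential on [[-2, -1]], halved on account of the integral of
   the probe. *)
pose c0 := expR (- ((nc l0 + 1) * (2 + `|a0|))) / 2.
have c00 : 0 < c0 by rewrite divr_gt0// expR_gt0.
pose K := 2 + `|b0|; have K0 : 0 < K by rewrite ltr_wpDr.
have key (t : R) : 0 < t -> t < d1 -> t < d3 -> t < d4 -> t < d5 -> t < 1 -> t * K <= 4^-1 ->
    c0 ^+ 2 <= Q * (M * t) ^+ 2.
  move=> t0 t1 t3 t4 t5 t11 tK; pose m : C := l0 + t%:C.
  have ml : m - l0 = t%:C by rewrite /m addrC addKr.
  have nml : nc (m - l0) = t by rewrite ml nc_real ger0_norm// ltW.
  have mne : m != l0 by rewrite -subr_eq0 -nc_gt0 nml.
  have Wm : Om a0 b0 s m != 0.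
    rewrite hW mulf_neq0 ?expf_neq0 ?subr_eq0// -nc_gt0; apply: lt_le_trans (h4 m _); rewrite ?nml//.
    by rewrite divr_gt0// nc_gt0.
  have Wle : nc (Om a0 b0 s m) <= M * t by have := h5 m; rewrite W0 subr0 nml; apply.
  have eF := hF m mne; rewrite nml in eF; have {}eF := eF t1 f fL.
  have mF : cmeas (F m f).
    have := goodK_scale (- (Om a0 b0 s m)^-1) (goodK_green m G) => gK.
    by have [p _ _] := goodK_sol gK hf; exact: cprim_cmeas p.
  have := hS m mne; rewrite nml => /(_ t3 f hf); rewrite mul1e N2f => hSm.
  have [mS _] := H2norm2_lt (le_lt_trans hSm (ltry _)).
  pose S x := (m - l0)^-1 * (F m f x - B l0 f x) - D f x.
  have mS' : cmeas S by apply: cmeasB => //; apply: cmeasZ; exact: cmeasB.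
  have eS : aeq (fun x => (m - l0)^-1 * (B m f x - B l0 f x) - D f x) S.
    by apply: (ae_imp eF) => x; rewrite /S expr0 invr1 mul1r => ->.
  have hS' : (L2norm2 [set` `](- 3)%R, 3%R[] S <= (N2 f)%:E)%E.
    by rewrite -(L2norm2_ae mA mS mS' eS); exact: le_trans (L2norm2_le_H2norm2 _ _) hSm.
  have rS := L2norm2_rint mA mS' (le_lt_trans hS' (ltry _)).
  have rD := L2norm2_rint mA mD (le_lt_trans hq2 (ltry _)).
  have rB := L2norm2_rint mA mB (le_lt_trans hq1 (ltry _)).
  have lowF x : -2 <= x <= -2 + 1 -> c0 / nc (Om a0 b0 s m) <= nc (F m f x).
    move=> /andP[x2 x1]; have x1' : x <= -1 by rlra.
    rewrite /F /f (gres_probe _ _ sd a1 b1 x1') (ncM (_ * _)) (ncM (- _)) ncN ncV mulrC -mulrA.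
    rewrite ler_wpM2l ?invr_ge0 ?nc_ge0// /c0 ler_pM ?expR_ge0 ?invr_ge0//.
      rewrite nc_cexp ler_expR ReN Re_ilt opprK.
      have := nc_Im m; rewrite ler_norml => /andP[i1 i2].
      have nm : nc m <= nc l0 + 1.
        by rewrite /m (le_trans (ncD _ _))// lerD2l nc_real ger0_norm ltW.
      have xa : 0 <= a0 - x <= 2 + `|a0| by have := ler_norm a0; rlra.
      have l00 := nc_ge0 l0; nra.
    apply: (Cintegral_near1 (K := K)).
      move=> y /andP[y1 y2]; rewrite (le_trans (ler_normB _ _))// lerD2r ger0_norm; rlra.
    by rewrite ncM nc_i mul1r nml.
  have eq x : F m f x = (m - l0) * S x + (m - l0) * D f x + B l0 f x.
    rewrite /S; have u0 : m - l0 != 0 by rewrite subr_eq0.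
    by rewrite mulrBr mulrA divff// mul1r; ring.
  have up x : nc (F m f x) ^+ 2 <= 3 * (nc (S x) ^+ 2 + nc (D f x) ^+ 2 + nc (B l0 f x) ^+ 2).
    have hh : nc (F m f x) <= nc (S x) + nc (D f x) + nc (B l0 f x).
      rewrite eq (le_trans (ncD _ _))// lerD2r (le_trans (ncD _ _))// !ncM nml.
      by rewrite lerD// ler_piMl ?nc_ge0// ltW.
    have k1 := nc_ge0 (S x); have k2 := nc_ge0 (D f x); have k3 := nc_ge0 (B l0 f x).
    move: hh k1 k2 k3 (nc_ge0 (F m f x)); move: (nc _) (nc _) (nc _) (nc _) => w v u p hh k1 k2 k3 p0.
    have h2 : p ^+ 2 <= (u + v + w) ^+ 2 by rewrite lerXn2r ?nnegrE ?addr_ge0//.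
    apply: (le_trans h2); have := sqr_ge0 (u - v); have := sqr_ge0 (u - w); have := sqr_ge0 (v - w).
    rewrite !expr2; rlra.
  have nW : 0 < nc (Om a0 b0 s m) by rewrite nc_gt0.
  have mJ := measurable_itv `[(- 2 : R), - 2 + 1].
  have sJ : `[(- 2 : R), - 2 + 1] `<=` `](- 3), 3[.
    by move=> x /=; rewrite !in_itv /=; rlra.
  have hL : (c0 / nc (Om a0 b0 s m)) ^+ 2 <= Q.
    have z0 : 0 <= c0 / nc (Om a0 b0 s m) by rewrite divr_ge0// ltW.
    have lowE x : -2 <= x <= -2 + 1 -> (c0 / nc (Om a0 b0 s m)) ^+ 2 <= 3 * (nc (S x) ^+ 2 + nc (D f x) ^+ 2 + nc (B l0 f x) ^+ 2).
      by move=> hx; apply: le_trans (up x); rewrite lerXn2r// ?nnegrE ?nc_ge0 ?lowF.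
    have rI := rintZ 3 mJ (rintD mJ (rintD mJ (rintS mA mJ sJ rS) (rintS mA mJ sJ rD)) (rintS mA mJ sJ rB)).
    have : \int[mu]_(x in `[(- 2 : R), - 2 + 1]) (c0 / nc (Om a0 b0 s m)) ^+ 2 <=
       \int[mu]_(x in `[(- 2 : R), - 2 + 1]) (3 * (nc (S x) ^+ 2 + nc (D f x) ^+ 2 + nc (B l0 f x) ^+ 2)).
      apply: le_Rintegral; [exact: mJ|exact: rint_cst|exact: rI|].
      by move=> x /=; rewrite in_itv /= => /lowE.
    rewrite Rint_cst ?lerDl// addrC addKr mulr1 => /le_trans; apply.
    rewrite (RintZl _ mJ (rintD mJ (rintD mJ (rintS mA mJ sJ rS) (rintS mA mJ sJ rD)) (rintS mA mJ sJ rB))).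
    rewrite (RintD mJ (rintD mJ (rintS mA mJ sJ rS) (rintS mA mJ sJ rD)) (rintS mA mJ sJ rB)).
    rewrite (RintD mJ (rintS mA mJ sJ rS) (rintS mA mJ sJ rD)) /Q.
    have sub u q : cmeas u -> rint `](- 3), 3[ (fun x => nc (u x) ^+ 2) ->
        (L2norm2 [set` `](- 3)%R, 3%R[] u <= q%:E)%E ->
        \int[mu]_(x in `[(- 2 : R), - 2 + 1]) nc (u x) ^+ 2 <= q.
      move=> mu1 ru hu; rewrite -lee_fin -(rint_fine mJ (rintS mA mJ sJ ru)); apply: le_trans hu.
      apply: ge0_subset_integral => //.
      - by apply/measurable_EFinP; apply: measurable_funTS; apply: measurable_funX; exact: measurable_nc.
      - by move=> x _; rewrite lee_fin sqr_ge0.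
    by rewrite ler_wpM2l// !lerD// sub.
  rewrite expr_div_n ler_pdivrMr ?exprn_gt0// in hL.
  have Q0 : 0 <= Q by rewrite /Q mulr_ge0// !addr_ge0// N2_ge0.
  by apply: (le_trans hL); rewrite ler_wpM2l// lerXn2r// nnegrE ?nc_ge0// (le_trans (nc_ge0 _) Wle).
pose E := Q * M ^+ 2.
have Q0 : 0 <= Q by rewrite /Q mulr_ge0// !addr_ge0// N2_ge0.
have E0 : 0 <= E by rewrite mulr_ge0// sqr_ge0.
pose t0 := Num.min (Num.min d1 d3) (Num.min (Num.min d4 d5) (Num.min 1 (Num.min (4^-1 / K) (c0 ^+ 2 / (E + 1))))).
have tt0 : 0 < t0 by rewrite !lt_min d10 d30 d40 d50 ltr01 !divr_gt0//= ?exprn_gt0// ltr_wpDl.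
pose t := t0 / 2; have tp : 0 < t by rewrite divr_gt0.
have tl : t < t0 by rewrite /t; rlra.
have := tl; rewrite !lt_min => /and3P[/andP[h1 h3] /andP[h4' h5'] /and3P[h6 h7 h8]].
have := key t tp h1 h3 h4' h5' h6; rewrite -ler_pdivlMr// => /(_ (ltW h7)).
rewrite ltr_pdivlMr in h8; last by rewrite ltr_wpDl.
rewrite [(M * t) ^+ 2]exprMn (mulrA Q) -/E => hh.
have h9 : E * t ^+ 2 <= t * (E + 1).
  rewrite expr2 mulrCA ler_wpM2l ?(ltW tp)//.
  apply: (@le_trans _ _ E); last by rewrite lerDl.
  by rewrite ler_piMr// ltW.
by have := le_lt_trans (le_trans hh h9) h8; rewrite ltxx.
Qed.

Lemma helmholtz_ae (V V' : R -> C) l u f : aeq V V' -> helmholtz V l u f -> helmholtz V' l u f.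
Proof.
move=> e [h [u1 [u2 [w1 w2 h3]]]]; split=> //; exists u1, u2; split=> //.
by apply: (ae_imp (ae_and e h3)) => x [<-].
Qed.

Lemma is_resolvent_ae (V V' : R -> C) l T : aeq V V' -> is_resolvent V l T -> is_resolvent V' l T.
Proof.
move=> e h f hf; have [h1 h2] := h f hf; split; first exact: helmholtz_ae e h1.
by move=> u hu; apply: h2; exact: helmholtz_ae (aeq_sym e) hu.
Qed.

Lemma resonance_step (a0 b0 : R) s l0 (V : R -> C) : stepdata a0 b0 s -> -1 <= a0 -> b0 <= 1 ->
  aeq (fun x => (steppot (closestep b0 s) x)%:C) V -> Om a0 b0 s l0 = 0 -> resonance V l0.
Proof.
move=> sd a1 b1 e W0.
exists (gres (fun x l => (psiM a0 b0 s l x).1) (fun x l => (psiP a0 b0 s l x).1) (Om a0 b0 s)); last exact: is_pole_step.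
split.
  apply: (green_meromorphic (z1 := 2 * 'i%C) (green_step sd)); apply: Om_neq0 => //; rewrite /=; lra.
exists 1 => l hl; exists (gres (fun x l => (psiM a0 b0 s l x).1) (fun x l => (psiP a0 b0 s l x).1) (Om a0 b0 s) l).
  apply: (is_resolvent_ae e); apply: step_resolvent => //; last exact: Om_neq0.
  exact: lt_trans ltr01 hl.
by move=> f _; exact: aeW.
Qed.

End Poles.

(** * The minimum modulus principle on a square *)

Section MinimumModulus.
Variable R : realType.
Local Notation C := R[i].

Lemma entire_nc_continuous (W : C -> C) (z0 : C) : entfam (fun _ : R => W) ->
  continuous (fun p : R * R => nc (W (z0 + (p.1 +i* p.2)))).
Proof.
move=> eW p; apply/cvgrPdist_le => e e0.
have [dW hW] := entfam_hol0 (z0 + (p.1 +i* p.2)) eW.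
have [M [d [d0 M0 hM]]] := hol_lip hW.
have M1 : 0 < M + 1 by rewrite ltr_wpDl.
pose k := Num.min d (e / (M + 1)) / 2.
have k0 : 0 < k by rewrite divr_gt0// lt_min d0 divr_gt0.
exists (ball p.1 k, ball p.2 k); first by split; apply: nbhsx_ballx.
move=> q [] /= q1 q2; rewrite /ball /= in q1 q2.
have hd : nc (z0 + (q.1 +i* q.2) - (z0 + (p.1 +i* p.2))) < Num.min d (e / (M + 1)).
  have -> : z0 + (q.1 +i* q.2) - (z0 + (p.1 +i* p.2)) = (q.1 - p.1) +i* (q.2 - p.2).
    by apply: complexP; rewrite !ReImE /=; ring.
  apply: (le_lt_trans (nc_ReIm _)); rewrite /= distrC [X in _ + X]distrC.
  by have := ltrD q1 q2; rewrite /k; set m := Num.min _ _; lra.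
move: hd; rewrite lt_min => /andP[/hM h1]; rewrite ltr_pdivlMr// => h2.
set u := W _ in h1 *; set v := W _ in h1 *; set t := nc (_ - (_ + _)) in h1 h2.
have t0 : 0 <= t by exact: nc_ge0.
have uv : nc (u - v) <= e by apply: (le_trans h1); nra.
rewrite ler_norml; have := ncB_ge u v; have := ncB_ge v u; rewrite (ncBC v); lra.
Qed.

(* At an interior point where an entire function is nonzero and not locally constant, its
   modulus decreases in some direction, found from a [k]-th root. *)
Lemma not_local_min (W : C -> C) (z1 z2 : C) (d : R) : entfam (fun _ : R => W) -> W z2 != W z1 -> W z1 != 0 ->
  0 < d -> exists2 z, nc (z - z1) < d & nc (W z) < nc (W z1).
Proof.
move=> eW W21 W1 d0.
have eV : entfam (fun _ : R => fun z => W z - W z1) by apply: entfamB => //; exact: entfam_cst.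
have V2 : W z2 - W z1 != 0 by rewrite subr_eq0.
have [N [g [eg g1 hg]]] := entire_zero_factor z1 eV V2.
have N0 : (0 < N)%N.
  case: N hg => // hg; have := hg z1; rewrite subrr expr0 mul1r => /esym/eqP.
  by rewrite (negPf g1).
pose c : C := N.-root (- W z1 / g z1).
have hc : c ^+ N * g z1 = - W z1.
  by rewrite /c rootCK// divfK.
have c0 : c != 0.
  apply/eqP => h; move: hc; rewrite h expr0n gtn_eqF// mul0r => /esym/eqP.
  by rewrite oppr_eq0 (negPf W1).
have nc0' : 0 < nc c by rewrite nc_gt0.
have [dg hdg] := entfam_hol0 z1 eg; have [M [r [r0 M0 hM]]] := hol_lip hdg.
have w1 : 0 < nc (W z1) by rewrite nc_gt0.
pose K := nc c ^+ N * M * nc c.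
have K0 : 0 <= K by rewrite !mulr_ge0 ?exprn_ge0 ?nc_ge0.
have K1 : 0 < K + 1 by rewrite ltr_wpDl.
pose t0 := Num.min 1 (Num.min (d / nc c) (Num.min (r / nc c) (nc (W z1) / (K + 1)))).
have t00 : 0 < t0 by rewrite !lt_min ltr01 !divr_gt0.
pose t := t0 / 2; have tp : 0 < t by rewrite divr_gt0.
have tl : t < t0 by rewrite /t; lra.
have := tl; rewrite !lt_min !ltr_pdivlMr// => /and4P[t1 td tr tK].
have nt : nc (t%:C * c) = t * nc c by rewrite ncM nc_real gtr0_norm.
exists (z1 + t%:C * c); first by rewrite addrC addKr nt.
have eq : W (z1 + t%:C * c) = (1 - t ^+ N)%:C * W z1 + (t%:C * c) ^+ N * (g (z1 + t%:C * c) - g z1).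
  have := hg (z1 + t%:C * c); have -> : z1 + t%:C * c - z1 = t%:C * c by ring.
  move=> h; have -> : W (z1 + t%:C * c) = W z1 + (t%:C * c) ^+ N * g (z1 + t%:C * c) by rewrite -h; ring.
  rewrite rmorphB rmorph1 rmorphXn /= exprMn mulrBr -[_ * g z1]mulrA hc; ring.
have hgd : nc (g (z1 + t%:C * c) - g z1) <= M * (t * nc c).
  have e1 : z1 + t%:C * c - z1 = t%:C * c by ring.
  by have := hM (z1 + t%:C * c); rewrite e1 nt => h; exact: (h tr).
have tN0 : 0 < t ^+ N by rewrite exprn_gt0.
have tN1 : t ^+ N <= 1 by rewrite exprn_ile1// ltW.
rewrite eq; apply: (le_lt_trans (ncD _ _)); rewrite (ncM (_%:C)) (ncM (_ ^+ N)) nc_real ger0_norm ?subr_ge0//.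
rewrite ncX nt [(t * nc c) ^+ _]exprMn.
have h1 : t ^+ N * nc c ^+ N * nc (g (z1 + t%:C * c) - g z1) <= t ^+ N * nc c ^+ N * (M * (t * nc c)).
  by rewrite ler_wpM2l// mulr_ge0 ?exprn_ge0 ?nc_ge0// ltW.
have h2 : t ^+ N * nc c ^+ N * (M * (t * nc c)) = t ^+ N * (t * K) by rewrite /K; ring.
have h3 : t * K < nc (W z1) by apply: le_lt_trans tK; rewrite ler_wpM2l ?(ltW tp)// lerDl.
have h4 : t ^+ N * (t * K) < t ^+ N * nc (W z1) by rewrite ltr_pM2l.
rewrite h2 in h1; lra.
Qed.

(** The minimum of [|W|] over the square is not on the boundary, where the value at the centre is
    exceeded; at an interior minimum [not_local_min] forces a zero. *)
Lemma box_zero (W : C -> C) (z0 : C) (r : R) : entfam (fun _ : R => W) -> 0 < r ->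
  (forall x y : R, `|x| <= r -> `|y| <= r -> (`|x| == r) || (`|y| == r) -> nc (W z0) < nc (W (z0 + (x +i* y)))) ->
  exists x y : R, [/\ `|x| <= r, `|y| <= r & W (z0 + (x +i* y)) = 0].
Proof.
move=> eW r0 hb; have cW := entire_nc_continuous (z0 := z0) eW.
have cK : compact (`[- r, r] `*` `[- r, r] : set (R * R)).
  by apply: compact_setX; exact: segment_compact.
have inK (p : R * R) : (p \in (`[- r, r] `*` `[- r, r] : set (R * R))) = (`|p.1| <= r) && (`|p.2| <= r).
  apply/idP/idP; rewrite inE /= !in_itv /= !ler_norml.
    by move=> [-> ->].
  by move=> /andP[-> ->].
have K0 : (`[- r, r] `*` `[- r, r] : set (R * R)) !=set0.
  by exists (0, 0); rewrite /= !in_itv /= oppr_le0 (ltW r0).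
have [p] := compact_EVT_min K0 cK (continuous_subspaceT cW).
rewrite inK => /andP[p1 p2] pmin.
exists p.1, p.2; split=> //; apply/eqP; apply: contraT => W1.
have h0 := pmin (0, 0); rewrite inK /= normr0 (ltW r0) in h0; have {}h0 := h0 isT.
have e00 : z0 + (0 +i* 0) = z0 :> C by apply: complexP; rewrite !ReImE /= addr0.
rewrite e00 in h0.
have p1' : `|p.1| < r.
  rewrite lt_neqAle p1 andbT; apply/negP => h; have := hb _ _ p1 p2; rewrite h => /(_ isT).
  by rewrite ltNge h0.
have p2' : `|p.2| < r.
  rewrite lt_neqAle p2 andbT; apply/negP => h; have := hb _ _ p1 p2; rewrite h orbT => /(_ isT).
  by rewrite ltNge h0.
set z1 := z0 + (p.1 +i* p.2) in W1 pmin h0.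
(* A boundary value witnesses that [W] is not constant. *)
have W2 : W (z0 + (r +i* 0)) != W z1.
  apply/eqP => h; have := hb r 0; rewrite normr0 (gtr0_norm r0) lexx (ltW r0) eqxx h => /(_ isT isT isT).
  by rewrite ltNge h0.
pose d := Num.min (r - `|p.1|) (r - `|p.2|).
have d0 : 0 < d by rewrite lt_min !subr_gt0 p1'.
have [z hz hW] := not_local_min eW W2 W1 d0.
have ez : z = z0 + ((p.1 + complex.Re (z - z1)) +i* (p.2 + complex.Im (z - z1))).
  by apply: complexP; rewrite /z1 !ReImE /=; ring.
have := pmin (p.1 + complex.Re (z - z1), p.2 + complex.Im (z - z1)); rewrite inK /= -ez.
move: hz; rewrite lt_min => /andP[z1' z2'].
have a1 : `|p.1 + complex.Re (z - z1)| <= r.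
  by rewrite (le_trans (ler_normD _ _))//; have := nc_Re (z - z1); lra.
have a2 : `|p.2 + complex.Im (z - z1)| <= r.
  by rewrite (le_trans (ler_normD _ _))//; have := nc_Im (z - z1); lra.
by rewrite a1 a2 => /(_ isT); rewrite leNgt hW.
Qed.

End MinimumModulus.

(** * The transfer matrix of two steps *)

Section TransferMatrix.
Variable R : realType.
Local Notation C := R[i].

Lemma nc_add (a b : C) (x y : R) : nc a <= x -> nc b <= y -> nc (a + b) <= x + y.
Proof. by move=> ha hb; rewrite (le_trans (ncD _ _))// lerD. Qed.

Lemma nc_mul (a b : C) (x y : R) : nc a <= x -> nc b <= y -> nc (a * b) <= x * y.
Proof. by move=> ha hb; rewrite ncM ler_pM ?nc_ge0. Qed.

Lemma nc_opp (a : C) (x : R) : nc a <= x -> nc (- a) <= x.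
Proof. by rewrite ncN. Qed.

(** Bookkeeping of relative errors through products, inverses and powers. *)
Definition near1 (t : R) (z : C) := nc (z - 1) <= t.

Lemma near1M (t u : R) (z w : C) : near1 t z -> near1 u w -> near1 (t + u + t * u) (z * w).
Proof.
move=> hz hw; rewrite /near1; have -> : z * w - 1 = (z - 1) + (w - 1) + (z - 1) * (w - 1) by ring.
by apply: nc_add; [exact: nc_add|exact: nc_mul].
Qed.

Lemma near1_ge (t : R) (z : C) : near1 t z -> 1 - t <= nc z.
Proof. by move=> h; have := ncB_ge 1 (1 - z); rewrite opprB addrCA subrr addr0 nc1 (ncBC 1); rewrite /near1 in h; lra. Qed.

Lemma near1_le (t : R) (z : C) : near1 t z -> nc z <= 1 + t.
Proof. by move=> h; rewrite -[z](subrK 1) addrC; apply: nc_add; rewrite ?nc1. Qed.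

Lemma near1V (t : R) (z : C) : near1 t z -> t <= 2^-1 -> near1 (2 * t) z^-1.
Proof.
move=> h t2; have z1 := near1_ge h; have z0 : z != 0 by rewrite -nc_gt0; lra.
rewrite /near1; have -> : z^-1 - 1 = (1 - z) / z by rewrite mulrBl divff// mul1r.
rewrite ncM ncV ler_pdivrMr ?nc_gt0// ncBC; have t0 := le_trans (nc_ge0 _) h.
rewrite /near1 in h; nra.
Qed.

(** The error is at most [(1 + t) ^ m - 1], and [(1 + t) ^ m <= exp (m t) <= 1 / (1 - m t)]. *)
Lemma near1X (t : R) (z : C) m : near1 t z -> m%:R * t <= 2^-1 -> near1 (2 * (m%:R * t)) (z ^+ m).
Proof.
move=> h ht; have t0 := le_trans (nc_ge0 _) h.
have : near1 ((1 + t) ^+ m - 1) (z ^+ m).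
  elim: m {ht} => [|m IH]; first by rewrite /near1 !expr0 !subrr nc0.
  have := near1M h IH; rewrite -exprS; rewrite /near1 => /le_trans; apply.
  by rewrite exprS le_eqVlt; apply/orP; left; apply/eqP; ring.
move=> /le_trans; apply; have e1 : (1 + t) ^+ m <= expR (m%:R * t).
  rewrite [m%:R * t]mulrC expRM_natr lerXn2r ?nnegrE ?expR_ge0 ?addr_ge0//; exact: expR_ge1Dx.
have mt0 : 0 <= m%:R * t by rewrite mulr_ge0.
have e2 : expR (m%:R * t) <= (1 - m%:R * t)^-1 by apply: expR_le_inv => //; lra.
have e3 : (1 - m%:R * t)^-1 <= 1 + 2 * (m%:R * t).
  rewrite -[X in X <= _]mul1r ler_pdivrMr; last by lra.
  by move: mt0 ht; set u := _ * t => *; nra.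
lra.
Qed.

Section Estimates.
Variables (eta e cp cm sp sm : C) (g : R).

(* [eta = i l h] and [e = +- h ^ 2] for steps of length [h]; [cp] and [sp] stand for
   [cosh (sqrt (eta ^ 2 + e))] and [sinh (sqrt (eta ^ 2 + e)) / sqrt (eta ^ 2 + e)], and
   [cm], [sm] for the same with [- e]. *)
Record tdata : Prop := TData {
  td_g0 : 0 < g; td_g1 : 1000 * g <= 1; td_eta : nc eta = g; td_e : nc e <= g ^+ 2;
  td_cp : nc (cp - (1 + (eta ^+ 2 + e) / 2)) <= g ^+ 4;
  td_cm : nc (cm - (1 + (eta ^+ 2 - e) / 2)) <= g ^+ 4;
  td_sp : nc (sp - 1) <= g ^+ 2; td_sm : nc (sm - 1) <= g ^+ 2;
  td_dp : cp ^+ 2 - (eta ^+ 2 + e) * sp ^+ 2 = 1;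
  td_dm : cm ^+ 2 - (eta ^+ 2 - e) * sm ^+ 2 = 1
}.

(* [2 * tX] is the trace of the transfer matrix of two steps, and [2 * ka * tP], with
   [ka = i l], the value of the form [phi ka] after two steps from the data [(1, - ka)]. *)
Definition tX := cm * cp + eta ^+ 2 * (sm * sp).
Definition tP := tX - eta * (cm * sp + sm * cp) - e / (2 * eta) * (cm * sp - sm * cp).

Lemma nc_two : nc (2 : C) = 2. Proof. exact: nc_nat. Qed.
Lemma nc_twoV : nc (2^-1 : C) <= 2^-1. Proof. by rewrite ncV nc_two. Qed.

Lemma pow_small : tdata -> [/\ 0 < g ^+ 2, 0 < g ^+ 3, 0 < g ^+ 4, 0 < g ^+ 6 & 0 < g ^+ 8] /\
  [/\ 1000 * g ^+ 2 <= g, 1000 * g ^+ 3 <= g ^+ 2, 1000 * g ^+ 4 <= g ^+ 3, 1000 * g ^+ 6 <= g ^+ 4 & 1000 * g ^+ 8 <= g ^+ 6].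
Proof.
move=> [g0 g1 _ _ _ _ _ _ _ _]; split; first by split; exact: exprn_gt0.
have h k : 1000 * g ^+ k.+1 <= g ^+ k.
  by rewrite exprS mulrA ler_piMl// exprn_ge0// ltW.
have h2 k : 1000 * g ^+ k.+2 <= g ^+ k.
  have := h k; have := h k.+1; have : 0 <= g ^+ k.+1 by rewrite exprn_ge0// ltW.
  by move: (g ^+ k) (g ^+ k.+1) (g ^+ k.+2) => x y z; rlra.
by split; [exact: h 1%N|exact: h|exact: h|exact: h2|exact: h2].
Qed.

Lemma tdata_eta : tdata -> [/\ eta != 0, nc eta <= g & nc (eta ^+ 2) <= g ^+ 2].
Proof.
by move=> [g0 _ hg _ _ _ _ _ _ _]; rewrite -nc_gt0 ncX hg. Qed.

Ltac prep := move=> T; have [eta0 heta heta2] := tdata_eta T;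
  have [[g20 g30 g40 g60 g80] [l2 l3 l4 l6 l8]] := pow_small T;
  have [g0 g1 hg he hcp hcm hsp hsm dp dm] := T; have nn2 := nc_two; have nn2V := nc_twoV.

Lemma tdata_cp : tdata -> nc (cp - 1) <= 2 * g ^+ 2.
Proof.
prep; have -> : cp - 1 = (cp - (1 + (eta ^+ 2 + e) / 2)) + (eta ^+ 2 + e) / 2 by ring.
have := nc_add hcp (nc_mul (nc_add heta2 he) nc_twoV); move=> /le_trans; apply.
rlra.
Qed.

Lemma tdata_cm : tdata -> nc (cm - 1) <= 2 * g ^+ 2.
Proof.
prep; have -> : cm - 1 = (cm - (1 + (eta ^+ 2 - e) / 2)) + (eta ^+ 2 - e) / 2 by ring.
have := nc_add hcm (nc_mul (nc_add heta2 (nc_opp he)) nc_twoV); move=> /le_trans; apply.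
rlra.
Qed.

(** The terms linear in [e] cancel at order [g ^ 2] between the two steps of opposite sign, which
    leaves the expansion of the free half-trace [cosh (2 eta)]. *)
Lemma tX_approx : tdata -> nc (tX - (1 + 2 * eta ^+ 2)) <= 8 * g ^+ 4.
Proof.
prep; set rp := cp - (1 + (eta ^+ 2 + e) / 2) in hcp; set rm := cm - (1 + (eta ^+ 2 - e) / 2) in hcm.
have n2' := @two_neq0 R.
have -> : tX - (1 + 2 * eta ^+ 2) = (eta ^+ 2 / 2 * (eta ^+ 2 / 2) - e / 2 * (e / 2)) +
  (rm * (cp - 1) + rm) + ((eta ^+ 2 - e) / 2 * rp + rp) + eta ^+ 2 * ((sm - 1) * (sp - 1) + (sm - 1) + (sp - 1)).
  by rewrite /tX /rp /rm; field.
have a1 := nc_mul heta2 nc_twoV; have a2 := nc_mul he nc_twoV.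
have := nc_add (nc_add (nc_add (nc_add (nc_mul a1 a1) (nc_opp (nc_mul a2 a2)))
  (nc_add (nc_mul hcm (tdata_cp T)) hcm)) (nc_add (nc_mul (nc_mul (nc_add heta2 (nc_opp he)) nc_twoV) hcp) hcp))
  (nc_mul heta2 (nc_add (nc_add (nc_mul hsm hsp) hsm) hsp)).
move=> /le_trans; apply; rlra.
Qed.

Lemma tdata_cmsp : tdata -> nc (cm * sp - 1) <= 4 * g ^+ 2.
Proof.
prep; have := near1M (tdata_cm T) hsp; rewrite /near1 => /le_trans; apply; rlra. Qed.

Lemma tdata_smcp : tdata -> nc (sm * cp - 1) <= 4 * g ^+ 2.
Proof.
prep; have := near1M hsm (tdata_cp T); rewrite /near1 => /le_trans; apply; rlra. Qed.

Lemma tdata_diff : tdata -> nc (cm * sp - sm * cp) <= 8 * g ^+ 2.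
Proof.
prep; have -> : cm * sp - sm * cp = (cm * sp - 1) - (sm * cp - 1) by ring.
by have := nc_add (tdata_cmsp T) (nc_opp (tdata_smcp T)); move=> /le_trans; apply; rlra.
Qed.

(** The term of [tP] divided by [eta] carries [e] and the difference [cm * sp - sm * cp], each of
    order [g ^ 2], so it is of order [g ^ 3]. *)
Lemma tX_tP : tdata -> nc (tX - tP - 2 * eta) <= 12 * g ^+ 3.
Proof.
prep; have -> : tX - tP - 2 * eta = eta * ((cm * sp - 1) + (sm * cp - 1)) + e / 2 / eta * (cm * sp - sm * cp).
  rewrite /tP; move: (@two_neq0 R) eta0 => u v; field; rewrite ?u ?v//.
have hi : nc eta^-1 <= g^-1 by rewrite ncV hg.
have h1 : nc eta <= g by rewrite hg.
have := nc_add (nc_mul h1 (nc_add (tdata_cmsp T) (tdata_smcp T))) (nc_mul (nc_mul (nc_mul he nc_twoV) hi) (tdata_diff T)).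
move=> /le_trans; apply.
have -> : g ^+ 2 * 2^-1 / g * (8 * g ^+ 2) = 4 * g ^+ 3 by field; rewrite gt_eqF.
have -> : g * (4 * g ^+ 2 + 4 * g ^+ 2) = 8 * g ^+ 3 by ring.
rlra.
Qed.

Definition tQ := e ^+ 2 * ((sm * sp) ^+ 2 - ((cm * sp - sm * cp) / (2 * eta)) ^+ 2).

(** Since [m + 1 / m = 2 X], the product is [2 X P - 1 - P ^ 2]. With [1] replaced by the product of
    the two determinant relations, everything but the terms in [e ^ 2] cancels identically. *)
Lemma tQ_eq (m : C) : tdata -> m != 0 -> m ^+ 2 - 2 * tX * m + 1 = 0 -> (m - tP) * (tP - m^-1) = tQ.
Proof.
prep; move=> m0 hm; have hX : 2 * tX = m + m^-1.
  apply: (mulIf m0); rewrite [RHS]mulrDl mulVf//.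
  by apply/eqP; rewrite -subr_eq0 -oppr_eq0 -hm; apply/eqP; ring.
have -> : (m - tP) * (tP - m^-1) = 2 * tX * tP - 1 - tP ^+ 2.
  by rewrite hX; field; rewrite m0.
have dd : (cp ^+ 2 - (eta ^+ 2 + e) * sp ^+ 2) * (cm ^+ 2 - (eta ^+ 2 - e) * sm ^+ 2) = 1.
  by rewrite dp dm mulr1.
have -> : 2 * tX * tP - 1 - tP ^+ 2 = 2 * tX * tP - (cp ^+ 2 - (eta ^+ 2 + e) * sp ^+ 2) *
    (cm ^+ 2 - (eta ^+ 2 - e) * sm ^+ 2) - tP ^+ 2 by rewrite dd.
rewrite /tQ /tP /tX; move: (@two_neq0 R) eta0 => u v; field; rewrite ?u ?v//.
Qed.

Lemma tQ_approx : tdata -> exists2 b : C, near1 (40 * g ^+ 2) b & tQ = e ^+ 2 * b.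
Proof.
prep; exists ((sm * sp) ^+ 2 - ((cm * sp - sm * cp) / (2 * eta)) ^+ 2) => //.
have h1 := near1M hsm hsp; have h2 := near1M h1 h1.
have hi : nc (2 * eta)^-1 <= (2 * g)^-1 by rewrite ncV ncM nc_two hg.
have h3 := nc_mul (tdata_diff T) hi.
rewrite /near1 !expr2; set w := _ / _ in h3 *.
have -> : sm * sp * (sm * sp) - w * w - 1 = (sm * sp * (sm * sp) - 1) - w * w by ring.
have := nc_add h2 (nc_opp (nc_mul h3 h3)); move=> /le_trans; apply.
have -> : 8 * g ^+ 2 / (2 * g) * (8 * g ^+ 2 / (2 * g)) = 16 * g ^+ 2 by field; rewrite gt_eqF.
pose t := g ^+ 2 + g ^+ 2 + g ^+ 2 * g ^+ 2; rewrite -/t; have t3 : t <= 3 * g ^+ 2 by rewrite /t; rlra.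
have t0 : 0 <= t by rewrite /t !addr_ge0 ?mulr_ge0// ltW.
have tt : t * t <= 3 * g ^+ 2 * (3 * g ^+ 2) by apply: ler_pM.
move: tt; rlra.
Qed.

(** The characteristic polynomial at [nu = exp (2 eta)] is [O (g ^ 4)] and factors as
    [(nu - m1) (nu - m2)]. The two factors add up to [2 (nu - X)], close to [4 eta], so the larger
    has modulus at least [1.9 g] and the smaller is [O (g ^ 3)]. *)
Lemma eigenvalue_approx : tdata -> exists m : C, [/\ m != 0, m ^+ 2 - 2 * tX * m + 1 = 0,
  nc (m - cexp (2 * eta)) <= 20 * g ^+ 3 & nc (m - tX - 2 * eta) <= 25 * g ^+ 3].
Proof.
prep; set nu := cexp (2 * eta).
have n2e : nc (2 * eta) = 2 * g by rewrite ncM nc_two hg.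
have E : expR (2 * g) <= 2.
  have h1 : 2 * g < 1 by rlra.
  have h0 : 0 <= 2 * g by rlra.
  apply: (le_trans (expR_le_inv h0 h1)); rewrite -[X in _ <= X]invrK lef_pV2 ?posrE ?invr_gt0 ?subr_gt0//; rlra.
(* The cubic terms cancel in [nu + 1 / nu], which is why the expansion with error [g ^ 4] is carried
   along. *)
have tayl (w : C) : nc w = 2 * g -> nc (cexp w - (1 + w + w ^+ 2 / 2)) <= 4 * g ^+ 3 /\
    nc (cexp w - (1 + w + w ^+ 2 / 2 + w ^+ 3 / 6)) <= 2 * g ^+ 4.
  move=> hw; have t3 := cexp_taylor 3 w; have t4 := cexp_taylor 4 w.
  have e3 : cexp_sum 3 w = 1 + w + w ^+ 2 / 2.
    by rewrite /cexp_sum !big_ord_recr big_ord0 /= fact0 (_ : 1`! = 1)%N// (_ : 2`! = 2)%N// expr0 expr1 add0r; field.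
  have e4 : cexp_sum 4 w = 1 + w + w ^+ 2 / 2 + w ^+ 3 / 6.
    rewrite /cexp_sum !big_ord_recr big_ord0 /= fact0 (_ : 1`! = 1)%N// (_ : 2`! = 2)%N//.
    by rewrite (_ : 3`! = 6)%N// expr0 expr1 add0r; field.
  rewrite e3 hw in t3; rewrite e4 hw in t4; split.
    apply: (le_trans t3); have : (2 * g) ^+ 3 / (3`!)%:R * expR (2 * g) <= (2 * g) ^+ 3 / (3`!)%:R * 2.
      by rewrite ler_wpM2l// divr_ge0// exprn_ge0// mulr_ge0// ltW.
    move=> /le_trans; apply; rewrite (_ : 3`! = 6)%N//.
    have -> : (2 * g) ^+ 3 / 6 * 2 = 8 / 3 * g ^+ 3 by field.
    by rlra.
  apply: (le_trans t4); have : (2 * g) ^+ 4 / (4`!)%:R * expR (2 * g) <= (2 * g) ^+ 4 / (4`!)%:R * 2.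
    by rewrite ler_wpM2l// divr_ge0// exprn_ge0// mulr_ge0// ltW.
  move=> /le_trans; apply; rewrite (_ : 4`! = 24)%N//.
  have -> : (2 * g) ^+ 4 / 24 * 2 = 4 / 3 * g ^+ 4 by field.
  by rlra.
have [ta tb] := tayl _ n2e.
have n2e' : nc (- (2 * eta)) = 2 * g by rewrite ncN.
have [_ tc] := tayl _ n2e'.
have nu0 : nu != 0 by exact: cexp_neq0.
have nuV : cexp (- (2 * eta)) = nu^-1 by rewrite cexpN.
rewrite -/nu in ta tb; rewrite nuV in tc.
set r3 := nu - _ in ta; set r4 := nu - _ in tb; set r4' := nu^-1 - _ in tc.
have hY : nu + nu^-1 - 2 * (1 + 2 * eta ^+ 2) = r4 + r4' by rewrite /r4 /r4'; field.
have hf : nc (nu ^+ 2 - 2 * tX * nu + 1) <= 22 * g ^+ 4.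
  have -> : nu ^+ 2 - 2 * tX * nu + 1 = nu * (r4 + r4' + 2 * - (tX - (1 + 2 * eta ^+ 2))).
    by rewrite -hY; field.
  have hnu : nc nu <= 1 + 20^-1.
    have -> : nu = 1 + (2 * eta + (2 * eta) ^+ 2 / 2 + r3) by rewrite /r3; ring.
    have h1 : nc (2 * eta) <= 2 * g by rewrite n2e.
    have h2 : nc ((2 * eta) ^+ 2) <= (2 * g) ^+ 2 by rewrite ncX n2e.
    have n1 : nc (1 : C) <= 1 by rewrite nc1.
    have := nc_add n1 (nc_add (nc_add h1 (nc_mul h2 nc_twoV)) ta); move=> /le_trans; apply.
    rlra.
  have n2' : nc (2 : C) <= 2 by rewrite nc_two.
  have := nc_mul hnu (nc_add (nc_add tb tc) (nc_mul n2' (nc_opp (tX_approx T)))).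
  move=> /le_trans; apply; rlra.
pose m1 : C := tX + sqrtc (tX ^+ 2 - 1); pose m2 : C := tX - sqrtc (tX ^+ 2 - 1).
have m12 : m1 * m2 = 1.
  rewrite /m1 /m2; have -> : (tX + sqrtc (tX ^+ 2 - 1)) * (tX - sqrtc (tX ^+ 2 - 1)) = tX ^+ 2 - sqrtc (tX ^+ 2 - 1) ^+ 2 by ring.
  by rewrite sqr_sqrtc; ring.
have m1D : m1 + m2 = 2 * tX by rewrite /m1 /m2; ring.
have fac : nu ^+ 2 - 2 * tX * nu + 1 = (nu - m1) * (nu - m2) by rewrite -m1D -m12; ring.
have enu : nu - tX = 2 * eta + (r3 - (tX - (1 + 2 * eta ^+ 2))) by rewrite /r3; field.
have main0 (a b : C) : a * b = 1 -> a + b = 2 * tX -> nc (nu - a) <= nc (nu - b) ->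
    [/\ a != 0, a ^+ 2 - 2 * tX * a + 1 = 0 & nc (a - nu) <= 20 * g ^+ 3].
  move=> ab apb hle; split.
  - by apply/eqP => h; move/eqP: ab; rewrite h mul0r eq_sym oner_eq0.
  - by rewrite -apb -ab; ring.
  have hfac : nu ^+ 2 - 2 * tX * nu + 1 = (nu - a) * (nu - b) by rewrite -apb -ab; ring.
  have low : 19 / 10 * g <= nc (nu - b).
    have h2 : nc (2 * (nu - tX)) <= 2 * nc (nu - b).
      have -> : 2 * (nu - tX) = (nu - a) + (nu - b) by rewrite mulrBr -apb; ring.
      apply: (le_trans (ncD _ _)); move: hle; rlra.
    rewrite ncM nc_two in h2.
    have := ncD_ge (2 * eta) (r3 - (tX - (1 + 2 * eta ^+ 2))); rewrite -enu n2e.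
    have := nc_add ta (nc_opp (tX_approx T)); move: h2; rlra.
  have p0 : 0 < 19 / 10 * g by rewrite mulr_gt0// divr_gt0.
  have : nc (nu - a) * (19 / 10 * g) <= 22 * g ^+ 4.
    by apply: le_trans hf; rewrite hfac ncM ler_wpM2l ?nc_ge0.
  rewrite -ler_pdivlMr// ncBC => /le_trans; apply.
  rewrite ler_pdivrMr//; have -> : 20 * g ^+ 3 * (19 / 10 * g) = 38 * g ^+ 4 by field.
  rlra.
have main (a b : C) : a * b = 1 -> a + b = 2 * tX -> nc (nu - a) <= nc (nu - b) ->
    [/\ a != 0, a ^+ 2 - 2 * tX * a + 1 = 0, nc (a - nu) <= 20 * g ^+ 3 & nc (a - tX - 2 * eta) <= 25 * g ^+ 3].
  move=> ab apb hle; have [k1 k2 k3] := main0 a b ab apb hle; split=> //.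
  have -> : a - tX - 2 * eta = (a - nu) + (nu - tX - 2 * eta) by ring.
  have -> : nu - tX - 2 * eta = r3 + - (tX - (1 + 2 * eta ^+ 2)) by rewrite enu; ring.
  by have := nc_add k3 (nc_add ta (nc_opp (tX_approx T))); move=> /le_trans; apply; rlra.
have [h|/ltW h] := lerP (nc (nu - m1)) (nc (nu - m2)).
  by exists m1; exact: (main m1 m2).
by exists m2; apply: (main m2 m1); rewrite // ?[m2 * _]mulrC ?[m2 + _]addrC.
Qed.

End Estimates.

End TransferMatrix.

(** * Powers of the transfer matrix *)

Section Alternating.
Variable R : realType.
Local Notation C := R[i].

(** The recurrence has the characteristic roots [m] and [1 / m]; the factor [m - 1 / m] clears the
    denominator of its general solution. *)
Lemma two_term (a : nat -> C) (m X : C) : m != 0 -> m ^+ 2 - 2 * X * m + 1 = 0 ->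
  (forall j, a j.+2 = 2 * X * a j.+1 - a j) ->
  forall j, a j * (m - m^-1) = m ^- j * (m * a 0%N - a 1%N) + m ^+ j * (a 1%N - m^-1 * a 0%N).
Proof.
move=> m0 hm ha; have hX : 2 * X = m + m^-1.
  apply: (mulIf m0); rewrite [RHS]mulrDl mulVf//.
  by apply/eqP; rewrite -subr_eq0 -oppr_eq0 -hm; apply/eqP; ring.
have mi (j : nat) : m ^- j.+1 = m ^- j * m^-1 by rewrite exprSr invfM.
suff h j : (a j * (m - m^-1) = m ^- j * (m * a 0%N - a 1%N) + m ^+ j * (a 1%N - m^-1 * a 0%N)) /\
   (a j.+1 * (m - m^-1) = m ^- j.+1 * (m * a 0%N - a 1%N) + m ^+ j.+1 * (a 1%N - m^-1 * a 0%N)).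
  by move=> j; have [] := h j.
elim: j => [|j [h1 h2]].
  split; first by rewrite expr0 invr1; ring.
  rewrite expr1; move: (a 0%N) (a 1%N) => x y.
  have -> : m^-1 * (m * x - y) + m * (y - m^-1 * x) = (m^-1 * m) * x - m^-1 * y + m * y - m * m^-1 * x by ring.
  by rewrite mulVf// divff//; ring.
split=> //.
have -> : a j.+2 * (m - m^-1) = 2 * X * (a j.+1 * (m - m^-1)) - a j * (m - m^-1) by rewrite ha; ring.
rewrite h1 h2 hX !mi !exprS.
have v0 : m ^+ j != 0 by rewrite expf_neq0.
move: (m ^+ j) v0 (a 0%N) (a 1%N) => v v0 x y.
by field; rewrite m0 v0.
Qed.

Lemma near1_le_trans (t u : R) (z : C) : near1 t z -> t <= u -> near1 u z.
Proof. exact: le_trans. Qed.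

Lemma cexp_mulnat (z : C) n : cexp z ^+ n = cexp (n%:R * z).
Proof. by rewrite cexpX. Qed.

(* [a n] is the quantity [Om], and [1 + v z] its oscillating factor. *)
Lemma alternating_factor (eta e cp cm sp sm ka : C) (g : R) (n : nat) (a : nat -> C) :
  tdata eta e cp cm sp sm g -> ka = (2 * n)%:R * eta -> 1000 * (10 * (n%:R * g ^+ 3)) <= 1 ->
  a 0%N = 2 * ka -> a 1%N = 2 * ka * tP eta e cp cm sp sm ->
  (forall j, a j.+2 = 2 * tX eta cp cm sp sm * a j.+1 - a j) ->
  exists u v : C, [/\ near1 50^-1 u, near1 50^-1 v &
    a n = 2 * ka * cexp (- ka) * u * (1 + cexp (2 * ka) * (e ^+ 2 / (16 * eta ^+ 2)) * v)].
Proof.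
move=> T hka hn a0 a1 ha.
have [m [m0 hm m1 m2]] := eigenvalue_approx T.
have [eta0 heta heta2] := tdata_eta T; have [[g20 g30 g40 _ _] [l2 l3 _ _ _]] := pow_small T.
have [g0 g1 hg _ _ _ _ _ _ _] := T.
have sol := two_term m0 hm ha n.
have XP := tX_tP T; have Qe := tQ_eq T m0 hm; have [b nb Qb] := tQ_approx T.
set X := tX _ _ _ _ _ in ha hm m2 XP; set P := tP _ _ _ _ _ _ in XP Qe a1.
set Q := tQ _ _ _ _ _ _ in Qe Qb; set D := m - P; set E := m - m^-1 in sol.
have n4 : nc (4 * eta) = 4 * g by rewrite ncM nc_nat hg.
have e4 : 4 * eta != 0 by rewrite -nc_gt0 n4 mulr_gt0.
have rel (z : C) (t : R) : nc (z - 4 * eta) <= 4 * (t * g ^+ 3) -> near1 (t * g ^+ 2) (z / (4 * eta)).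
  move=> h; rewrite /near1; have -> : z / (4 * eta) - 1 = (z - 4 * eta) / (4 * eta).
    by rewrite mulrBl divff.
  rewrite ncM ncV n4 ler_pdivrMr ?mulr_gt0//; apply: (le_trans h).
  by rewrite le_eqVlt; apply/orP; left; apply/eqP; ring.
(* Both [D] and [E] are [4 eta] up to a relative error of order [g ^ 2]. *)
have nD : near1 (10 * g ^+ 2) (D / (4 * eta)).
  apply: rel; have -> : D - 4 * eta = (m - X - 2 * eta) + (X - P - 2 * eta) by rewrite /D; ring.
  by have := nc_add m2 XP; move=> /le_trans; apply; rlra.
have nE : near1 (13 * g ^+ 2) (E / (4 * eta)).
  apply: rel; have -> : E - 4 * eta = 2 * (m - X - 2 * eta).
    have hX : 2 * X = m + m^-1.
      apply: (mulIf m0); rewrite [RHS]mulrDl mulVf//.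
      by apply/eqP; rewrite -subr_eq0 -oppr_eq0 -hm; apply/eqP; ring.
    have -> : 2 * (m - X - 2 * eta) = 2 * m - 2 * X - 4 * eta by ring.
    by rewrite hX /E; ring.
  by rewrite ncM nc_nat; lra.
set nu := cexp (2 * eta) in m1.
have nu0 : nu != 0 by exact: cexp_neq0.
have nul : 99 / 100 <= nc nu.
  rewrite /nu nc_cexp; apply: le_trans (expR_ge1Dx _).
  have := nc_Re (2 * eta); rewrite ncM nc_nat hg ler_norml => /andP[h _].
  by move: h g1; rlra.
have nm : near1 (22 * g ^+ 3) (m / nu).
  rewrite /near1; have -> : m / nu - 1 = (m - nu) / nu by rewrite mulrBl divff.
  rewrite ncM ncV ler_pdivrMr; last by lra.
  by apply: (le_trans m1); move: nul g30; nra.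
have ng0 : 0 <= n%:R * g ^+ 3 by rewrite mulr_ge0// ltW.
(* The relative error of [m], of order [g ^ 3], is amplified by the power [n]; it stays small
   because [n * g ^ 3 <= 1 / 10000]. *)
have nmn : near1 (1 / 200) ((m / nu) ^+ n).
  have h : n%:R * (22 * g ^+ 3) <= 2^-1 by move: hn ng0; rlra.
  by apply: (near1_le_trans (near1X nm h)); move: hn ng0; rlra.
have nm2n : near1 (1 / 100) ((m / nu) ^+ (2 * n)).
  have h : (2 * n)%:R * (22 * g ^+ 3) <= 2^-1 by rewrite natrM; move: hn ng0; rlra.
  by apply: (near1_le_trans (near1X nm h)); rewrite natrM; move: hn ng0; rlra.
have gs : 1000 * (1000 * g ^+ 2) <= 1 by move: l2 g1; rlra.
have D0 : D != 0.
  have := near1_ge nD => h; apply/eqP => h0; move: h; rewrite h0 mul0r nc0; move: gs; rlra.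
have E0 : E != 0.
  have := near1_ge nE => h; apply/eqP => h0; move: h; rewrite h0 mul0r nc0; move: gs; rlra.
have nD1 : near1 (1 / 1000) (D / (4 * eta)) by apply: near1_le_trans nD _; move: gs; rlra.
have nE1 : near1 (1 / 1000) (E / (4 * eta)) by apply: near1_le_trans nE _; move: gs; rlra.
have nb1 : near1 (1 / 1000) b by apply: near1_le_trans nb _; move: gs; rlra.
have h2 : (1 / 200 : R) <= 2^-1 by rlra.
have h3 : (1 / 1000 : R) <= 2^-1 by rlra.
exists (((m / nu) ^+ n)^-1 * ((D / (4 * eta)) * (E / (4 * eta))^-1)).
exists ((m / nu) ^+ (2 * n) * (b * ((D / (4 * eta))^-1 * (D / (4 * eta))^-1))).
split.
- have := near1M (near1V nmn h2) (near1M nD1 (near1V nE1 h3)).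
  by move=> /near1_le_trans; apply; rlra.
- have := near1M nm2n (near1M nb1 (near1M (near1V nD1 h3) (near1V nD1 h3))).
  by move=> /near1_le_trans; apply; rlra.
have nun : nu ^+ n = cexp ka by rewrite /nu cexp_mulnat hka; congr cexp; rewrite natrM; ring.
have nu2n : nu ^+ (2 * n) = cexp (2 * ka) by rewrite mulnC exprM nun cexp_mulnat; congr cexp.
apply: (mulIf E0); rewrite sol a0 a1.
(* The small coefficient comes from the exact product [Q]; the approximation of [m] is too coarse to
   give it as a difference. *)
have PQ : P - m^-1 = Q / D by rewrite -Qe -/D mulrAC divff// mul1r.
have -> : 2 * ka * P - m^-1 * (2 * ka) = 2 * ka * (P - m^-1) by ring.
rewrite PQ Qb; have -> : m * (2 * ka) - 2 * ka * P = 2 * ka * D by rewrite /D; ring.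
rewrite !expr_div_n nu2n cexpN -nun.
have -> : m ^+ (2 * n) = m ^+ n * m ^+ n by rewrite mul2n -addnn exprD.
have -> : cexp (2 * ka) = nu ^+ n * nu ^+ n by rewrite -nu2n mul2n -addnn exprD.
have mn0 : m ^+ n != 0 by rewrite expf_neq0.
have vn0 : nu ^+ n != 0 by rewrite expf_neq0.
have gen (M N D' E' : C) : M != 0 -> N != 0 -> D' != 0 -> E' != 0 ->
  M^-1 * (2 * ka * D') + M * (2 * ka * (e ^+ 2 * b / D')) =
  2 * ka / N * ((M / N)^-1 * (D' / (4 * eta) / (E' / (4 * eta)))) *
  (1 + N * N * (e ^+ 2 / (16 * eta ^+ 2)) *
   (M * M / (N * N) * (b * ((D' / (4 * eta))^-1 / (D' / (4 * eta)))))) * E'.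
  by move=> M0 N0 D'0 E'0; field; rewrite ?M0 ?N0 ?D'0 ?E'0 ?eta0.
exact: gen.
Qed.

End Alternating.

(** * The Wronskian of the alternating potential *)

Section AlternatingSteps.
Variable R : realType.
Local Notation C := R[i].
Implicit Types (l : C) (h sg : R).

(** [sg] is the value on the leftmost step; for the oscillating potential it is the parity sign of
    [n]. *)
Definition altv sg (j : nat) : R := (-1) ^+ j * sg.

Definition altseq h sg (k : nat) : seq (R * R) :=
  [seq (- 2^-1 + j%:R * h, altv sg j) | j <- iota 0 k].

Lemma altseqS h sg k : altseq h sg k.+1 = rcons (altseq h sg k) (- 2^-1 + k%:R * h, altv sg k).
Proof. by rewrite /altseq -(addn1 k) iotaD map_cat /= cats1. Qed.

Lemma altv_norm sg j : `|altv sg j| = `|sg|.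
Proof. by rewrite /altv normrM normrX normrN1 expr1n mul1r. Qed.

Lemma altseq_path h sg k : 0 <= h ->
  path (fun a b => a <= b) (- 2^-1) [seq av.1 | av <- altseq h sg k] /\
  last (- 2^-1) [seq av.1 | av <- altseq h sg k] <= - 2^-1 + k%:R * h.
Proof.
move=> h0; elim: k => [|k [IH1 IH2]]; first by rewrite /= mul0r addr0.
rewrite altseqS map_rcons rcons_path last_rcons IH1 IH2 /=; split=> //.
by rewrite lerD2l ler_wpM2r// ler_nat.
Qed.

Lemma altseq_data h sg k : 0 <= h -> `|sg| <= 1 -> k%:R * h = 1 ->
  stepdata (- 2^-1) 2^-1 (altseq h sg k).
Proof.
move=> h0 s1 kh; have [h1 h2] := altseq_path sg k h0; split=> //.
  by apply: (le_trans h2); rewrite kh; lra.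
by move=> av /mapP[j _ ->] /=; rewrite altv_norm.
Qed.

Lemma steppot_alt h sg k x : 0 <= h ->
  (x <= - 2^-1 -> steppot (altseq h sg k) x = 0) /\
  (forall j, (j < k)%N -> - 2^-1 + j%:R * h < x <= - 2^-1 + j.+1%:R * h ->
    steppot (altseq h sg k) x = altv sg j).
Proof.
move=> h0; elim: k => [|k [IH1 IH2]]; first by split.
rewrite altseqS steppot_rcons /=; split=> [hx|j].
  by rewrite ifT ?IH1// (le_trans hx)// lerDl mulr_ge0.
rewrite ltnS leq_eqVlt => /orP[/eqP ->|jk] /andP[x1 x2].
  by rewrite leNgt x1.
rewrite ifT ?(IH2 j jk)// ?x1//; apply: (le_trans x2).
by rewrite lerD2l ler_wpM2r// ler_nat.
Qed.

Lemma stepsol_alt h sg l Y k : 0 <= h ->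
  stepsol l (- 2^-1) Y (altseq h sg k.+1) (- 2^-1 + k.+1%:R * h) =
  estep ((altv sg k)%:C - l ^+ 2) h (stepsol l (- 2^-1) Y (altseq h sg k) (- 2^-1 + k%:R * h)).
Proof.
move=> h0; rewrite altseqS stepsol_right; last by rewrite lerD2l ler_wpM2r// ler_nat.
by congr estep; rewrite -natr1; ring.
Qed.

Definition twostep h sg l (Y : C * C) : C * C :=
  estep (- sg%:C - l ^+ 2) h (estep (sg%:C - l ^+ 2) h Y).

Lemma stepsol_alt2 h sg l Y k : 0 <= h ->
  stepsol l (- 2^-1) Y (altseq h sg (2 * k)) (- 2^-1 + (2 * k)%:R * h) = iter k (twostep h sg l) Y.
Proof.
move=> h0; elim: k => [|k IH].
  by rewrite muln0 /= mul0r addr0 /stepsol /= subrr estep0.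
rewrite mulnS !addSn add0n !stepsol_alt// IH iterS /twostep.
have e1 : altv sg (2 * k).+1 = - sg by rewrite /altv exprS exprM sqrrN expr1n expr1n mulr1 mulN1r.
have e2 : altv sg (2 * k) = sg by rewrite /altv exprM sqrrN expr1n expr1n mul1r.
by rewrite e1 e2 rmorphN.
Qed.

(** Taylor bounds at the argument [y = |sqrt (sg - l ^ 2)| h], for which [y ^ 2 <= 2 g ^ 2]: both
    [|eta| ^ 2] and [|e|] are at most [g ^ 2], because [1 <= nc ka] gives [h <= g]. *)
Lemma step_tdata h sg l : sg ^+ 2 = 1 -> 0 < h -> 1 <= nc ('i%C * l) -> 1000 * (nc ('i%C * l) * h) <= 1 ->
  let ka := 'i%C * l in
  tdata (ka * h%:C) (sg * h ^+ 2)%:C (coshs (sg%:C - l ^+ 2) h) (coshs (- sg%:C - l ^+ 2) h)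
    (sinhs (sg%:C - l ^+ 2) h / h%:C) (sinhs (- sg%:C - l ^+ 2) h / h%:C) (nc ka * h).
Proof.
move=> s1 h0 k1 g1 ka; have kl : ka ^+ 2 = - l ^+ 2 by rewrite exprMn expr2 sqri mulN1r.
have hC : h%:C != 0 :> C by rewrite -nc_gt0 nc_real gtr0_norm.
have nh : nc h%:C = h by rewrite nc_real gtr0_norm.
set g := nc ka * h in g1 *; have g0 : 0 < g by rewrite mulr_gt0// (lt_le_trans ltr01).
have hg : h <= g by rewrite /g ler_peMl// ltW.
have ns : `|sg| = 1.
  by apply/eqP; rewrite -(@eqrXn2 _ 2)// expr1n real_normK ?num_real// s1.
have main (s : R) : s ^+ 2 = 1 -> let z := s%:C - l ^+ 2 in
   [/\ nc (coshs z h - (1 + ((ka * h%:C) ^+ 2 + (s * h ^+ 2)%:C) / 2)) <= g ^+ 4,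
    nc (sinhs z h / h%:C - 1) <= g ^+ 2 &
    coshs z h ^+ 2 - ((ka * h%:C) ^+ 2 + (s * h ^+ 2)%:C) * (sinhs z h / h%:C) ^+ 2 = 1].
  move=> ss z; have zh : (ka * h%:C) ^+ 2 + (s * h ^+ 2)%:C = z * h%:C ^+ 2.
    by rewrite /z exprMn kl rmorphM rmorphXn /=; ring.
  have ns' : `|s| = 1.
    by apply/eqP; rewrite -(@eqrXn2 _ 2)// expr1n real_normK ?num_real// ss.
  have sq := sqr_sqrtc z; set b := sqrtc z in sq.
  set y := nc b * `|h|; have y0 : 0 <= y by rewrite mulr_ge0 ?nc_ge0.
  have y2 : y ^+ 2 <= 2 * g ^+ 2.
    have -> : y ^+ 2 = nc (z * h%:C ^+ 2).
      by rewrite /y exprMn -(ncX b) sq (ncM z) (ncX h%:C) nh (gtr0_norm h0).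
    rewrite -zh (le_trans (ncD _ _))// ncX ncM nh -/g nc_real normrM ns' mul1r.
    by rewrite ger0_norm ?sqr_ge0// mulr2n mulrDl mul1r lerD2l lerXn2r// nnegrE ltW.
  have gs : 1000 * g ^+ 2 <= g by rewrite expr2 mulrA ler_piMl// ltW.
  have y1 : y <= 2^-1.
    rewrite leNgt; apply/negP => hy; have : 2^-1 * 2^-1 < y * y by apply: ltr_pM.
    by move: y2 gs g1; rewrite expr2; lra.
  have E : expR y <= 2.
    have y11 : y < 1 by rlra.
    apply: (le_trans (expR_le_inv y0 y11)).
    by rewrite -[X in _ <= X]invrK lef_pV2 ?posrE ?invr_gt0 ?subr_gt0//; rlra.
  split.
  - have := coshs_taylor 2 h sq; rewrite -/y !big_ord_recr big_ord0 /= add0r.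
    rewrite muln0 muln1 fact0 !expr0 !expr1 divr1 mulr1 (_ : 2`! = 2)%N// (_ : (2 * 2)`! = 24)%N//.
    rewrite zh => /le_trans; apply.
    have q : y ^+ (2 * 2) <= 4 * g ^+ 4.
      have -> : 4 * g ^+ 4 = (2 * g ^+ 2) ^+ 2 by ring.
      by rewrite exprM lerXn2r// nnegrE ?exprn_ge0// mulr_ge0// exprn_ge0// ltW.
    have : y ^+ (2 * 2) / 24 * expR y <= (4 * g ^+ 4) / 24 * 2.
      by apply: ler_pM; rewrite ?divr_ge0 ?exprn_ge0 ?expR_ge0// ler_wpM2r.
    by move=> /le_trans; apply; have := exprn_ge0 4 (ltW g0); rlra.
  - have := sinhs_taylor 1 h sq; rewrite -/y !big_ord_recr big_ord0 /= add0r muln0 muln1 expr0 expr1 mul1r.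
    rewrite (_ : 1`! = 1)%N// (_ : 3`! = 6)%N// divr1 => hs.
    have -> : sinhs z h / h%:C - 1 = (sinhs z h - h%:C) / h%:C by rewrite mulrBl divff.
    rewrite ncM ncV nh ler_pdivrMr//; apply: (le_trans hs).
    have -> : nc b ^+ 2 * `|h| ^+ 3 / 6 * expR y = y ^+ 2 * expR y / 6 * h.
      by rewrite /y (gtr0_norm h0); field.
    rewrite ler_wpM2r ?(ltW h0)//.
    have : y ^+ 2 * expR y <= 2 * g ^+ 2 * 2 by apply: ler_pM; rewrite ?exprn_ge0 ?expR_ge0.
    by have := exprn_ge0 2 (ltW g0); rlra.
  rewrite zh; have -> : z * h%:C ^+ 2 * (sinhs z h / h%:C) ^+ 2 = z * sinhs z h ^+ 2; last exact: coshs_det.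
  by move: hC; move: (h%:C) (sinhs z h) => H S H0; field; rewrite H0.
have [c1 c2 c3] := main sg s1; have [d1 d2 d3] : [/\ _, _ & _] := main (- sg) (etrans (sqrrN _) s1).
rewrite /= rmorphN mulNr rmorphN /= in d1 d2 d3.
split=> //; first by rewrite ncM nh.
by rewrite nc_real normrM ns mul1r ger0_norm ?sqr_ge0// lerXn2r// nnegrE ltW.
Qed.

Definition phi ka (Y : C * C) : C := ka * Y.1 - Y.2.

(** The recurrence is the Cayley-Hamilton identity for the two-step matrix, of determinant one and
    trace [2 X]. *)
Lemma phi_twostep h sg l : 0 < h -> 'i%C * l != 0 :> C ->
  let ka := 'i%C * l in
  let X := tX (ka * h%:C) (coshs (sg%:C - l ^+ 2) h) (coshs (- sg%:C - l ^+ 2) h)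
    (sinhs (sg%:C - l ^+ 2) h / h%:C) (sinhs (- sg%:C - l ^+ 2) h / h%:C) in
  let P := tP (ka * h%:C) (sg * h ^+ 2)%:C (coshs (sg%:C - l ^+ 2) h) (coshs (- sg%:C - l ^+ 2) h)
    (sinhs (sg%:C - l ^+ 2) h / h%:C) (sinhs (- sg%:C - l ^+ 2) h / h%:C) in
  phi ka (twostep h sg l (1, - ka)) = 2 * ka * P /\
  forall Y, phi ka (twostep h sg l (twostep h sg l Y)) = 2 * X * phi ka (twostep h sg l Y) - phi ka Y.
Proof.
move=> h0 ka0 ka X P.
have hC : h%:C != 0 :> C by rewrite -nc_gt0 nc_real gtr0_norm.
have kl : - l ^+ 2 = ka ^+ 2 by apply/esym; rewrite exprMn expr2 sqri mulN1r.
have dp := coshs_det (sg%:C - l ^+ 2) h; have dm := coshs_det (- sg%:C - l ^+ 2) h.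
rewrite /X /P /tP /tX /twostep /phi /estep /= {X P}.
rewrite rmorphM rmorphXn /=.
have zp : sg%:C - l ^+ 2 = sg%:C + ka ^+ 2 by rewrite -kl.
have zm : - sg%:C - l ^+ 2 = - sg%:C + ka ^+ 2 by rewrite -kl.
rewrite zp zm in dp dm *.
move: dp dm; move: (coshs _ _) (coshs _ _) (sinhs _ _) (sinhs _ _) => cm cp sm sp.
move: h%:C hC sg%:C => H H0 s dp dm; have u := @two_neq0 R; split.
  by field; rewrite ?H0 ?u ?ka0.
move=> [y1 y2] /=.
have dd : (cp ^+ 2 - (s + ka ^+ 2) * sp ^+ 2) * (cm ^+ 2 - (- s + ka ^+ 2) * sm ^+ 2) = 1.
  by rewrite dp dm mulr1.
rewrite -[X in _ = _ - X]mul1r -[X in _ = _ - X * _]dd.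
by field; rewrite ?H0 ?u ?ka0.
Qed.

Lemma Om_alternating (n : nat) sg l : (0 < n)%N -> sg ^+ 2 = 1 ->
  let ka := 'i%C * l in let h := (2 * n%:R)^-1 in
  1 <= nc ka -> 1000 * (nc ka * h) <= 1 -> 1000 * (10 * (n%:R * (nc ka * h) ^+ 3)) <= 1 ->
  exists u v : C, [/\ near1 50^-1 u, near1 50^-1 v &
    Om (- 2^-1) 2^-1 (altseq h sg (2 * n)) l =
    2 * ka * cexp (- ka) * u * (1 + cexp (2 * ka) / (64 * n%:R ^+ 2 * ka ^+ 2) * v)].
Proof.
move=> n0 s1 ka h k1 g1 gn.
have nn : 0 < n%:R :> R by rewrite ltr0n.
have h0 : 0 < h by rewrite invr_gt0 mulr_gt0.
have ka0 : ka != 0 by rewrite -nc_gt0; apply: lt_le_trans k1.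
have T := step_tdata s1 h0 k1 g1; rewrite /= -/ka in T.
have [p1 p2] := phi_twostep sg h0 ka0; rewrite /= -/ka in p1 p2.
pose a j := phi ka (iter j (twostep h sg l) (1, - ka)).
have hh : (2 * n)%:R * h = 1 by rewrite natrM /h divff// mulf_neq0// gt_eqF.
have hka : ka = (2 * n)%:R * (ka * h%:C).
  by rewrite mulrCA -[(2 * n)%:R]/(((2 * n)%:R)) -(rmorph_nat (real_complex R)) -rmorphM /= hh mulr1.
have a0 : a 0%N = 2 * ka by rewrite /a /phi /=; ring.
have ha j : a j.+2 = _ * a j.+1 - a j := p2 (iter j (twostep h sg l) (1, - ka)).
have [u [v [hu hv e]]] := alternating_factor T hka gn a0 p1 ha.
exists u, v; split=> //.
(* The Wronskian of [psiM] and [psiP] is constant; at [1 / 2], where [psiP] has data [(1, ka)], it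
   is [phi ka] of [psiM], that is [a n]. *)
have w := stepsol_wron l (- 2^-1) (altseq h sg (2 * n)) (1, - ka)
  (al (- 2^-1) 2^-1 (altseq h sg (2 * n)) l, be (- 2^-1) 2^-1 (altseq h sg (2 * n)) l) 2^-1.
rewrite psiP_at in w.
have eb : 2^-1 = - 2^-1 + (2 * n)%:R * h by rewrite hh; rlra.
have st := stepsol_alt2 sg l (1, - ka) n (ltW h0); rewrite -eb in st.
rewrite st in w.
have -> : Om (- 2^-1) 2^-1 (altseq h sg (2 * n)) l = a n.
  rewrite /wron /= mulr1 mul1r -/ka in w; rewrite /a /phi [ka * _]mulrC w /Om -/ka; ring.
rewrite e; congr (_ * (1 + _ * _)); congr (_ * _).
have hC : (h%:C : C) = (2 * n%:R)^-1 by rewrite /h fmorphV rmorphM /= !rmorph_nat.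
have nC : (n%:R : C) != 0 by rewrite pnatr_eq0 -lt0n.
rewrite rmorphM rmorphXn /= hC.
have sC : (sg%:C : C) ^+ 2 = 1 by rewrite -rmorphXn /= s1.
rewrite exprMn sC; move: ka0 nC (@two_neq0 R) => x0 y0 z0.
by field; rewrite x0 y0.
Qed.

End AlternatingSteps.

(** * A zero of the Wronskian near the approximate one *)

Section ZeroExistence.
Variable R : realType.
Local Notation C := R[i].

Lemma expR_ge_pow (x : R) k : 0 <= x -> (0 < k)%N -> (x / k%:R) ^+ k <= expR x.
Proof.
move=> x0 k0; have kk : (k%:R : R) != 0 by rewrite pnatr_eq0 -lt0n.
have e : expR x = expR (x / k%:R) ^+ k by rewrite -expRM_natr divfK.
rewrite e lerXn2r ?nnegrE ?divr_ge0 ?expR_ge0//.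
by apply: le_trans (expR_ge1Dx _); rewrite lerDr.
Qed.

Definition ell (n : nat) : R := ln (8 * n%:R).

(* With [k = center n], [exp (2 k) = - 64 n ^ 2 (ell n) ^ 2], which nearly cancels
   [1 + exp (2 k) / (64 n ^ 2 k ^ 2)] because [k] is close to [ell n]. *)
Definition center (n : nat) : C := (ell n + ln (ell n)) +i* (pi / 2).

(** Powers absorb the constants: with [t = ln (ell n)], [ell n = exp t >= (t / 4) ^ 4] where
    [t / 4 >= 25], and [8 n = exp (ell n) >= (ell n / 3) ^ 3]. *)
Lemma ell_large n : (0 < n)%N -> 0 < ell n -> 100 <= ln (ell n) ->
  [/\ 1000 * 100 <= ell n, 1000 * (ln (ell n) + 2) <= ell n & ell n ^+ 2 <= n%:R].
Proof.
move=> n0 l0; set t := ln (ell n) => t100.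
have et : expR t = ell n by rewrite lnK.
have h4 : (t / 4) ^+ 4 <= ell n by rewrite -et; apply: expR_ge_pow => //; lra.
have s1 : 25 <= t / 4 by lra.
have s2 : 25 * (t / 4) <= (t / 4) ^+ 2 by rewrite expr2 ler_wpM2r//; lra.
have s3 : 25 * (t / 4) ^+ 2 <= (t / 4) ^+ 3 by rewrite (exprS _ 2) ler_wpM2r ?sqr_ge0.
have s4 : 25 * (t / 4) ^+ 3 <= (t / 4) ^+ 4 by rewrite (exprS _ 3) ler_wpM2r// exprn_ge0//; lra.
have r1 : 1000 * 100 <= ell n.
  by move: s1 s2 s3 s4 h4; move: (t / 4) (_ ^+ 2) (_ ^+ 3) (_ ^+ 4) => a b c d; lra.
split=> //.
  have ta : t = 4 * (t / 4) by field.
  rewrite {1}ta; move: s1 s2 s3 s4 h4; move: (t / 4) (_ ^+ 2) (_ ^+ 3) (_ ^+ 4) => a b c d; rlra.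
have en : expR (ell n) = 8 * n%:R by rewrite lnK// posrE mulr_gt0// ltr0n.
have h3 : (ell n / 3) ^+ 3 <= 8 * n%:R.
  by rewrite -en; apply: expR_ge_pow => //; exact: ltW.
have e27 : (ell n / 3) ^+ 3 = ell n * (ell n ^+ 2) / 27 by field.
rewrite e27 in h3; have nn : 0 <= n%:R :> R by [].
have s5 : 1000 * ell n ^+ 2 <= ell n * ell n ^+ 2 by rewrite ler_wpM2r ?sqr_ge0//; rlra.
rlra.
Qed.

(** For [w = 2 z] with [z] on the boundary of the square, [nc w] lies between [1 / 4] and
    [1 / sqrt 8]; the linear term of [1 - exp w] then exceeds the remainder, at most [1 / 10], by
    [3 / 20]. *)
Lemma cexp_sub1_ge (w : C) : complex.Re w ^+ 2 + complex.Im w ^+ 2 <= 8^-1 ->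
  4^-1 <= nc w -> 3 / 20 <= nc (1 - cexp w).
Proof.
rewrite -nc_sqr => h1 h2; have := cexp_taylor 2 w.
have -> : cexp_sum 2 w = 1 + w.
  by rewrite /cexp_sum !big_ord_recr big_ord0 /= fact0 (_ : 1`! = 1)%N// expr0 expr1 add0r; field.
rewrite (_ : 2`! = 2)%N// => h.
have w0 := nc_ge0 w.
have w1 : nc w <= 36 / 100.
  rewrite leNgt; apply/negP => hw; have : 36 / 100 * (36 / 100) < nc w * nc w by apply: ltr_pM.
  by move: h1; rewrite expr2; lra.
have E : expR (nc w) <= 16 / 10.
  have w11 : nc w < 1 by lra.
  apply: (le_trans (expR_le_inv w0 w11)); rewrite -[X in _ <= X]invrK lef_pV2 ?posrE ?invr_gt0 ?subr_gt0 ?divr_gt0//.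
  by rewrite invf_div; lra.
have : nc w ^+ 2 / 2 * expR (nc w) <= 8^-1 / 2 * (16 / 10).
  by apply: ler_pM; rewrite ?divr_ge0 ?exprn_ge0 ?expR_ge0// ler_wpM2r.
move=> hh; have := ncB_ge (- w) (cexp w - (1 + w)).
have -> : - w - (cexp w - (1 + w)) = 1 - cexp w by ring.
rewrite ncN; lra.
Qed.

Lemma pihalf_le2 : 0 <= (pi / 2 : R) <= 2.
Proof. by have [] := pihalf_02_cos_pihalf R. Qed.

Lemma center_rel n (z : C) : (0 < n)%N -> 0 < ell n -> 100 <= ln (ell n) -> nc z <= 4^-1 ->
  near1 500^-1 ((center n + z) / (ell n)%:C).
Proof.
move=> n0 l0 t100 hz; have [r1 r2 r3] := ell_large n0 l0 t100.
have lC : (ell n)%:C != 0 :> C by rewrite -nc_gt0 nc_real gtr0_norm.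
have /andP[p0 p2] := pihalf_le2.
rewrite /near1; have -> : (center n + z) / (ell n)%:C - 1 = ((ln (ell n)) +i* (pi / 2) + z) / (ell n)%:C.
  apply: (mulIf lC); rewrite mulrBl !divfK// mul1r /center.
  by apply: complexP; rewrite !ReImE /=; ring.
rewrite ncM ncV nc_real (gtr0_norm l0) ler_pdivrMr//.
have h : nc (ln (ell n) +i* (pi / 2) + z) <= (ln (ell n) + 2) + 4^-1.
  apply: nc_add => //; apply: (le_trans (nc_ReIm _)); rewrite /=.
  by rewrite !ger0_norm// ?lerD//; rlra.
by apply: (le_trans h); rlra.
Qed.

Lemma cexp_center n : (0 < n)%N -> 0 < ell n -> cexp (2 * center n) = - (64 * n%:R ^+ 2 * (ell n)%:C ^+ 2) /\
  nc (cexp (- center n)) = (8 * n%:R * ell n)^-1.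
Proof.
move=> n0 l0; have en : expR (ell n + ln (ell n)) = 8 * n%:R * ell n.
  by rewrite expRD !lnK// posrE mulr_gt0// ltr0n.
split; last by rewrite nc_cexp ReN /= expRN en.
have e1 : cexp (2 * center n) = cexp (center n) ^+ 2 by rewrite -cexpX.
have e2 : cexp (center n) = (8 * n%:R * ell n)%:C * 'i%C.
  rewrite /cexp /center /= en; congr (_ * _); rewrite /cis cos_pihalf sin_pihalf.
  by apply: complexP.
have i2 : ('i%C : C) ^+ 2 = -1 by rewrite expr2 sqri.
rewrite e1 e2 exprMn i2 -rmorphXn /=.
have -> : (8 * n%:R * ell n) ^+ 2 = 64 * n%:R ^+ 2 * ell n ^+ 2 by ring.
by rewrite rmorphM rmorphM rmorphXn rmorphXn /= !rmorph_nat; ring.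
Qed.

(** Replacing [k] by [ell n] in [64 n ^ 2 k ^ 2] costs a factor close to [1], absorbed in [w]; the
    remaining quotient is exactly [- exp (2 z)] by the choice of [center]. *)
Lemma Om_near n sg (z : C) : (0 < n)%N -> 0 < ell n -> 100 <= ln (ell n) -> sg ^+ 2 = 1 -> nc z <= 4^-1 ->
  exists u w : C, [/\ near1 50^-1 u, near1 (3 / 100) w &
   Om (- 2^-1) 2^-1 (altseq (2 * n%:R)^-1 sg (2 * n)) (- 'i%C * (center n + z)) =
   2 * (center n + z) * cexp (- (center n + z)) * u * (1 - cexp (2 * z) * w)].
Proof.
move=> n0 l0 t100 s1 hz; have [r1 r2 r3] := ell_large n0 l0 t100.
have nr := center_rel n0 l0 t100 hz; have [ec _] := cexp_center n0 l0.
set ka := center n + z in nr *; have ik : 'i%C * (- 'i%C * ka) = ka by rewrite mulrA mulrN sqri opprK mul1r.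
have lC : (ell n)%:C != 0 :> C by rewrite -nc_gt0 nc_real gtr0_norm.
have nn : 0 < n%:R :> R by rewrite ltr0n.
have kE : nc ka = nc (ka / (ell n)%:C) * ell n.
  by rewrite ncM ncV nc_real (gtr0_norm l0) divfK// gt_eqF.
have k1 := near1_ge nr; have k2 := near1_le nr.
have kl : nc ka <= 2 * ell n by rewrite kE ler_wpM2r ?(ltW l0)//; lra.
have kg : 1 <= nc ka.
  have : 2^-1 * ell n <= nc ka by rewrite kE ler_wpM2r ?(ltW l0)//; lra.
  by rlra.
have ll : 1000 * 100 * ell n <= ell n ^+ 2 by rewrite expr2 ler_wpM2r// ltW.
have g1 : 1000 * (nc ka * (2 * n%:R)^-1) <= 1.
  by rewrite mulrA ler_pdivrMr ?mulr_gt0//; lra.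
have g3 : 1000 * (10 * (n%:R * (nc ka * (2 * n%:R)^-1) ^+ 3)) <= 1.
  have -> : 1000 * (10 * (n%:R * (nc ka * (2 * n%:R)^-1) ^+ 3)) = 1250 * nc ka ^+ 3 / n%:R ^+ 2.
    by move: nn; move: (n%:R : R) (nc ka) => N K N0; field; rewrite gt_eqF.
  rewrite ler_pdivrMr ?exprn_gt0// mul1r.
  have b1 : nc ka ^+ 3 <= 8 * ell n ^+ 3.
    have -> : 8 * ell n ^+ 3 = (2 * ell n) ^+ 3 by ring.
    by rewrite lerXn2r// nnegrE ?nc_ge0// mulr_ge0// ltW.
  have b2 : ell n ^+ 4 <= n%:R ^+ 2.
    by rewrite -[4%N]/(2 * 2)%N exprM lerXn2r// nnegrE ?sqr_ge0.
  have b3 : 1000 * 100 * ell n ^+ 3 <= ell n ^+ 4 by rewrite (exprS _ 3) ler_wpM2r// exprn_ge0// ltW.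
  have b4 : 0 <= ell n ^+ 3 by rewrite exprn_ge0// ltW.
  by move: b1 b2 b3 b4; move: (nc ka ^+ 3) (ell n ^+ 3) (ell n ^+ 4) (n%:R ^+ 2) => a b c d; rlra.
have := @Om_alternating R n sg (- 'i%C * ka) n0 s1; rewrite /= ik => /(_ kg g1 g3) [u [v [hu hv ->]]].
have h5 : (500^-1 : R) <= 2^-1 by rlra.
pose w := ((ka / (ell n)%:C) * (ka / (ell n)%:C))^-1.
exists u, (w * v); split=> //.
  have h6 := near1M nr nr; have h7 : 500^-1 + 500^-1 + 500^-1 * 500^-1 <= 2^-1 :> R by rlra.
  by have := near1M (near1V h6 h7) hv; move=> /near1_le_trans; apply; rlra.
congr (_ * _); rewrite -[X in X = _]/(1 + _); congr (1 + _).
have ka0 : ka != 0 by rewrite -nc_gt0; lra.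
have e1 : cexp (2 * ka) = cexp (2 * center n) * cexp (2 * z) by rewrite -cexpD; congr cexp; rewrite /ka; ring.
have nC : (n%:R : C) != 0 by rewrite pnatr_eq0 -lt0n.
have gen (k N L E : C) : k != 0 -> N != 0 -> L != 0 ->
    - (64 * N ^+ 2 * L ^+ 2) * E / (64 * N ^+ 2 * k ^+ 2) * v = - (E * ((k / L * (k / L))^-1 * v)).
  by move=> k0 N0 L0; field; rewrite ?k0 ?N0 ?L0.
by rewrite e1 ec /w gen.
Qed.

Lemma expR_quarter : expR 4^-1 <= 4 / 3 :> R.
Proof.
have h0 : (0 : R) <= 4^-1 by [].
have h1 : (4^-1 : R) < 1 by lra.
apply: (le_trans (expR_le_inv h0 h1)).
rewrite -[X in _ <= X]invrK lef_pV2 ?posrE ?invr_gt0 ?subr_gt0 ?divr_gt0// invf_div; lra.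
Qed.

Lemma boundary_const1 : (0 : R) <= 1 - 500^-1. Proof. by lra. Qed.
Lemma boundary_const2 : (0 : R) <= 7 / 8. Proof. by lra. Qed.
Lemma boundary_const3 : (0 : R) <= 1 - 50^-1. Proof. by lra. Qed.
Lemma boundary_const4 : (0 : R) <= 11 / 100. Proof. by lra. Qed.

Lemma boundary_final (p q t : R) : 0 < t -> p <= (1 + 500^-1) * t * ((1 + 50^-1) * (3 / 100)) ->
  (1 - 500^-1) * (7 / 8 * t) * ((1 - 50^-1) * (11 / 100)) <= q -> 2 * p < 2 * q.
Proof. lra. Qed.

(** The factor [3 / 100] at the centre competes with [11 / 100] on the boundary; the other factors
    reduce this quotient by less than a fifth. *)
Lemma boundary_compare (E l a b c d e1 f g : R) : 0 < E -> 0 < l -> 0 <= a -> 0 <= b ->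
  0 <= c -> a <= (1 + 500^-1) * l -> b <= 1 + 50^-1 -> c <= 3 / 100 ->
  (1 - 500^-1) * l <= d -> 7 / 8 * E <= e1 -> 1 - 50^-1 <= f -> 11 / 100 <= g ->
  2 * a * E * b * c < 2 * d * e1 * f * g.
Proof.
move=> E0 l0 a0 b0 c0 ha hb hc hd he hf hg.
have lE : 0 < l * E by rewrite mulr_gt0.
have h1 : a * E * (b * c) <= (1 + 500^-1) * l * E * ((1 + 50^-1) * (3 / 100)).
  apply: ler_pM; rewrite ?mulr_ge0 ?(ltW E0)//; last exact: ler_pM.
  by rewrite ler_wpM2r// ltW.
have n1 : 0 <= (1 - 500^-1) * l := mulr_ge0 boundary_const1 (ltW l0).
have n2 : 0 <= 7 / 8 * E := mulr_ge0 boundary_const2 (ltW E0).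
have h2 : (1 - 500^-1) * l * (7 / 8 * E) * ((1 - 50^-1) * (11 / 100)) <= d * e1 * (f * g).
  apply: ler_pM.
  - exact: mulr_ge0.
  - exact: mulr_ge0 boundary_const3 boundary_const4.
  - exact: ler_pM.
  - exact: ler_pM boundary_const3 boundary_const4 hf hg.
have e2 : 2 * a * E * b * c = 2 * (a * E * (b * c)) by ring.
have e3 : 2 * d * e1 * f * g = 2 * (d * e1 * (f * g)) by ring.
rewrite e2 e3; apply: (boundary_final lE).
  by rewrite (mulrA _ l E).
by rewrite (mulrCA _ l E) (mulrA _ l).
Qed.

Lemma zero_exists n sg : (0 < n)%N -> 0 < ell n -> 100 <= ln (ell n) -> sg ^+ 2 = 1 ->
  exists2 z : C, nc z <= 4^-1 &
   Om (- 2^-1) 2^-1 (altseq (2 * n%:R)^-1 sg (2 * n)) (- 'i%C * (center n + z)) = 0.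
Proof.
move=> n0 l0 t100 s1; have [r1 r2 r3] := ell_large n0 l0 t100.
set s := altseq _ _ _.
have nn : 0 < n%:R :> R by rewrite ltr0n.
have sd : stepdata (- 2^-1) 2^-1 s.
  apply: altseq_data; first by rewrite invr_ge0 mulr_ge0// ltW.
    have : `|sg| ^+ 2 <= 1 ^+ 2 by rewrite real_normK ?num_real// s1 expr1n.
    by rewrite lerXn2r_le1 || rewrite ler_pXn2r// nnegrE.
  by rewrite natrM divff// mulf_neq0// gt_eqF.
have eW := green_entfam (green_step sd).
(* Multiplication by [i], since [k = i l]: the square around [- i * center n] in the variable [l] is
   again a square in [z]. *)
pose zz (x y : R) : C := (- y) +i* x.
have shift x y : - 'i%C * center n + (x +i* y) = - 'i%C * (center n + zz x y).
  rewrite mulrDr; congr (_ + _); apply: complexP; rewrite !ReImE /=; ring.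
have nzz x y : `|x| <= 8^-1 -> `|y| <= 8^-1 -> nc (zz x y) <= 4^-1.
  by move=> hx hy; apply: (le_trans (nc_ReIm _)); rewrite /= normrN; rlra.
have r8 : 0 < 8^-1 :> R by rlra.
suff hb x y : `|x| <= 8^-1 -> `|y| <= 8^-1 -> (`|x| == 8^-1) || (`|y| == 8^-1) ->
    nc (Om (- 2^-1) 2^-1 s (- 'i%C * center n)) < nc (Om (- 2^-1) 2^-1 s (- 'i%C * center n + (x +i* y))).
  have [x [y [hx hy hz]]] := box_zero eW r8 hb.
  by exists (zz x y); [exact: nzz|rewrite -shift].
move=> hx hy hb; rewrite shift.
have [u [w [hu hw ->]]] := Om_near n0 l0 t100 s1 (nzz x y hx hy).
have z00 : nc (0 : C) <= 4^-1 by rewrite nc0; rlra.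
have [u0 [w0 [hu0 hw0 e0]]] := Om_near n0 l0 t100 s1 z00.
rewrite addr0 in e0; rewrite e0 mulr0 cexp0 mul1r.
have [_ ec] := cexp_center n0 l0; set E := nc (cexp (- center n)) in ec.
have E0 : 0 < E by rewrite nc_gt0 cexp_neq0.
have rel0 := center_rel n0 l0 t100 z00; rewrite addr0 in rel0.
have relz := center_rel n0 l0 t100 (nzz x y hx hy).
have kE (k : C) : nc k = nc (k / (ell n)%:C) * ell n.
  by rewrite ncM ncV nc_real (gtr0_norm l0) divfK// gt_eqF.
have a1 : nc (center n) <= (1 + 500^-1) * ell n by rewrite kE ler_wpM2r ?(ltW l0)// near1_le.
have a2 : (1 - 500^-1) * ell n <= nc (center n + zz x y) by rewrite kE ler_wpM2r ?(ltW l0)// near1_ge.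
(* [11 / 100] is [3 / 20 - (4 / 3) (3 / 100)]: the boundary bound for [1 - exp (2 z)] minus the
   effect of [w]. *)
have lo : 11 / 100 <= nc (1 - cexp (2 * zz x y) * w).
  have Re2 : complex.Re (2 * zz x y) = - (2 * y) by rewrite mulr_natl mulr2n ReD /=; ring.
  have Im2 : complex.Im (2 * zz x y) = 2 * x by rewrite mulr_natl mulr2n ImD /=; ring.
  have x2 : `|x| ^+ 2 <= 8^-1 ^+ 2 by rewrite lerXn2r// nnegrE.
  have y2 : `|y| ^+ 2 <= 8^-1 ^+ 2 by rewrite lerXn2r// nnegrE.
  have b1 : 3 / 20 <= nc (1 - cexp (2 * zz x y)).
    apply: cexp_sub1_ge.
      rewrite Re2 Im2; move: x2 y2; rewrite !real_normK ?num_real//; rlra.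
    case/orP: hb => /eqP hb.
      by apply: le_trans (nc_Im _); rewrite Im2 normrM hb ger0_norm//; rlra.
    by apply: le_trans (nc_Re _); rewrite Re2 normrN normrM hb ger0_norm//; rlra.
  have b2 : nc (cexp (2 * zz x y)) <= 4 / 3.
    rewrite nc_cexp Re2; have h1 : - (2 * y) <= 4^-1 by move: hy; rewrite ler_norml => /andP[]; rlra.
    apply: (@le_trans _ _ (expR 4^-1)); first by rewrite ler_expR.
    exact: expR_quarter.
  have -> : 1 - cexp (2 * zz x y) * w = (1 - cexp (2 * zz x y)) - cexp (2 * zz x y) * (w - 1) by ring.
  apply: le_trans (ncB_ge _ _); rewrite (ncM (cexp _)).
  have : nc (cexp (2 * zz x y)) * nc (w - 1) <= 4 / 3 * (3 / 100) by apply: ler_pM; rewrite ?nc_ge0.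
  by lra.
have up : nc (1 - w0) <= 3 / 100 by rewrite ncBC.
have b3 := near1_ge hu; have b4 := near1_le hu0.
have ez : 7 / 8 * E <= nc (cexp (- (center n + zz x y))).
  have -> : - (center n + zz x y) = - center n + - zz x y by ring.
  rewrite cexpD (ncM (cexp _)) -/E mulrC ler_wpM2l ?(ltW E0)// nc_cexp ReN /=.
  apply: le_trans (expR_ge1Dx _); move: hy; rewrite ler_norml => /andP[]; rlra.
rewrite !(ncM (_ * _)) (ncM 2) (ncM 2) (nc_nat _ 2) -/E.
by apply: (@boundary_compare E (ell n)) => //; exact: nc_ge0.
Qed.

End ZeroExistence.

(** * Values of the oscillating potential *)

Section Potential.
Variable R : realType.
Local Notation C := R[i].
Local Notation mu := (@lebesgue_measure R).
Implicit Types (x y : R).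

Lemma periodized_shift (A : set R) y (m : int) : periodized A (y + 2 * pi * m%:~R) = periodized A y.
Proof.
apply/propext; split=> -[k hk].
  by exists (m + k); rewrite intrD mulrDr addrA.
by exists (k - m); rewrite -addrA -mulrDr -intrD addrC addrC (addrC m) subrK.
Qed.

Lemma indic_shift (A : set R) y (m : int) :
  \1_(periodized A) (y + 2 * pi * m%:~R) = \1_(periodized A) y :> R.
Proof. by rewrite !indicE /in_mem /mem /= /in_set periodized_shift. Qed.

(** A point inside one arc does not meet the periodized other arc: that would give an integer
    strictly between [-1] and [0]. *)
Lemma W_pos x y (m : int) : 0 < y + 2 * pi * m%:~R < pi -> `|x| <= 2^-1 -> W x y = 1.
Proof.
move=> /andP[y0 y1] hx; have p0 := pi_gt0 R.
have p2 : 0 < 2 * pi :> R by lra.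
rewrite /W -!(indic_shift _ y m); set z := y + _ in y0 y1 *.
rewrite !indicE mem_set ?mul1r; last by rewrite /= in_itv /= -ler_norml.
rewrite mem_set; last by exists 0; rewrite mulr0z mulr0 addr0 /= in_itv /= !ltW.
rewrite memNset ?subr0// => -[k]; rewrite /= in_itv /= => /andP[k1 k2].
have k3 : k%:~R < (0 : R) by rewrite -(@pmulr_rlt0 _ (2 * pi)) //; lra.
have k4 : -1 < k%:~R :> R by rewrite -(@ltr_pM2l _ (2 * pi)) //; lra.
by move: k3 k4; rewrite -(mulrN1z 1) ltr_int ltrz0; case: k {k1 k2} => // -[].
Qed.

Lemma W_neg x y (m : int) : - pi < y + 2 * pi * m%:~R < 0 -> `|x| <= 2^-1 -> W x y = -1.
Proof.
move=> /andP[y0 y1] hx; have p0 := pi_gt0 R.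
have p2 : 0 < 2 * pi :> R by lra.
rewrite /W -!(indic_shift _ y m); set z := y + _ in y0 y1 *.
rewrite !indicE mem_set ?mul1r; last by rewrite /= in_itv /= -ler_norml.
rewrite [X in _ - (nat_of_bool X)%:R]mem_set; last by exists 0; rewrite mulr0z mulr0 addr0 /= in_itv /= !ltW.
rewrite memNset ?sub0r// => -[k]; rewrite /= in_itv /= => /andP[k1 k2].
have k3 : (0 : R) < k%:~R by rewrite -(@pmulr_rgt0 _ (2 * pi)) //; lra.
have k4 : k%:~R < 1 :> R by rewrite -(@ltr_pM2l _ (2 * pi)) //; lra.
by move: k3 k4; rewrite -(mulr1z 1) ltr_int ltr0z; case: k {k1 k2} => // -[].
Qed.

Lemma W_out x y : 2^-1 < `|x| -> W x y = 0.
Proof.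
move=> hx; rewrite /W indicE memNset ?mul0r//= in_itv /= -ler_norml; apply/negP.
by rewrite -ltNge.
Qed.

(** On the step [j] the phase [x / eps] lies between [pi (j - n)] and [pi (j + 1 - n)], so its arc
    is decided by the parity of [n + j]; the four cases of parities select the multiple of [2 pi]
    that brings it back around [0]. *)
Lemma Vosc_alternating n (j : nat) x : (0 < n)%N -> (j < 2 * n)%N ->
  - 2^-1 + j%:R / (2 * n%:R) < x < - 2^-1 + j.+1%:R / (2 * n%:R) ->
  Vosc (eps_ R n) x = (-1) ^+ (n + j).
Proof.
move=> n0 jn /andP[x1 x2]; have p0 := pi_gt0 R; have nn : 0 < n%:R :> R by rewrite ltr0n.
have n2 : 0 < 2 * n%:R :> R by rewrite mulr_gt0.
have hx : `|x| <= 2^-1.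
  rewrite ler_norml; apply/andP; split; apply/ltW.
    by apply: le_lt_trans x1; rewrite lerDl divr_ge0// ltW.
  apply: (lt_le_trans x2); have : j.+1%:R / (2 * n%:R) <= (1 : R).
    by rewrite ler_pdivrMr// mul1r -natrM ler_nat.
  lra.
have hy : x / eps_ R n = 2 * pi * n%:R * x by rewrite /eps_ invrK mulrC.
have y1 : pi * (j%:R - n%:R) < x / eps_ R n.
  have -> : pi * (j%:R - n%:R) = 2 * pi * n%:R * (- 2^-1 + j%:R / (2 * n%:R)) :> R.
    by field; rewrite gt_eqF.
  by rewrite hy ltr_pM2l// !mulr_gt0.
have y2 : x / eps_ R n < pi * (j%:R + 1 - n%:R).
  have -> : pi * (j%:R + 1 - n%:R) = 2 * pi * n%:R * (- 2^-1 + j.+1%:R / (2 * n%:R)) :> R.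
    by rewrite -natr1; field; rewrite gt_eqF.
  by rewrite hy ltr_pM2l// !mulr_gt0.
rewrite -signr_odd oddD /Vosc; set y := x / _ in y1 y2 *.
have ej : j%:R = (odd j)%:R + 2 * (j./2)%:R :> R by rewrite -{1}(odd_double_half j) natrD -mul2n natrM.
have en : n%:R = (odd n)%:R + 2 * (n./2)%:R :> R by rewrite -{1}(odd_double_half n) natrD -mul2n natrM.
rewrite ej en in y1 y2; move: y1 y2.
have eI (a b : int) : 2 * pi * (a - b)%:~R = 2 * (pi * a%:~R) - 2 * (pi * b%:~R) :> R by rewrite intrB; ring.
have dist (a b c d : R) : pi * (a + 2 * b - (c + 2 * d)) = pi * a + 2 * (pi * b) - pi * c - 2 * (pi * d) by ring.
have dist2 (a b c d : R) : pi * (a + 2 * b + 1 - (c + 2 * d)) = pi * a + 2 * (pi * b) + pi - pi * c - 2 * (pi * d) by ring.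
rewrite dist dist2.
case: (odd n) (odd j) => -[] /=; rewrite ?mulr1 ?mulr0 => y1 y2.
- rewrite (@W_pos _ _ ((n./2 : int) - (j./2 : int)))//= eI -!pmulrn -?natr1 ?mulrDr; lra.
- rewrite (@W_neg _ _ ((n./2 : int) - (j./2 : int)))//= eI -!pmulrn -?natr1 ?mulrDr; rlra.
- rewrite (@W_neg _ _ ((n./2 : int) - (j./2.+1 : int)))//= eI -!pmulrn -?natr1 ?mulrDr; rlra.
- rewrite (@W_pos _ _ ((n./2 : int) - (j./2 : int)))//= eI -!pmulrn -?natr1 ?mulrDr; rlra.
Qed.

End Potential.

(** * Resonances and their asymptotics *)

Section Resonances.
Variable R : realType.
Local Notation C := R[i].
Local Notation mu := (@lebesgue_measure R).

Lemma aeq_countable (f g : R -> C) (A : set R) : countable A ->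
  (forall x, ~ A x -> f x = g x) -> aeq f g.
Proof.
move=> cA h; rewrite /aeq; apply: (@negligibleS _ _ _ mu A).
  by move=> x /= hx; apply: contrapT => /h.
exists A; split => //; first exact: countable_measurable.
exact: countable_lebesgue_measure0.
Qed.

(** Off the countable set of points [- 1 / 2 + j / (2 n)] the two potentials agree. *)
Lemma steppot_Vosc n : (0 < n)%N ->
  aeq (fun x => (steppot (closestep 2^-1 (altseq (2 * n%:R)^-1 ((-1) ^+ n) (2 * n))) x)%:C)
      (fun x => (Vosc (eps_ R n) x)%:C).
Proof.
move=> n0; have nn : 0 < n%:R :> R by rewrite ltr0n.
have n2 : 0 < 2 * n%:R :> R by rewrite mulr_gt0.
have h0 : 0 <= (2 * n%:R)^-1 :> R by rewrite invr_ge0 ltW.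
pose A := (fun j : nat => - 2^-1 + j%:R / (2 * n%:R) : R) @` setT.
apply: (@aeq_countable _ _ A); first exact: sub_countable (card_image_le _ _) (countableP _).
move=> x hx; congr (_%:C); rewrite /closestep steppot_rcons /=.
have [hi lo] := steppot_alt ((-1) ^+ n) (2 * n) x h0.
have [x1|x1] := lerP x 2^-1; last first.
  by rewrite /Vosc W_out// (lt_le_trans x1) ?ler_norm.
have [x2|x2] := lerP x (- 2^-1).
  rewrite (hi x2) /Vosc W_out// ltNge ler_norml x1 andbT -ltNge lt_neqAle x2 andbT.
  by apply/eqP => xe; apply: hx; exists 0; rewrite // mul0r addr0.
set t := (x + 2^-1) * (2 * n%:R); have t0 : 0 <= t by rewrite mulr_ge0 ?(ltW n2)//; lra.
have xt : x = - 2^-1 + t / (2 * n%:R) by rewrite /t mulfK ?gt_eqF//; ring.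
have /andP[] := truncn_itv t0; set j := Num.truncn t => j1 j2.
have j3 : j%:R < t.
  rewrite lt_neqAle j1 andbT; apply/eqP => je; apply: hx; exists j => //.
  by rewrite je -xt.
have jn : (j < 2 * n)%N.
  have : t <= 2 * n%:R by rewrite /t ler_piMl ?(ltW n2)//; lra.
  by rewrite -natrM => h; rewrite -(ltr_nat R) (lt_le_trans j3).
have x3 : - 2^-1 + j%:R / (2 * n%:R) < x by rewrite [ltRHS]xt ltrD2l ltr_pM2r ?invr_gt0.
have x4 : x < - 2^-1 + j.+1%:R / (2 * n%:R) by rewrite [ltLHS]xt ltrD2l ltr_pM2r ?invr_gt0.
rewrite (lo j jn) ?x3 ?ltW// /altv (Vosc_alternating n0 jn) ?x3//.
by rewrite addnC exprD.
Qed.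

Lemma ell_infty (T : R) : \forall n \near \oo, [/\ (0 < n)%N, 0 < ell R n & T <= ln (ell R n)].
Proof.
near=> n.
have h : expR (expR T) <= n%:R by near: n; exact: nbhs_infty_ger.
have n0 : (0 < n)%N by rewrite -(ltr0n R); apply: lt_le_trans h; exact: expR_gt0.
have h2 : expR T <= ell R n.
  rewrite -[leLHS]expRK ler_ln ?posrE ?expR_gt0 ?mulr_gt0 ?ltr0n//.
  by apply: (le_trans h); rewrite ler_peMl//; lra.
have h3 : 0 < ell R n by apply: lt_le_trans h2; exact: expR_gt0.
split=> //; by rewrite -[T]expRK ler_ln ?posrE ?expR_gt0.
Unshelve. all: by end_near. Qed.

Lemma quadratic_dominates (T d : R) : 100 <= T -> 16 / d <= T -> 0 < d -> 2 * (T + 10) <= d * (T / 2) ^+ 2.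
Proof.
move=> h1 h2 d0; have h3 : 16 <= d * T by rewrite -ler_pdivrMl// mulrC.
have -> : d * (T / 2) ^+ 2 = (d * T) * T / 4 by field.
have : 16 * T <= (d * T) * T by apply: ler_wpM2r => //; lra.
lra.
Qed.

(** The quotient minus [1] is [(ln 8 + t + i pi / 2 + z) / ln n] with [t = ln (ell n)]. The
    numerator is at most [t + 10], while [ln n >= ell n / 2] and [ell n >= (t / 2) ^ 2]. *)
Lemma resonance_asymptotics n (z : C) (d : R) : (0 < n)%N -> 0 < ell R n -> 100 <= ln (ell R n) ->
  16 / d <= ln (ell R n) -> 0 < d -> nc z <= 4^-1 ->
  nc (- 'i%C * (center R n + z) / (- ('i%C * (ln n%:R)%:C)) - 1) <= d.
Proof.
move=> n0 l0 t100 td d0 hz; set t := ln (ell R n) in t100 td *.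
have nn : 0 < n%:R :> R by rewrite ltr0n.
have [r1 _ _] := ell_large n0 l0 t100.
have ln8 : ln 8 <= 7 :> R.
  have -> : 8 = 1 + 7 :> R by lra.
  by apply: le_ln1Dx; lra.
have ln80 : 0 <= ln 8 :> R by apply: ln_ge0; lra.
have le : ell R n = ln 8 + ln n%:R by rewrite /ell lnM ?posrE.
have lhalf : ell R n / 2 <= ln n%:R by lra.
have lnC : (ln n%:R)%:C != 0 :> C by rewrite -nc_gt0 nc_real gtr0_norm; rlra.
have i0 : 'i%C != 0 :> C by apply/eqP => /(congr1 (@complex.Im R)) /= /eqP; rewrite oner_eq0.
have /andP[p0 p2] := pihalf_le2 R.
have -> : - 'i%C * (center R n + z) / (- ('i%C * (ln n%:R)%:C)) - 1 =
    ((ln 8 + t) +i* (pi / 2) + z) / (ln n%:R)%:C.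
  have -> : - 'i%C * (center R n + z) / (- ('i%C * (ln n%:R)%:C)) = (center R n + z) / (ln n%:R)%:C.
    by move: i0 lnC; move: ('i%C : C) (_%:C) (center _ _ + z) => i L k i0 L0; field; rewrite ?i0 ?L0.
  have -> : 1 = (ln n%:R)%:C / (ln n%:R)%:C :> C by rewrite divff.
  by rewrite -mulrBl /center -/t le; congr (_ / _); apply: complexP; rewrite !ReImE /=; ring.
rewrite ncM ncV nc_real gtr0_norm; last by rlra.
rewrite ler_pdivrMr; last by rlra.
have h : nc ((ln 8 + t) +i* (pi / 2) + z) <= (t + 9) + 4^-1.
  apply: nc_add => //; apply: (le_trans (nc_ReIm _)); rewrite /=.
  by rewrite !ger0_norm; rlra.
have t0 : 0 <= t by rlra.
have h2 : (t / 2) ^+ 2 <= ell R n by rewrite -[leRHS](lnK l0) -/t; exact: expR_ge_pow.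
have h3 := quadratic_dominates t100 td d0.
have h4 : d * (t / 2) ^+ 2 <= d * ell R n by rewrite ler_pM2l.
have h5 : d * (ell R n / 2) <= d * ln n%:R by rewrite ler_pM2l.
by move: h h3 h4 h5; rewrite (mulrA d); move: (d * ln _) (d * ell _ _) (d * _ ^+ 2) => a b c; rlra.
Qed.

Lemma resonances_exist : exists lam : nat -> R[i],
  (\forall n \near \oo, resonance (fun x => (Vosc (eps_ R n) x)%:C) (lam n)) /\
  (fun n => lam n / (- ('i%C * (ln n%:R)%:C))) @ \oo --> (1 : R[i]^o).
Proof.
have ex n : exists z : C, [/\ (0 < n)%N, 0 < ell R n & 100 <= ln (ell R n)] ->
    nc z <= 4^-1 /\ Om (- 2^-1) 2^-1 (altseq (2 * n%:R)^-1 ((-1) ^+ n) (2 * n)) (- 'i%C * (center R n + z)) = 0.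
  (* For the finitely many excluded [n] the value of [z] is arbitrary. *)
  have [[n0 l0 t0]|h] := pselect [/\ (0 < n)%N, 0 < ell R n & 100 <= ln (ell R n)]; last by exists 0.
  have s1 : ((-1) ^+ n) ^+ 2 = 1 :> R by rewrite -exprM mulnC exprM sqrrN !expr1n.
  by have [z h1 h2] := zero_exists n0 l0 t0 s1; exists z.
have [z hz] := choice ex.
exists (fun n => - 'i%C * (center R n + z n)); split.
  apply: filterS (ell_infty 100) => n hn; have [_ W0] := hz n hn; have [n0 _ _] := hn.
  have nn : 0 < n%:R :> R by rewrite ltr0n.
  apply: (@resonance_step R (- 2^-1) 2^-1 (altseq (2 * n%:R)^-1 ((-1) ^+ n) (2 * n))) => //.
  - apply: altseq_data; first by rewrite invr_ge0 mulr_ge0// ltW.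
      by rewrite normrX normrN1 expr1n.
    by rewrite natrM divff// mulf_neq0// gt_eqF.
  - lra.
  - lra.
  - exact: steppot_Vosc.
move=> A /= /near_ncP[d d0 hd].
have d20 : 0 < d / 2 by lra.
suff hh : \forall n \near \oo, A (- 'i%C * (center R n + z n) / (- ('i%C * (ln n%:R)%:C))) by [].
apply: filterS2 (ell_infty 100) (ell_infty (16 / (d / 2))) => n hn [_ _ hd2]; apply: hd.
have [z1 _] := hz n hn; have [n0 l0 t0] := hn.
by apply: (le_lt_trans (resonance_asymptotics n0 l0 t0 hd2 d20 z1)); lra.
Qed.

End Resonances.

(** * Integrability of the Bessel weight *)

Section BesselWeight.
Variable R : realType.
Local Notation C := R[i].
Local Notation mu := (@lebesgue_measure R).
Implicit Types (x a p : R).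

Definition jpow a x : R := (1 + x ^+ 2) `^ (- a).

Let one_addsqr_gt0 x : 0 < 1 + x ^+ 2. Proof. by rewrite ltr_pwDl ?sqr_ge0. Qed.

Lemma jpow_gt0 a x : 0 < jpow a x. Proof. exact: powR_gt0. Qed.

Lemma jpow_le a b x : a <= b -> jpow b x <= jpow a x.
Proof. by move=> ab; apply: ler_powR; rewrite ?lerN2// lerDl sqr_ge0. Qed.

Lemma jpowS a x : jpow (a + 1) x = jpow a x / (1 + x ^+ 2).
Proof.
rewrite /jpow opprD powRD; last by rewrite (gt_eqF (one_addsqr_gt0 x)) implybT.
by rewrite powR_inv1// ltW.
Qed.

Lemma rder_jpow a : rder (jpow a) (fun x => - (2 * a * x) * jpow (a + 1) x).
Proof.
move=> x; have hb : is_derive x 1 (fun y : R => 1 + y ^+ 2) (2 * x).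
  have := rderD (rder_cst 1) (rderX 2 (@rder_id R)) x.
  by rewrite add0r expr1 mulr1.
have h1 := @is_derive1_comp _ (@ln R) (fun y => 1 + y ^+ 2) x _ _ (is_derive1_ln (one_addsqr_gt0 x)) hb.
have h2 := is_deriveZ (- a) h1.
have h3 := @is_derive1_comp _ expR _ x _ _ (is_derive_expR _) h2.
have e : jpow a = fun y => expR (- a * ln (1 + y ^+ 2)).
  by apply/funext => y; rewrite /jpow /powR gt_eqF.
rewrite jpowS e; apply: (is_derive_eq h3); rewrite /GRing.scale /=.
by have := one_addsqr_gt0 x; move: (expR _) => E h; field; rewrite gt_eqF.
Qed.

Lemma rder_xjpow a : rder (fun x => x * jpow a x) (fun x => (1 - 2 * a) * jpow a x + 2 * a * jpow (a + 1) x).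
Proof.
apply: (rder_eq (rderM (@rder_id R) (rder_jpow a))) => x; rewrite jpowS.
by have := one_addsqr_gt0 x; move: (jpow a x) => E h; field; rewrite gt_eqF.
Qed.

Lemma xjpow_le1 a x : 2^-1 <= a -> `|x * jpow a x| <= 1.
Proof.
move=> ha; have j0 := jpow_gt0 a x; have j1 := jpow_gt0 2^-1 x.
apply: (@le_trans _ _ `|x * jpow 2^-1 x|).
  by rewrite !normrM ler_wpM2l// !gtr0_norm// jpow_le.
rewrite -(@ler_pXn2r _ 2)// ?nnegrE// expr1n real_normK ?num_real// exprMn.
have -> : jpow 2^-1 x ^+ 2 = (1 + x ^+ 2)^-1.
  rewrite /jpow -powR_mulrn ?powR_ge0// -powRrM mulNr mulVf// powR_inv1// ltW//.
by rewrite ler_pdivrMr// mul1r lerDr.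
Qed.

Lemma continuous_jpow a : continuous (jpow a).
Proof. exact: (rder_continuous (rder_jpow a)). Qed.

(** Comparison with an explicit derivative: [G' = 2 jpow (3/2) + (2 p - 1) jpow p - 2 p jpow (p +
    1)], and [p * jpow (p + 1) <= jpow (3/2)] gives [G' >= (2 p - 1) jpow p]. Since [|G| <= 3], the
    integral of [G'] over an interval is at most [6]. *)
Lemma jpow_integrable p : 2^-1 < p -> p <= 1 ->
  rint setT (jpow p) /\ \int[mu]_x jpow p x <= 6 / (2 * p - 1).
Proof.
move=> p1 p2; have q0 : 0 < 2 * p - 1 by lra.
pose G x := 2 * (x * jpow 2^-1 x) - x * jpow p x.
pose G1 x := 2 * ((1 - 2 * 2^-1) * jpow 2^-1 x + 2 * 2^-1 * jpow (2^-1 + 1) x) -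
   ((1 - 2 * p) * jpow p x + 2 * p * jpow (p + 1) x).
have hG : rder G G1 by apply: rderB; [apply: rderZ; exact: rder_xjpow|exact: rder_xjpow].
have cG : continuous G1.
  move=> x; apply: (@continuousB _ _ _ (fun x => 2 * ((1 - 2 * 2^-1) * jpow 2^-1 x + 2 * 2^-1 * jpow (2^-1 + 1) x))
     (fun x => (1 - 2 * p) * jpow p x + 2 * p * jpow (p + 1) x)).
    apply: continuousM; first exact: cvg_cst.
    by apply: continuousD; (apply: continuousM; [exact: cvg_cst|exact: continuous_jpow]).
  by apply: continuousD; (apply: continuousM; [exact: cvg_cst|exact: continuous_jpow]).
have [_ iG eG] := rder_rprim hG cG.
have ij a b : rint `[a, b] (jpow p) by exact: continuous_rint (@continuous_jpow p) a b.
apply: rint_exhaust.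
- exact: continuous_measurable_fun (@continuous_jpow p).
- by move=> x; exact/ltW/jpow_gt0.
- by [].
move=> n; have nn : - n%:R <= n%:R :> R by rewrite -subr_ge0 opprK addr_ge0.
have mI := measurable_itv `[- n%:R : R, n%:R].
rewrite ler_pdivlMr// mulrC -(RintZl _ mI (ij _ _)).
have : \int[mu]_(x in `[- n%:R, n%:R]) ((2 * p - 1) * jpow p x) <= \int[mu]_(x in `[- n%:R, n%:R]) G1 x.
  apply: le_Rintegral => //; [exact: rintZ (ij _ _)|exact: iG|].
  move=> x _; rewrite /G1.
  have h1 : jpow (p + 1) x <= jpow (2^-1 + 1) x by apply: jpow_le; lra.
  have h2 : 0 < jpow (p + 1) x := jpow_gt0 _ _.
  have h3 : p * jpow (p + 1) x <= jpow (p + 1) x by rewrite ler_piMl// ltW.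
  have h4 : 2 * 2^-1 = 1 :> R by field.
  by rewrite h4; lra.
move=> /le_trans; apply; rewrite -(eG _ _ nn) /G.
have b1 y : `|y * jpow 2^-1 y| <= 1 by exact: xjpow_le1.
have b2 y : `|y * jpow p y| <= 1 by apply: xjpow_le1; exact: ltW.
have := b1 n%:R; have := b1 (- n%:R); have := b2 n%:R; have := b2 (- n%:R).
rewrite !ler_norml => /andP[? ?] /andP[? ?] /andP[? ?] /andP[? ?]; lra.
Qed.

End BesselWeight.

(** * Fourier coefficients and Fourier transforms *)

Section Waves.
Variable R : realType.
Local Notation C := R[i].
Local Notation mu := (@lebesgue_measure R).
Implicit Types (a b w x y : R).

Definition wave w y : C := cis (- (w * y)).

Lemma waveE w y : wave w y = cexp (- ('i%C * w%:C) * y%:C).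
Proof.
rewrite /wave /cexp; have -> : complex.Re (- ('i%C * w%:C) * y%:C) = 0 :> R by rewrite !ReImE /=; ring.
have -> : complex.Im (- ('i%C * w%:C) * y%:C) = - (w * y) :> R by rewrite !ReImE /=; ring.
by rewrite expR0 mul1r.
Qed.

Lemma cprim_wave w : cprim (wave w) (fun y => - ('i%C * w%:C) * wave w y).
Proof.
have -> : wave w = fun y => cexp (- ('i%C * w%:C) * y%:C) by apply/funext => y; exact: waveE.
by have h := cder_cexp (- ('i%C * w%:C)); exact: cder_cprim h (cderZ _ h).
Qed.

Lemma cmeas_wave w : cmeas (wave w).
Proof. exact: cprim_cmeas (cprim_wave w). Qed.

Lemma nc_wave w y : nc (wave w y) = 1.
Proof. exact: nc_cis. Qed.

Lemma Cint_wave w a b : Cint `[a, b] (wave w).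
Proof.
apply: (Cint_le (measurable_itv _) (cmeas_wave w) (rint_cst a b 1)) => y _.
by rewrite nc_wave.
Qed.

(** The wave is its own derivative up to the factor [- i w], and the two boundary terms have modulus
    one. *)
Lemma wave_decay w a b : a <= b -> w != 0 -> nc (Cintegral `[a, b] (wave w)) <= 2 / `|w|.
Proof.
move=> ab w0; have wp : 0 < `|w| by rewrite normr_gt0.
have := cprimE (cprim_wave w) ab; rewrite CintegralZ; [|exact: measurable_itv|exact: Cint_wave] => e.
rewrite ler_pdivlMr// mulrC.
have -> : `|w| * nc (Cintegral `[a, b] (wave w)) = nc (wave w b - wave w a).
  by rewrite e (ncM _ (Cintegral _ _)) ncN (ncM 'i%C) nc_i mul1r nc_real.
by apply: (le_trans (ncB _ _)); rewrite !nc_wave.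
Qed.

Lemma wave_bounded w a b : a <= b -> nc (Cintegral `[a, b] (wave w)) <= b - a.
Proof.
move=> ab; have h1 y : `[a, b]%classic y -> nc (wave w y) <= 1 by rewrite nc_wave.
apply: (le_trans (nc_Cintegral_le (measurable_itv _) (Cint_wave w a b) (rint_cst a b 1) h1)).
have [_ _ e] := rder_rprim (@rder_id R) (fun x => cvg_cst _).
by rewrite -(e _ _ ab).
Qed.

Lemma wave0_integral a b : a <= b -> Cintegral `[a, b] (wave 0) = (b - a)%:C.
Proof.
move=> ab; have h := cder_cprim (@cder_id R) (cder_cst 1).
rewrite rmorphB /= (cprimE h ab); apply: eq_Cintegral => y _.
by rewrite /wave mul0r oppr0 /cis cos0 sin0.
Qed.

(** The Fourier coefficient of the square wave in [y], without the cut-off in [x]. *)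
Definition Wcoef (k : int) : C :=
  ((2 * pi)^-1)%:C * (Cintegral `[0, pi] (wave k%:~R) - Cintegral `[- pi, 0] (wave k%:~R)).

(** In [[- pi, pi]] the periodized arcs meet at [0] and at both endpoints, where the indicators
    cancel; at the endpoints one of the arcs is reached by a translation by [2 pi]. *)
Lemma W_central x y : `|y| <= pi -> W x y =
  \1_(`[- 2^-1, 2^-1] : set R) x * (if `|y| == pi then 0 else (0 <= y)%R%:R - (y <= 0)%R%:R).
Proof.
move=> hy; have p0 := pi_gt0 R; have [x1|x1] := lerP `|x| 2^-1; last first.
  by rewrite W_out// indicE memNset ?mul0r//= in_itv /= -ler_norml; apply/negP; rewrite -ltNge.
rewrite [in RHS]indicE mem_set ?mul1r; last by rewrite /= in_itv /= -ler_norml.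
have e0 : y + 2 * pi * (0 : int)%:~R = y by rewrite mulr0 addr0.
have both : periodized `[0, pi] y -> periodized `[- pi, 0] y -> W x y = 0.
  by move=> h1 h2; rewrite /W !indicE (mem_set h1) (mem_set h2) subrr mulr0.
have [ey|y1] := eqVneq `|y| pi; last first.
  have {}y1 : `|y| < pi by rewrite lt_neqAle y1.
  have [y2|y2|y2] := ltrgtP 0 y.
  - by rewrite (@W_pos _ _ _ 0) ?e0// ?subr0// y2 (le_lt_trans (ler_norm _) y1).
  - rewrite (@W_neg _ _ _ 0) ?e0// ?sub0r// y2 andbT ltrNl.
    by apply: le_lt_trans y1; rewrite -normrN ler_norm.
  rewrite subrr; apply: both; exists 0; rewrite mulr0 addr0 /= -y2 in_itv /=; lra.
have [y2|y2] := lerP 0 y.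
  rewrite ger0_norm// in ey; apply: both.
    by exists 0; rewrite e0 ey /= in_itv /= lexx ltW.
  by exists (-1); rewrite ey /= in_itv /= mulrN1z mulrN1; lra.
rewrite ltr0_norm// in ey; have {}ey : y = - pi by rewrite -ey opprK.
apply: both.
  by exists 1; rewrite ey /= in_itv /= mulr1z mulr1; lra.
by exists 0; rewrite e0 ey /= in_itv /= lexx; lra.
Qed.

Lemma Cintegral_restrict (A B : set R) (f : R -> C) : measurable A -> measurable B -> B `<=` A ->
  Cintegral A (fun y => if y \in B then f y else 0) = Cintegral B f.
Proof.
move=> mA mB BA; rewrite Cintegral_mkcond// [RHS]Cintegral_mkcond//.
apply: eq_Cintegral => y _; have [yB|yB] := boolP (y \in B); last by case: ifP.
by rewrite ifT// inE; apply: BA; rewrite -inE.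
Qed.

Lemma cmeas_restrict (a b : R) (f : R -> C) : cmeas f -> cmeas (fun y => if y \in `[a, b]%classic then f y else 0).
Proof.
move=> mf; have -> : (fun y => if y \in `[a, b]%classic then f y else 0) = (fun y => if a <= y <= b then f y else 0).
  apply/funext => y; congr (if _ then _ else _); by apply/idP/idP; rewrite inE /= in_itv.
apply: (@cmeas_if _ _ _ (fun y => a <= y <= b) f (fun=> 0)); [|exact: mf|exact: cmeas_cst].
by apply: measurable_itv_bool => //; exact: measurable_cst.
Qed.

Lemma fourier_coef_W (k : int) x :
  fourier_coef (@W R) k x = if x \in `[- 2^-1, 2^-1]%classic then Wcoef k else 0.
Proof.
have p0 := pi_gt0 R.
pose P := `[0, pi : R]%classic; pose N := `[- pi, 0 : R]%classic.
have mP : measurable P := measurable_itv _; have mN : measurable N := measurable_itv _.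
have mA : measurable `[- pi, pi : R]%classic := measurable_itv _.
pose h y := (if y \in P then wave k%:~R y else 0) - (if y \in N then wave k%:~R y else 0).
have mw := cmeas_wave k%:~R.
have mh : cmeas h by apply: cmeasB; exact: cmeas_restrict.
have iP : Cint `[- pi, pi] (fun y => if y \in P then wave k%:~R y else 0).
  apply: (Cint_le mA (cmeas_restrict _ _ mw) (rint_cst _ _ 1)) => y _.
  by case: ifP => _; rewrite ?nc0 ?nc_wave.
have iN : Cint `[- pi, pi] (fun y => if y \in N then wave k%:~R y else 0).
  apply: (Cint_le mA (cmeas_restrict _ _ mw) (rint_cst _ _ 1)) => y _.
  by case: ifP => _; rewrite ?nc0 ?nc_wave.
have eh : Cintegral `[- pi, pi] h = Cintegral P (wave k%:~R) - Cintegral N (wave k%:~R).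
  rewrite /h CintegralB// !Cintegral_restrict//; apply: subset_itv; rewrite bnd_simp; lra.
pose c : R := \1_(`[- 2^-1, 2^-1] : set R) x.
rewrite /fourier_coef; have -> : Cintegral `[- pi, pi] (fun y => (W x y)%:C * cis (- (k%:~R * y))) =
    Cintegral `[- pi, pi] (fun y => if `|y| == pi then 0 else c%:C * h y).
  apply: eq_Cintegral => y; rewrite /= in_itv /= -ler_norml => hy.
  rewrite (W_central x hy) -/c; case: ifP => [_|_]; first by rewrite mulr0 mul0r.
  rewrite rmorphM /= -mulrA; congr (_ * _); rewrite -/(wave _ _) /h.
  have -> : (y \in P) = (0 <= y).
    apply/idP/idP => [|y0]; first by rewrite inE /P /= in_itv /= => /andP[].
    by rewrite inE /P /= in_itv /= y0 (le_trans (ler_norm _) hy).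
  have -> : (y \in N) = (y <= 0).
    apply/idP/idP => [|y0]; first by rewrite inE /N /= in_itv /= => /andP[].
    by rewrite inE /N /= in_itv /= y0 andbT; move: hy; rewrite ler_norml => /andP[].
  by case: (0 <= y); case: (y <= 0) => /=; rewrite ?subr0 ?sub0r ?subrr ?rmorphN ?mulNr ?mul1r ?mul0r.
have -> : Cintegral `[- pi, pi] (fun y => if `|y| == pi then 0 else c%:C * h y) =
    Cintegral `[- pi, pi] (fun y => c%:C * h y).
  apply: aeq_Cintegral => //.
  - apply: (@cmeas_if _ _ _ (fun y : R => `|y| == pi) (fun=> 0)); [|exact: cmeas_cst|exact: cmeasZ].
    by apply: measurable_fun_eqr; [exact: continuous_measurable_fun (@norm_continuous _ R^o)|exact: measurable_cst].
  - exact: cmeasZ.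
  apply: (@aeq_countable _ _ _ ([set pi] `|` [set - pi])).
    by apply: finite_set_countable; exact: finite_set2.
  move=> y hy; rewrite ifF//; apply/negP; rewrite eqr_norm2 || idtac.
  move=> /eqP hp; apply: hy; have [y0|y0] := lerP 0 y.
    by left; rewrite /= -hp ger0_norm.
  by right; rewrite /= -hp ltr0_norm// opprK.
rewrite CintegralZ//; last exact: CintD mA iP (CintN mA iN).
rewrite eh /Wcoef /c indicE; case: (x \in _); last by rewrite mul0r mulr0.
by rewrite mul1r.
Qed.

Lemma Wcoef0 : Wcoef 0 = 0.
Proof.
have p0 := pi_gt0 R; rewrite /Wcoef !wave0_integral; [|lra|lra].
by rewrite subr0 sub0r opprK subrr mulr0.
Qed.

(** Each half-period contributes at most [2 / |k|], and [4 <= 2 pi]. *)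
Lemma Wcoef_decay (k : int) : k != 0 -> nc (Wcoef k) <= (`|k|%:~R)^-1.
Proof.
move=> k0; have p0 := pi_gt0 R; have p2 := pi_ge2 R.
have kR : k%:~R != 0 :> R by rewrite intr_eq0.
have kp : 0 < `|k|%:~R :> R by rewrite ltr0z normr_gt0.
have d1 : nc (Cintegral `[0, pi] (wave k%:~R)) <= 2 / `|k|%:~R.
  by rewrite intr_norm; apply: wave_decay => //; exact: ltW.
have d2 : nc (Cintegral `[- pi, 0] (wave k%:~R)) <= 2 / `|k|%:~R.
  by rewrite intr_norm; apply: wave_decay => //; lra.
rewrite /Wcoef (ncM _%:C) nc_real gtr0_norm ?invr_gt0 ?mulr_gt0//.
rewrite ler_pdivrMl ?mulr_gt0//; apply: (le_trans (ncB _ _)); apply: (le_trans (lerD d1 d2)).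
by rewrite -mulrDl ler_wpM2r ?invr_ge0 ?(ltW kp)//; rlra.
Qed.

Lemma fourier_box (c : C) xi : fourier (fun x => if x \in `[- 2^-1, 2^-1]%classic then c else 0) xi =
  c * Cintegral `[- 2^-1, 2^-1] (wave xi).
Proof.
have mI : measurable `[- 2^-1, 2^-1 : R]%classic := measurable_itv _.
rewrite -CintegralZ//; last exact: Cint_wave.
rewrite (Cintegral_mkcond _ mI); apply: eq_Cintegral => x _.
by case: ifP; rewrite ?mul0r.
Qed.

(** The integral of the wave has modulus [I <= 1] and satisfies [|xi| I <= 2], whence
    [5 = 1 + 4]. *)
Lemma nc_fourier_box (c : C) xi :
  nc (fourier (fun x => if x \in `[- 2^-1, 2^-1]%classic then c else 0) xi) ^+ 2 <= 5 * nc c ^+ 2 / (1 + xi ^+ 2).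
Proof.
have b0 : 0 < 1 + xi ^+ 2 by rewrite ltr_pwDl ?sqr_ge0.
rewrite fourier_box (ncM c) exprMn ler_pdivlMr//.
set I := nc (Cintegral _ _); suff h : (1 + xi ^+ 2) * I ^+ 2 <= 5.
  have -> : nc c ^+ 2 * I ^+ 2 * (1 + xi ^+ 2) = nc c ^+ 2 * ((1 + xi ^+ 2) * I ^+ 2).
    by move: (nc c) I {h} => u v; ring.
  by rewrite (mulrC 5) ler_wpM2l ?sqr_ge0.
have hab : - 2^-1 <= 2^-1 :> R by lra.
have I0 : 0 <= I := nc_ge0 _.
have I1 : I <= 1 by apply: (le_trans (wave_bounded xi hab)); lra.
have I2 : I ^+ 2 <= 1 by rewrite -(expr1n _ 2) lerXn2r// nnegrE.
have I3 : xi ^+ 2 * I ^+ 2 <= 4.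
  have [->|x0] := eqVneq xi 0; first by rewrite expr0n mul0r.
  have xp : 0 < `|xi| by rewrite normr_gt0.
  have := wave_decay hab x0; rewrite -/I ler_pdivlMr// => h.
  have -> : xi ^+ 2 * I ^+ 2 = (I * `|xi|) ^+ 2 by rewrite exprMn real_normK ?num_real// mulrC.
  have -> : 4 = 2 ^+ 2 :> R by ring.
  have t0 : 0 <= I * `|xi| := mulr_ge0 I0 (ltW xp).
  by rewrite lerXn2r// nnegrE.
by rewrite mulrDl mul1r; lra.
Qed.

End Waves.

(** * Summability of the weighted Sobolev norms *)

Section FourierSeries.
Variable R : realType.
Local Notation C := R[i].
Local Notation mu := (@lebesgue_measure R).
Implicit Types (s x : R).

(** The integral of a nonnegative function is a supremum over the simple functions below it, so
    monotonicity holds for arbitrary [f] and [g]; it is applied to the squared modulus of a Fourier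
    transform. *)
Lemma ge0_integral_mono (f g : R -> \bar R) : (forall x, (0 <= f x)%E) -> (forall x, (f x <= g x)%E) ->
  (\int[mu]_x f x <= \int[mu]_x g x)%E.
Proof.
move=> f0 fg; rewrite !ge0_integralTE//; last by move=> x; exact: le_trans (f0 x) (fg x).
apply: ereal_sup_le_subset || apply: le_ereal_sup => _ [h hf <-]; exists h => // x.
by apply: le_trans (fg x); exact: hf.
Qed.

(** The squared transform decays like [1 / (1 + xi ^ 2)], so the integrand is bounded by a multiple
    of [jpow (1 - s)], integrable because [1 - s > 1 / 2]. *)
Lemma Hnorm_W s (k : int) : 0 < s -> s < 2^-1 ->
  (Hnorm s (fourier_coef (@W R) k) <=
   (Num.sqrt ((2 * pi)^-1 * (5 * (6 / (2 * (1 - s) - 1)))) * nc (Wcoef R k))%:E)%E.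
Proof.
move=> s0 s1; have p0 := pi_gt0 R; set c := Wcoef R k.
have -> : fourier_coef (@W R) k = fun x => if x \in `[- 2^-1, 2^-1]%classic then c else 0.
  by apply/funext => x; exact: fourier_coef_W.
set F := fun x => _.
have h1 : 2^-1 < 1 - s by lra.
have h2 : 1 - s <= 1 by lra.
have [ij bj] := jpow_integrable h1 h2.
have bnd : (\int[mu]_xi ((1 + xi ^+ 2) `^ s * nc (fourier F xi) ^+ 2)%:E <=
    (5 * nc c ^+ 2 * (6 / (2 * (1 - s) - 1)))%:E)%E.
  apply: (@le_trans _ _ (\int[mu]_xi (5 * nc c ^+ 2 * jpow (1 - s) xi)%:E)%E).
    apply: ge0_integral_mono => xi; rewrite lee_fin; first by rewrite mulr_ge0 ?powR_ge0 ?sqr_ge0.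
    have b0 : 0 < 1 + xi ^+ 2 by rewrite ltr_pwDl ?sqr_ge0.
    have -> : jpow (1 - s) xi = (1 + xi ^+ 2) `^ s / (1 + xi ^+ 2).
      have e : - (1 - s) = s - 1 by ring.
      by rewrite /jpow e powRD ?(gt_eqF b0) ?implybT// powR_inv1// ltW.
    have -> : 5 * nc c ^+ 2 * ((1 + xi ^+ 2) `^ s / (1 + xi ^+ 2)) =
        (1 + xi ^+ 2) `^ s * (5 * nc c ^+ 2 / (1 + xi ^+ 2)).
      by move: (_ `^ s) (nc c) (_^-1) => u v w; ring.
    by rewrite ler_wpM2l ?powR_ge0//; exact: nc_fourier_box.
  have iz := rintZ (5 * nc c ^+ 2) measurableT ij.
  rewrite (rint_fine measurableT iz) lee_fin (RintZl _ measurableT ij).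
  by rewrite ler_wpM2l// mulr_ge0// sqr_ge0.
rewrite /Hnorm; set I := (\int[mu]_xi _)%E in bnd *.
have I0 : (0 <= I)%E.
  by apply: integral_ge0 => xi _; rewrite lee_fin mulr_ge0 ?powR_ge0 ?sqr_ge0.
set J := 5 * _ * _ in bnd.
have J0 : 0 <= J by rewrite -lee_fin (le_trans I0).
have h : ((2 * pi)^-1%:E * I <= ((2 * pi)^-1 * J)%:E)%E.
  by rewrite EFinM lee_wpmul2l// lee_fin invr_ge0 mulr_ge0// ltW.
have -> : Num.sqrt ((2 * pi)^-1 * (5 * (6 / (2 * (1 - s) - 1)))) * nc c = ((2 * pi)^-1 * J) `^ 2^-1.
  set A := (2 * pi)^-1 * (5 * _); have A0 : 0 <= A.
    by rewrite mulr_ge0 ?invr_ge0 ?mulr_ge0 ?(ltW p0)// invr_ge0; rlra.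
  have -> : (2 * pi)^-1 * J = A * nc c ^+ 2 by rewrite /A /J; ring.
  by rewrite (powR12_sqrt (mulr_ge0 A0 (sqr_ge0 _))) (sqrtrM _ A0) sqrtr_sqr ger0_norm// nc_ge0.
rewrite -poweR_EFin; apply: gt0_ler_poweR => //.
- by rewrite in_itv /= leey andbT mule_ge0// lee_fin invr_ge0 mulr_ge0// ltW.
- by rewrite in_itv /= leey andbT lee_fin mulr_ge0// invr_ge0 mulr_ge0// ltW.
Qed.

(** From [ln (m + 1) - ln m >= 1 / (m + 1)] and [exp u >= 1 + u]. It lets the series of
    [m ^ (- s - 1)] telescope. *)
Lemma powR_telescope s (m : R) : 0 < s -> 0 < m ->
  s * ((m + 1) `^ (- s) / (m + 1)) <= m `^ (- s) - (m + 1) `^ (- s).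
Proof.
move=> s0 m0; have m1 : 0 < m + 1 by lra.
have -> : m `^ (- s) = (m + 1) `^ (- s) * expR (s * (ln (m + 1) - ln m)).
  by rewrite /powR !gt_eqF// -expRD; congr expR; ring.
have l1 : (m + 1)^-1 <= ln (m + 1) - ln m.
  have h : -1 < - (m + 1)^-1 by rewrite ltrN2 invf_lt1//; lra.
  have := le_ln1Dx h; have -> : 1 + - (m + 1)^-1 = m / (m + 1) by field; rewrite gt_eqF.
  by rewrite ln_div ?posrE//; lra.
have l2 : 1 + s * (m + 1)^-1 <= expR (s * (ln (m + 1) - ln m)).
  by apply: le_trans (expR_ge1Dx _); rewrite lerD2l ler_pM2l.
have -> : s * ((m + 1) `^ (- s) / (m + 1)) = (m + 1) `^ (- s) * (1 + s * (m + 1)^-1) - (m + 1) `^ (- s).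
  by move: (_ `^ _) (_^-1) => u v; ring.
by rewrite lerD2r ler_wpM2l// powR_ge0.
Qed.

Lemma telescope_step (S t c u v : R) : S <= 1 + c * (1 - u) -> t <= c * (u - v) -> S + t <= 1 + c * (1 - v).
Proof. by rewrite !mulrBr; lra. Qed.

Lemma powR_sum_le s n : 0 < s ->
  \sum_(i < n) (i.+1%:R `^ (- s) / i.+1%:R) <= 1 + s^-1 :> R.
Proof.
move=> s0.
have gen k : \sum_(i < k.+1) (i.+1%:R `^ (- s) / i.+1%:R) <= 1 + s^-1 * (1 - k.+1%:R `^ (- s)) :> R.
  elim: k => [|k IH]; first by rewrite big_ord1 powR1 subrr mulr0 addr0 divr1.
  rewrite big_ord_recr /=; have := @powR_telescope s k.+1%:R s0; rewrite ltr0n natr1 => /(_ isT) h.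
  have h2 : k.+2%:R `^ (- s) / k.+2%:R <= s^-1 * (k.+1%:R `^ (- s) - k.+2%:R `^ (- s)).
    by rewrite ler_pdivlMl.
  exact: telescope_step IH h2.
case: n => [|k]; first by rewrite big_ord0 addr_ge0// invr_ge0 ltW.
apply: (le_trans (gen k)); rewrite lerD2l ler_piMr ?invr_ge0 ?(ltW s0)// gerBl powR_ge0.
Qed.

Lemma esum_nat_lt (a : nat -> R) (M : R) : (forall n, 0 <= a n) -> (forall n, \sum_(i < n) a i <= M) ->
  (\esum_(i in [set: nat]) (a i)%:E < +oo)%E.
Proof.
move=> a0 h; rewrite -nneseries_esumT; last by move=> n; rewrite lee_fin.
apply: (@le_lt_trans _ _ M%:E); last exact: ltry.
apply: lime_le; first by apply: is_cvg_nneseries => n _ _; rewrite lee_fin.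
by apply: nearW => n; rewrite sumEFin lee_fin big_mkord.
Qed.

(** The norms are of order [1 / |k|], which leaves the series of [|k| ^ (- s - 1)]; positive and
    negative indices are both reindexed by [n + 1]. *)
Lemma fourier_series_summable s : 0 < s -> s < 2^-1 ->
  (\esum_(k in [set k : int | k != 0%R])
     ((`|k|%:~R : R) `^ (- s))%:E * Hnorm s (fourier_coef (@W R) k) < +oo)%E.
Proof.
move=> s0 s1; set K := Num.sqrt ((2 * pi)^-1 * (5 * (6 / (2 * (1 - s) - 1)))) : R.
have K0 : 0 <= K by exact: sqrtr_ge0.
pose a n : R := K * (n.+1%:R `^ (- s) / n.+1%:R).
have a0 n : 0 <= a n by rewrite mulr_ge0// divr_ge0// powR_ge0.
pose b (k : int) : R := K * ((`|k|%:~R) `^ (- s) / `|k|%:~R).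
have b0 k : 0 <= b k by rewrite mulr_ge0// divr_ge0 ?powR_ge0// ler0z.
apply: (@le_lt_trans _ _ (\esum_(k in [set k : int | k != 0%R]) (b k)%:E)%E).
  apply: le_esum => k /= k0.
  apply: (@le_trans _ _ (((`|k|%:~R : R) `^ (- s))%:E * (K * nc (Wcoef R k))%:E)%E).
    by apply: lee_wpmul2l; [rewrite lee_fin powR_ge0|exact: Hnorm_W].
  rewrite -EFinM lee_fin /b mulrCA ler_wpM2l// ler_wpM2l ?powR_ge0//.
  exact: Wcoef_decay.
rewrite (esumID [set k : int | 0 < k]); last by move=> k _; rewrite lee_fin.
have fin : (\esum_(i in [set: nat]) (a i)%:E < +oo)%E.
  apply: (esum_nat_lt (M := K * (1 + s^-1)) a0) => n.
  by rewrite -mulr_sumr ler_wpM2l//; exact: powR_sum_le.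
apply: lte_add_pinfty.
  rewrite (@reindex_esum _ _ _ [set: nat] _ (fun n => n.+1%:Z)); first exact: fin.
  split.
  - by move=> n _ /=; split.
  - by move=> m n _ _ [].
  - by move=> k /= [_]; case: k => // -[//|n] _; exists n.
rewrite (@reindex_esum _ _ _ [set: nat] _ (fun n => - n.+1%:Z)).
  by apply: le_lt_trans fin; apply: le_esum => n _; rewrite /b /a normrN.
split.
- by move=> n _; split.
- by move=> m n _ _ /oppr_inj [].
- by move=> k /= [k0 /negP]; case: k k0 => [[|n]//|n] _ _; exists n; rewrite // NegzE.
Qed.

End FourierSeries.

Theorem mainTheorem6 (R : realType) :
  [/\ (forall x : R, fourier_coef (@W R) 0 x = 0),
      (forall s : R, 0 < s -> s < 2^-1 ->
        (\esum_(k in [set k : int | k != 0%R])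
           ((`|k|%:~R : R) `^ (- s))%:E * Hnorm s (fourier_coef (@W R) k)
         < +oo)%E),
      (forall n : nat, (0 < n)%N ->
        (forall (j : nat) (x : R), (j < 2 * n)%N ->
           - 2^-1 + j%:R / (2 * n%:R) < x < - 2^-1 + j.+1%:R / (2 * n%:R) ->
           Vosc (eps_ R n) x = (-1) ^+ (n + j)) /\
        (forall x : R, 2^-1 < `|x| -> Vosc (eps_ R n) x = 0))
    & exists lam : nat -> R[i],
        (\forall n \near \oo,
           resonance (fun x => (Vosc (eps_ R n) x)%:C) (lam n)) /\
        (fun n => lam n / (- ('i%C * (ln n%:R)%:C))) @ \oo --> (1 : R[i]^o)].
Proof.
split.
- by move=> x; rewrite fourier_coef_W Wcoef0; case: ifP.
- by move=> s s0 s1; exact: fourier_series_summable.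
- move=> n n0; split; first by move=> j x jn; exact: Vosc_alternating.
  by move=> x hx; exact: W_out.
- exact: resonances_exist.
Qed.
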